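(* Let $M$ be a compact convex $m$-dimensional Riemannian manifold with constant negative sectional curvature $-k^2$, where $k>0$, and set $r_0=\frac{1}{k}\log\left(\sqrt{2}+1\right)$. Then there exists a point $x_0\in M$ such that at least $\frac{1}{m+1}$ of all the geodesics of $M$ pass through the ball $B(x_0,r_0)$; that is, $$\frac{\operatorname{vol} C(x_0,r_0)}{(\operatorname{vol} M)^2}\geq \frac{1}{m+1},$$ where $C(x_0,r_0)=\{(p,q)\in M\times M : [p,q]\cap B(x_0,r_0)\neq\emptyset\}$.
   Context: Riemannian manifolds are allowed to have boundary. A Riemannian manifold $M$ is \emph{convex} if any two points $p,q\in M$ are joined by a unique geodesic arc $[p,q]$, whose interior is disjoint from the boundary of $M$ (so $[p,q]$ meets $\partial M$ at most at its endpoints). The ball is $B(x,r)=\{y\in M : d(x,y)\leq r\}$. The set of (oriented) geodesics of a compact convex $M$ is identified with $M\times M$ via $(p,q)\mapsto[p,q]$, and is measured by the product of the Riemannian volume measure $\mu$ with itself; thus the set of all geodesics has size $(\operatorname{vol} M)^2$, and $\operatorname{vol} C(x,r)=\int_{C(x,r)}d\mu(p)\,d\mu(q)$. *)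

(* Defs.v *)
From HB Require Import structures.
From mathcomp Require Import all_boot all_order all_algebra.
From mathcomp Require Import all_classical all_reals all_analysis.

Set Implicit Arguments.
Unset Strict Implicit.
Unset Printing Implicit Defensive.

Import Order.TTheory GRing.Theory Num.Theory.
Import numFieldNormedType.Exports.

Local Open Scope classical_set_scope.
Local Open Scope ring_scope.

Section EuclideanCalculus.
Context {R : realType}.

(* The model {x_0 >= 0}.  For m = 0 it is the single point R^0, so that a
   0-dimensional manifold has empty boundary. *)
Definition halfspace m : set 'rV[R]_m :=
  [set x | forall a : 'I_m, a = 0%N :> nat -> 0 <= x 0 a].

Definition halfspace_bd m : set 'rV[R]_m :=
  [set x | exists a : 'I_m, a = 0%N :> nat /\ x 0 a = 0].

Fixpoint Cn m (n : nat) (V : set 'rV[R]_m) (f : 'rV[R]_m -> R) : Prop :=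
  (forall x, V x -> {for x, continuous f}) /\
  (if n is n'.+1 then
     forall a : 'I_m, (forall x, V x -> derivable f x (delta_mx 0 a)) /\
                      Cn n' V (fun x => 'D_(delta_mx 0 a) f x)
   else True).

Definition Cinfty m (V : set 'rV[R]_m) (f : 'rV[R]_m -> R) : Prop :=
  forall n, Cn n V f.

(* Smoothness on a set that need not be open: local extendability to a smooth
   function on an open subset of R^m. *)
Definition smooth_on m (W : set 'rV[R]_m) (f : 'rV[R]_m -> R) : Prop :=
  forall x, W x -> exists V (F : 'rV[R]_m -> R),
    [/\ open V, V x, Cinfty V F & forall y, V y -> W y -> f y = F y].

(* The partial derivative is taken from the right (h > 0) so that it only
   involves values in the half-space, also at its boundary.  Where f is smooth
   on a relatively open subset of the half-space, it is the usual partial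
   derivative of any smooth extension of f. *)
Definition partial m (a : 'I_m) (f : 'rV[R]_m -> R) (x : 'rV[R]_m) : R :=
  lim ((h^-1 * (f (x + h *: delta_mx 0 a) - f x)) @[h --> 0^'+]).

(* Lebesgue integral over R^n of a nonnegative Borel function, as an iterated
   integral (Tonelli). *)
Fixpoint lebesgue_int n : ('rV[R]_n -> \bar R) -> \bar R :=
  match n return ('rV[R]_n -> \bar R) -> \bar R with
  | 0 => fun f => f 0
  | n'.+1 => fun f => (\int[lebesgue_measure]_(x in [set: R])
      lebesgue_int (fun v : 'rV[R]_n' => f (row_mx (x%:M : 'rV[R]_1) v)))%E
  end.

End EuclideanCalculus.

Section LocalRiemannianGeometry.
Context {R : realType} {m : nat}.
Variable G : 'rV[R]_m -> 'M[R]_m.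
Implicit Types (x u v : 'rV[R]_m).

Definition ginner x u v : R := (u *m G x *m v^T) 0 0.

Definition gnorm x v : R := Num.sqrt (ginner x v v).

(* [christoffel k i j] is Gamma^k_{ij}. *)
Definition christoffel (k i j : 'I_m) x : R :=
  2^-1 * \sum_(l < m) invmx (G x) k l *
    (partial i (fun y => G y j l) x + partial j (fun y => G y i l) x
     - partial l (fun y => G y i j) x).

(* R(d_i, d_j) d_k = \sum_l (curvature i j k l) d_l, with the convention
   R(X, Y) Z = nabla_X nabla_Y Z - nabla_Y nabla_X Z - nabla_[X,Y] Z. *)
Definition curvature (i j k l : 'I_m) x : R :=
  partial i (christoffel l j k) x - partial j (christoffel l i k) x
  + \sum_(s < m) (christoffel l i s x * christoffel s j k x
                  - christoffel l j s x * christoffel s i k x).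

Definition Riem x u v (w : 'rV[R]_m) : 'rV[R]_m :=
  \row_l \sum_(i < m) \sum_(j < m) \sum_(k < m)
    u 0 i * v 0 j * w 0 k * curvature i j k l x.

(* Meaningful for linearly independent u, v. *)
Definition sectional_curvature x u v : R :=
  ginner x (Riem x u v v) u /
  (ginner x u u * ginner x v v - ginner x u v ^+ 2).

End LocalRiemannianGeometry.

(* Smooth m-manifold with (possibly empty) boundary, given by an atlas of
   charts [cmap i], defined on the open set [dom i], with values in the
   half-space.  [par i] is the inverse of [cmap i]; the values of [cmap i]
   outside [dom i] and of [par i] outside the image are irrelevant. *)
Record manifold (R : realType) (m : nat) (M : topologicalType) := Manifold {
  chart : Type;
  dom : chart -> set M;
  cmap : chart -> M -> 'rV[R]_m;
  par : chart -> 'rV[R]_m -> M;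
  chart_at : M -> chart;
  manifold_hausdorff : hausdorff_space M;
  manifold_second_countable : @second_countable M;
  dom_chart_at : forall p, dom (chart_at p) p;
  dom_open : forall i, open (dom i);
  cmap_image : forall i, exists2 V : set 'rV[R]_m, open V &
        cmap i @` dom i = V `&` halfspace (R := R) (m := m);
  cmapK : forall i p, dom i p -> par i (cmap i p) = p;
  cmap_continuous : forall i p, dom i p -> {for p, continuous (cmap i)};
  par_continuous : forall i, {within cmap i @` dom i, continuous (par i)};
  transition_smooth : forall i j (a : 'I_m),
        smooth_on (cmap i @` (dom i `&` dom j))
                  (fun x => cmap j (par i x) 0 a)
}.

Definition boundary (R : realType) (m : nat) (M : topologicalType)
    (X : manifold R m M) : set M :=
  [set p | exists i : chart X, dom i p /\ halfspace_bd (cmap i p)].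

(* [gmx i x] is the Gram matrix of the metric, at the point of coordinates x,
   in the coordinate frame of the chart i. *)
Record riemannian_metric (R : realType) (m : nat) (M : topologicalType)
    (X : manifold R m M) := RiemannianMetric {
  gmx : chart X -> 'rV[R]_m -> 'M[R]_m;
  gmx_smooth : forall (i : chart X) (a b : 'I_m),
        smooth_on (cmap i @` dom i) (fun x => gmx i x a b);
  gmx_sym : forall (i : chart X) p, dom i p ->
        (gmx i (cmap i p))^T = gmx i (cmap i p);
  gmx_pos : forall (i : chart X) p (v : 'rV[R]_m), dom i p -> v != 0 ->
        0 < ginner (gmx i) (cmap i p) v v;
  gmx_transition : forall (i j : chart X) p, dom i p -> dom j p ->
        let J : 'M[R]_m := \matrix_(a, b)
          partial a (fun x => cmap j (par i x) 0 b) (cmap i p) in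
        gmx i (cmap i p) = J *m gmx j (cmap j p) *m J^T
}.

Notation borel M := (g_sigma_algebraType (@open M)).

Section RiemannianManifold.
Context {R : realType} {m : nat} {M : topologicalType} {X : manifold R m M}.
Variable g : riemannian_metric X.

Definition constant_sectional_curvature (K : R) : Prop :=
  forall (i : chart X) (p : M) (u v : 'rV[R]_m), dom i p ->
    row_free (col_mx u v) -> sectional_curvature (gmx g i) (cmap i p) u v = K.

(* Geodesic arc from p to q, parametrized by [0, 1] proportionally to arc
   length.  The equation c''^k + Gamma^k_{ab} c'^a c'^b = 0 is imposed for
   0 < t < 1; by continuity of the curve at 0 and 1 its solution then extends
   smoothly to [0, 1]. *)
Definition geodesic (p q : M) (gam : R -> M) : Prop :=
  [/\ gam 0 = p, gam 1 = q, {within `[0, 1], continuous gam} &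
   forall (t : R) (i : chart X), 0 < t < 1 -> dom i (gam t) ->
     let c : R -> 'rV[R]_m := fun s => cmap i (gam s) in
     [/\ derivable c t 1, derivable (derive1 c) t 1 &
      forall k : 'I_m,
        derive1 (derive1 c) t 0 k +
        \sum_(a < m) \sum_(b < m) christoffel (gmx g i) k a b (c t) *
           derive1 c t 0 a * derive1 c t 0 b = 0]].

Definition geodesic_arc (p q : M) : set M :=
  [set z | exists gam t, [/\ geodesic p q gam, 0 <= t <= 1 & z = gam t]].

(* "The interior of [p, q] is disjoint from the boundary" is read as
   "[p, q] meets the boundary at most at its endpoints": for a degenerate arc
   [p, p] at a boundary point p there is no interior. *)
Definition convex_manifold : Prop :=
  forall p q : M,
    (exists2 gam, geodesic p q gam &
       forall gam', geodesic p q gam' -> {in `[0, 1], gam' =1 gam}) /\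
    geodesic_arc p q `&` boundary X `<=` [set p; q].

(* Curves from p to q that are continuous on [0, 1] and C^1 outside a finite
   set of parameters. *)
Definition piecewise_C1 (p q : M) (gam : R -> M) : Prop :=
  [/\ gam 0 = p, gam 1 = q, {within `[0, 1], continuous gam} &
   exists s : seq R, forall (t : R) (i : chart X),
     0 < t < 1 -> t \notin s -> dom i (gam t) ->
     let c : R -> 'rV[R]_m := fun s => cmap i (gam s) in
     derivable c t 1 /\ {for t, continuous (derive1 c)}].

Definition speed (gam : R -> M) (t : R) : R :=
  let i := chart_at X (gam t) in
  gnorm (gmx g i) (cmap i (gam t)) (derive1 (fun s => cmap i (gam s)) t).

Definition curve_length (gam : R -> M) : \bar R :=
  (\int[lebesgue_measure]_(t in `]0%R, 1%R[) (speed gam t)%:E)%E.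

Definition dist (p q : M) : \bar R :=
  ereal_inf [set curve_length gam | gam in piecewise_C1 p q].

Definition gball (x : M) (r : R) : set M := [set y | (dist x y <= r%:E)%E].

Definition geodesics_through (x : M) (r : R) : set (M * M) :=
  [set pq | geodesic_arc pq.1 pq.2 `&` gball x r !=set0].

End RiemannianManifold.

(* The Riemannian volume is the Borel measure with density sqrt(det g) in every
   chart; this determines it, by second countability. *)
Definition volume_measure (R : realType) (m : nat) (M : ptopologicalType)
    (X : manifold R m M) (g : riemannian_metric X)
    (mu : set (borel M) -> \bar R) : Prop :=
  forall (i : chart X) (A : set (borel M)), measurable A -> A `<=` dom i ->
    mu A = lebesgue_int (fun x : 'rV[R]_m =>
      (Num.sqrt (\det (gmx g i x)) * \1_(cmap i @` A) x)%:E).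

(* Main.v *)
(* Since the curvature is constant, the connection on R (+) T^* given by
     d_i f = w_i,   d_i w_j = Gamma^l_ij w_l + k^2 g_ij f
   is flat, and its parallel frames (Frobenius) are local isometric immersions of
   the interior of M, scaled by k, into the hyperboloid B(y, y) = 1 of R^(m+1).
   Continuation along the geodesics issued from an interior point gives a
   continuous injective map Phi from M to the hyperboloid that sends [p, q] onto
   the segment from Phi p to Phi q, with B(Phi p, Phi q) = cosh(k length [p, q]).
   The cone over Phi(M) is therefore convex and Helly's theorem in R^(m+1) gives
   a centerpoint x0: every half-space l <= 0 with l(Phi x0) = 0 carries at least
   1/(m+1) of the volume.  Fix p and write P = Phi p, O = Phi x0.  For
   l(Q) = B(Q, B(P, O) O - P), the points q with Q = Phi q in l <= 0 satisfy
   B(P, Q) >= B(P, O) B(Q, O), and then the point of the hyperboloid proportional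
   to P / B(P, O) + Q / B(Q, O) lies on [p, q] and has B-product at most
   sqrt 2 = cosh(k r0) with O, i.e. lies in the ball. *)
Require Import Defs.
From HB Require Import structures.
From mathcomp Require Import all_boot all_order all_algebra.
From mathcomp Require Import all_classical all_reals all_analysis.
From mathcomp Require Import measurable_realfun ring lra zify.

Set Implicit Arguments.
Unset Strict Implicit.
Unset Printing Implicit Defensive.

Import Order.TTheory GRing.Theory Num.Theory.
Import numFieldNormedType.Exports.

Local Open Scope classical_set_scope.
Local Open Scope ring_scope.

(** * Calculus on cubes *)

(** Arcs solve the geodesic equation only for 0 < t < 1, and the metric reaches the boundary only
    through local smooth extensions. The flat connection is therefore integrated over the interior
    alone; the boundary is reached by an a priori bound: the connection coefficients stay bounded
    near a boundary point, so Phi is locally Lipschitz up to it. Uniqueness of the arc replaces the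
    exponential map of M: a hyperboloid segment lifted through a local isometry is a geodesic, hence
    it is the arc between its ends. The same uniqueness shows that an arc never returns to an
    endpoint, so that its interior parameters avoid the boundary. Distances are only estimated from
    above: an arc is a competitor for the infimum, and balls are closed because a curve can be
    prolonged by a short arc. The product measure integrates the measures of sections, so the final
    estimate is made for each fixed p, where the set of good q is closed. *)

Section OneVariable.
Context {R : realType}.
Implicit Types (f g : R -> R) (a b c d e t L : R).

(** This multiplied-out form is the working definition of the derivative below: it makes sense at
    [h] = 0, and its error terms add up without quotients. *)
Lemma is_derive_epsP f t d :
  is_derive t 1 f d <->
  forall e, 0 < e -> exists2 r : R, 0 < r &
    forall h, `|h| < r -> `|f (t + h) - f t - d * h| <= e * `|h|.
Proof.
split.
- move=> [df <-] e e0.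
  have /cvgrPdist_le /(_ e e0) : (fun h => h^-1 *: ((f \o shift t) (h *: 1) - f t))
      @ 0^' --> 'D_1 f t by exact: df.
  move=> /nbhs_ballP[r /= r0 rP]; exists r => // h hr.
  have [->|h0] := eqVneq h 0; first by rewrite addr0 subrr mulr0 subr0 normr0 mulr0.
  have := rP h; rewrite /ball /= sub0r normrN => /(_ hr h0).
  rewrite /GRing.scale /= mulr1 (addrC h t) => H.
  have -> : f (t + h) - f t - 'D_1 f t * h
     = - (('D_1 f t - h^-1 * (f (t + h) - f t)) * h).
    by rewrite mulrBl mulrAC mulVf// mul1r opprB.
  by rewrite normrN normrM ler_wpM2r.
- move=> H.
  have cv : (fun h => h^-1 *: ((f \o shift t) (h *: 1) - f t)) @ 0^' --> d.
    apply/cvgrPdist_le => e e0; have [r r0 rP] := H e e0.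
    apply/nbhs_ballP; exists r => //= h.
    rewrite /ball /= sub0r normrN => hr h0.
    have := rP h hr; rewrite /GRing.scale /= mulr1 (addrC h t).
    have -> : f (t + h) - f t - d * h
     = - ((d - h^-1 * (f (t + h) - f t)) * h).
      by rewrite mulrBl mulrAC mulVf// mul1r opprB.
    by rewrite normrN normrM ler_pM2r// normr_gt0.
  by split; [apply/cvg_ex; exists d | exact/cvg_lim].
Qed.

Lemma is_derive_continuous f t d : is_derive t 1 f d -> {for t, continuous f}.
Proof. by case=> df _; apply/differentiable_continuous/derivable1_diffP. Qed.

Lemma is_derive_within_continuous f df a b :
  (forall t, a <= t <= b -> is_derive t 1 f (df t)) ->
  {within `[a, b], continuous f}.
Proof.
move=> H; apply: derivable_within_continuous => x; rewrite in_itv /= => xab.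
by have [] := H x xab.
Qed.

(** [L] is a reference slope: [L] = 0 gives a Lipschitz bound, and [L] equal to the derivative at a
    point gives the first-order remainder. The minimum and maximum allow steps of either sign. *)
Lemma MVT_bound f df a b L e :
  (forall t, Num.min a b <= t <= Num.max a b -> is_derive t 1 f (df t)) ->
  (forall t, Num.min a b <= t <= Num.max a b -> `|df t - L| <= e) ->
  `|f b - f a - L * (b - a)| <= e * `|b - a|.
Proof.
wlog ab : a b / a <= b.
  move=> W; have [|ba] := orP (le_total a b); first exact: W.
  rewrite minC maxC => H1 H2; have := W _ _ ba H1 H2.
  by rewrite (distrC a b) -(opprB (f b)) -(opprB b) mulrN -opprD normrN.
rewrite (min_idPl ab) (max_idPr ab) => H1 H2.
have [c] := MVT_segment ab (fun x xab => H1 x (subset_itv_oo_cc xab))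
  (is_derive_within_continuous H1).
rewrite in_itv /= => cab ->.
by rewrite -mulrBl normrM ler_wpM2r// H2.
Qed.

Lemma is_derive1_0_cst f a b :
  (forall t, a < t < b -> is_derive t 1 f 0) ->
  forall s t, a < s < b -> a < t < b -> f s = f t.
Proof.
move=> H s t sab tab; apply/eqP; rewrite -subr_eq0 -normr_le0.
have H1 x : Num.min t s <= x <= Num.max t s -> a < x < b.
  by move: sab tab; case: (leP t s) => *; lra.
have : `|f s - f t - 0 * (s - t)| <= 0 * `|s - t|.
  apply: (MVT_bound (df := fun=> 0)) => [x /H1/H//|x _].
  by rewrite subrr normr0.
by rewrite !mul0r subr0.
Qed.

Lemma between0_norm (T t : R) : Num.min 0 T <= t <= Num.max 0 T -> `|t| <= `|T|.
Proof. by case: (leP 0 T) => T0 H; [rewrite !ger0_norm|rewrite !ler0_norm]; lra. Qed.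

Lemma between0_trans (T u v : R) : Num.min 0 T <= u <= Num.max 0 T ->
  Num.min 0 u <= v <= Num.max 0 u -> Num.min 0 T <= v <= Num.max 0 T.
Proof. by case: (leP 0 T) => ?; case: (leP 0 u) => ? *; lra. Qed.

Lemma between0_self (T : R) : Num.min 0 T <= T <= Num.max 0 T.
Proof. by case: (leP 0 T) => ?; rewrite lexx ?andbT// ltW. Qed.

Lemma is_derive_scale (c t : R) (f : R -> R) d :
  is_derive t 1 f d -> is_derive t 1 (fun u => c * f u) (c * d).
Proof. by move=> H; exact: (@is_deriveZ _ _ _ f c t 1 d H). Qed.

Lemma quarter_le (q e : R) : 0 <= q -> 0 <= e -> q * (e / (4 * (q + 1))) <= e / 4.
Proof.
move=> q0 e0; have q1 : 0 < q + 1 by rewrite ltr_wpDl.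
rewrite mulrA ler_pdivrMr ?mulr_gt0// mulrA divfK ?pnatr_eq0//.
by rewrite mulrC ler_wpM2l// lerDl.
Qed.

End OneVariable.

Section Lines.
Context {R : realType} {V : normedModType R}.

Lemma is_derive_line (f : V -> R) (x v : V) (t d : R) :
  is_derive (x + t *: v) v f d <-> is_derive t 1 (fun s => f (x + s *: v)) d.
Proof.
have E : (fun h : R => h^-1 *: ((f \o shift (x + t *: v)) (h *: v) - f (x + t *: v)))
  = (fun h => h^-1 *: (((fun s => f (x + s *: v)) \o shift t) (h *: 1) - f (x + t *: v))).
  apply/funext => h /=; congr (_ *: (f _ - _)).
  by rewrite [h *: 1]mulr1 scalerDl addrCA.
by split=> -[df d_]; split; move: df d_; rewrite /derivable /derive /= E.
Qed.

Lemma is_derive_line0 (f : V -> R) (x v : V) (d : R) :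
  is_derive x v f d <-> is_derive (0 : R) 1 (fun s => f (x + s *: v)) d.
Proof. by rewrite -is_derive_line scale0r addr0. Qed.

End Lines.

Section Cubes.
Context {R : realType} {m : nat}.
Implicit Types (x y z v : 'rV[R]_m).

(** Open balls of the sup norm, written by coordinates so that paths parallel to the axes can be
    followed inside them. *)
Definition cube x (r : R) : set 'rV[R]_m := [set y | forall a, `|y 0 a - x 0 a| < r].

Lemma coord_le_norm x a : `|x 0 a| <= `|x|.
Proof. by rewrite [leRHS]mx_normrE; apply: (le_bigmax _ _ (0, a)). Qed.

Lemma norm_le_coord x (r : R) : 0 <= r -> (forall a, `|x 0 a| <= r) -> `|x| <= r.
Proof. by move=> r0 H; rewrite [leLHS]mx_normrE bigmax_le// => -[i j] _ /=; rewrite (ord1 i). Qed.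

Lemma coord_line x (s : R) a b :
  (x + s *: delta_mx 0 a) 0 b = x 0 b + (if b == a then s else 0).
Proof. by rewrite !mxE eqxx /=; case: eqVneq => _; rewrite ?mulr1 ?mulr0. Qed.

Lemma nbhs_cubeP x (A : set 'rV[R]_m) :
  nbhs x A <-> exists2 r : R, 0 < r & cube x r `<=` A.
Proof.
split=> [/nbhs_ballP[r /= r0 rA]|[r r0 rA]].
- exists (r / 2); first by rewrite divr_gt0.
  move=> y yr; apply: rA; rewrite -ball_normE /= distrC.
  apply: (@le_lt_trans _ _ (r / 2)); last by rewrite ltr_pdivrMr// ltr_pMr// ltr1n.
  apply: norm_le_coord => [|a]; first by rewrite divr_ge0// ltW.
  by rewrite !mxE; apply/ltW/yr.
- apply/nbhs_ballP; exists r => //= y; rewrite -ball_normE /= distrC => yr.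
  apply: rA => a; apply: le_lt_trans yr.
  by have := coord_le_norm (y - x) a; rewrite !mxE.
Qed.

Lemma cube_center x (r : R) : 0 < r -> cube x r x.
Proof. by move=> r0 a; rewrite subrr normr0. Qed.

Lemma open_cubeP (V : set 'rV[R]_m) x : open V -> V x ->
  exists2 r : R, 0 < r & cube x r `<=` V.
Proof. by move=> oV Vx; apply/nbhs_cubeP; exact: open_nbhs_nbhs. Qed.

Lemma cube_near x (r : R) y : cube x r y -> exists2 s : R, 0 < s & cube y s `<=` cube x r.
Proof.
move=> yr; have [m0|m0] := posnP m.
  by exists 1 => // z _ a; have := ltn_ord a; rewrite {2}m0.
pose s := \big[Num.min/1]_(a < m) (r - `|y 0 a - x 0 a|).
have s0 : 0 < s by apply: lt_bigmin => [|a _]; rewrite ?ltr01// subr_gt0.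
exists s => // z zs a.
have : s <= r - `|y 0 a - x 0 a| by exact: bigmin_le_cond.
have := zs a; have := ler_normD (z 0 a - y 0 a) (y 0 a - x 0 a).
by rewrite subrKA; lra.
Qed.

Lemma open_cube x (r : R) : open (cube x r).
Proof.
rewrite openE => y /cube_near[s s0 sP]; apply/nbhs_cubeP; by exists s.
Qed.

Lemma cubeS x (r s : R) : r <= s -> cube x r `<=` cube x s.
Proof. by move=> rs y H a; apply: lt_le_trans (H a) rs. Qed.

(** What an axis-parallel staircase between two points needs. Besides cubes, it covers the part of a
    cube inside the open half-space, which is used near the boundary. *)
Definition boxy (B : set 'rV[R]_m) := forall y z w : 'rV[R]_m, B y -> B z ->
  (forall a, Num.min (y 0 a) (z 0 a) <= w 0 a <= Num.max (y 0 a) (z 0 a)) -> B w.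

Lemma boxy_cube x r : boxy (cube x r).
Proof.
move=> y z w By Bz H a; move: (H a) (By a) (Bz a).
by rewrite !ltr_norml; case: (leP (y 0 a) (z 0 a)) => *; lra.
Qed.

Lemma boxy_segment B y z (t : R) : boxy B -> B y -> B z -> 0 <= t <= 1 ->
  B (y + t *: (z - y)).
Proof.
move=> bB By Bz /andP[t0 t1]; apply: (bB y z) => // a; rewrite !mxE.
set u := y 0 a; set v := z 0 a.
by have [uv|vu] := leP u v; apply/andP; split; nra.
Qed.

Lemma box_mean_value (B : set 'rV[R]_m) (f : 'rV[R]_m -> R) (df : 'I_m -> 'rV[R]_m -> R)
    (L : 'I_m -> R) (e : R) y z : boxy B -> B y -> B z ->
  (forall x a, B x -> is_derive x (delta_mx 0 a) f (df a x)) ->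
  (forall x a, B x -> `|df a x - L a| <= e) ->
  `|f z - f y - \sum_a (z 0 a - y 0 a) * L a| <= e * \sum_a `|z 0 a - y 0 a|.
Proof.
move=> bB By Bz fd fe.
(* [w j] has the first [j] coordinates of [z] and the others of [y]. The increments telescope, and
   each of them is a mean value estimate in one variable. *)
pose w (j : nat) : 'rV[R]_m := \row_a (if (a < j)%N then z 0 a else y 0 a).
have w0 : w 0 = y by apply/rowP => a; rewrite mxE ltn0.
have wm : w m = z by apply/rowP => a; rewrite mxE ltn_ord.
have -> : f z - f y = \sum_(a < m) (f (w a.+1) - f (w a)).
  by rewrite -(big_mkord xpredT (fun a => f (w a.+1) - f (w a))) telescope_sumr// w0 wm.
rewrite -sumrB (le_trans (ler_norm_sum _ _ _))// mulr_sumr ler_sum// => a _.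
pose p (s : R) := w a + s *: delta_mx 0 a.
have pE s b : p s 0 b = if b == a then y 0 a + s else w a 0 b.
  rewrite !mxE eqxx /=; case: eqVneq => [->|_]; last by rewrite mulr0 addr0.
  by rewrite ltnn mulr1.
have p0 : p 0 = w a by rewrite /p scale0r addr0.
have p1 : p (z 0 a - y 0 a) = w a.+1.
  apply/rowP => b; rewrite pE !mxE.
  case: eqVneq => [->|ba]; first by rewrite ltnSn addrC subrK.
  rewrite [in RHS]ltnS [in RHS]leq_eqVlt.
  by have /negbTE -> : (b : nat) != a by [].
have Bp s : Num.min 0 (z 0 a - y 0 a) <= s <= Num.max 0 (z 0 a - y 0 a) -> B (p s).
  move=> H; apply: (bB y z) => // b; rewrite pE.
  case: eqVneq => [->|_].
    have : (Num.min (y 0 a) (z 0 a) = y 0 a + Num.min 0 (z 0 a - y 0 a)) /\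
       (Num.max (y 0 a) (z 0 a) = y 0 a + Num.max 0 (z 0 a - y 0 a)).
      by rewrite addr_minr addr_maxr addr0 addrC subrK.
    by move=> [-> ->]; rewrite !lerD2l.
  by rewrite mxE; case: ifP => _; rewrite ge_min le_max lexx ?orbT.
have := @MVT_bound _ (f \o p) (df a \o p) 0 (z 0 a - y 0 a) (L a) e.
rewrite /= p0 p1 subr0 (mulrC (L a)); apply => s /Bp Bs; last exact: fe.
exact: (is_derive_line f (w a) (delta_mx 0 a) s (df a (p s))).1 (fd _ _ Bs).
Qed.

Lemma sum_coord_le y : \sum_a `|y 0 a| <= m%:R * `|y|.
Proof.
rewrite (le_trans (ler_sum _ (fun a _ => coord_le_norm y a)))//.
by rewrite sumr_const card_ord mulr_natl.
Qed.

End Cubes.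

Lemma continuous_dist_le {R : realType} {T : topologicalType} (f : T -> R) (x : T) (e : R) :
  {for x, continuous f} -> 0 < e -> \forall y \near x, `|f y - f x| <= e.
Proof.
move=> cf e0; have /cvgrPdist_le/(_ _ e0) := cf.
by apply: filterS => y; rewrite distrC.
Qed.

Lemma continuous_dist_intro {R : realType} {T : topologicalType} (f : T -> R) (x : T) :
  (forall e, 0 < e -> \forall y \near x, `|f y - f x| <= e) -> {for x, continuous f}.
Proof.
by move=> H; apply/cvgrPdist_le => e /H; apply: filterS => y; rewrite distrC.
Qed.

Section ChainRule.
Context {R : realType} {m : nat}.
Implicit Types (f : 'rV[R]_m -> R) (c : R -> 'rV[R]_m).

(** The increment of [f] between [c t] and [c (t + h)] is compared with its linear part by
    [box_mean_value]; continuity of the partial derivatives at the single point [c t] controls the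
    error. *)
Lemma is_derive_along (B : set 'rV[R]_m) f (df : 'I_m -> 'rV[R]_m -> R) c t
    (dc : 'I_m -> R) : nbhs (c t) B ->
  (forall x a, B x -> is_derive x (delta_mx 0 a) f (df a x)) ->
  (forall a, {for c t, continuous (df a)}) ->
  (forall a, is_derive t 1 (fun s => c s 0 a) (dc a)) ->
  is_derive t 1 (f \o c) (\sum_a df a (c t) * dc a).
Proof.
move=> Bct fd cdf cd; apply/is_derive_epsP => e e0.
pose D : R := \sum_a (`|dc a| + 1).
have D0 : 0 <= D by apply: sumr_ge0 => a _; rewrite addr_ge0.
pose L : R := \sum_a `|df a (c t)|.
have L0 : 0 <= L by apply: sumr_ge0.
have [e1 e10 e1P] : exists2 e1 : R, 0 < e1 & e1 * D + L * e1 <= e.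
  exists (e / (D + L + 1)); first by rewrite divr_gt0//; lra.
  rewrite (mulrC L) -mulrDr -mulrA ler_piMr ?(ltW e0)//.
  by rewrite mulrC ler_pdivrMr ?mul1r; lra.
have [r r0 rB] : exists2 r : R, 0 < r & cube (c t) r `<=`
    B `&` [set x | forall a, `|df a x - df a (c t)| <= e1].
  apply/nbhs_cubeP; apply: filterI => //.
  have : \forall x \near c t, forall a, `|df a x - df a (c t)| <= e1.
    apply: (@filter_forall _ _ (fun a x => `|df a x - df a (c t)| <= e1) (nbhs (c t))) => a.
    exact: (continuous_dist_le (cdf a) e10).
  by [].
(* The bound 1 in the minimum makes the increment of [c] at most a fixed multiple of [|h|], which
   keeps [c (t + h)] in the cube. *)
have [s s0 sP] : exists2 s : R, 0 < s & forall h, `|h| < s -> forall a,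
    `|c (t + h) 0 a - c t 0 a - dc a * h| <= Num.min e1 1 * `|h|.
  have /filter_forall : forall a, \forall h \near (0 : R),
      `|c (t + h) 0 a - c t 0 a - dc a * h| <= Num.min e1 1 * `|h|.
    move=> a; have /is_derive_epsP := cd a.
    move=> /(_ (Num.min e1 1)) []; first by rewrite lt_min e10 ltr01.
    move=> s s0 sP; apply/nbhs_ballP; exists s => //= h.
    by rewrite /ball /= sub0r normrN => /sP.
  move=> /nbhs_ballP[s /= s0 sP]; exists s => // h hs; apply: sP.
  by rewrite /ball /= sub0r normrN.
pose d := Num.min s (r / (D + 1)).
have d0 : 0 < d by rewrite lt_min s0 divr_gt0// ltr_wpDl.
exists d => // h; rewrite lt_min => /andP[hs hr].
have cb a : `|c (t + h) 0 a - c t 0 a| <= (`|dc a| + 1) * `|h|.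
  have := sP h hs a; have := ler_normD (c (t + h) 0 a - c t 0 a - dc a * h) (dc a * h).
  rewrite subrK (normrM (dc a)) mulrDl mul1r.
  have : Num.min e1 1 * `|h| <= 1 * `|h| by rewrite ler_wpM2r// ge_min lexx orbT.
  by lra.
have cD a : (`|dc a| + 1) <= D.
  by rewrite /D (bigD1 a)//= lerDl sumr_ge0// => b _; rewrite addr_ge0.
have cr : cube (c t) r (c (t + h)).
  move=> a; apply: le_lt_trans (cb a) _.
  apply: (@le_lt_trans _ _ ((D + 1) * `|h|)); first by rewrite ler_wpM2r// (le_trans (cD a))// lerDl.
  by move: hr; rewrite ltr_pdivlMr ?ltr_wpDl// mulrC.
have := box_mean_value (f := f) (df := df) (L := fun a => df a (c t)) (e := e1)
  (@boxy_cube _ _ (c t) r) (cube_center _ r0) cr.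
move=> /(_ (fun x a Bx => fd x a (rB x Bx).1) (fun x a Bx => (rB x Bx).2 a)) H.
have -> : (f \o c) (t + h) - (f \o c) t - (\sum_a df a (c t) * dc a) * h =
  (f (c (t + h)) - f (c t) - \sum_a (c (t + h) 0 a - c t 0 a) * df a (c t))
  + \sum_a df a (c t) * (c (t + h) 0 a - c t 0 a - dc a * h).
  have -> : (\sum_a df a (c t) * dc a) * h =
      \sum_a (c (t + h) 0 a - c t 0 a) * df a (c t)
      - \sum_a df a (c t) * (c (t + h) 0 a - c t 0 a - dc a * h).
    by rewrite mulr_suml -sumrB; apply: eq_bigr => a _; ring.
  by rewrite /= opprB addrA addrAC.
apply: le_trans (ler_normD _ _) _.
apply: (@le_trans _ _ ((e1 * D + L * e1) * `|h|)); last by rewrite ler_wpM2r.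
rewrite mulrDl lerD//.
  apply: le_trans H _; rewrite -mulrA ler_wpM2l ?(ltW e10)// /D mulr_suml.
  by apply: ler_sum.
rewrite (le_trans (ler_norm_sum _ _ _))// /L -mulrA mulr_suml ler_sum// => a _.
rewrite normrM ler_wpM2l// (le_trans (sP h hs a))// ler_wpM2r//.
by rewrite ge_min lexx.
Qed.

End ChainRule.

(** * Functions of class C^n on open sets *)

Section Smooth.
Context {R : realType} {m : nat}.
Implicit Types (V : set 'rV[R]_m) (f g : 'rV[R]_m -> R).
Local Notation "'d_ a" := (fun f => 'D_(delta_mx 0 a : 'rV[R]_m) f) (at level 0).

Lemma Cn_continuous n V f x : Cn n V f -> V x -> {for x, continuous f}.
Proof. by case: n => [|n] [H _]; apply: H. Qed.

Lemma Cn_is_derive n V f x a : Cn n.+1 V f -> V x ->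
  is_derive x (delta_mx 0 a) f ('D_(delta_mx 0 a) f x).
Proof. by move=> [_ /(_ a)[H _]] /H; split. Qed.

Lemma Cn_derive n V f a : Cn n.+1 V f -> Cn n V ('D_(delta_mx 0 a) f).
Proof. by move=> [_ /(_ a)[]]. Qed.

Lemma CnS n V f : Cn n.+1 V f -> Cn n V f.
Proof.
elim: n f => [|n IH] f [cf df]; first by split.
by split=> // a; have [? ?] := df a; split=> //; exact: IH.
Qed.

Lemma CnW n k V f : (k <= n)%N -> Cn n V f -> Cn k V f.
Proof.
move=> /subnK <-; elim: (n - k)%N => // j IH /CnS; exact: IH.
Qed.

Lemma Cn_sub n (V W : set 'rV[R]_m) f : W `<=` V -> Cn n V f -> Cn n W f.
Proof.
move=> WV; elim: n f => [|n IH] f [cf df]; split=> //; first by move=> x /WV/cf.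
  by move=> x /WV/cf.
by move=> a; have [dfa ?] := df a; split; [move=> x /WV/dfa|exact: IH].
Qed.

(** The last hypothesis quantifies over every [g] equal to [df a] on [V], because the derivative of
    [f] is known to agree with [df a] only there. *)
Lemma Cn_intro n V f (df : 'I_m -> 'rV[R]_m -> R) : open V ->
  (forall x, V x -> {for x, continuous f}) ->
  (forall x a, V x -> is_derive x (delta_mx 0 a) f (df a x)) ->
  (forall a g, (forall x, V x -> g x = df a x) -> Cn n V g) -> Cn n.+1 V f.
Proof.
move=> oV cf dfE cdf; split=> // a; split=> [x /dfE -/(_ a)[]//|].
by apply: cdf => x Vx; have [_ ->] := dfE x a Vx.
Qed.

Lemma open_near V f g x : open V -> {in V, f =1 g} -> V x -> \forall y \near x, f y = g y.
Proof.
move=> oV fg Vx; have : nbhs x V by exact: open_nbhs_nbhs.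
by apply: filterS => y Vy; apply: fg; rewrite inE.
Qed.

Lemma Cn_ext n V f g : open V -> {in V, f =1 g} -> Cn n V f -> Cn n V g.
Proof.
move=> oV; elim: n f g => [|n IH] f g fg [cf df].
  split=> // x Vx; have := cf x Vx; rewrite /prop_for /continuous_at -(fg x) ?inE//.
  exact: (cvg_trans (near_eq_cvg (open_near oV fg Vx))).
split=> [x Vx|a].
  have := cf x Vx; rewrite /prop_for /continuous_at -(fg x) ?inE//.
  exact: (cvg_trans (near_eq_cvg (open_near oV fg Vx))).
have [dfa cdfa] := df a; split=> [x Vx|].
  exact: near_eq_derivable (open_near oV fg Vx) (dfa x Vx).
by apply: IH cdfa => x; rewrite inE => Vx; apply/near_eq_derive/(open_near oV fg Vx).
Qed.

Lemma Cn_cst n V (k : R) : Cn n V (cst k).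
Proof.
elim: n k => [|n IH] k; first by split=> [x _|//]; exact: cst_continuous.
split=> [x _|a]; first exact: cst_continuous.
split=> [x _|]; first exact: derivable_cst.
rewrite (_ : (fun x => _) = cst 0); first exact: IH.
by apply/funext => x; rewrite derive_cst.
Qed.

Lemma Cn_add n V f g : open V -> Cn n V f -> Cn n V g -> Cn n V (fun x => f x + g x).
Proof.
move=> oV; elim: n f g => [|n IH] f g Hf Hg.
  by split=> // x Vx; exact: (continuousD (Cn_continuous Hf Vx) (Cn_continuous Hg Vx)).
apply: (Cn_intro (df := fun a x => 'D_(delta_mx 0 a) f x + 'D_(delta_mx 0 a) g x)) => //.
- by move=> x Vx; exact: (continuousD (Cn_continuous Hf Vx) (Cn_continuous Hg Vx)).
- by move=> x a Vx; apply: is_deriveD; apply: Cn_is_derive Vx; eassumption.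
- move=> a h hE; apply: Cn_ext (IH _ _ (Cn_derive a Hf) (Cn_derive a Hg)) => //.
  by move=> x; rewrite inE => /hE.
Qed.

Lemma Cn_mul n V f g : open V -> Cn n V f -> Cn n V g -> Cn n V (fun x => f x * g x).
Proof.
move=> oV; elim: n f g => [|n IH] f g Hf Hg.
  by split=> // x Vx; exact: (continuousM (Cn_continuous Hf Vx) (Cn_continuous Hg Vx)).
apply: (Cn_intro (df := fun a x => f x * 'D_(delta_mx 0 a) g x + 'D_(delta_mx 0 a) f x * g x)) => //.
- by move=> x Vx; exact: (continuousM (Cn_continuous Hf Vx) (Cn_continuous Hg Vx)).
- move=> x a Vx; apply: is_derive_eq; first by apply: is_deriveM; apply: Cn_is_derive Vx; eassumption.
  by rewrite [X in _ + X]mulrC.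
- move=> a h hE; apply: Cn_ext (Cn_add oV (IH _ _ (CnS Hf) (Cn_derive a Hg)) (IH _ _ (Cn_derive a Hf) (CnS Hg))) => //.
  by move=> x; rewrite inE => /hE.
Qed.

Lemma Cn_sum n V (I : Type) (s : seq I) (P : pred I) (F : I -> 'rV[R]_m -> R) : open V ->
  (forall i, Cn n V (F i)) -> Cn n V (fun x => \sum_(i <- s | P i) F i x).
Proof.
move=> oV H; elim: s => [|i s IH].
  by rewrite (_ : (fun x => _) = cst 0) //; [exact: Cn_cst|apply/funext => x; rewrite big_nil].
rewrite (_ : (fun x => _) = (fun x => (if P i then F i x else 0) + \sum_(j <- s | P j) F j x)).
  apply: Cn_add => //; case: (P i) => //; exact: Cn_cst.
by apply/funext => x; rewrite big_cons; case: ifP; rewrite ?add0r.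
Qed.

Lemma Cn_prod n V (I : Type) (s : seq I) (P : pred I) (F : I -> 'rV[R]_m -> R) : open V ->
  (forall i, Cn n V (F i)) -> Cn n V (fun x => \prod_(i <- s | P i) F i x).
Proof.
move=> oV H; elim: s => [|i s IH].
  by rewrite (_ : (fun x => _) = cst 1) //; [exact: Cn_cst|apply/funext => x; rewrite big_nil].
rewrite (_ : (fun x => _) = (fun x => (if P i then F i x else 1) * \prod_(j <- s | P j) F j x)).
  apply: Cn_mul => //; case: (P i) => //; exact: Cn_cst.
by apply/funext => x; rewrite big_cons; case: ifP; rewrite ?mul1r.
Qed.

Lemma Cn_opp n V f : open V -> Cn n V f -> Cn n V (fun x => - f x).
Proof.
move=> oV Hf; rewrite (_ : (fun x => _) = (fun x => cst (-1) x * f x)); last first.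
  by apply/funext => x; rewrite mulN1r.
exact/Cn_mul/Hf/Cn_cst.
Qed.

Lemma Cn_inv n V f : open V -> (forall x, V x -> f x != 0) ->
  Cn n V f -> Cn n V (fun x => (f x)^-1).
Proof.
move=> oV f0; elim: n => [|n IH] Hf.
  by split=> // x Vx; exact: (continuousV (f0 x Vx) (Cn_continuous Hf Vx)).
apply: (Cn_intro (df := fun a x => - ((f x)^-1 * (f x)^-1) * 'D_(delta_mx 0 a) f x)) => //.
- by move=> x Vx; exact: (continuousV (f0 x Vx) (Cn_continuous Hf Vx)).
- move=> x a Vx; have Hd := Cn_is_derive a Hf Vx.
  split; first by apply: derivableV; [exact: f0|case: Hd].
  rewrite (@deriveV _ _ f x (delta_mx 0 a) (f0 x Vx)); last by case: Hd.
  by rewrite /GRing.scale /= expr2 invfM.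
- move=> a h hE; apply: Cn_ext (Cn_mul oV (Cn_opp oV (Cn_mul oV (IH (CnS Hf)) (IH (CnS Hf)))) (Cn_derive a Hf)) => //.
  by move=> x; rewrite inE => /hE.
Qed.

Lemma Cn_along V f (c : R -> 'rV[R]_m) (t : R) (dc : 'I_m -> R) : open V -> Cn 1 V f -> V (c t) ->
  (forall a, is_derive t 1 (fun s => c s 0 a) (dc a)) ->
  is_derive t 1 (f \o c) (\sum_a 'D_(delta_mx 0 a) f (c t) * dc a).
Proof.
move=> oV Hf Vc cd.
apply: (@is_derive_along _ _ V f (fun a => 'D_(delta_mx 0 a) f) c t dc) => //.
- exact: open_nbhs_nbhs.
- by move=> x a Vx; exact: (Cn_is_derive a Hf Vx).
- by move=> a; apply: Cn_continuous Vc; exact: Cn_derive Hf.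
Qed.

Lemma Cn_line n V f x a (s : R) : Cn n.+1 V f -> V (x + s *: delta_mx 0 a) ->
  is_derive s 1 (fun s => f (x + s *: delta_mx 0 a))
    ('D_(delta_mx 0 a) f (x + s *: delta_mx 0 a)).
Proof.
move=> Hf Vx; exact: (is_derive_line f x _ s _).1 (Cn_is_derive a Hf Vx).
Qed.

Lemma Cn_line_bound V f x a (h C L : R) : Cn 1 V f ->
  (forall u : R, Num.min 0 h <= u <= Num.max 0 h -> V (x + u *: delta_mx 0 a)) ->
  (forall u : R, Num.min 0 h <= u <= Num.max 0 h ->
    `|'D_(delta_mx 0 a) f (x + u *: delta_mx 0 a) - L| <= C) ->
  `|f (x + h *: delta_mx 0 a) - f x - L * h| <= C * `|h|.
Proof.
move=> Hf HV HC; have := @MVT_bound _ (fun u => f (x + u *: delta_mx 0 a))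
  (fun u => 'D_(delta_mx 0 a) f (x + u *: delta_mx 0 a)) 0 h L C
  (fun u uh => Cn_line Hf (HV u uh)) HC.
by rewrite scale0r addr0 subr0.
Qed.

End Smooth.

(** * Symmetry of second derivatives *)

Section Schwarz.
Context {R : realType} {m : nat}.
Implicit Types (V : set 'rV[R]_m) (f g : 'rV[R]_m -> R).
Local Notation e_ a := (delta_mx 0 a : 'rV[R]_m).

Let second_difference f (x : 'rV[R]_m) (a b : 'I_m) (h : R) : R :=
  f (x + h *: e_ a + h *: e_ b) - f (x + h *: e_ a) - f (x + h *: e_ b) + f x.

Lemma cube_shift x (r s t : R) a b : 0 < r -> `|s| < r / 2 -> `|t| < r / 2 ->
  cube x r (x + s *: e_ a + t *: e_ b).
Proof.
move=> r0 sr tr d; rewrite !mxE eqxx /=.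
have -> : x 0 d + s * (d == a)%:R + t * (d == b)%:R - x 0 d
  = s * (d == a)%:R + t * (d == b)%:R by ring.
have H (u : R) (c : bool) : `|u| < r / 2 -> `|u * c%:R| < r / 2.
  by case: c => ur; rewrite ?mulr1// mulr0 normr0 divr_gt0.
by rewrite (le_lt_trans (ler_normD _ _))// (splitr r) ltrD// H.
Qed.

(** The mean value estimate is used twice: in direction [a] for the difference taken in direction
    [b], then in direction [b] for its derivative. Continuity of the mixed derivative at [x]
    supplies [e]. *)
Lemma second_difference_lim V f x a b (e : R) : open V -> Cn 2 V f -> V x -> 0 < e ->
  exists2 r : R, 0 < r & forall h : R, `|h| < r ->
  `|second_difference f x a b h - h * h * 'D_(e_ b) ('D_(e_ a) f) x| <= e * (h * h).
Proof.
move=> oV Hf Vx e0; pose L : R := 'D_(e_ b) ('D_(e_ a) f) x.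
have Hfa : Cn 1 V ('D_(e_ a) f) by exact: Cn_derive Hf.
have [r r0 rP] : exists2 r : R, 0 < r & cube x r `<=` V `&` [set y | `|'D_(e_ b) ('D_(e_ a) f) y - L| <= e].
  apply/nbhs_cubeP; apply: filterI; first exact: open_nbhs_nbhs.
  exact: (continuous_dist_le (Cn_continuous (Cn_derive b Hfa) Vx) e0).
exists (r / 2) => [|h hr]; first by rewrite divr_gt0.
have hs (s : R) : Num.min 0 h <= s <= Num.max 0 h -> `|s| < r / 2.
  by move: hr; rewrite !ltr_norml; case: (leP 0 h) => *; lra.
pose g (s : R) := f (x + h *: e_ b + s *: e_ a) - f (x + s *: e_ a).
pose dg (s : R) := 'D_(e_ a) f (x + h *: e_ b + s *: e_ a) - 'D_(e_ a) f (x + s *: e_ a).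
have gd s : Num.min 0 h <= s <= Num.max 0 h -> is_derive s 1 g (dg s).
  move=> /hs sr; apply: is_deriveB; apply: (Cn_line Hf).
    by apply: (rP _ _).1; exact: cube_shift.
  apply: (rP _ _).1; rewrite -[x + s *: _]addr0 -(scale0r (e_ b)).
  by apply: cube_shift => //; rewrite normr0 divr_gt0.
have gb s : Num.min 0 h <= s <= Num.max 0 h -> `|dg s - h * L| <= e * `|h|.
  move=> /hs sr.
  have := @MVT_bound _ (fun t => 'D_(e_ a) f (x + s *: e_ a + t *: e_ b))
     (fun t => 'D_(e_ b) ('D_(e_ a) f) (x + s *: e_ a + t *: e_ b)) 0 h L e.
  rewrite subr0 scale0r addr0 (mulrC L) (addrAC x) => H; apply: H => t /hs tr.
    apply: (Cn_line Hfa).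
    by apply: (rP _ _).1; exact: cube_shift.
  by apply: (rP _ _).2; exact: cube_shift.
have := MVT_bound gd gb.
rewrite subr0 /second_difference.
have -> : g h - g 0 - h * L * h =
  f (x + h *: e_ a + h *: e_ b) - f (x + h *: e_ a) - f (x + h *: e_ b) + f x - h * h * L.
  by rewrite /g scale0r !addr0 (addrAC x); ring.
by rewrite -[X in _ <= X -> _]mulrA -normrM ger0_norm// -expr2 sqr_ge0.
Qed.

(** The second difference is unchanged when [a] and [b] are exchanged, so both mixed derivatives
    times h^2 approximate the same number within e h^2 / 2. *)
Lemma derive_swap V f x a b : open V -> Cn 2 V f -> V x ->
  'D_(e_ b) ('D_(e_ a) f) x = 'D_(e_ a) ('D_(e_ b) f) x.
Proof.
move=> oV Hf Vx; pose L1 : R := 'D_(e_ b) ('D_(e_ a) f) x.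
pose L2 : R := 'D_(e_ a) ('D_(e_ b) f) x; rewrite -/L1 -/L2.
apply/eqP; rewrite -subr_eq0 -normr_le0; apply/ler_addgt0Pr => e e0; rewrite add0r.
have e2 : 0 < e / 2 by rewrite divr_gt0.
have [r r0 rP] := second_difference_lim a b oV Hf Vx e2.
have [s s0 sP] := second_difference_lim b a oV Hf Vx e2.
pose h : R := Num.min r s / 2.
have h0 : 0 < h by rewrite divr_gt0// lt_min r0.
have hrs : h < Num.min r s by rewrite ltr_pdivrMr// ltr_pMr ?ltr1n// lt_min r0.
have := rP h; have := sP h; rewrite gtr0_norm//.
move: hrs; rewrite lt_min => /andP[-> ->] /(_ isT) H2 /(_ isT) H1.
have hh : 0 < h * h by rewrite mulr_gt0.
rewrite -(ler_pM2r hh) -[X in _ * X <= _](gtr0_norm hh) -normrM.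
have E : second_difference f x b a h = second_difference f x a b h.
  by rewrite /second_difference (addrAC x); ring.
move: H1 H2; rewrite E -/L1 -/L2; set S := second_difference _ _ _ _ _.
have -> : (L1 - L2) * (h * h) = (S - h * h * L2) - (S - h * h * L1) by ring.
move=> H1 H2; rewrite (splitr e) mulrDl.
exact: le_trans (ler_normB _ _) (lerD H2 H1).
Qed.

End Schwarz.

(** * Linear differential equations and Frobenius' theorem *)
Lemma le0_geometric {R : realType} (x M : R) :
  (forall k, x <= M * 2^-1 ^+ k) -> x <= 0.
Proof.
move=> H; have h : (M * 2^-1 ^+ k @[k --> \oo]) --> (0 : R).
  have := @cvg_geometric R M 2^-1; rewrite ger0_norm//.
  by apply; rewrite invf_lt1// ltr1n.
rewrite leNgt; apply/negP => x0.
have [k _ /(_ k (leqnn k))] := cvgr_lt _ h _ x0.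
by rewrite /= ltNge H.
Qed.

Lemma continuous_sum_at {R : realType} {T : topologicalType} (I : Type) (s : seq I)
    (F : I -> T -> R) (x : T) :
  (forall i, {for x, continuous (F i)}) ->
  {for x, continuous (fun t => \sum_(i <- s) F i t)}.
Proof.
move=> H; elim: s => [|i s IH].
  rewrite (_ : (fun t => _) = cst 0); first exact: cst_continuous.
  by apply/funext => t; rewrite big_nil.
rewrite (_ : (fun t => _) = F i \+ (fun t => \sum_(j <- s) F j t)).
  exact: (continuousD (H i) IH).
by apply/funext => t; rewrite big_cons.
Qed.

Lemma primitive {R : realType} (f : R -> R) (r : R) : continuous f -> 0 < r ->
  exists F : R -> R, F 0 = 0 /\ forall t : R, `|t| < r -> is_derive t 1 F (f t).
Proof.
move=> cf r0.
pose F x : R := (\int[lebesgue_measure]_(t in `[(- r), x]) f t)%R.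
have HF (t : R) : `|t| < r -> is_derive t 1 F (f t).
  rewrite ltr_norml => /andP[t1 t2].
  have intf : lebesgue_measure.-integrable `[(- r), r] (EFin \o f).
    apply: continuous_compact_integrable; first exact: segment_compact.
    exact: continuous_subspaceT.
  have [H1 H2] := continuous_FTC1_closed t2 intf t1 (cf t).
  by apply: (DeriveDef H1); rewrite -H2 derive1E.
exists (fun x => F x - F 0); split; first by rewrite subrr.
move=> t tr; rewrite -[f t]subr0.
by apply: is_deriveB; exact: HF.
Qed.

Lemma is_derive_eps_fin {R : realType} {I : finType} (f : I -> R -> R) (d : I -> R) (t e : R) :
  (forall a, is_derive t 1 (f a) (d a)) -> 0 < e ->
  exists2 r : R, 0 < r & forall h, `|h| < r -> forall a,
    `|f a (t + h) - f a t - d a * h| <= e * `|h|.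
Proof.
move=> fd e0.
have /nbhs_ballP[r /= r0 rP] : \forall h \near (0 : R), forall a,
    `|f a (t + h) - f a t - d a * h| <= e * `|h|.
  apply: (@filter_forall _ _ (fun a h => `|f a (t + h) - f a t - d a * h| <= e * `|h|) (nbhs (0 : R))) => a.
  have /is_derive_epsP/(_ _ e0)[r r0 rP] := fd a.
  by apply/nbhs_ballP; exists r => //= h; rewrite /ball /= sub0r normrN => /rP.
by exists r => // h hr; apply: rP; rewrite /ball /= sub0r normrN.
Qed.

Lemma is_derive_sum_fun {R : realType} {I : Type} (s : seq I) (F : I -> R -> R) (d : I -> R) (t : R) :
  (forall i, is_derive t 1 (F i) (d i)) ->
  is_derive t 1 (fun u => \sum_(i <- s) F i u) (\sum_(i <- s) d i).
Proof.
move=> H; elim: s => [|i s IH].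
  rewrite big_nil (_ : (fun u => _) = cst 0); first exact: is_derive_cst.
  by apply/funext => u; rewrite big_nil.
rewrite big_cons (_ : (fun u => _) = F i \+ (fun u => \sum_(j <- s) F j u)).
  by apply: is_deriveD; exact: H.
by apply/funext => u; rewrite big_cons.
Qed.

Section LinearODE.
Context {R : realType} {n : nat}.
Implicit Types (y z : R -> 'cV[R]_n) (A : R -> 'M[R]_n).

Lemma mulmx_entry_le (p : nat) (M : 'M[R]_(p, n)) (v : 'cV[R]_n) (C : R) a :
  0 <= C -> (forall b, `|M a b| <= C) -> `|(M *m v) a 0| <= C * \sum_b `|v b 0|.
Proof.
move=> C0 MC; rewrite mxE (le_trans (ler_norm_sum _ _ _))// mulr_sumr ler_sum// => b _.
by rewrite normrM ler_wpM2r.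
Qed.

Lemma sum_le_card (F : 'I_n -> R) (K : R) : (forall a, F a <= K) -> \sum_a F a <= n%:R * K.
Proof. by move=> H; rewrite (le_trans (ler_sum _ (fun a _ => H a)))// sumr_const card_ord mulr_natl. Qed.

(** A Gronwall bound for short times without exponentials: at a maximum [c] of the sum [S] of
    absolute values, the mean value estimate reads S c <= S 0 + S c / 2 + error, and the half is
    absorbed on the left. *)
Lemma small_gronwall y (dy : R -> 'cV[R]_n) (T C e : R) :
  (forall t a, Num.min 0 T <= t <= Num.max 0 T ->
     is_derive t 1 (fun s => y s a 0) (dy t a 0)) ->
  (forall t a, Num.min 0 T <= t <= Num.max 0 T ->
     `|dy t a 0| <= C * (\sum_b `|y t b 0|) + e) ->
  0 <= C -> 0 <= e -> n%:R * C * `|T| <= 2^-1 ->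
  forall t, Num.min 0 T <= t <= Num.max 0 T ->
  \sum_a `|y t a 0| <= 2 * (\sum_a `|y 0 a 0| + n%:R * e * `|T|).
Proof.
move=> yd dyb C0 e0 nCT t tT.
pose S (s : R) : R := \sum_a `|y s a 0|.
have cS : {within `[Num.min 0 T, Num.max 0 T], continuous S}.
  move=> s; apply: (@continuous_sum_at _ (subspace _)) => a.
  apply: continuous_comp; last exact: norm_continuous.
  exact: (is_derive_within_continuous (fun t tT => yd t a tT)).
have mM : Num.min 0 T <= Num.max 0 T by rewrite ge_min !le_max !lexx.
have [c cT cmax] := EVT_max mM cS.
have {}cT : Num.min 0 T <= c <= Num.max 0 T by move: cT; rewrite in_itv.
have {}cmax s : Num.min 0 T <= s <= Num.max 0 T -> S s <= S c.
  by move=> sT; apply: cmax; rewrite in_itv.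
apply: le_trans (cmax _ tT) _.
have S0 : 0 <= S c by apply: sumr_ge0.
have cT' : `|c| <= `|T|.
  exact: between0_norm.
have H a : `|y c a 0| <= `|y 0 a 0| + (C * S c + e) * `|T|.
  have Hs (s : R) : Num.min 0 c <= s <= Num.max 0 c -> Num.min 0 T <= s <= Num.max 0 T.
    exact: between0_trans.
  have : `|y c a 0 - y 0 a 0 - 0 * (c - 0)| <= (C * S c + e) * `|c - 0|.
    apply: (@MVT_bound _ (fun s => y s a 0) (fun s => dy s a 0)) => s /Hs sT; first exact: yd.
    rewrite subr0 (le_trans (dyb _ _ sT))// lerD2r ler_wpM2l//; exact: cmax.
  rewrite mul0r !subr0 => Hc.
  have : `|y c a 0| <= `|y 0 a 0| + `|y c a 0 - y 0 a 0|.
    by rewrite -{1}(subrK (y 0 a 0) (y c a 0)) addrC ler_normD.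
  move=> /le_trans; apply; rewrite lerD2l (le_trans Hc)// ler_wpM2l//.
  by rewrite addr_ge0// mulr_ge0.
have : S c <= \sum_a (`|y 0 a 0| + (C * S c + e) * `|T|) by exact: ler_sum.
rewrite big_split /= sumr_const card_ord -mulr_natl => {}H.
have : n%:R * C * `|T| * S c <= 2^-1 * S c by rewrite ler_wpM2r.
by move: (\sum_a _) H; move: (S c) => s u; lra.
Qed.

(** Composing with this retraction makes a coefficient given on [-r, r] continuous on the whole line
    and leaves the equation inside unchanged. *)
Definition clamp (r t : R) : R := Num.max (- r) (Num.min r t).

Lemma clamp_id r t : `|t| <= r -> clamp r t = t.
Proof.
by rewrite ler_norml /clamp => /andP[h1 h2]; rewrite min_r// max_r.
Qed.

Lemma clamp_le r t : 0 <= r -> `|clamp r t| <= r.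
Proof.
move=> r0; rewrite ler_norml /clamp le_max lexx /= ge_max ge_min lexx /=.
by rewrite (le_trans _ r0)// oppr_le0.
Qed.

Lemma continuous_clamp r : continuous (clamp r).
Proof.
move=> t; rewrite /clamp; apply: (@continuous_max _ _ (cst (- r)) (fun t => Num.min r t)).
  exact: cst_continuous.
by apply: (@continuous_min _ _ (cst r) id); [exact: cst_continuous|].
Qed.

(** The limit is the supremum of the lower bounds u_k - M / 2^k; every u_j + M / 2^j lies above all
    of them. *)
Lemma sandwich_limit (u : nat -> R) (M : R) :
  (forall k j, `|u (k + j)%N - u k| <= M * 2^-1 ^+ k) ->
  exists l, forall k, `|l - u k| <= M * 2^-1 ^+ k.
Proof.
move=> H; pose S := [set u k - M * 2^-1 ^+ k | k in [set: nat]].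
have Sub j : ubound S (u j + M * 2^-1 ^+ j).
  move=> _ [k _ <-]; have [kj|/ltnW jk] := leqP k j.
    have := H k (j - k)%N; have := H j 0%N; rewrite addn0 subrr normr0 subnKC//.
    by rewrite ler_norml => h1 /andP[h2 h3]; lra.
  have := H j (k - j)%N; have := H k 0%N; rewrite addn0 subrr normr0 subnKC//.
  by rewrite ler_norml => h1 /andP[h2 h3]; lra.
have S0 : S !=set0 by exists (u 0%N - M * 2^-1 ^+ 0), 0%N.
exists (sup S) => k; rewrite ler_distl; apply/andP; split.
  by apply: ub_le_sup; [exists (u 0%N + M * 2^-1 ^+ 0)|exists k].
exact: ge_sup.
Qed.

(** Picard iteration. The smallness condition n C r <= 1/2 makes it contract with ratio 1/2 on all
    of [-r, r], so the solution lives on the prescribed interval. *)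
Lemma linear_ODE A (r C : R) (y0 : 'cV[R]_n) : 0 < r -> 0 <= C ->
  (forall (t : R) a b, `|t| <= r -> {for t, continuous (fun s => A s a b)}) ->
  (forall (t : R) a b, `|t| <= r -> `|A t a b| <= C) ->
  n%:R * C * r <= 2^-1 ->
  exists y, y 0 = y0 /\ forall (t : R) a, `|t| < r ->
    is_derive t 1 (fun s => y s a 0) ((A t *m y t) a 0).
Proof.
move=> r0 C0 cA bA nCr.
pose A' (t : R) := A (clamp r t).
have cl (t : R) : `|clamp r t| <= r by exact/clamp_le/ltW.
have cA' a b : continuous (fun s => A' s a b).
  move=> t; apply: (@continuous_comp _ _ _ (clamp r) (fun s => A s a b) t).
    exact: continuous_clamp.
  exact: cA.
have r2 : 0 < 2 * r by rewrite mulr_gt0.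
have rr2 : r < 2 * r by rewrite ltr_pMl// ltr1n.
(* A primitive is chosen for all functions at once, so that the iteration becomes a plain map; for a
   discontinuous [f] the choice is arbitrary. *)
have exP (f : R -> R) : exists F : R -> R, continuous f ->
    F 0 = 0 /\ forall t : R, `|t| < 2 * r -> is_derive t 1 F (f t).
  have [cf|ncf] := pselect (continuous f); last by exists f.
  by have [F HF] := primitive cf r2; exists F.
have [P HP] := choice exP.
pose contv y := forall a, continuous (fun s => y s a 0).
have cAy y : contv y -> forall a, continuous (fun s => (A' s *m y s) a 0).
  move=> cy a t; rewrite (_ : (fun s => _) = (fun s => \sum_b A' s a b * y s b 0)).
    by apply: continuous_sum_at => b; exact: (continuousM (cA' _ _ _) (cy _ _)).
  by apply/funext => s; rewrite mxE.
pose next y t : 'cV[R]_n := \col_a (y0 a 0 + P (fun s => (A' s *m y s) a 0) (clamp r t)).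
have next_d y : contv y -> forall (t : R) a, `|t| < r ->
    is_derive t 1 (fun s => next y s a 0) ((A' t *m y t) a 0).
  move=> cy t a tr; have [_ Hd] := HP _ (cAy _ cy a).
  apply: (@near_eq_is_derive _ _ _ (fun s => y0 a 0 + P (fun s => (A' s *m y s) a 0) s)).
    apply/nbhs_ballP; exists (r - `|t|) => /=; first by rewrite subr_gt0.
    move=> s; rewrite /ball /= => ts; rewrite mxE clamp_id//.
    have := ler_normB s t; have := ler_normD (s - t) t; rewrite subrK distrC.
    by move: ts; lra.
  rewrite -[(A' t *m y t) a 0]add0r; apply: is_deriveD; apply: Hd; exact: lt_trans rr2.
have next_c y : contv y -> contv (next y).
  move=> cy a t; have [_ Hd] := HP _ (cAy _ cy a).
  rewrite (_ : (fun s => _) = cst (y0 a 0) \+ (P (fun s => (A' s *m y s) a 0) \o clamp r)).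
    apply: (@continuousD _ _ _ (cst (y0 a 0)) (P (fun s => (A' s *m y s) a 0) \o clamp r) t).
      exact: cst_continuous.
    apply: (@continuous_comp _ _ _ (clamp r) (P (fun s => (A' s *m y s) a 0)) t).
      exact: continuous_clamp.
    by apply: (is_derive_continuous (Hd _ _)); apply: le_lt_trans rr2.
  by apply/funext => s; rewrite mxE.
have prim_le f K : continuous f -> 0 <= K -> (forall t : R, `|t| <= r -> `|f t| <= K) ->
    forall t, `|P f (clamp r t)| <= K * r.
  move=> cf K0 fK t; have [P0 Hd] := HP _ cf.
  have hs s : Num.min 0 (clamp r t) <= s <= Num.max 0 (clamp r t) -> `|s| <= r.
    by move=> /between0_norm /le_trans; apply.
  have : `|P f (clamp r t) - P f 0 - 0 * (clamp r t - 0)| <= K * `|clamp r t - 0|.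
    apply: (@MVT_bound _ _ f) => s /hs sr; first by apply: Hd; exact: le_lt_trans rr2.
    by rewrite subr0 fK.
  by rewrite P0 mul0r !subr0 => /le_trans; apply; rewrite ler_wpM2l.
have PB f g : continuous f -> continuous g -> forall t,
    P f (clamp r t) - P g (clamp r t) = P (f \- g) (clamp r t).
  move=> cf cg t; have [Pf Hf] := HP _ cf; have [Pg Hg] := HP _ cg.
  have cfg : continuous (f \- g) by move=> x; exact: (continuousB (cf x) (cg x)).
  have [Pfg Hfg] := HP _ cfg.
  have H x : - (2 * r) < x < 2 * r -> is_derive x 1 (fun s => P f s - P g s - P (f \- g) s) 0.
    rewrite -ltr_norml => xr; rewrite -(subrr (f x - g x)).
    by apply: is_deriveB; [apply: is_deriveB; [exact: Hf|exact: Hg]|exact: Hfg].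
  have := is_derive1_0_cst H (s := clamp r t) (t := 0).
  rewrite Pf Pg Pfg !subr0 => E; apply/eqP; rewrite -subr_eq0; apply/eqP/E.
    by rewrite -ltr_norml (le_lt_trans (cl t)).
  by rewrite oppr_lt0 r2.
have next_lip y z (K : R) : contv y -> contv z -> 0 <= K ->
    (forall s a, `|y s a 0 - z s a 0| <= K) ->
    forall t a, `|next y t a 0 - next z t a 0| <= K * 2^-1.
  move=> cy cz K0 yzK t a; rewrite !mxE opprD addrACA subrr add0r PB; [|exact: cAy|exact: cAy].
  apply: (@le_trans _ _ ((C * (n%:R * K)) * r)); last first.
    have : n%:R * C * r * K <= 2^-1 * K by rewrite ler_wpM2r.
    by lra.
  apply: prim_le => [||s sr].
  - by move=> x; exact: (continuousB (cAy _ cy _ _) (cAy _ cz _ _)).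
  - by rewrite mulr_ge0// mulr_ge0.
  - rewrite /= (_ : _ - _ = (A' s *m (y s - z s)) a 0); last by rewrite mulmxBr !mxE.
    rewrite (le_trans (mulmx_entry_le _ C0 _))//; first by move=> b; exact: bA.
    by rewrite ler_wpM2l//; apply: sum_le_card => b; rewrite !mxE.
pose Y k := iter k next (cst y0).
have cY k : contv (Y k).
  by elim: k => [a|k IH]; [exact: cst_continuous|exact: next_c].
pose M : R := C * (\sum_b `|y0 b 0|) * r.
have M0 : 0 <= M by rewrite !mulr_ge0// ?sumr_ge0// ltW.
have p0 k : 0 <= 2^-1 ^+ k :> R by rewrite exprn_ge0// invr_ge0.
have D k t a : `|Y k.+1 t a 0 - Y k t a 0| <= M * 2^-1 ^+ k.
  elim: k t a => [|k IH] t a.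
    rewrite expr0 mulr1 /Y /= mxE addrC addKr; apply: prim_le; first exact: (cAy _ (cY 0%N)).
      by rewrite mulr_ge0// sumr_ge0.
    by move=> s sr; apply: mulmx_entry_le => // b; exact: bA.
  rewrite exprSr mulrA; apply: (next_lip (Y k.+1) (Y k)).
  - exact: cY.
  - exact: cY.
  - exact: (mulr_ge0 M0 (p0 k)).
  - exact: IH.
have D' k j t a : `|Y (k + j)%N t a 0 - Y k t a 0| <= 2 * M * 2^-1 ^+ k.
  apply: (@le_trans _ _ (2 * M * (2^-1 ^+ k - 2^-1 ^+ (k + j)))); last first.
    by rewrite mulrBr gerBl mulr_ge0// mulr_ge0.
  elim: j => [|j IH]; first by rewrite addn0 !subrr normr0 mulr0.
  rewrite addnS -(subrKA (Y (k + j)%N t a 0)) (le_trans (ler_normD _ _))//.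
  apply: le_trans (lerD (D _ _ _) IH) _; rewrite exprSr.
  by move: (2^-1 ^+ k) (2^-1 ^+ (k + j)) => u v; lra.
have exY (ta : R * 'I_n) : exists l, forall k, `|l - Y k ta.1 ta.2 0| <= 2 * M * 2^-1 ^+ k.
  by apply: (@sandwich_limit (fun k => Y k ta.1 ta.2 0)) => k j; exact: D'.
have [yf Hyf] := choice exY.
pose y t : 'cV[R]_n := \col_a yf (t, a).
have Hy k t a : `|y t a 0 - Y k t a 0| <= 2 * M * 2^-1 ^+ k by rewrite mxE (Hyf (t, a)).
have cy : contv y.
  move=> a t; apply/cvgrPdist_le => e e0.
  have [k hk] : exists k, 2 * M * 2^-1 ^+ k <= e / 3.
    apply: contrapT => H; have : e / 3 <= 0.
      apply: (@le0_geometric _ _ (2 * M)) => k; apply/ltW; rewrite ltNge.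
      by apply/negP => h; apply: H; exists k.
    by rewrite leNgt divr_gt0.
  have e3 : 0 < e / 3 by rewrite divr_gt0.
  have := continuous_dist_le (cY k a t) e3; apply: filterS => s sY.
  have := Hy k t a; have := Hy k s a; rewrite (distrC (y s a 0)) => H1 H2.
  have -> : y t a 0 - y s a 0 = (y t a 0 - Y k t a 0) - (Y k s a 0 - Y k t a 0) + (Y k s a 0 - y s a 0) by ring.
  apply: le_trans (ler_normD _ _) _; have := ler_normB (y t a 0 - Y k t a 0) (Y k s a 0 - Y k t a 0).
  by lra.
(* Both sides are within a multiple of 2^-k of [Y k.+1], so the limit is a fixed point and inherits
   its derivative from [next_d]. *)
have ny t a : next y t a 0 = y t a 0.
  apply/eqP; rewrite -subr_eq0 -normr_le0; apply: (@le0_geometric _ _ (4 * M)) => k.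
  have h1 := next_lip _ _ _ cy (cY k) _ (Hy k) t a.
  have := h1 (mulr_ge0 (mulr_ge0 (ler0n _ 2) M0) (p0 k)) => {}h1.
  have h2 := Hy k.+1 t a; rewrite distrC in h2.
  have -> : next y t a 0 - y t a 0 = (next y t a 0 - next (Y k) t a 0) + (Y k.+1 t a 0 - y t a 0).
    by rewrite subrKA.
  apply: le_trans (ler_normD _ _) _; apply: le_trans (lerD h1 h2) _.
  rewrite exprSr; move: (p0 k); move: (2^-1 ^+ k) => u u0.
  by have : 0 <= M * u; [rewrite mulr_ge0|lra].
exists y; split.
  apply/colP => a; rewrite -ny mxE clamp_id ?normr0 ?(ltW r0)//.
  by have [-> _] := HP _ (cAy _ cy a); rewrite addr0.
move=> t a tr; have := next_d _ cy t a tr.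
by rewrite /A' clamp_id ?ltW// (_ : (fun s => _) = (fun s => y s a 0))//; apply/funext.
Qed.

End LinearODE.

Definition dmx {R : realType} {m p q : nat} (j : 'I_m)
    (F : 'rV[R]_m -> 'M[R]_(p, q)) (x : 'rV[R]_m) : 'M[R]_(p, q) :=
  \matrix_(a, b) 'D_(delta_mx 0 j : 'rV[R]_m) (fun y => F y a b) x.

Section Frobenius.
Context {R : realType} {m n : nat}.
Local Notation e_ a := (delta_mx 0 a : 'rV[R]_m).
Variables (A : 'I_m -> 'rV[R]_m -> 'M[R]_n) (V : set 'rV[R]_m) (x0 : 'rV[R]_m).
Hypotheses (oV : open V) (Vx0 : V x0).
Hypothesis sA : forall i a b, Cn 2 V (fun x => A i x a b).

(** Integrability: equality of the mixed derivatives d_j d_i y = d_i d_j y demands this if d_i y =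
    A_i y is solvable for every initial value. *)
Hypothesis flat : forall x i j, V x ->
  dmx j (A i) x + A i x *m A j x = dmx i (A j) x + A j x *m A i x.

(** The bounds hold on the cube of radius 2r because the equations in one coordinate are solved on
    closed segments |t| <= r, which leave the open cube of radius r. *)
Lemma local_bounds : exists C r : R, [/\ 0 <= C, 0 < r, n%:R * C * r <= 2^-1 &
  forall x, cube x0 (2 * r) x -> V x /\ forall i j l a b,
   [/\ `|A i x a b| <= C, `|dmx j (A i) x a b| <= C &
       `|'D_(e_ l) ('D_(e_ j) (fun y => A i y a b)) x| <= C]].
Proof.
have bound (F : 'rV[R]_m -> R) : {for x0, continuous F} -> exists K : R, \forall x \near x0, `|F x| <= K.
  move=> cF; exists (`|F x0| + 1).
  have := continuous_dist_le cF ltr01; apply: filterS => x.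
  have := ler_normD (F x - F x0) (F x0); rewrite subrK.
  by move: (`|F x|) (`|F x0|) (`|_ - _|) => *; lra.
pose Bd (k : R) (q : 'I_m * 'I_m * 'I_m * 'I_n * 'I_n) (x : 'rV[R]_m) : Prop :=
  [/\ `|A q.1.1.1.1 x q.1.2 q.2| <= k,
      `|dmx q.1.1.1.2 (A q.1.1.1.1) x q.1.2 q.2| <= k &
      `|'D_(e_ q.1.1.2) ('D_(e_ q.1.1.1.2) (fun y => A q.1.1.1.1 y q.1.2 q.2)) x| <= k].
have exK q : exists k, \forall x \near x0, Bd k q x.
  case: q => -[[[i j] l] a] b.
  have [k1 H1] := bound _ (Cn_continuous (sA i a b) Vx0).
  have [k2 H2] := bound _ (Cn_continuous (Cn_derive j (sA i a b)) Vx0).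
  have [k3 H3] := bound _ (Cn_continuous (Cn_derive l (Cn_derive j (sA i a b))) Vx0).
  exists (Num.max k1 (Num.max k2 k3)); near=> x; split => /=.
  - by rewrite le_max; apply/orP; left; near: x.
  - by rewrite mxE !le_max; apply/orP; right; apply/orP; left; near: x.
  - by rewrite !le_max; apply/orP; right; apply/orP; right; near: x.
have [K HK] := choice exK.
pose C : R := \sum_q `|K q|.
have C0 : 0 <= C by apply: sumr_ge0.
have KC q : K q <= C.
  rewrite (le_trans (ler_norm _))// /C (bigD1 q)//= lerDl sumr_ge0//.
have [r1 r10 r1P] : exists2 r : R, 0 < r & cube x0 r `<=` V `&` [set x | forall q, Bd C q x].
  apply/nbhs_cubeP; apply: filterI; first exact: open_nbhs_nbhs.
  apply: (@filter_forall _ _ (fun q x => Bd C q x) (nbhs x0)) => q.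
  have := HK q; have := KC q => KCq.
  by apply: filterS => x [h1 h2 h3]; split; apply: le_trans KCq.
pose nC : R := n%:R * C.
have nC0 : 0 <= nC by rewrite mulr_ge0.
exists C, (Num.min (r1 / 2) (2^-1 / (nC + 1))); split => //.
- by rewrite lt_min !divr_gt0// ltr_wpDl.
- apply: (@le_trans _ _ (nC * (2^-1 / (nC + 1)))).
    by rewrite ler_wpM2l// ge_min lexx orbT.
  rewrite mulrCA ler_piMr ?invr_ge0// ler_pdivrMr ?ltr_wpDl// mul1r lerDl//.
- move=> x xr; have [Vx Hx] : (V `&` [set x | forall q, Bd C q x]) x.
    apply: r1P; apply: cubeS xr.
    by rewrite -ler_pdivlMl// mulrC ge_min lexx.
  by split=> // i j l a b; exact: (Hx (i, j, l, a, b)).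
Unshelve. all: by end_near. Qed.

(** The coordinates are released one at a time: a solution on the slice where only the first [j]
    vary is continued along coordinate [j] by [linear_ODE]. The new equation holds by construction,
    the earlier ones are propagated by flatness. Regularity then follows from the equation
    itself. *)
Lemma frobenius : exists2 r : R, 0 < r & cube x0 r `<=` V /\
  forall y0 : 'cV[R]_n, exists y : 'rV[R]_m -> 'cV[R]_n, [/\ y x0 = y0,
    forall x i a, cube x0 r x ->
      is_derive x (e_ i) (fun x => y x a 0) ((A i x *m y x) a 0) &
    forall a, Cn 2 (cube x0 r) (fun x => y x a 0)].
Proof.
have [C [r [C0 r0 nCr HB]]] := local_bounds.
have rr2 : r <= 2 * r by rewrite ler_pMl// ler1n.
have rV : cube x0 r `<=` V by move=> x /(cubeS rr2)/HB[].
exists r => //; split=> // y0.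
pose N0 : R := \sum_a `|y0 a 0|.
pose slice (j : nat) : set 'rV[R]_m :=
  [set x | cube x0 r x /\ forall l : 'I_m, (j <= l)%N -> x 0 l = x0 0 l].
suff [y [y1 y2 y3]] : exists y : 'rV[R]_m -> 'cV[R]_n, [/\ y x0 = y0,
    (forall x, slice m x -> \sum_a `|y x a 0| <= 2 ^+ m * N0) &
    forall x (i : 'I_m) a, slice m x -> (i < m)%N ->
      is_derive x (e_ i) (fun x => y x a 0) ((A i x *m y x) a 0)].
  have cs x : cube x0 r x -> slice m x by split=> // l; rewrite leqNgt ltn_ord.
  have yd x i a : cube x0 r x ->
      is_derive x (e_ i) (fun x => y x a 0) ((A i x *m y x) a 0).
    by move=> /cs xs; apply: y3.
  exists y; split=> //.
  have yb x i a : cube x0 r x -> `|(A i x *m y x) a 0 - 0| <= C * (2 ^+ m * N0).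
    move=> xr; rewrite subr0 (le_trans (mulmx_entry_le _ C0 _))//.
      by move=> b; have [_ /(_ i i i a b)[]] := HB _ (cubeS rr2 xr).
    by rewrite ler_wpM2l// y2//; exact: cs.
  have yc a : Cn 0 (cube x0 r) (fun x => y x a 0).
    split=> // x xr; apply: continuous_dist_intro => e e0.
    pose K : R := C * (2 ^+ m * N0).
    have K0 : 0 <= K by rewrite !mulr_ge0// sumr_ge0.
    have H : \forall t \near x, cube x0 r t /\ `|t - x| <= e / (K * m%:R + 1).
      apply: filterI; first by apply: open_nbhs_nbhs; split => //; exact: open_cube.
      apply/nbhs_ballP; exists (e / (K * m%:R + 1)) => /=.
        by rewrite divr_gt0// ltr_wpDl// mulr_ge0.
      by move=> t; rewrite -ball_normE /= distrC => /ltW.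
    apply: filterS H => t [tr te].
    have := @box_mean_value _ _ (cube x0 r) (fun x => y x a 0) (fun i x => (A i x *m y x) a 0)
      (fun=> 0) K x t (@boxy_cube _ _ _ _) xr tr (fun x i xr => yd x i a xr) (fun x i xr => yb x i a xr).
    rewrite big1 ?subr0; last by move=> i _; rewrite mulr0.
    move=> /le_trans; apply; rewrite -/K.
    apply: (@le_trans _ _ (K * (m%:R * `|t - x|))).
      rewrite ler_wpM2l// (le_trans _ (sum_coord_le (t - x)))//.
      by apply: ler_sum => i _; rewrite !mxE.
    rewrite mulrA; apply: (@le_trans _ _ (K * m%:R * (e / (K * m%:R + 1)))).
      by rewrite ler_wpM2l// mulr_ge0.
    have q0 : 0 <= K * m%:R by rewrite mulr_ge0.
    rewrite mulrCA ler_piMr ?(ltW e0)// ler_pdivrMr ?ltr_wpDl// mul1r lerDl//.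
  have Hstep k : (k <= 2)%N -> (forall a, Cn k (cube x0 r) (fun x => y x a 0)) ->
      forall a, Cn k.+1 (cube x0 r) (fun x => y x a 0).
    move=> k2 yk a.
    have HG i g : (forall x, cube x0 r x -> g x = (A i x *m y x) a 0) -> Cn k (cube x0 r) g.
      move=> gE; apply: (@Cn_ext _ _ _ _ (fun x => \sum_b A i x a b * y x b 0)).
      - exact: open_cube.
      - by move=> x; rewrite inE => xr; rewrite gE// mxE.
      - apply: Cn_sum => [|b]; first exact: open_cube.
        apply: Cn_mul; [exact: open_cube| |exact: yk].
        exact: CnW k2 (Cn_sub rV (sA i a b)).
    exact: (Cn_intro (@open_cube _ _ _ _) (fun x xr => Cn_continuous (yk a) xr)
      (fun x i xr => yd x i a xr) HG).
  exact: (Hstep 1%N isT (Hstep 0%N isT yc)).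
(* By [small_gronwall] the sum of absolute values at most doubles when a coordinate is released,
   whence the factor 2^j. *)
suff H j : (j <= m)%N -> exists y : 'rV[R]_m -> 'cV[R]_n, [/\ y x0 = y0,
    (forall x, slice j x -> \sum_a `|y x a 0| <= 2 ^+ j * N0) &
    forall x (i : 'I_m) a, slice j x -> (i < j)%N ->
      is_derive x (e_ i) (fun x => y x a 0) ((A i x *m y x) a 0)] by exact: H.
elim: j => [_|j IH jm].
  by exists (cst y0); split=> // x _; rewrite expr0 mul1r.
have [y [y1 y2 y3]] := IH (ltnW jm).
pose jj : 'I_m := Ordinal jm.
pose bs (x : 'rV[R]_m) := x - (x 0 jj - x0 0 jj) *: e_ jj.
have bsE x l : bs x 0 l = if l == jj then x0 0 jj else x 0 l.
  rewrite !mxE eqxx /=; case: eqVneq => [->|_]; first by rewrite mulr1; ring.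
  by rewrite mulr0 subr0.
have bsS x : slice j.+1 x -> slice j (bs x).
  move=> [xr xl]; split.
    move=> l; rewrite bsE; case: eqVneq => [->|_]; last exact: xr.
    by rewrite subrr normr0.
  move=> l jl; rewrite bsE; case: eqVneq => [->//|ljj]; apply: xl.
  by rewrite ltn_neqAle jl andbT; apply: contra ljj => /eqP jl'; apply/eqP/val_inj.
have line2 b (t : R) : slice j b -> `|t| <= r -> cube x0 (2 * r) (b + t *: e_ jj).
  move=> [br bl] tr l; rewrite coord_line; case: eqVneq => [->|_].
    by rewrite bl//= addrC addKr (le_lt_trans tr)// ltr_pMl// ltr1n.
  by rewrite addr0; exact: cubeS br l.
have exZ b : exists Z : R -> 'cV[R]_n, slice j b -> Z 0 = y b /\
    forall (t : R) a, `|t| < r ->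
      is_derive t 1 (fun s => Z s a 0) ((A jj (b + t *: e_ jj) *m Z t) a 0).
  have [bj|nbj] := pselect (slice j b); last by exists (cst 0).
  have [|||Z [Z1 Z2]] := @linear_ODE _ _ (fun t => A jj (b + t *: e_ jj)) r C (y b) r0 C0.
  - move=> t a c tr; have [Vt _] := HB _ (line2 b t bj tr).
    exact: is_derive_continuous (Cn_line (sA jj a c) Vt).
  - by move=> t a c tr; have [_ /(_ jj jj jj a c)[]] := HB _ (line2 b t bj tr).
  - exact: nCr.
  - by exists Z.
have [Z HZ] := choice exZ.
pose K0 : R := 2 ^+ j.+1 * N0.
have N00 : 0 <= N0 by exact: sumr_ge0.
have K00 : 0 <= K0 by rewrite mulr_ge0// exprn_ge0.
have between (T t : R) : `|T| < r -> Num.min 0 T <= t <= Num.max 0 T -> `|t| < r.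
  by move=> Tr /between0_norm /le_lt_trans; apply.
have ZB b (t : R) : slice j b -> `|t| < r -> \sum_a `|Z b t a 0| <= K0.
  move=> bj tr; have [Zb Zd] := HZ b bj.
  have := @small_gronwall _ _ (Z b) (fun t => A jj (b + t *: e_ jj) *m Z b t) t C 0.
  move=> /(_ _ _ C0 (lexx 0)) H.
  apply: le_trans (H _ _ _ t _) _.
  - by move=> s a /(between _ _ tr); exact: Zd.
  - move=> s a /(between _ _ tr) /ltW sr; rewrite addr0; apply: mulmx_entry_le => // c.
    by have [_ /(_ jj jj jj a c)[]] := HB _ (line2 b s bj sr).
  - by apply: le_trans nCr; rewrite ler_wpM2l ?mulr_ge0// ltW.
  - exact: between0_self.
  - by rewrite mulr0 mul0r addr0 Zb /K0 exprS -mulrA ler_wpM2l// y2.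
pose y' x := Z (bs x) (x 0 jj - x0 0 jj).
have xT x : slice j.+1 x -> `|x 0 jj - x0 0 jj| < r by move=> [xr _]; exact: xr.
exists y'; split.
- have bx0 : bs x0 = x0 by rewrite /bs subrr scale0r subr0.
  rewrite /y' bx0 subrr; have [|-> //] := HZ x0.
  by split=> // l; rewrite subrr normr0.
- by move=> x xs; apply: ZB; [exact: bsS|exact: xT].
move=> x i a xs ij; have bj := bsS _ xs; have Tr := xT _ xs.
set b := bs x in bj *; set T := x 0 jj - x0 0 jj in Tr *.
have xbT : b + T *: e_ jj = x by rewrite /b /bs subrK.
have [Zb Zd] := HZ b bj.
have [ijj|ijj] := eqVneq i jj.
  apply/is_derive_line0; rewrite ijj.
  have -> : (fun s : R => y' (x + s *: e_ jj) a 0) = (fun s => Z b (T + s) a 0).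
    apply/funext => s; rewrite /y' /bs coord_line eqxx; congr (Z _ _ a 0).
      by rewrite /b /bs !scalerBl scalerDl; apply/rowP => l; rewrite !mxE; ring.
    by rewrite /T; ring.
  have := Zd T a Tr; rewrite xbT => /is_derive_epsP H; apply/is_derive_epsP => e e0.
  by have [d d0 dP] := H e e0; exists d => // h hd; rewrite add0r addr0; exact: dP.
have {ijj}ij : (i < j)%N.
  by rewrite ltn_neqAle -ltnS ij andbT; apply: contra ijj => /eqP ij'; apply/eqP/val_inj.
have bi : bs (x + 0 *: e_ i) = b by rewrite scale0r addr0.
have bsh h : bs (x + h *: e_ i) = b + h *: e_ i.
  have ni : jj == i = false by apply/negbTE/eqP => E; move: ij; rewrite -E ltnn.
  apply/rowP => l; rewrite /b /bs !mxE eqxx /= ni mulr0 addr0; ring.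
have y'h h : y' (x + h *: e_ i) = Z (b + h *: e_ i) T.
  have ni : jj == i = false by apply/negbTE/eqP => E; move: ij; rewrite -E ltnn.
  by rewrite /y' bsh !mxE eqxx /= ni mulr0 addr0.
apply/is_derive_line0/is_derive_epsP => e e0.
(* Constants of the two O(h^2) terms in the equation for [w] below: the second-order remainder of
   A_j times Z, and the first-order increment of A_j times A_i Z. *)
pose E : R := C * K0 + C * (n%:R * (C * K0)).
have E0 : 0 <= E by rewrite addr_ge0// !mulr_ge0.
pose e1 : R := e / (4 * (n%:R + 1)).
have n0 : 0 <= n%:R :> R by [].
have e10 : 0 < e1 by rewrite divr_gt0// mulr_gt0// ltr_wpDl.
have [d1 d10 d1P] : exists2 d : R, 0 < d & forall h, `|h| < d -> forall a,
    `|y (b + h *: e_ i) a 0 - y b a 0 - (A i b *m y b) a 0 * h| <= e1 * `|h|.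
  have Hd c : is_derive (0 : R) 1 (fun s => y (b + s *: e_ i) c 0) ((A i b *m y b) c 0).
    exact: (is_derive_line0 (fun x => y x c 0) b (e_ i) _).1 (y3 b i c bj ij).
  have [d d0 dP] := is_derive_eps_fin Hd e10; exists d => // h hd c.
  by have := dP h hd c; rewrite add0r scale0r addr0.
have [s s0 sP] : exists2 s : R, 0 < s & cube b s `<=` cube x0 r by apply: cube_near; case: bj.
have bline (u : R) : `|u| < s -> slice j (b + u *: e_ i).
  move=> us; split.
    apply: sP => l; rewrite coord_line addrC addKr.
    by case: (l == i); rewrite ?normr0.
  move=> l jl; rewrite coord_line -(bj.2 l jl).
  have /negbTE -> : l != i by apply: contraTneq jl => ->; rewrite -ltnNge.
  by rewrite addr0.
pose q : R := n%:R * E * r.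
have q0 : 0 <= q by rewrite !mulr_ge0// ltW.
exists (Num.min (Num.min d1 s) (e / (4 * (q + 1)))).
  by rewrite !lt_min d10 s0 divr_gt0// mulr_gt0// ltr_wpDl.
move=> h; rewrite !lt_min => /andP[/andP[hd1 hs] hq].
rewrite add0r y'h y'h scale0r addr0.
have bhj : slice j (b + h *: e_ i).
  exact: bline.
have [Zhb Zhd] := HZ _ bhj.
pose be t := A i (b + t *: e_ jj); pose al t := A jj (b + t *: e_ jj).
pose alh t := A jj (b + h *: e_ i + t *: e_ jj).
pose dal t := dmx i (A jj) (b + t *: e_ jj).
pose dbe t := dmx jj (A i) (b + t *: e_ jj).
(* The error of the expected first-order expansion of [Z] in direction [i], followed along
   coordinate [jj]. By flatness it satisfies a linear equation with inhomogeneity O(h^2); it starts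
   at o(h) by the induction hypothesis, so [small_gronwall] keeps it o(h) up to [T]. *)
pose w t : 'cV[R]_n := Z (b + h *: e_ i) t - Z b t - h *: (be t *m Z b t).
pose dw t : 'cV[R]_n := alh t *m w t + (alh t - al t - h *: dal t) *m Z b t
  + h *: ((alh t - al t) *m (be t *m Z b t)).
have wd (t : R) c : `|t| < r -> is_derive t 1 (fun u => w u c 0) (dw t c 0).
  move=> tr; have [Vt _] := HB _ (line2 b t bj (ltW tr)).
  have -> : dw t = alh t *m Z (b + h *: e_ i) t - al t *m Z b t
      - h *: (be t *m (al t *m Z b t) + dbe t *m Z b t).
    have -> : be t *m (al t *m Z b t) + dbe t *m Z b t
       = dal t *m Z b t + al t *m (be t *m Z b t).
      by rewrite mulmxA -mulmxDl addrC (flat i jj Vt) mulmxDl mulmxA.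
    rewrite /dw /w !mulmxBr !mulmxBl -scalemxAr -scalemxAl.
    apply/colP => d; rewrite !mxE.
    move: (\sum_(_ < n) _) (\sum_(_ < n) _) (\sum_(_ < n) _) (\sum_(_ < n) _) (\sum_(_ < n) _) (\sum_(_ < n) _) => *.
    ring.
  have Hprod : is_derive t 1 (fun u => (be u *m Z b u) c 0)
      ((be t *m (al t *m Z b t) + dbe t *m Z b t) c 0).
    have -> : (fun u => (be u *m Z b u) c 0) = (fun u => \sum_d be u c d * Z b u d 0).
      by apply/funext => u; rewrite mxE.
    have -> : (be t *m (al t *m Z b t) + dbe t *m Z b t) c 0 =
        \sum_d (be t c d * (al t *m Z b t) d 0 + Z b t d 0 * dbe t c d).
      rewrite big_split /= !mxE; congr (_ + _).
      by apply: eq_bigr => d _; rewrite mulrC.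
    apply: is_derive_sum_fun => d; apply: is_deriveM; last exact: Zd.
    by rewrite mxE; exact: (Cn_line (sA i c d) Vt).
  have -> : (fun u => w u c 0) = (fun u => Z (b + h *: e_ i) u c 0 - Z b u c 0 - h * (be u *m Z b u) c 0).
    by apply/funext => u; rewrite /w [LHS]mxE [X in X + _]mxE [X in _ + X + _]mxE [X in _ + X]mxE [X in _ - X]mxE.
  rewrite [X in is_derive _ _ _ X]mxE [X in is_derive _ _ _ (X + _)]mxE.
  rewrite [X in is_derive _ _ _ (_ + X + _)]mxE [X in is_derive _ _ _ (_ + X)]mxE [X in is_derive _ _ _ (_ - X)]mxE.
  exact: (is_deriveB (is_deriveB (Zhd t c tr) (Zd t c tr)) (is_derive_scale h Hprod)).
have hr0 (u : R) : Num.min 0 h <= u <= Num.max 0 h -> `|u| < s.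
  by move=> /between0_norm /le_lt_trans; apply.
have line3 (u t : R) : Num.min 0 h <= u <= Num.max 0 h -> `|t| < r ->
    cube x0 (2 * r) (b + t *: e_ jj + u *: e_ i).
  move=> /hr0 us tr; rewrite addrAC; apply: line2; last exact: ltW.
  exact: bline.
have entryE (X Y D : 'M[R]_n) c d : (X - Y - h *: D) c d = X c d - Y c d - D c d * h.
  by rewrite !mxE mulrC.
have al1 (t : R) c d : `|t| < r -> `|(alh t - al t) c d| <= C * `|h|.
  move=> tr; have -> : (alh t - al t) c d =
      A jj (b + t *: e_ jj + h *: e_ i) c d - A jj (b + t *: e_ jj) c d - 0 * h.
    by rewrite mul0r subr0 !mxE /alh addrAC.
  apply: (Cn_line_bound (CnS (sA jj c d))) => u uh.
    by have [] := HB _ (line3 _ _ uh tr).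
  have [_ /(_ jj i i c d)[_ + _]] := HB _ (line3 _ _ uh tr).
  by rewrite mxE subr0.
have al2 (t : R) c d : `|t| < r -> `|(alh t - al t - h *: dal t) c d| <= C * `|h| * `|h|.
  move=> tr; have -> : (alh t - al t - h *: dal t) c d =
      A jj (b + t *: e_ jj + h *: e_ i) c d - A jj (b + t *: e_ jj) c d - dal t c d * h.
    by rewrite entryE /alh /al (addrAC b).
  apply: (Cn_line_bound (CnS (sA jj c d))) => u uh.
    by have [] := HB _ (line3 _ _ uh tr).
  apply: (@le_trans _ _ (C * `|u|)); last by rewrite ler_wpM2l//; exact: between0_norm.
  have := @Cn_line_bound _ _ V ('D_(e_ i) (fun y => A jj y c d)) (b + t *: e_ jj) i u C 0
    (Cn_derive i (sA jj c d)).
  rewrite mul0r subr0 /dal [in X in _ -> X]mxE; apply => v /(between0_trans uh) vh.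
    by have [] := HB _ (line3 _ _ vh tr).
  by have [_ /(_ jj i i c d)[_ _]] := HB _ (line3 _ _ vh tr); rewrite subr0.
have h0 : 0 <= `|h| by [].
have wb (t : R) c : `|t| < r -> `|dw t c 0| <= C * (\sum_d `|w t d 0|) + E * `|h| * `|h|.
  move=> tr; have Ch0 : 0 <= C * `|h| by rewrite mulr_ge0.
  rewrite /dw mxE [X in X + _]mxE.
  apply: le_trans (ler_normD _ _) _; apply: le_trans (lerD (ler_normD _ _) (lexx _)) _.
  rewrite -addrA; apply: lerD.
    apply: mulmx_entry_le => // d; rewrite /alh addrAC.
    have hh : Num.min 0 h <= h <= Num.max 0 h.
      exact: between0_self.
    by have [_ /(_ jj i i c d)[]] := HB _ (line3 _ _ hh tr).
  rewrite /E !mulrDl; apply: lerD.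
    apply: (@le_trans _ _ (C * `|h| * `|h| * \sum_d `|Z b t d 0|)).
      by apply: mulmx_entry_le => [|d]; [rewrite mulr_ge0|exact: al2].
    have -> : C * K0 * `|h| * `|h| = C * `|h| * `|h| * K0 by ring.
    by rewrite ler_wpM2l ?mulr_ge0//; exact: ZB.
  rewrite mxE normrM mulrC ler_wpM2r//.
  apply: (@le_trans _ _ (C * `|h| * \sum_d `|(be t *m Z b t) d 0|)).
    by apply: mulmx_entry_le => // d; exact: al1.
  have -> : C * (n%:R * (C * K0)) * `|h| = C * `|h| * (n%:R * (C * K0)) by ring.
  rewrite ler_wpM2l//.
  apply: sum_le_card => d; apply: le_trans (mulmx_entry_le _ C0 _) _.
    move=> f; have [_ /(_ i i i d f)[]] := HB _ (line2 b t bj (ltW tr)).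
    by [].
  by rewrite ler_wpM2l// ZB.
have := @small_gronwall _ _ w dw T C (E * `|h| * `|h|)
  (fun t c tT => wd t c (between _ _ Tr tT)) (fun t c tT => wb t c (between _ _ Tr tT)) C0.
have Eh0 : 0 <= E * `|h| * `|h| by rewrite !mulr_ge0.
have nCT : n%:R * C * `|T| <= 2^-1.
  by apply: le_trans nCr; rewrite ler_wpM2l ?mulr_ge0// ltW.
have TT : Num.min 0 T <= T <= Num.max 0 T.
  exact: between0_self.
move=> /(_ Eh0 nCT T TT) HT.
have -> : Z (b + h *: e_ i) T a 0 - Z b T a 0 - (A i x *m Z b T) a 0 * h = w T a 0.
  by rewrite /w /be xbT; move: (A i x *m Z b T) => u; rewrite !mxE; ring.
apply: (@le_trans _ _ (\sum_c `|w T c 0|)).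
  by rewrite (bigD1 a)//= lerDl sumr_ge0.
apply: le_trans HT _.
have w0 : \sum_c `|w 0 c 0| <= n%:R * (e1 * `|h|).
  apply: sum_le_card => c; have := d1P _ hd1 c.
  rewrite /w /be scale0r addr0 Zb Zhb; move: (A i b *m y b) => u.
  by rewrite !mxE (mulrC h).
have H1 : n%:R * (e1 * `|h|) <= e / 4 * `|h|.
  by rewrite mulrA ler_wpM2r// /e1 quarter_le// ltW.
have H2 : n%:R * (E * `|h| * `|h|) * `|T| <= e / 4 * `|h|.
  apply: (@le_trans _ _ (q * `|h| * `|h|)).
    have -> : n%:R * (E * `|h| * `|h|) * `|T| = n%:R * E * `|T| * `|h| * `|h| by ring.
    by rewrite ler_wpM2r// ler_wpM2r// /q ler_wpM2l ?mulr_ge0// ltW.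
  rewrite ler_wpM2r//; apply: (@le_trans _ _ (q * (e / (4 * (q + 1))))).
    by rewrite ler_wpM2l// ltW.
  by rewrite quarter_le// ltW.
have H0 := le_trans w0 H1.
have -> : e * `|h| = 4 * (e / 4 * `|h|) by rewrite mulrA mulrCA divff ?mulr1 ?pnatr_eq0.
by clear -H0 H2; move: H0 H2; move: (\sum_c _) (n%:R * _ * `|T|) (e / 4 * `|h|) => *; lra.
Qed.

End Frobenius.

(** * Curvature tensor in constant curvature *)
Lemma is_derive_mul {R : realType} (f g : R -> R) (t df dg : R) :
  is_derive t 1 f df -> is_derive t 1 g dg ->
  is_derive t 1 (fun s => f s * g s) (f t * dg + df * g t).
Proof.
by move=> Hf Hg; apply: is_derive_eq (is_deriveM Hf Hg) _; rewrite [df * _]mulrC.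
Qed.

Section Gronwall.
Context {R : realType} {I : finType}.
Implicit Types w dw : I -> R -> R.

Lemma sumM_le_sum_sq (u : I -> R) :
  \sum_i `|u i| * (\sum_j `|u j|) <= #|I|%:R * \sum_i u i ^+ 2.
Proof.
rewrite -mulr_suml big_distrlr /=.
apply: (@le_trans _ _ (\sum_i \sum_j (2^-1 * u i ^+ 2 + 2^-1 * u j ^+ 2))).
  apply: ler_sum => i _; apply: ler_sum => j _; rewrite -mulrDr.
  rewrite -[X in _ * (X + _)]real_normK ?num_real// -[X in _ * (_ + X)]real_normK ?num_real//.
  move: (`|u i|) (`|u j|) => x y; have := sqr_ge0 (x - y); rewrite sqrrB; lra.
rewrite (eq_bigr (fun i => #|I|%:R * (2^-1 * u i ^+ 2) + 2^-1 * \sum_j u j ^+ 2)); last first.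
  by move=> i _; rewrite big_split /= sumr_const mulr_natl -mulr_sumr.
rewrite big_split /= sumr_const -mulr_sumr -[X in _ + X]mulr_natl -mulr_sumr.
rewrite (_ : #|xpredT|%:R = #|I|%:R :> R)// -mulrDr -mulrDl.
by rewrite (_ : 2^-1 + 2^-1 = 1 :> R) ?mul1r//; lra.
Qed.

(** Sums of squares are differentiable where sums of absolute values are not; the sum of squares
    times exp(-2 C N t), with N the number of components, is nonincreasing. *)
Lemma gronwall w dw (C : R) : 0 <= C ->
  (forall i (t : R), 0 <= t <= 1 -> is_derive t 1 (w i) (dw i t)) ->
  (forall i (t : R), 0 <= t <= 1 -> `|dw i t| <= C * \sum_j `|w j t|) ->
  \sum_i w i 1 ^+ 2 <= expR (2 * C * #|I|%:R) * \sum_i w i 0 ^+ 2.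
Proof.
move=> C0 wd wb; pose K : R := 2 * C * #|I|%:R.
pose u (t : R) : R := \sum_i w i t ^+ 2.
pose du (t : R) : R := \sum_i 2 * (w i t * dw i t).
pose F (t : R) : R := expR (- K * t) * u t.
pose dF (t : R) : R := expR (- K * t) * du t + - K * expR (- K * t) * u t.
have ud (t : R) : 0 <= t <= 1 -> is_derive t 1 u (du t).
  move=> t01; apply: is_derive_sum_fun => i.
  have -> : (fun u => w i u ^+ 2) = w i * w i by apply/funext => s; rewrite expr2.
  apply: is_derive_eq; first by apply: is_deriveM; exact: wd.
  by rewrite /GRing.scale /= mulr_natl mulr2n.
have Fd (t : R) : 0 <= t <= 1 -> is_derive t 1 F (dF t).
  move=> t01; have ed : is_derive t 1 (fun s => expR (- K * s)) (- K * expR (- K * t)).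
    have H : is_derive t 1 (fun s : R => - K * s) (- K * 1).
      by apply: is_derive_scale; exact: is_derive_id.
    have := @is_derive1_comp _ expR (fun s => - K * s) t _ _ (is_derive_expR _) H.
    by rewrite mulr1 mulrC.
  exact: (is_derive_mul ed (ud t t01)).
have dF0 (t : R) : 0 <= t <= 1 -> dF t <= 0.
  move=> t01; rewrite /dF mulrAC -[X in _ + X]mulrC mulrA.
  rewrite (_ : _ + _ = expR (- K * t) * (du t - K * u t)); last by ring.
  rewrite mulr_ge0_le0 ?expR_ge0// subr_le0 /du /K /u -mulr_sumr -!mulrA ler_wpM2l//.
  apply: (@le_trans _ _ (C * \sum_i `|w i t| * \sum_j `|w j t|)).
    rewrite mulr_sumr; apply: ler_sum => i _.
    rewrite mulrCA (le_trans (ler_norm _))// normrM ler_wpM2l//; exact: wb.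
  by rewrite ler_wpM2l// sumM_le_sum_sq.
have F01 : F 1 <= F 0.
  have [c c01 E] := MVT_segment ler01 (fun t t01 => Fd t (subset_itv_oo_cc t01))
    (is_derive_within_continuous Fd).
  by rewrite -subr_le0 E subr0 mulr1 dF0//; move: c01; rewrite in_itv.
have : expR K * F 1 <= expR K * F 0 by rewrite ler_wpM2l// expR_ge0.
by rewrite /F mulr0 expR0 mul1r mulr1 mulrA -expRD subrr expR0 mul1r.
Qed.

End Gronwall.

(** * Smooth matrix-valued functions *)

Section SmoothMatrices.
Context {R : realType} {m : nat}.
Variable V : set 'rV[R]_m.
Hypothesis oV : open V.
Implicit Types f : 'rV[R]_m -> R.

Definition Cmx n p q (F : 'rV[R]_m -> 'M[R]_(p, q)) := forall a b, Cn n V (fun x => F x a b).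

Lemma Cn_det n p (F : 'rV[R]_m -> 'M[R]_p) : Cmx n F -> Cn n V (fun x => \det (F x)).
Proof.
move=> HF; apply: Cn_sum => // s; apply: Cn_mul => //; first exact: Cn_cst.
by apply: Cn_prod => // i; exact: HF.
Qed.

Lemma Cmx_invmx n p (F : 'rV[R]_m -> 'M[R]_p) : (forall x, V x -> F x \in unitmx) ->
  Cmx n F -> Cmx n (fun x => invmx (F x)).
Proof.
move=> uF HF a b.
(* Cramer's rule: the entries of the inverse are cofactors divided by the determinant. *)
apply: (@Cn_ext _ _ _ _ (fun x => (\det (F x))^-1 * ((-1) ^+ (b + a) * \det (row' b (col' a (F x)))))) => //.
  by move=> x; rewrite inE => Vx; rewrite /invmx uF// !mxE.
apply: Cn_mul => //.
  apply: Cn_inv => //; last exact: Cn_det.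
  by move=> x Vx; have := uF x Vx; rewrite unitmxE unitfE.
apply: Cn_mul => //; first exact: Cn_cst.
apply: Cn_det => c d; apply: (Cn_ext _ _ (HF (lift b c) (lift a d))) => //.
by move=> x _; rewrite !mxE.
Qed.

Lemma dmx_is_derive n p q (F : 'rV[R]_m -> 'M[R]_(p, q)) j x a b : Cmx n.+1 F -> V x ->
  is_derive x (delta_mx 0 j) (fun y => F y a b) (dmx j F x a b).
Proof. by move=> HF Vx; rewrite mxE; exact: Cn_is_derive (HF a b) Vx. Qed.

Lemma Cmx_mul n p q r (A : 'rV[R]_m -> 'M[R]_(p, q)) (B : 'rV[R]_m -> 'M[R]_(q, r)) :
  Cmx n A -> Cmx n B -> Cmx n (fun y => A y *m B y).
Proof.
move=> HA HB a b; apply: (@Cn_ext _ _ _ _ (fun y => \sum_c A y a c * B y c b)) => //.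
  by move=> y _; rewrite mxE.
by apply: Cn_sum => // c; apply: Cn_mul.
Qed.

Lemma Cmx_add n p q (A B : 'rV[R]_m -> 'M[R]_(p, q)) :
  Cmx n A -> Cmx n B -> Cmx n (fun y => A y + B y).
Proof.
move=> HA HB a b; apply: (@Cn_ext _ _ _ _ (fun y => A y a b + B y a b)) => //.
  by move=> y _; rewrite mxE.
exact: Cn_add.
Qed.

Lemma Cmx_tr n p q (A : 'rV[R]_m -> 'M[R]_(p, q)) : Cmx n A -> Cmx n (fun y => (A y)^T).
Proof.
move=> HA a b; apply: (Cn_ext oV _ (HA b a)) => y _; by rewrite mxE.
Qed.

Lemma dmx_ext p q j (F F' : 'rV[R]_m -> 'M[R]_(p, q)) x : (forall y, V y -> F y = F' y) ->
  V x -> dmx j F x = dmx j F' x.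
Proof.
move=> FF' Vx; apply/matrixP => a b; rewrite !mxE; apply: near_eq_derive.
have : nbhs x V by exact: open_nbhs_nbhs.
by apply: filterS => y Vy; rewrite FF'.
Qed.

Lemma dmx_tr p q j (F : 'rV[R]_m -> 'M[R]_(p, q)) x :
  dmx j (fun y => (F y)^T) x = (dmx j F x)^T.
Proof.
apply/matrixP => a b; rewrite !mxE; apply: near_eq_derive.
by apply: filterE => y; rewrite mxE.
Qed.

Lemma dmx_add p q j (A B : 'rV[R]_m -> 'M[R]_(p, q)) x :
  Cmx 1 A -> Cmx 1 B -> V x -> dmx j (fun y => A y + B y) x = dmx j A x + dmx j B x.
Proof.
move=> HA HB Vx; apply/matrixP => a b; rewrite 4!mxE.
have [hf _] := Cn_is_derive j (HA a b) Vx; have [hg _] := Cn_is_derive j (HB a b) Vx.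
rewrite -(deriveD hf hg); apply: near_eq_derive.
by apply: filterE => y; rewrite mxE.
Qed.

Lemma dmx_mul p q r j (A : 'rV[R]_m -> 'M[R]_(p, q)) (B : 'rV[R]_m -> 'M[R]_(q, r)) x :
  Cmx 1 A -> Cmx 1 B -> V x ->
  dmx j (fun y => A y *m B y) x = dmx j A x *m B x + A x *m dmx j B x.
Proof.
move=> HA HB Vx; apply/matrixP => a b; rewrite [LHS]mxE.
suff : is_derive x (delta_mx 0 j) (fun y => (A y *m B y) a b)
  ((dmx j A x *m B x + A x *m dmx j B x) a b) by case.
apply/is_derive_line0.
have -> : (fun s : R => (A (x + s *: delta_mx 0 j) *m B (x + s *: delta_mx 0 j)) a b) =
  (fun s => \sum_c A (x + s *: delta_mx 0 j) a c * B (x + s *: delta_mx 0 j) c b).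
  by apply/funext => s; rewrite mxE.
rewrite [X in is_derive _ _ _ X]mxE [X in X + _]mxE [X in _ + X]mxE -big_split /=.
apply: is_derive_sum_fun => c.
have HAd := (is_derive_line0 (fun y => A y a c) x (delta_mx 0 j) _).1 (dmx_is_derive j a c HA Vx).
have HBd := (is_derive_line0 (fun y => B y c b) x (delta_mx 0 j) _).1 (dmx_is_derive j c b HB Vx).
have := is_derive_mul HAd HBd; rewrite scale0r addr0 addrC; exact.
Qed.

Lemma dmx_swap p q i j (A : 'rV[R]_m -> 'M[R]_(p, q)) x : Cmx 2 A -> V x ->
  dmx i (dmx j A) x = dmx j (dmx i A) x.
Proof.
move=> HA Vx; apply/matrixP => a b; rewrite [LHS]mxE [RHS]mxE.
have E k l : 'D_(delta_mx 0 k) (fun y => dmx l A y a b) x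
    = 'D_(delta_mx 0 k : 'rV[R]_m) ('D_(delta_mx 0 l) (fun y => A y a b)) x.
  by apply: near_eq_derive; apply: filterE => y; rewrite mxE.
by rewrite !E; exact: (derive_swap _ _ oV (HA a b) Vx).
Qed.

Lemma is_derive_partial f F x a d :
  (\forall h \near (0 : R)^'+, f (x + h *: delta_mx 0 a) = F (x + h *: delta_mx 0 a)) ->
  f x = F x -> is_derive x (delta_mx 0 a) F d -> partial a f x = d.
Proof.
move=> fF fx [Fd <-]; apply: cvg_lim => //.
have : h^-1 *: ((F \o shift x) (h *: delta_mx 0 a) - F x) @[h --> (0 : R)^'] --> 'D_(delta_mx 0 a) F x.
  exact: Fd.
move=> /cvg_dnbhs_at_right; apply: cvg_trans; apply: near_eq_cvg.
by apply: filterS fF => h fF; rewrite /= fx fF (addrC x).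
Qed.

End SmoothMatrices.

Section CurvatureTensorAlgebra.
Context {R : realType} {I : Type}.
Variable S : I -> I -> I -> I -> R.
Hypothesis S12 : forall i j k h, S i j k h = - S j i k h.
Hypothesis S34 : forall i j k h, S i j k h = - S i j h k.
Hypothesis bianchi : forall i j k h, S i j k h + S j k i h + S k i j h = 0.

Lemma curvature_pair_symmetry i j k h : S i j k h = S k h i j.
Proof.
have := bianchi i j k h; have := bianchi j k h i; have := bianchi k h i j.
have := bianchi h i j k.
move: (S34 i j h k) (S34 j k i h) (S12 k i j h) (S34 i k j h) (S34 k h j i).
move: (S12 h j k i) (S34 j h k i) (S34 h i k j).
lra.
Qed.

(* Polarization in both arguments of the vanishing of S(u, v, v, u). *)
Hypothesis polarized : forall i j k h,
  S i j k h + S i k j h + S h j k i + S h k j i = 0.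

(** Polarization and pair symmetry make [S] antisymmetric in its second and third arguments too;
    then the three terms of the Bianchi sum coincide. *)
Lemma curvature_tensor_eq0 i j k h : S i j k h = 0.
Proof.
have anti a b c d : S a b c d = - S a c b d.
  have := polarized a b c d.
  have -> : S d c b a = S a b c d.
    by rewrite curvature_pair_symmetry S12 S34 opprK.
  have -> : S d b c a = S a c b d.
    by rewrite curvature_pair_symmetry S12 S34 opprK.
  lra.
have := bianchi i j k h.
rewrite (_ : S j k i h = S i j k h); last by rewrite anti S12 opprK.
rewrite (_ : S k i j h = S i j k h); first by lra.
by rewrite S12 anti opprK.
Qed.

End CurvatureTensorAlgebra.

Section ConstantCurvatureAlgebra.
Context {R : realType} {I : Type}.
Variables (Rr : I -> I -> I -> I -> R) (g : I -> I -> R) (K : R).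
Hypothesis r12 : forall i j k h, Rr i j k h = - Rr j i k h.
Hypothesis r34 : forall i j k h, Rr i j k h = - Rr i j h k.
Hypothesis rB : forall i j k h, Rr i j k h + Rr j k i h + Rr k i j h = 0.
Hypothesis gC : forall i j, g i j = g j i.
Hypothesis polar : forall i j k h, Rr i j k h + Rr i k j h + Rr h j k i + Rr h k j i =
  K * (4 * (g i h * g j k) - 2 * (g i j * g k h) - 2 * (g i k * g j h)).

(** The difference with the space form tensor has all the curvature symmetries and, by [polar], no
    sectional curvature. *)
Lemma constant_curvature_tensor i j k h :
  Rr i j k h = K * (g j k * g i h - g i k * g j h).
Proof.
apply/eqP; rewrite -subr_eq0; apply/eqP.
apply: (@curvature_tensor_eq0 _ _ (fun i j k h => Rr i j k h - K * (g j k * g i h - g i k * g j h))).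
- by move=> a b c d; rewrite r12; ring.
- by move=> a b c d; rewrite r34; ring.
- move=> a b c d; have := rB a b c d.
  rewrite (gC b a) (gC c a) (gC c b).
  move: (Rr a b c d) (Rr b c a d) (Rr c a b d) => r1 r2 r3 H.
  by rewrite -[RHS]H; ring.
- move=> a b c d; have := polar a b c d.
  rewrite (gC c b) (gC b a) (gC c a) (gC d a) (gC d b) (gC d c).
  move: (Rr a b c d) (Rr a c b d) (Rr d b c a) (Rr d c b a) => r1 r2 r3 r4 H.
  by apply/eqP; rewrite -subr_eq0 -[X in _ - X](subrr (r1 + r2 + r3 + r4)) {2}H; apply/eqP; ring.
Qed.

End ConstantCurvatureAlgebra.

(** Nine instances of the diagonal identity, at sums of the four vectors, are combined by inclusion
    and exclusion; additivity leaves only the mixed terms. *)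
Lemma sectional_polarization {R : realType} {U : zmodType} (Q : U -> U -> U -> U -> R)
    (b : U -> U -> R) (K : R) :
  (forall u u' v w z, Q (u + u') v w z = Q u v w z + Q u' v w z) ->
  (forall u v v' w z, Q u (v + v') w z = Q u v w z + Q u v' w z) ->
  (forall u v w w' z, Q u v (w + w') z = Q u v w z + Q u v w' z) ->
  (forall u v w z z', Q u v w (z + z') = Q u v w z + Q u v w z') ->
  (forall u u' v, b (u + u') v = b u v + b u' v) -> (forall u v, b u v = b v u) ->
  (forall u v, Q u v v u = K * (b u u * b v v - b u v ^+ 2)) ->
  forall i j k h, Q i j k h + Q i k j h + Q h j k i + Q h k j i =
  K * (4 * (b i h * b j k) - 2 * (b i j * b k h) - 2 * (b i k * b j h)).
Proof.
move=> Q1 Q2 Q3 Q4 b1 bC H i j k h.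
have b2 u v v' : b u (v + v') = b u v + b u v' by rewrite bC b1 !(bC u).
have := H (i + h) (j + k); have := H (i + h) j; have := H (i + h) k.
have := H i (j + k); have := H h (j + k).
have := H i j; have := H i k; have := H h j; have := H h k.
rewrite !(Q1, Q2, Q3, Q4, b1, b2) (bC h i) (bC k j) (bC h j) (bC h k) (bC k h).
move=> H1 H2 H3 H4 H5 H6 H7 H8 H9.
lra.
Qed.

Lemma mxDE {R : nmodType} {p q : nat} (A B : 'M[R]_(p, q)) a b : (A + B) a b = A a b + B a b.
Proof. by rewrite mxE. Qed.

Lemma mxBE {R : zmodType} {p q : nat} (A B : 'M[R]_(p, q)) a b : (A - B) a b = A a b - B a b.
Proof. by rewrite !mxE. Qed.

Lemma rowE' {R : Type} {p q : nat} (A : 'M[R]_(p, q)) a b : row a A 0 b = A a b.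
Proof. by rewrite mxE. Qed.

Lemma row3_eq0 {R : zmodType} {p q : nat} (A B C : 'M[R]_(p, q)) i j k :
  (forall l, A k l + B i l + C j l = 0) -> row k A + row i B + row j C = 0.
Proof. by move=> H; apply/rowP => l; rewrite !mxDE !rowE' H mxE. Qed.

Lemma row3_mul_eq0 {R : comRingType} {p q r : nat} (A B C : 'M[R]_(p, q)) (g : 'M[R]_(q, r)) i j k h :
  row k A + row i B + row j C = 0 ->
  (A *m g) k h + (B *m g) i h + (C *m g) j h = 0.
Proof.
move=> E; have : ((row k A + row i B + row j C) *m g) 0 h = 0 by rewrite E mul0mx mxE.
by rewrite !mulmxDl !mxDE -!row_mul !rowE'.
Qed.

Lemma bianchi_algebra {R : comRingType} {I : Type} (D P : I -> I -> I -> R) i j k :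
  (forall a b c, D a b c = D a c b) -> (forall b a c, P b a c = P c a b) ->
  D i j k - D j i k + (P j i k - P i j k) + (D j k i - D k j i + (P k j i - P j k i))
  + (D k i j - D i k j + (P i k j - P k i j)) = 0.
Proof.
move=> DS PS; rewrite (DS i j k) (DS j k i) (DS k i j) (PS j i k) (PS i j k) (PS j k i).
by ring.
Qed.

(** The hypothesis is the equality of mixed second derivatives of a metric [g] whose first
    derivatives are A g + g A^T and B g + g B^T; the conclusion is skewness of the curvature with
    lowered index. *)
Lemma omega_lowered_antisym {R : comRingType} {m : nat} (D1 D2 A B g : 'M[R]_m) : g^T = g ->
  D1 *m g + B *m (A *m g + g *m A^T) + ((A *m g + g *m A^T) *m B^T + g *m D1^T) =
  D2 *m g + A *m (B *m g + g *m B^T) + ((B *m g + g *m B^T) *m A^T + g *m D2^T) ->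
  ((D1 - D2 + (B *m A - A *m B)) *m g)^T = - ((D1 - D2 + (B *m A - A *m B)) *m g).
Proof.
move=> gT /eqP; rewrite -subr_eq0 => /eqP E; apply/eqP; rewrite -addr_eq0; apply/eqP.
rewrite -[RHS]E trmx_mul gT.
have -> : (D1 - D2 + (B *m A - A *m B))^T = D1^T - D2^T + (A^T *m B^T - B^T *m A^T).
  by rewrite -!trmx_mul -!linearB -linearD.
rewrite !(mulmxDl, mulmxDr, mulNmx, mulmxN, mulmxA).
by apply/matrixP => a b; rewrite !mxE; ring.
Qed.

(** * Levi-Civita connection and curvature in one chart *)

Section LocalGeometry.
Context {R : realType} {m : nat}.
Variables (G : 'rV[R]_m -> 'M[R]_m) (V : set 'rV[R]_m) (K : R).
Hypotheses (oV : open V) (sG : forall n, Cmx V n G).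
Hypothesis symG : forall x, V x -> (G x)^T = G x.
Hypothesis posG : forall x v, V x -> v != 0 -> 0 < ginner G x v v.
Hypothesis curvG : forall x u v, V x -> row_free (col_mx u v) ->
  sectional_curvature G x u v = K.
Local Notation e_ a := (delta_mx 0 a : 'rV[R]_m).

Lemma unitG x : V x -> G x \in unitmx.
Proof.
move=> Vx; rewrite -row_free_unit -kermx_eq0; apply/negPn/negP => /rowV0Pn[v].
move=> /sub_kermxP vG v0; have := posG Vx v0.
by rewrite /ginner vG mul0mx mxE ltxx.
Qed.

Lemma partialE n f x a : Cn n.+1 V f -> V x -> partial a f x = 'D_(e_ a) f x.
Proof.
move=> Hf Vx; apply: (@is_derive_partial _ _ f f) => //; last exact: Cn_is_derive Hf Vx.
by apply: filterE.
Qed.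

Lemma symGE x a b : V x -> G x a b = G x b a.
Proof. by move=> Vx; rewrite -{1}(symG Vx) mxE. Qed.

Definition Smx (i : 'I_m) x : 'M[R]_m := \matrix_(j, l)
  ('D_(e_ i) (fun y => G y j l) x + 'D_(e_ j) (fun y => G y i l) x
   - 'D_(e_ l) (fun y => G y i j) x).

(** One matrix per direction, acting from the left on components of covectors; metric compatibility
    and curvature then become matrix identities. *)
Definition Gam (i : 'I_m) x : 'M[R]_m := \matrix_(j, l) christoffel G l i j x.

Lemma GamE i x : V x -> Gam i x = 2^-1 *: (Smx i x *m invmx (G x)).
Proof.
move=> Vx; apply/matrixP => j l; rewrite !mxE /christoffel; congr (_ * _).
apply: eq_bigr => s _; rewrite !mxE !(partialE _ (sG 1 _ _) Vx) mulrC; congr (_ * _).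
by rewrite -[in LHS](symG Vx) -trmx_inv mxE.
Qed.

Lemma Cmx_Gam n i : Cmx V n (Gam i).
Proof.
move=> j l; apply: (@Cn_ext _ _ _ _ (fun x => 2^-1 * \sum_s Smx i x j s * invmx (G x) s l)) => //.
  by move=> x; rewrite inE => Vx; rewrite GamE// !mxE.
apply: Cn_mul => //; first exact: Cn_cst.
apply: Cn_sum => // s; apply: Cn_mul => //; last first.
  by apply: (Cmx_invmx oV unitG) => a b; exact: sG.
apply: (@Cn_ext _ _ _ _ (fun x => 'D_(e_ i) (fun y => G y j s) x + 'D_(e_ j) (fun y => G y i s) x
   + - 'D_(e_ s) (fun y => G y i j) x)) => //; first by move=> x _; rewrite mxE.
apply: Cn_add => //; first by apply: Cn_add => //; apply: Cn_derive (sG n.+1 _ _).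
by apply: Cn_opp => //; apply: Cn_derive (sG n.+1 _ _).
Qed.

Lemma Gam_sym i j l x : V x -> Gam i x j l = Gam j x i l.
Proof.
move=> Vx; rewrite !GamE// !mxE; congr (_ * _); apply: eq_bigr => s _.
rewrite !mxE; congr (_ * _).
have -> : 'D_(e_ s) (fun y => G y i j) x = 'D_(e_ s) (fun y => G y j i) x.
  apply: near_eq_derive; have : nbhs x V by exact: open_nbhs_nbhs.
  by apply: filterS => y Vy; exact: symGE.
by rewrite addrC (addrC ('D_(e_ j) _ _)) addrC.
Qed.

Lemma derive_symG i a b x : V x -> 'D_(e_ i) (fun y => G y a b) x = 'D_(e_ i) (fun y => G y b a) x.
Proof.
move=> Vx; apply: near_eq_derive; have : nbhs x V by exact: open_nbhs_nbhs.
by apply: filterS => y Vy; exact: symGE.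
Qed.

Lemma metric_compat i x : V x -> dmx i G x = Gam i x *m G x + G x *m (Gam i x)^T.
Proof.
move=> Vx; have -> : G x *m (Gam i x)^T = (Gam i x *m G x)^T.
  by rewrite trmx_mul symG.
have -> : Gam i x *m G x = 2^-1 *: Smx i x.
  by rewrite GamE// -scalemxAl mulmxKV// unitG.
apply/matrixP => a b; rewrite !mxE (derive_symG a i b Vx) (derive_symG b i a Vx) (derive_symG i b a Vx).
lra.
Qed.

(** Its entry (k, l) is the coefficient of d_l in R(d_i, d_j) d_k. The products appear in reversed
    order because the rows of [Gam] carry the lower index. *)
Definition Omega (i j : 'I_m) x : 'M[R]_m :=
  dmx i (Gam j) x - dmx j (Gam i) x + (Gam j x *m Gam i x - Gam i x *m Gam j x).

Lemma curvatureE i j k l x : V x -> curvature G i j k l x = Omega i j x k l.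
Proof.
move=> Vx; rewrite /curvature !mxE.
have pE a b c d : partial a (christoffel G b c d) x = 'D_(e_ a) (fun y => Gam c y d b) x.
  have -> : christoffel G b c d = (fun y => Gam c y d b) by apply/funext => y; rewrite mxE.
  exact: (partialE _ (Cmx_Gam 1 _ _ _) Vx).
rewrite !pE; congr (_ + _); rewrite -sumrB; apply: eq_bigr => s _.
by rewrite !mxE mulrC [X in _ - X]mulrC.
Qed.

(* [Rm i j x k h] is <R(d_i, d_j) d_k, d_h>. *)
Definition Rm (i j : 'I_m) x : 'M[R]_m := Omega i j x *m G x.

Lemma Omega12 i j x : Omega i j x = - Omega j i x.
Proof. by rewrite /Omega opprD !opprB. Qed.

(** The mixed second derivatives of [G] commute; both are expressed by the connection by applying
    [metric_compat] twice. *)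
Lemma Rm34 i j x : V x -> (Rm i j x)^T = - Rm i j x.
Proof.
move=> Vx; have CG := Cmx_Gam 1; have sG1 := sG 1.
have ddG i' j' : dmx j' (dmx i' G) x =
    dmx j' (Gam i') x *m G x + Gam i' x *m (Gam j' x *m G x + G x *m (Gam j' x)^T)
    + ((Gam j' x *m G x + G x *m (Gam j' x)^T) *m (Gam i' x)^T + G x *m (dmx j' (Gam i') x)^T).
  rewrite (dmx_ext oV j' (fun y Vy => metric_compat i' Vy) Vx).
  have CT := Cmx_tr oV (CG i').
  rewrite (dmx_add j' (Cmx_mul oV (CG i') sG1) (Cmx_mul oV sG1 CT) Vx).
  rewrite (dmx_mul j' (CG i') sG1 Vx) (dmx_mul j' sG1 CT Vx) (metric_compat j' Vx).
  by rewrite dmx_tr.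
have := dmx_swap oV i j (sG 2) Vx; rewrite (ddG j i) (ddG i j).
exact: omega_lowered_antisym (symG Vx).
Qed.

Opaque Gam dmx.

Lemma Omega_bianchi i j k x : V x ->
  row k (Omega i j x) + row i (Omega j k x) + row j (Omega k i x) = 0.
Proof.
move=> Vx; have GS i' j' l' : Gam i' x j' l' = Gam j' x i' l' by exact: Gam_sym.
have DS a i' j' l' : dmx a (Gam i') x j' l' = dmx a (Gam j') x i' l'.
  Transparent dmx.
  rewrite [LHS]mxE [RHS]mxE; apply: near_eq_derive; have : nbhs x V by exact: open_nbhs_nbhs.
  Opaque dmx.
  by apply: filterS => y Vy; exact: Gam_sym.
have MS a i' j' l' : (Gam i' x *m Gam a x) j' l' = (Gam j' x *m Gam a x) i' l'.
  by rewrite !mxE; apply: eq_bigr => s _; rewrite GS.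
apply: row3_eq0 => l.
have OE a b c : Omega a b x c l = dmx a (Gam b) x c l - dmx b (Gam a) x c l +
  ((Gam b x *m Gam a x) c l - (Gam a x *m Gam b x) c l) by rewrite mxDE !mxBE.
apply: etrans (@bianchi_algebra _ _ (fun a b c => dmx a (Gam b) x c l)
  (fun b a c => (Gam b x *m Gam a x) c l) i j k
  (fun a b c => DS a b c l) (fun b a c => MS a b c l)).
by congr (_ + _ + _); exact: OE.
Qed.

Opaque Omega.

Lemma Rm_bianchi i j k h x : V x -> Rm i j x k h + Rm j k x i h + Rm k i x j h = 0.
Proof.
by move=> Vx; exact: row3_mul_eq0 (Omega_bianchi i j k Vx).
Qed.

Definition R4 x (u v w z : 'rV[R]_m) : R :=
  \sum_i \sum_j \sum_k \sum_h u 0 i * v 0 j * w 0 k * z 0 h * Rm i j x k h.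

Lemma ginner_Riem x u v w z : V x -> ginner G x (Riem G x u v w) z = R4 x u v w z.
Proof.
move=> Vx; have -> : Riem G x u v w = \sum_i \sum_j \sum_k (u 0 i * v 0 j * w 0 k) *: row k (Omega i j x).
  apply/rowP => l; rewrite !mxE summxE; apply: eq_bigr => i _; rewrite summxE.
  apply: eq_bigr => j _; rewrite summxE; apply: eq_bigr => k _.
  by rewrite curvatureE// [RHS]mxE rowE'.
rewrite /ginner !mulmx_suml summxE; apply: eq_bigr => i _.
rewrite !mulmx_suml summxE; apply: eq_bigr => j _.
rewrite !mulmx_suml summxE; apply: eq_bigr => k _.
rewrite -!scalemxAl -row_mul mxE [X in _ * X]mxE mulr_sumr; apply: eq_bigr => h _.
rewrite -/(Rm i j x) rowE' [z^T _ _]mxE; move: (Rm i j x k h) => r; ring.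
Qed.

Opaque Rm.

Lemma sum4_delta (F : 'I_m -> 'I_m -> 'I_m -> 'I_m -> R) (a b c d : 'I_m) :
  \sum_i \sum_j \sum_k \sum_h
    e_ a 0 i * e_ b 0 j * e_ c 0 k * e_ d 0 h * F i j k h = F a b c d.
Proof.
have E i j : e_ i 0 j = (j == i)%:R by rewrite mxE eqxx.
rewrite (bigD1 a)//= [X in _ + X]big1 ?addr0; last first.
  move=> i /negbTE ia; rewrite big1// => j _; rewrite big1// => k _; rewrite big1// => h _.
  by rewrite E ia !mul0r.
rewrite (bigD1 b)//= [X in _ + X]big1 ?addr0; last first.
  move=> i /negbTE ia; rewrite big1// => j _; rewrite big1// => k _.
  by rewrite [e_ b 0 i]E ia mulr0 !mul0r.
rewrite (bigD1 c)//= [X in _ + X]big1 ?addr0; last first.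
  move=> i /negbTE ia; rewrite big1// => j _.
  by rewrite [e_ c 0 i]E ia mulr0 !mul0r.
rewrite (bigD1 d)//= [X in _ + X]big1 ?addr0; last first.
  by move=> i /negbTE ia; rewrite [e_ d 0 i]E ia mulr0 !mul0r.
by rewrite !E !eqxx !mul1r.
Qed.

Lemma R4_delta x a b c d : R4 x (e_ a) (e_ b) (e_ c) (e_ d) = Rm a b x c d.
Proof. exact: (sum4_delta (fun i j k h => Rm i j x k h)). Qed.

Lemma R4Dl x u u' v w z : R4 x (u + u') v w z = R4 x u v w z + R4 x u' v w z.
Proof.
rewrite /R4 -big_split /=; apply: eq_bigr => i _; rewrite -big_split /=; apply: eq_bigr => j _.
rewrite -big_split /=; apply: eq_bigr => k _; rewrite -big_split /=; apply: eq_bigr => h _.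
by rewrite mxDE; ring.
Qed.

Lemma R4D2 x u v v' w z : R4 x u (v + v') w z = R4 x u v w z + R4 x u v' w z.
Proof.
rewrite /R4 -big_split /=; apply: eq_bigr => i _; rewrite -big_split /=; apply: eq_bigr => j _.
rewrite -big_split /=; apply: eq_bigr => k _; rewrite -big_split /=; apply: eq_bigr => h _.
by rewrite mxDE; ring.
Qed.

Lemma R4D3 x u v w w' z : R4 x u v (w + w') z = R4 x u v w z + R4 x u v w' z.
Proof.
rewrite /R4 -big_split /=; apply: eq_bigr => i _; rewrite -big_split /=; apply: eq_bigr => j _.
rewrite -big_split /=; apply: eq_bigr => k _; rewrite -big_split /=; apply: eq_bigr => h _.
by rewrite mxDE; ring.
Qed.

Lemma R4D4 x u v w z z' : R4 x u v w (z + z') = R4 x u v w z + R4 x u v w z'.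
Proof.
rewrite /R4 -big_split /=; apply: eq_bigr => i _; rewrite -big_split /=; apply: eq_bigr => j _.
rewrite -big_split /=; apply: eq_bigr => k _; rewrite -big_split /=; apply: eq_bigr => h _.
by rewrite mxDE; ring.
Qed.

Transparent Rm.
Lemma Rm12 i j k h x : Rm i j x k h = - Rm j i x k h.
Proof. by rewrite /Rm Omega12 mulNmx mxE. Qed.
Opaque Rm.

Lemma R4_12 x u v w z : R4 x u v w z = - R4 x v u w z.
Proof.
rewrite /R4 exchange_big -sumrN; apply: eq_bigr => j _; rewrite -sumrN; apply: eq_bigr => i _.
rewrite -sumrN; apply: eq_bigr => k _; rewrite -sumrN; apply: eq_bigr => h _.
by rewrite Rm12 mulrN; congr (- (_ * _ * _ * _)); exact: mulrC.
Qed.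

Lemma R4Zl x (c : R) u v w z : R4 x (c *: u) v w z = c * R4 x u v w z.
Proof.
rewrite /R4 mulr_sumr; apply: eq_bigr => i _; rewrite mulr_sumr; apply: eq_bigr => j _.
rewrite mulr_sumr; apply: eq_bigr => k _; rewrite mulr_sumr; apply: eq_bigr => h _.
by rewrite mxE; ring.
Qed.

Lemma ginnerDl x u v w : ginner G x (u + v) w = ginner G x u w + ginner G x v w.
Proof. by rewrite /ginner !mulmxDl mxDE. Qed.

Lemma ginnerZl x c u w : ginner G x (c *: u) w = c * ginner G x u w.
Proof. by rewrite /ginner -!scalemxAl mxE. Qed.

Lemma ginnerC x u v : V x -> ginner G x u v = ginner G x v u.
Proof.
move=> Vx; rewrite /ginner -{1}(trmxK (u *m G x *m v^T)) mxE.
by rewrite !trmx_mul trmxK symG// mulmxA.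
Qed.

Lemma ginner_delta x a b : ginner G x (e_ a) (e_ b) = G x a b.
Proof. by rewrite /ginner -rowE trmx_delta -colE !mxE. Qed.

(* For linearly dependent vectors both sides vanish. *)
Lemma R4_sect x u v : V x ->
  R4 x u v v u = K * (ginner G x u u * ginner G x v v - ginner G x u v ^+ 2).
Proof.
move=> Vx; have [uv|] := boolP (row_free (col_mx u v)).
  have := curvG Vx uv; rewrite /sectional_curvature ginner_Riem// => <-.
  rewrite divfK//; apply: lt0r_neq0.
  have inj (a b : R) : a *: u + b *: v = 0 -> a = 0 /\ b = 0.
    have E : row_mx (a%:M : 'rV[R]_1) (b%:M : 'rV[R]_1) *m col_mx u v = a *: u + b *: v.
      by rewrite mul_row_col !mul_scalar_mx.
    rewrite -E -[in RHS](mul0mx _ (col_mx u v)) => /(row_free_inj uv) H.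
    have := congr1 lsubmx H; have := congr1 rsubmx H; rewrite row_mxKl row_mxKr !linear0.
    by move=> /matrixP/(_ 0 0) + /matrixP/(_ 0 0); rewrite !mxE !mulr1n.
  have v0 : v != 0.
    apply/eqP => v0; have [_ /eqP] : (0 : R) = 0 /\ (1 : R) = 0.
      by apply: inj; rewrite scale0r v0 scaler0 addr0.
    by rewrite oner_eq0.
  pose c : R := ginner G x u v / ginner G x v v.
  have gv := posG Vx v0.
  have w0 : u - c *: v != 0.
    apply/eqP => w0; have [/eqP] : (1 : R) = 0 /\ - c = 0.
      by apply: inj; rewrite scale1r scaleNr.
    by rewrite oner_eq0.
  have := posG Vx w0.
  have -> : ginner G x (u - c *: v) (u - c *: v) =
      ginner G x u u - ginner G x u v ^+ 2 / ginner G x v v.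
    rewrite -scaleNr ginnerDl ginnerZl !(ginnerC _ (_ + _))// !ginnerDl !ginnerZl.
    rewrite (ginnerC v u)// /c; field; exact: lt0r_neq0.
  by rewrite -(ltr_pM2r gv) mul0r mulrBl divfK ?lt0r_neq0.
move=> nuv; have [->|v0] := eqVneq v 0.
  rewrite R4_12 -(scale0r u) R4Zl mul0r oppr0 ginnerC// ginnerZl ginnerC// ginnerZl.
  by rewrite !mul0r mulr0 expr2 mulr0 subrr mulr0.
have [c ->] : exists c, u = c *: v.
  have : kermx (col_mx u v) != 0 by rewrite kermx_eq0.
  move=> /rowV0Pn[w /sub_kermxP + w0].
  rewrite -{1}(hsubmxK w) mul_row_col.
  set a := lsubmx w; set b := rsubmx w.
  rewrite (mx11_scalar a) (mx11_scalar b) !mul_scalar_mx => E.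
  have [a0|a0] := eqVneq (a 0 0) 0.
    move: E; rewrite a0 scale0r add0r => /eqP; rewrite scaler_eq0 (negbTE v0) orbF => /eqP b0.
    move: w0; rewrite -(hsubmxK w) -/a -/b (mx11_scalar a) (mx11_scalar b) a0 b0.
    by rewrite raddf0 row_mx0 eqxx.
  exists (- (b 0 0 / a 0 0)); apply: (scalerI a0).
  by rewrite scalerA mulrN mulrCA divff// mulr1 scaleNr; apply/eqP; rewrite -addr_eq0 E.
have R0 : R4 x v v v v = 0 by have := R4_12 x v v v v; lra.
by rewrite R4Zl R4_12 !ginnerZl (ginnerC v)// ginnerZl; have := R4_12 x v v v (c *: v); rewrite expr2; nra.
Qed.

Lemma Rm34' i j k h x : V x -> Rm i j x k h = - Rm i j x h k.
Proof.
move=> /(Rm34 i j)/matrixP/(_ h k); rewrite mxE => ->.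
by rewrite mxE.
Qed.

Lemma Rm_const i j k h x : V x ->
  Rm i j x k h = K * (G x j k * G x i h - G x i k * G x j h).
Proof.
move=> Vx.
apply: (@constant_curvature_tensor _ _ (fun i j k h => Rm i j x k h) (fun a b => G x a b)).
- exact: (fun i j k h => Rm12 i j k h x).
- exact: (fun i j k h => Rm34' i j k h Vx).
- exact: (fun i j k h => Rm_bianchi i j k h Vx).
- exact: (fun a b => symGE a b Vx).
- move=> a b c d; have := @sectional_polarization _ _ (R4 x) (ginner G x) K (R4Dl x) (R4D2 x)
    (R4D3 x) (R4D4 x) (ginnerDl x) (fun u v => ginnerC u v Vx) (fun u v => R4_sect u v Vx)
    (e_ a) (e_ b) (e_ c) (e_ d).
  by rewrite !ginner_delta !R4_delta.
Qed.

(** Multiplication by the invertible matrix [G x] is injective, so the index can be raised in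
    [Rm_const]. *)
Lemma Omega_const i j x : V x -> Omega i j x = - K *: (col i (G x) *m e_ j - col j (G x) *m e_ i).
Proof.
move=> Vx; apply: (can_inj (mulmxK (unitG Vx))).
Transparent Rm.
rewrite -/(Rm i j x); apply/matrixP => k h; rewrite Rm_const//.
rewrite -scalemxAl mulmxBl -!mulmxA -!rowE [RHS]mxE mxBE !mxE !big_ord1 !mxE.
rewrite (symGE k i)// (symGE k j)//; ring.
Qed.

End LocalGeometry.

(** * The flat connection of a hyperbolic metric *)
Section MatrixGrowth.
Context {R : realType} {m p q : nat}.
Variables (W : set 'rV[R]_m) (F : 'rV[R]_m -> 'M[R]_(p, q)) (C : R).
Hypotheses (oW : open W) (bW : boxy W) (CF : Cmx W 1 F) (C0 : 0 <= C).
Hypothesis dF : forall x i a b, W x -> `|dmx i F x a b| <= C * \sum_(c : 'I_p * 'I_q) `|F x c.1 c.2|.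

Lemma matrix_growth x0 x : W x0 -> W x ->
  \sum_(c : 'I_p * 'I_q) F x c.1 c.2 ^+ 2 <=
  expR (2 * (\sum_i `|x 0 i - x0 0 i| * C) * #|{: 'I_p * 'I_q}|%:R) *
    \sum_(c : 'I_p * 'I_q) F x0 c.1 c.2 ^+ 2.
Proof.
move=> Wx0 Wx; pose g (t : R) := x0 + t *: (x - x0).
have Wg (t : R) : 0 <= t <= 1 -> W (g t) by move=> t01; exact: boxy_segment.
have gd (t : R) a : is_derive t 1 (fun s => g s 0 a) (x 0 a - x0 0 a).
  have -> : (fun s : R => g s 0 a) = (fun s => x0 0 a + (x 0 a - x0 0 a) * s).
    by apply/funext => s; rewrite !mxE mulrC.
  rewrite -[X in is_derive _ _ _ X]add0r; apply: is_deriveD.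
  by rewrite -[X in is_derive _ _ _ X]mulr1; apply: is_derive_scale; exact: is_derive_id.
have := @gronwall _ _ (fun (c : 'I_p * 'I_q) t => F (g t) c.1 c.2)
  (fun c t => \sum_i 'D_(delta_mx 0 i) (fun y => F y c.1 c.2) (g t) * (x 0 i - x0 0 i))
  (\sum_i `|x 0 i - x0 0 i| * C).
have -> : g 0 = x0 by rewrite /g scale0r addr0.
have -> : g 1 = x by rewrite /g scale1r addrC subrK.
apply.
- by apply: sumr_ge0 => i _; rewrite mulr_ge0.
- move=> c t t01; exact: (Cn_along oW (CF c.1 c.2) (Wg t t01) (gd t)).
- move=> c t t01; apply: le_trans (ler_norm_sum _ _ _) _; rewrite mulr_suml.
  apply: ler_sum => i _; rewrite normrM mulrC -mulrA ler_wpM2l//.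
  have := dF i c.1 c.2 (Wg t t01); by rewrite mxE.
Qed.

Lemma matrix_unique x0 x : W x0 -> W x -> F x0 = 0 -> F x = 0.
Proof.
move=> Wx0 Wx F0; have := matrix_growth Wx0 Wx; rewrite F0 [X in _ * X]big1 ?mulr0; last first.
  by move=> c _; rewrite mxE expr0n.
move=> H; apply/matrixP => a b; rewrite [RHS]mxE; apply/eqP; rewrite -sqrf_eq0.
rewrite eq_le sqr_ge0 andbT; apply: le_trans H.
rewrite (bigD1 (a, b))//= lerDl sumr_ge0// => c _; exact: sqr_ge0.
Qed.

End MatrixGrowth.

Definition hyperbolic_on {R : realType} {m : nat} (G : 'rV[R]_m -> 'M[R]_m)
    (V : set 'rV[R]_m) (kap : R) :=
  [/\ open V, forall n, Cmx V n G, forall x, V x -> (G x)^T = G x,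
      forall x v, V x -> v != 0 -> 0 < ginner G x v v &
      forall x u v, V x -> row_free (col_mx u v) -> sectional_curvature G x u v = - kap].

Section Tractor.
Context {R : realType} {m : nat}.
Variables (G : 'rV[R]_m -> 'M[R]_m) (V : set 'rV[R]_m) (kap : R).
Hypotheses (HG : hyperbolic_on G V kap) (kap0 : 0 < kap).
Local Notation e_ a := (delta_mx 0 a : 'rV[R]_m).

Let oV : open V. Proof. by case: HG. Qed.
Let sG n : Cmx V n G. Proof. by case: HG. Qed.
Let symG x : V x -> (G x)^T = G x. Proof. by case: HG => _ _ + _ _; apply. Qed.
Let posG x v : V x -> v != 0 -> 0 < ginner G x v v. Proof. by case: HG => _ _ _ + _; apply. Qed.
Let curvG x u v : V x -> row_free (col_mx u v) -> sectional_curvature G x u v = - kap.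
Proof. by case: HG => _ _ _ _; apply. Qed.

(* The connection on R (+) T^* whose parallel sections (f, w) satisfy
   d_i f = w_i and d_i w_j = Gamma^l_ij w_l + kap g_ij f. *)
Definition tA (i : 'I_m) x : 'M[R]_(1 + m) :=
  block_mx 0 (e_ i) (kap *: col i (G x)) (Gam G i x).

Definition Dm x : 'M[R]_(1 + m) := block_mx 1%:M 0 0 (- kap *: G x).

Lemma dmx_block n (A : 'rV[R]_m -> 'M[R]_(1 + m)) x i (ul : 'M[R]_1) (ur : 'rV[R]_m)
  (dl : 'cV[R]_m) (dr : 'M[R]_m) : Cmx V n.+1 A -> V x ->
  (forall b, 'D_(e_ i) (fun y => A y (lshift m 0) (lshift m b)) x = ul 0 b) ->
  (forall b, 'D_(e_ i) (fun y => A y (lshift m 0) (rshift 1 b)) x = ur 0 b) ->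
  (forall a, 'D_(e_ i) (fun y => A y (rshift 1 a) (lshift m 0)) x = dl a 0) ->
  (forall a b, 'D_(e_ i) (fun y => A y (rshift 1 a) (rshift 1 b)) x = dr a b) ->
  dmx i A x = block_mx ul ur dl dr.
Proof.
move=> _ _ H1 H2 H3 H4; apply/matrixP => a b; rewrite [LHS]mxE.
case: (split_ordP a) => a' ->; case: (split_ordP b) => b' ->.
- by rewrite block_mxEul !(ord1 a') H1.
- by rewrite block_mxEur !(ord1 a') H2.
- by rewrite block_mxEdl !(ord1 b') H3.
- by rewrite block_mxEdr H4.
Qed.

Lemma Cmx_tA n i : Cmx V n (tA i).
Proof.
move=> a b; case: (split_ordP a) => a' ->; case: (split_ordP b) => b' ->.
- apply: (Cn_ext oV _ (@Cn_cst _ _ n V 0)) => y _; by rewrite block_mxEul mxE.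
- apply: (Cn_ext oV _ (@Cn_cst _ _ n V (e_ i a' b'))) => y _; by rewrite block_mxEur.
- apply: (Cn_ext oV _ (Cn_mul oV (@Cn_cst _ _ n V kap) (sG n a' i))) => y _.
  by rewrite block_mxEdl !mxE.
- apply: (Cn_ext oV _ (Cmx_Gam oV sG symG posG n i a' b')) => y _; by rewrite block_mxEdr.
Qed.

Lemma Cmx_Dm n : Cmx V n Dm.
Proof.
move=> a b; case: (split_ordP a) => a' ->; case: (split_ordP b) => b' ->.
- apply: (Cn_ext oV _ (@Cn_cst _ _ n V (1%:M a' b'))) => y _; by rewrite block_mxEul.
- apply: (Cn_ext oV _ (@Cn_cst _ _ n V 0)) => y _; by rewrite block_mxEur mxE.
- apply: (Cn_ext oV _ (@Cn_cst _ _ n V 0)) => y _; by rewrite block_mxEdl mxE.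
- apply: (Cn_ext oV _ (Cn_mul oV (@Cn_cst _ _ n V (- kap)) (sG n a' b'))) => y _.
  by rewrite block_mxEdr !mxE.
Qed.

Lemma dmx_tA i j x : V x ->
  dmx j (tA i) x = block_mx 0 0 (kap *: col i (dmx j G x)) (dmx j (Gam G i) x).
Proof.
move=> Vx; apply: (dmx_block (Cmx_tA 1 i) Vx).
- move=> b; have -> : (fun y => tA i y (lshift m 0) (lshift m b)) = cst 0.
    by apply/funext => y; rewrite block_mxEul mxE.
  by rewrite derive_cst mxE.
- move=> b; have -> : (fun y => tA i y (lshift m 0) (rshift 1 b)) = cst (e_ i 0 b).
    by apply/funext => y; rewrite block_mxEur.
  by rewrite derive_cst mxE.
- move=> a; have -> : (fun y => tA i y (rshift 1 a) (lshift m 0)) = kap \*: (fun y => G y a i).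
    by apply/funext => y; rewrite block_mxEdl !mxE.
  rewrite deriveZ; last by have [] := Cn_is_derive j (sG 1 a i) Vx.
  by rewrite !mxE.
- move=> a b; have -> : (fun y => tA i y (rshift 1 a) (rshift 1 b)) = (fun y => Gam G i y a b).
    by apply/funext => y; rewrite block_mxEdr.
  by rewrite [RHS]mxE.
Qed.

Lemma dmx_Dm i x : V x -> dmx i Dm x = block_mx 0 0 0 (- kap *: dmx i G x).
Proof.
move=> Vx; apply: (dmx_block (Cmx_Dm 1) Vx).
- move=> b; have -> : (fun y => Dm y (lshift m 0) (lshift m b)) = cst (1%:M 0 b).
    by apply/funext => y; rewrite block_mxEul.
  by rewrite derive_cst mxE.
- move=> b; have -> : (fun y => Dm y (lshift m 0) (rshift 1 b)) = cst 0.
    by apply/funext => y; rewrite block_mxEur mxE.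
  by rewrite derive_cst mxE.
- move=> a; have -> : (fun y => Dm y (rshift 1 a) (lshift m 0)) = cst 0.
    by apply/funext => y; rewrite block_mxEdl mxE.
  by rewrite derive_cst mxE.
- move=> a b; have -> : (fun y => Dm y (rshift 1 a) (rshift 1 b)) = - kap \*: (fun y => G y a b).
    by apply/funext => y; rewrite block_mxEdr !mxE.
  rewrite deriveZ; last by have [] := Cn_is_derive i (sG 1 a b) Vx.
  by rewrite !mxE.
Qed.

(** The form [Dm] is parallel for the connection [tA]. Hence, for a frame Y of parallel sections, Y
    B Y^T - [Dm] solves a linear equation, and an isometric frame at one point is isometric
    nearby. *)
Lemma Dm_compat i x : V x -> dmx i Dm x = tA i x *m Dm x + Dm x *m (tA i x)^T.
Proof.
move=> Vx; rewrite dmx_Dm// /tA /Dm tr_block_mx !mulmx_block add_block_mx.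
rewrite !(mul0mx, mulmx0, mul1mx, mulmx1, trmx0, addr0, add0r).
congr (block_mx _ _ _ _).
- by rewrite !linearZ /= -rowE tr_col symG// -scalerDl addNr scale0r.
- by rewrite -scalemxAl trmx_delta -colE -scalerDl addrN scale0r.
- by rewrite -scalemxAr -scalemxAl -scalerDr (metric_compat oV sG symG posG i Vx).
Qed.

Lemma tA_flat_dl (P Q g : 'M[R]_m) i j : row i Q = row j P ->
  col i (Q *m g + g *m Q^T) + P *m col j g = col j (P *m g + g *m P^T) + Q *m col i g.
Proof.
move=> H; have E (A : 'M[R]_m) a : col a (A *m g + g *m A^T) = A *m col a g + g *m (row a A)^T.
  by rewrite linearD /= !colE tr_row !colE !mulmxA.
by rewrite !E H addrC (addrC (Q *m _)) addrA.
Qed.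

Lemma tA_flat_dr (D1 D2 X1 X2 P Q : 'M[R]_m) : D2 - D1 + (Q *m P - P *m Q) = kap *: (X1 - X2) ->
  D1 + (kap *: X1 + P *m Q) = D2 + (kap *: X2 + Q *m P).
Proof.
move: (P *m Q) (Q *m P) => a b H; apply/eqP; rewrite -subr_eq0.
have -> : D1 + (kap *: X1 + a) - (D2 + (kap *: X2 + b)) = kap *: (X1 - X2) - (D2 - D1 + (b - a)).
  by apply/matrixP => x y; rewrite !mxE; ring.
by rewrite H subrr.
Qed.

(** The four blocks express in turn the symmetry of the metric, the absence of torsion, metric
    compatibility and the constancy of the curvature. *)
Lemma tA_flat i j x : V x ->
  dmx j (tA i) x + tA i x *m tA j x = dmx i (tA j) x + tA j x *m tA i x.
Proof.
move=> Vx; rewrite (dmx_tA i j Vx) (dmx_tA j i Vx) /tA.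
rewrite [X in _ + X = _]mulmx_block [X in _ = _ + X]mulmx_block.
rewrite [LHS]add_block_mx [RHS]add_block_mx.
rewrite !(mul0mx, mulmx0, addr0, add0r).
have symGam a b : row b (Gam G a x) = row a (Gam G b x).
  by apply/rowP => c; rewrite !rowE'; exact: (Gam_sym oV sG symG a b c Vx).
congr (block_mx _ _ _ _).
- rewrite -!scalemxAr -!rowE; congr (_ *: _).
  by apply/rowP => b; rewrite !rowE' [LHS]mxE [RHS]mxE (symGE symG).
- by rewrite -!rowE symGam.
- rewrite !(metric_compat oV sG symG posG _ Vx) -!scalemxAr -!scalerDr; congr (_ *: _).
  by apply: tA_flat_dl; exact: symGam.
- rewrite -!scalemxAl; apply: tA_flat_dr.
  by have := Omega_const oV sG symG posG curvG i j Vx; rewrite opprK.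
Qed.

(** The value in the first row and the partial derivatives below it. For a local isometric immersion
    the columns are parallel sections ([jet_eq]). *)
Definition jet (Psi : 'rV[R]_m -> 'rV[R]_(1 + m)) x : 'M[R]_(1 + m) :=
  col_mx (Psi x) (\matrix_(a, al) 'D_(e_ a) (fun y => Psi y 0 al) x).

(* Psi is an isometric immersion of W into the hyperboloid B(y, y) = 1, up to
   the factor kap: [Dm] is the block matrix diag(1, - kap g). *)
Definition isdev (B : 'M[R]_(1 + m)) (W : set 'rV[R]_m) (Psi : 'rV[R]_m -> 'rV[R]_(1 + m)) :=
  [/\ open W, W `<=` V, Cmx W 2 Psi &
      forall x, W x -> jet Psi x *m B *m (jet Psi x)^T = Dm x].

Lemma Dm_unit x : V x -> Dm x \in unitmx.
Proof.
move=> Vx; rewrite unitmxE det_ublock det1 mul1r detZ unitrM unitrX ?unitfE ?oppr_eq0; last exact: lt0r_neq0.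
by have := unitG posG Vx; rewrite unitmxE unitfE.
Qed.

Lemma jet0 Psi x al : jet Psi x (lshift m 0) al = Psi x 0 al.
Proof. by rewrite /jet col_mxEu. Qed.

Lemma jet1 Psi x a al : jet Psi x (rshift 1 a) al = 'D_(e_ a) (fun y => Psi y 0 al) x.
Proof. by rewrite /jet col_mxEd mxE. Qed.

Lemma dmxE p q j (F : 'rV[R]_m -> 'M[R]_(p, q)) x a b :
  dmx j F x a b = 'D_(e_ j) (fun y => F y a b) x.
Proof. by rewrite mxE. Qed.

Opaque jet dmx.

Section Jet.
Variables (B : 'M[R]_(1 + m)) (W : set 'rV[R]_m) (Psi : 'rV[R]_m -> 'rV[R]_(1 + m)).
Hypotheses (BT : B^T = B) (HP : isdev B W Psi).

Lemma jet_units x : W x -> jet Psi x \in unitmx /\ B \in unitmx.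
Proof.
case: HP => _ WV _ H Wx; have := Dm_unit (WV _ Wx); rewrite -(H _ Wx) !unitmx_mul.
by move=> /andP[/andP[-> ->]].
Qed.

Lemma Cmx_jet : Cmx W 1 (jet Psi).
Proof.
case: HP => oW WV sP _ a al; case: (split_ordP a) => a' ->.
- apply: (Cn_ext oW _ (CnS (sP 0 al))) => y _; by rewrite (ord1 a') jet0.
- apply: (Cn_ext oW _ (Cn_derive a' (sP 0 al))) => y _; by rewrite jet1.
Qed.

Lemma derive_ext {E F : normedModType R} (f h : E -> F) (v x : E) : f =1 h -> 'D_v f x = 'D_v h x.
Proof. by move/funext ->. Qed.

Lemma row_jet i x : row (rshift 1 i) (jet Psi x) = row (lshift m 0) (dmx i (jet Psi) x).
Proof.
apply/rowP => al; apply: etrans (rowE' _ _ _) _; apply: etrans (jet1 _ _ _ _) _.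
apply: etrans _ (esym (rowE' _ _ _)); apply: etrans _ (esym (dmxE _ _ _ _ _)).
by apply: derive_ext => y; rewrite jet0.
Qed.

Lemma dmx_jet_sym i j x : W x ->
  row (rshift 1 i) (dmx j (jet Psi) x) = row (rshift 1 j) (dmx i (jet Psi) x).
Proof.
case: HP => oW _ sP _ Wx; apply/rowP => al.
have E a b : row (rshift 1 a) (dmx b (jet Psi) x) 0 al =
    'D_(e_ b) ('D_(e_ a) (fun y => Psi y 0 al)) x.
  apply: etrans (rowE' _ _ _) _; apply: etrans (dmxE _ _ _ _ _) _.
  by apply: derive_ext => y; exact: jet1.
apply: etrans (E i j) _; apply: etrans _ (esym (E j i)).
exact: (derive_swap _ _ oW (sP 0 al) Wx).
Qed.

Lemma tA_sym i j x : V x -> row (rshift 1 i) (tA j x) = row (rshift 1 j) (tA i x).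
Proof.
move=> Vx; apply/rowP => b; rewrite !rowE' /tA.
case: (split_ordP b) => b' ->.
  rewrite [LHS]block_mxEdl [RHS]block_mxEdl.
  have E a c : (kap *: col a (G x)) c b' = kap * G x c a by rewrite !mxE.
  by rewrite !E (symGE symG).
by rewrite [LHS]block_mxEdr [RHS]block_mxEdr; exact: (Gam_sym oV sG symG j i b' Vx).
Qed.

Lemma tA_row0 i x (Y : 'M[R]_(1 + m)) : row (lshift m 0) (tA i x *m Y) = row (rshift 1 i) Y.
Proof.
rewrite row_mul (_ : row _ (tA i x) = delta_mx 0 (rshift 1 i)) -?rowE//.
apply/rowP => b; rewrite rowE' /tA; case: (split_ordP b) => b' ->.
  by rewrite block_mxEul !mxE eqxx -val_eqE /= ltn_eqF// (leq_trans (ltn_ord b')).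
by rewrite block_mxEur !mxE eqxx /= (inj_eq (@rshift_inj _ _)).
Qed.

(** A tensor symmetric in one pair of indices and antisymmetric in an overlapping pair vanishes, the
    algebra behind the uniqueness of the Levi-Civita connection; the index 0 is settled by the
    second hypothesis. *)
Lemma antisym3_eq0 (E : 'I_m -> 'M[R]_(1 + m)) :
  (forall i, E i + (E i)^T = 0) -> (forall i, row (lshift m 0) (E i) = 0) ->
  (forall i j, row (rshift 1 i) (E j) = row (rshift 1 j) (E i)) -> forall i, E i = 0.
Proof.
move=> anti E0 sym i.
have A k a b : E k a b = - E k b a.
  have /matrixP/(_ a b) := anti k; rewrite mxDE [_^T _ _]mxE [_ 0 _ _]mxE => /eqP.
  by rewrite addr_eq0 => /eqP.
have Z k b : E k (lshift m 0) b = 0.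
  by have /rowP/(_ b) := E0 k; rewrite rowE' mxE.
have S k l b : E l (rshift 1 k) b = E k (rshift 1 l) b.
  by have /rowP/(_ b) := sym k l; rewrite !rowE'.
apply/matrixP => a b; rewrite [RHS]mxE.
case: (split_ordP a) => a' ->; first by rewrite (ord1 a') Z.
case: (split_ordP b) => b' ->; first by rewrite A (ord1 b') Z oppr0.
have := S a' i (rshift 1 b'); have := A a' (rshift 1 i) (rshift 1 b').
have := S b' a' (rshift 1 i); have := A b' (rshift 1 a') (rshift 1 i).
have := S i b' (rshift 1 a'); have := A i (rshift 1 a') (rshift 1 b').
lra.
Qed.

Lemma antisym_defect n (Y dY A C : 'M[R]_n) : C^T = C ->
  dY *m C *m Y^T + Y *m C *m dY^T = A *m (Y *m C *m Y^T) + Y *m C *m Y^T *m A^T ->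
  (dY - A *m Y) *m C *m Y^T + ((dY - A *m Y) *m C *m Y^T)^T = 0.
Proof.
move=> CT H; rewrite trmx_mul trmxK trmx_mul CT linearB /= trmx_mul !mulmxBl !mulmxBr !mulmxA.
move: H; rewrite !mulmxA; move: (dY *m C *m _) (Y *m C *m _ ) (A *m Y *m C *m _) (Y *m C *m _ *m _).
move=> a b c d /eqP; rewrite -subr_eq0 => /eqP <-.
by rewrite addrACA opprD.
Qed.

(** The isometry condition, of first order, already determines the second derivatives (Gauss
    formula). The defect [Z], paired with the frame, is antisymmetric by differentiating the
    condition and symmetric by equality of mixed derivatives, so it vanishes; the pairing is
    invertible. *)
Lemma jet_eq i x : W x -> dmx i (jet Psi) x = tA i x *m jet Psi x.
Proof.
move=> Wx; have [oW WV sP HD] := HP; have Vx := WV _ Wx; have [uY uB] := jet_units Wx.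
pose Z a := dmx a (jet Psi) x - tA a x *m jet Psi x.
have ZE a : Z a *m B *m (jet Psi x)^T = 0.
  move: a; apply: antisym3_eq0.
  - move=> a; have := Dm_compat a Vx; rewrite -!(HD _ Wx).
    rewrite -(dmx_ext oW a (fun y Wy => HD y Wy) Wx).
    have CB : Cmx W 1 (fun=> B) by move=> ? ?; exact: Cn_cst.
    have CJ := Cmx_jet; have CT := Cmx_tr oW CJ.
    rewrite (dmx_mul a (Cmx_mul oW CJ CB) CT Wx) (dmx_mul a CJ CB Wx) dmx_tr.
    have -> : dmx a (fun=> B) x = 0 :> 'M[R]_(1 + m).
      by apply/matrixP => c d; rewrite dmxE derive_cst mxE.
    rewrite mulmx0 addr0 /Z => H.
    exact: antisym_defect BT H.
  - move=> a; rewrite !row_mul /Z linearB /= -row_jet tA_row0 subrr.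
    by rewrite !mul0mx.
  - move=> a b; have ZS c d : row (rshift 1 c) (Z d *m B *m (jet Psi x)^T) =
        (row (rshift 1 c) (dmx d (jet Psi) x) - row (rshift 1 c) (tA d x) *m jet Psi x)
          *m B *m (jet Psi x)^T.
      by rewrite -!row_mul -linearB /= -!row_mul.
    by rewrite !ZS dmx_jet_sym// tA_sym.
apply/eqP; rewrite -subr_eq0 -/(Z i); apply/eqP.
have uYT : (jet Psi x)^T \in unitmx by rewrite unitmx_tr.
by rewrite -(mulmxK uB (Z i)) -(mulmxK uYT (Z i *m B)) ZE !mul0mx.
Qed.

End Jet.

Lemma tA_bounded x0 : V x0 -> exists C r : R, [/\ 0 <= C, 0 < r, cube x0 r `<=` V &
  forall x i a b, cube x0 r x -> `|tA i x a b| <= C].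
Proof.
move=> Vx0; pose Q := ('I_m * 'I_(1 + m) * 'I_(1 + m))%type.
pose C : R := \sum_(q : Q) (`|tA q.1.1 x0 q.1.2 q.2| + 1).
have [r r0 rP] : exists2 r : R, 0 < r & cube x0 r `<=` V `&` [set x | forall q : Q, `|tA q.1.1 x q.1.2 q.2| <= C].
  apply/nbhs_cubeP; apply: filterI; first exact: open_nbhs_nbhs.
  apply: (@filter_forall _ _ (fun (q : Q) x => `|tA q.1.1 x q.1.2 q.2| <= C) (nbhs x0)) => q.
  have := continuous_dist_le (Cn_continuous (Cmx_tA 0 q.1.1 q.1.2 q.2) Vx0) ltr01.
  apply: filterS => x Hx.
  have : `|tA q.1.1 x0 q.1.2 q.2| + 1 <= C.
    by rewrite /C (bigD1 q)//= lerDl sumr_ge0// => i _; rewrite addr_ge0.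
  apply: le_trans; rewrite -lerBlDl; apply: le_trans Hx; exact: lerB_dist.
exists C, r; split => //; first by apply: sumr_ge0 => q _; rewrite addr_ge0.
  by move=> x /rP[].
by move=> x i a b /rP[_ /(_ (i, a, b))].
Qed.

Lemma mulmx_entry_sum_le p q r (A : 'M[R]_(p, q)) (F : 'M[R]_(q, r)) (C : R) a b : 0 <= C ->
  (forall i j, `|A i j| <= C) -> `|(A *m F) a b| <= C * \sum_(c : 'I_q * 'I_r) `|F c.1 c.2|.
Proof.
move=> C0 AC; rewrite mxE (le_trans (ler_norm_sum _ _ _))//.
apply: (@le_trans _ _ (\sum_j C * `|F j b|)).
  by apply: ler_sum => j _; rewrite normrM ler_wpM2r.
rewrite -mulr_sumr ler_wpM2l// -(pair_bigA _ (fun i j => `|F i j|)) /=.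
by apply: ler_sum => i _; rewrite (bigD1 b)//= lerDl sumr_ge0.
Qed.

(** The difference of the jets satisfies the linear equation of [jet_eq] and vanishes at [x1]. *)
Lemma dev_unique B W Psi1 Psi2 x1 : B^T = B -> isdev B W Psi1 -> isdev B W Psi2 -> W x1 ->
  jet Psi1 x1 = jet Psi2 x1 -> \forall x \near x1, Psi1 x = Psi2 x.
Proof.
move=> BT H1 H2 Wx1 E; have [oW WV sP1 _] := H1; have [_ _ sP2 _] := H2.
have [C [r [C0 r0 rV Cb]]] := tA_bounded (WV _ Wx1).
have [s s0 sW] : exists2 s : R, 0 < s & cube x1 s `<=` W by exact: open_cubeP.
pose t : R := Num.min r s; have t0 : 0 < t by rewrite lt_min r0.
have tr : cube x1 t `<=` cube x1 r by apply: cubeS; rewrite ge_min lexx.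
have ts : cube x1 t `<=` W.
  by apply: subset_trans sW; apply: cubeS; rewrite ge_min lexx orbT.
have CJ1 := Cmx_jet H1; have CJ2 := Cmx_jet H2.
pose F x := jet Psi1 x + (- 1%:M) *m jet Psi2 x.
have C1 : Cmx W 1 (fun=> - 1%:M : 'M[R]_(1 + m)) by move=> ? ?; exact: Cn_cst.
have CF : Cmx W 1 F := Cmx_add oW CJ1 (Cmx_mul oW C1 CJ2).
have dF i x : W x -> dmx i F x = tA i x *m F x.
  move=> Wx; rewrite (dmx_add i CJ1 (Cmx_mul oW C1 CJ2) Wx) (dmx_mul i C1 CJ2 Wx).
  have -> : dmx i (fun=> - 1%:M) x = 0 :> 'M[R]_(1 + m).
    by apply/matrixP => c d; rewrite dmxE derive_cst mxE.
  rewrite mul0mx add0r (jet_eq BT H1 i Wx) (jet_eq BT H2 i Wx) /F !mulNmx !mul1mx.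
  by rewrite mulmxDr mulmxN.
have Fu x : cube x1 t x -> F x = 0.
  move=> xt; apply: (@matrix_unique _ _ _ _ (cube x1 t) F C (@open_cube _ _ _ _) (@boxy_cube _ _ _ _) _ C0 _ x1 x _ xt).
  - by move=> a b; exact: Cn_sub ts (CF a b).
  - move=> y i a b yt; rewrite dF; last exact: ts.
    by apply: mulmx_entry_sum_le => // c d; apply: Cb; exact: tr.
  - exact: cube_center.
  - by rewrite /F E mulNmx mul1mx subrr.
apply/nbhs_cubeP; exists t => // x /Fu; rewrite /F mulNmx mul1mx => /eqP.
rewrite subr_eq0 => /eqP/matrixP H; apply/rowP => al.
by have := H (lshift m 0) al; rewrite !jet0.
Qed.

(** Frobenius, started at the columns of the identity, gives a full frame. [Psi] is its first row:
    the upper row of [tA] says that the other rows are the partial derivatives of the first. *)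
Lemma dev_exists x0 : V x0 -> exists (r : R) (Psi : 'rV[R]_m -> 'rV[R]_(1 + m)),
  [/\ 0 < r, isdev (Dm x0) (cube x0 r) Psi & jet Psi x0 = 1%:M].
Proof.
move=> Vx0; have [r r0 [rV H]] := frobenius oV Vx0 (fun i => Cmx_tA 2 i) (fun x i j Vx => tA_flat i j Vx).
have /choice[Y HY] : forall al : 'I_(1 + m), exists y : 'rV[R]_m -> 'cV[R]_(1 + m),
  [/\ y x0 = col al 1%:M,
    forall x i a, cube x0 r x -> is_derive x (e_ i) (fun x => y x a 0) ((tA i x *m y x) a 0) &
    forall a, Cn 2 (cube x0 r) (fun x => y x a 0)] by move=> al; exact: H.
have [C [r' [C0 r'0 r'V Cb]]] := tA_bounded Vx0.
pose t : R := Num.min r r'; have t0 : 0 < t by rewrite lt_min r0.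
have tr : cube x0 t `<=` cube x0 r by apply: cubeS; rewrite ge_min lexx.
have tr' : cube x0 t `<=` cube x0 r' by apply: cubeS; rewrite ge_min lexx orbT.
have oc := @open_cube _ _ x0 t.
pose YY x : 'M[R]_(1 + m) := \matrix_(a, al) Y al x a 0.
have YYE x a al : YY x a al = Y al x a 0 by rewrite mxE.
have CY n : (n <= 2)%N -> Cmx (cube x0 t) n YY.
  move=> n2 a al; have [_ _ Hs] := HY al.
  by apply: (Cn_ext oc _ (Cn_sub tr (CnW n2 (Hs a)))) => y _; rewrite YYE.
have dY i x : cube x0 t x -> dmx i YY x = tA i x *m YY x.
  move=> xt; apply/matrixP => a al; rewrite dmxE.
  rewrite (_ : (fun y => _) = fun y => Y al y a 0); last by apply/funext => y; rewrite YYE.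
  have [_ /(_ x i a (tr _ xt))[_ ->] _] := HY al.
  by rewrite !mxE; apply: eq_bigr => s _; rewrite YYE.
pose Psi x : 'rV[R]_(1 + m) := row (lshift m 0) (YY x).
have jetE x : cube x0 t x -> jet Psi x = YY x.
  move=> xt; apply/matrixP => a al; case: (split_ordP a) => a' ->.
    by rewrite (ord1 a') jet0 rowE'.
  rewrite jet1; have := tA_row0 a' x (YY x); rewrite -dY// => /rowP/(_ al).
  by rewrite !rowE' dmxE => <-; apply: derive_ext => y; rewrite rowE'.
have YY0 : YY x0 = 1%:M.
  by apply/matrixP => a al; rewrite YYE; have [-> _ _] := HY al; rewrite !mxE.
exists t, Psi; split => //; last by rewrite jetE; [exact: YY0|exact: cube_center].
split => //.
- by apply: subset_trans rV.
- move=> a b; apply: (Cn_ext oc _ (CY 2 isT (lshift m 0) b)) => y _.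
  by rewrite (ord1 a) rowE'.
- move=> x xt; rewrite jetE//.
  (* [F] measures the failure of the frame to be isometric. It vanishes at [x0] and, [Dm] being
     parallel, satisfies a linear equation. *)
  pose D0 := Dm x0; pose F x := YY x *m D0 *m (YY x)^T + (- 1%:M) *m Dm x.
  have CB (A : 'M[R]_(1 + m)) n : Cmx (cube x0 t) n (fun=> A) by move=> ? ?; exact: Cn_cst.
  have CD n : Cmx (cube x0 t) n Dm by move=> a b; exact: Cn_sub (subset_trans tr rV) (Cmx_Dm n a b).
  have CT := Cmx_tr oc (CY 1 isT).
  have CYB := Cmx_mul oc (CY 1 isT) (CB D0 1).
  have CYT := Cmx_mul oc CYB CT.
  have CDm := Cmx_mul oc (CB (- 1%:M) 1) (CD 1).
  have CF : Cmx (cube x0 t) 1 F := Cmx_add oc CYT CDm.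
  have d0 (A : 'M[R]_(1 + m)) i (y : 'rV[R]_m) : dmx i (fun=> A) y = 0 :> 'M[R]_(1 + m).
    apply/matrixP => c d; apply: etrans (dmxE _ _ _ _ _) _.
    by rewrite derive_cst mxE.
  have dF i y : cube x0 t y -> dmx i F y = tA i y *m F y + F y *m (tA i y)^T.
    move=> yt; rewrite (dmx_add i CYT CDm yt) (dmx_mul i CYB CT yt) (dmx_mul i (CY 1 isT) (CB D0 1) yt).
    rewrite (dmx_mul i (CB (- 1%:M) 1) (CD 1) yt) !d0 mulmx0 mul0mx addr0 add0r dmx_tr dY//.
    rewrite (Dm_compat i (rV _ (tr _ yt))) /F trmx_mul !mulNmx !mul1mx !mulmxDl !mulmxDr !mulmxN mulNmx !mulmxA.
    by rewrite opprD addrACA.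
  apply/eqP; rewrite -subr_eq0; apply/eqP.
  have <- : F x = YY x *m Dm x0 *m (YY x)^T - Dm x by rewrite /F mulNmx mul1mx.
  have CC : 0 <= C + C by rewrite addr_ge0.
  apply: (matrix_unique oc (@boxy_cube _ _ _ _) CF CC _ (cube_center _ t0) xt).
  - move=> y i a b yt; rewrite dF// mxDE mulrDl; apply: le_trans (ler_normD _ _) _.
    have tAC c d : `|tA i y c d| <= C by apply: Cb; exact: tr'.
    apply: lerD; first exact: mulmx_entry_sum_le.
    have -> : (F y *m (tA i y)^T) a b = (tA i y *m (F y)^T) b a.
      by rewrite -[in RHS](trmxK (tA i y)) -trmx_mul [in RHS]mxE.
    apply: le_trans (mulmx_entry_sum_le (F y)^T _ _ C0 tAC) _.
    rewrite ler_wpM2l// -(pair_bigA _ (fun i j => `|(F y)^T i j|)) -(pair_bigA _ (fun i j => `|(F y) i j|)) /=.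
    by rewrite exchange_big; apply: ler_sum => c _; apply: ler_sum => d _; rewrite mxE.
  - by rewrite /F YY0 mul1mx trmx1 mulmx1 mulNmx mul1mx subrr.
Qed.

Lemma row_mx_jet Psi x (s : R) (v : 'rV[R]_m) al : (row_mx s%:M v *m jet Psi x) 0 al =
  s * Psi x 0 al + \sum_a 'D_(e_ a) (fun y => Psi y 0 al) x * v 0 a.
Proof.
rewrite mxE big_split_ord /= big_ord1 jet0 row_mxEl mxE mulr1n; congr (_ + _).
by apply: eq_bigr => a _; rewrite row_mxEr jet1 mulrC.
Qed.

(** The covariant acceleration of a curve at [x] with velocity [v] and coordinate acceleration [w];
    it is zero along geodesics. *)
Definition geo_acc (x v w : 'rV[R]_m) : 'rV[R]_m :=
  \row_l (w 0 l + \sum_a \sum_b christoffel G l a b x * v 0 a * v 0 b).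

Lemma gauss_sum (D : 'I_m -> R) (Gm : 'M[R]_m) (v w : 'rV[R]_m) (Ga : 'I_m -> 'I_m -> 'I_m -> R) (P : R) :
  \sum_a (D a * w 0 a) + \sum_a (v 0 a * \sum_b (kap * Gm a b * P + \sum_l D l * Ga l b a) * v 0 b) =
  kap * (v *m Gm *m v^T) 0 0 * P +
   \sum_l D l * (\row_l (w 0 l + \sum_a \sum_b Ga l a b * v 0 a * v 0 b)) 0 l.
Proof.
have -> : (v *m Gm *m v^T) 0 0 = \sum_a \sum_b v 0 a * Gm a b * v 0 b.
  rewrite exchange_big mxE; apply: eq_bigr => b _; rewrite !mxE mulr_suml.
  by apply: eq_bigr => a _.
under [X in _ = _ + X]eq_bigr => l _ do rewrite mxE mulrDr.
rewrite big_split /= addrCA; congr (_ + _).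
rewrite mulr_sumr mulr_suml.
under [X in _ = _ + X]eq_bigr => l _ do (rewrite mulr_sumr; under eq_bigr => a _ do rewrite mulr_sumr).
rewrite [X in _ = _ + X]exchange_big /=.
under [X in _ = _ + X]eq_bigr => a _ do rewrite exchange_big /=.
rewrite [X in _ = _ + X]exchange_big -big_split; apply: eq_bigr => a _ /=.
rewrite !mulr_sumr mulr_suml -big_split; apply: eq_bigr => b _ /=.
rewrite mulrDl mulrDr; congr (_ + _); first by ring.
by rewrite mulr_suml mulr_sumr; apply: eq_bigr => l _; ring.
Qed.

Section Gauss.
Variables (B : 'M[R]_(1 + m)) (W : set 'rV[R]_m) (Psi : 'rV[R]_m -> 'rV[R]_(1 + m)).
Hypotheses (BT : B^T = B) (HP : isdev B W Psi).

Lemma dev_velocity (c : R -> 'rV[R]_m) (t : R) (v : 'rV[R]_m) al : W (c t) ->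
  (forall a, is_derive t 1 (fun s : R => c s 0 a) (v 0 a)) ->
  is_derive t 1 (fun s => Psi (c s) 0 al) ((row_mx 0 v *m jet Psi (c t)) 0 al).
Proof.
case: HP => oW _ sP _ Wc cv.
have := Cn_along oW (CnS (sP 0 al)) Wc cv.
by rewrite (_ : 0 = 0%:M) ?row_mx_jet ?mul0r ?add0r ?scalar_mx0// raddf0.
Qed.

Lemma dev_hessian a b x al : W x -> 'D_(e_ b) ('D_(e_ a) (fun y => Psi y 0 al)) x =
  kap * G x a b * Psi x 0 al + \sum_l 'D_(e_ l) (fun y => Psi y 0 al) x * christoffel G l b a x.
Proof.
move=> Wx; have /matrixP/(_ (rshift 1 a) al) := jet_eq BT HP b Wx.
rewrite dmxE (_ : (fun y => jet Psi y (rshift 1 a) al) = 'D_(e_ a) (fun y => Psi y 0 al)); last first.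
  by apply/funext => y; rewrite jet1.
move=> ->; rewrite mxE big_split_ord /= big_ord1 jet0 /tA block_mxEdl; congr (_ * _ + _).
  by rewrite !mxE.
apply: eq_bigr => l _; rewrite block_mxEdr jet1 mulrC; congr (_ * _).
by rewrite mxE.
Qed.

(** Psi o c has acceleration kap g(c', c') Psi + dPsi(covariant acceleration). Geodesics are thus
    sent to solutions of z'' = kap g(c', c') z. *)
Lemma dev_acceleration (c dc : R -> 'rV[R]_m) (t : R) (w : 'rV[R]_m) al : W (c t) ->
  (forall a, is_derive t 1 (fun s : R => c s 0 a) (dc t 0 a)) ->
  (forall a, is_derive t 1 (fun s : R => dc s 0 a) (w 0 a)) ->
  is_derive t 1 (fun s => (row_mx 0 (dc s) *m jet Psi (c s)) 0 al)
   ((row_mx (kap * ginner G (c t) (dc t) (dc t))%:M (geo_acc (c t) (dc t) w) *m jet Psi (c t)) 0 al).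
Proof.
case: (HP) => oW _ sP _ Wc cv cw.
have -> : (fun s => (row_mx 0 (dc s) *m jet Psi (c s)) 0 al) =
    (fun s => \sum_a 'D_(e_ a) (fun y => Psi y 0 al) (c s) * dc s 0 a).
  apply/funext => s; rewrite (_ : 0 = 0%:M) ?row_mx_jet ?mul0r ?add0r// raddf0//.
rewrite row_mx_jet.
have H a : is_derive t 1 (fun s => 'D_(e_ a) (fun y => Psi y 0 al) (c s) * dc s 0 a)
   ('D_(e_ a) (fun y => Psi y 0 al) (c t) * w 0 a + dc t 0 a *
     \sum_b 'D_(e_ b) ('D_(e_ a) (fun y => Psi y 0 al)) (c t) * dc t 0 b).
  apply: (is_derive_eq (is_derive_mul (Cn_along oW (Cn_derive a (sP 0 al)) Wc cv) (cw a))).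
  by rewrite /= [X in _ + X]mulrC.
apply: (is_derive_eq (is_derive_sum_fun (index_enum _) H)).
rewrite big_split /=.
rewrite -gauss_sum; congr (_ + _); apply: eq_bigr => a _; congr (_ * _).
by apply: eq_bigr => b _; rewrite dev_hessian.
Qed.

End Gauss.

End Tractor.

(** * Normal balls in the hyperboloid *)
Section BilinearForm.
Context {R : realType} {n : nat}.
Implicit Types (B : 'M[R]_n) (u v w : 'rV[R]_n).

Definition bil B u v : R := (u *m B *m v^T) 0 0.

Lemma bilDl B u v w : bil B (u + v) w = bil B u w + bil B v w.
Proof. by rewrite /bil !mulmxDl mxDE. Qed.

Lemma bilZl B c u w : bil B (c *: u) w = c * bil B u w.
Proof. by rewrite /bil -!scalemxAl mxE. Qed.

Lemma bilDr B u v w : bil B w (u + v) = bil B w u + bil B w v.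
Proof. by rewrite /bil linearD mulmxDr mxDE. Qed.

Lemma bilZr B c u w : bil B w (c *: u) = c * bil B w u.
Proof. by rewrite /bil linearZ -scalemxAr mxE. Qed.

Lemma bilNl B u w : bil B (- u) w = - bil B u w.
Proof. by rewrite -scaleN1r bilZl mulN1r. Qed.

Lemma bilNr B u w : bil B w (- u) = - bil B w u.
Proof. by rewrite -scaleN1r bilZr mulN1r. Qed.

Lemma bil0l B w : bil B 0 w = 0.
Proof. by rewrite -(scale0r w) bilZl mul0r. Qed.

Lemma bil0r B w : bil B w 0 = 0.
Proof. by rewrite -(scale0r w) bilZr mul0r. Qed.

Lemma bilC B u v : B^T = B -> bil B u v = bil B v u.
Proof.
move=> BT; rewrite /bil -{1}(trmxK (u *m B *m v^T)) mxE.
by rewrite !trmx_mul trmxK BT mulmxA.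
Qed.

Definition posdef B := forall v, v != 0 -> 0 < bil B v v.

Lemma posdef_ge0 B v : posdef B -> 0 <= bil B v v.
Proof. by move=> pB; have [->|/pB/ltW//] := eqVneq v 0; rewrite bil0l. Qed.

Lemma cauchy_schwarz B u v : B^T = B -> posdef B -> bil B u v ^+ 2 <= bil B u u * bil B v v.
Proof.
move=> BT pB; have [->|v0] := eqVneq v 0; first by rewrite !bil0r expr0n mulr0.
have bv := pB _ v0; rewrite -subr_ge0 -(pmulr_rge0 _ bv).
have := posdef_ge0 (bil B v v *: u - bil B u v *: v) pB.
rewrite bilDl bilNl !bilDr !bilNr !bilZl !bilZr (bilC v u BT).
move: (bil B u u) (bil B v v) (bil B u v) => a b c H; apply: (le_trans H).
by rewrite le_eqVlt; apply/orP; left; apply/eqP; ring.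
Qed.

Lemma posdef_unit B : posdef B -> B \in unitmx.
Proof.
move=> pB; rewrite -row_free_unit -kermx_eq0; apply/negPn/negP => /rowV0Pn[v].
move=> /sub_kermxP vB /pB; by rewrite /bil vB mul0mx mxE ltxx.
Qed.

(** The coordinate [z 0 a] is the product of [z] with e_a B^-1, so Cauchy-Schwarz bounds it by B(z,
    z) and a diagonal entry of the inverse. *)
Lemma posdef_small B (d : R) : B^T = B -> posdef B -> 0 < d ->
  exists2 s : R, 0 < s & forall z, bil B z z < s -> forall a, `|z 0 a| < d.
Proof.
move=> BT pB d0; pose K : R := \sum_a `|invmx B a a| + 1.
have K0 : 0 < K by rewrite ltr_wpDl// sumr_ge0.
exists (d ^+ 2 / K) => [|z zs a]; first by rewrite divr_gt0// exprn_gt0.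
pose u := delta_mx 0 a *m invmx B : 'rV[R]_n.
have uB : B *m u^T = delta_mx a 0.
  by rewrite trmx_mul trmx_inv BT trmx_delta mulKVmx// posdef_unit.
have zu : bil B z u = z 0 a.
  by rewrite /bil -mulmxA uB -colE mxE.
have uu : bil B u u = invmx B a a.
  by rewrite /bil -mulmxA uB -colE mxE /u -rowE mxE.
have := cauchy_schwarz z u BT pB; rewrite zu uu => H.
have iK : invmx B a a < K.
  rewrite /K (bigD1 a)//= -addrA ltr_pwDr//; first by rewrite ltr_wpDl// sumr_ge0.
  exact: ler_norm.
have : z 0 a ^+ 2 < d ^+ 2.
  apply: le_lt_trans H _; have z0 := posdef_ge0 z pB.
  apply: (@le_lt_trans _ _ (bil B z z * K)); first by rewrite ler_wpM2l// ltW.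
  by rewrite -ltr_pdivlMr.
by rewrite -real_normK ?num_real// ltr_sqr ?nnegrE// ltW.
Qed.

End BilinearForm.

(** * Inverting maps close to the identity *)

Section NearIdentity.
Context {R : realType} {m : nat}.
Local Notation e_ a := (delta_mx 0 a : 'rV[R]_m).
Variables (F : 'rV[R]_m -> 'rV[R]_m).

Definition near_id x0 (r : R) := forall x y, cube x0 r x -> cube x0 r y ->
  `|(F y - F x) - (y - x)| <= 2^-1 * `|y - x|.

Lemma near_identity (W : set 'rV[R]_m) x0 : open W -> W x0 -> Cmx W 1 F ->
  (forall a b, 'D_(e_ a) (fun y => F y 0 b) x0 = (a == b)%:R) ->
  exists2 r : R, 0 < r & cube x0 r `<=` W /\ near_id x0 r.
Proof.
move=> oW Wx0 CF D1; pose e : R := (2 * (m%:R + 1))^-1.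
have m1 : 0 < m%:R + 1 :> R by rewrite ltr_wpDl.
have e0 : 0 < e by rewrite invr_gt0 mulr_gt0.
have [r r0 rP] : exists2 r : R, 0 < r & cube x0 r `<=` W `&`
   [set x | forall q : 'I_m * 'I_m, `|'D_(e_ q.1) (fun y => F y 0 q.2) x - (q.1 == q.2)%:R| <= e].
  apply/nbhs_cubeP; apply: filterI; first exact: open_nbhs_nbhs.
  apply: (@filter_forall _ _ (fun (q : 'I_m * 'I_m) x =>
     `|'D_(e_ q.1) (fun y => F y 0 q.2) x - (q.1 == q.2)%:R| <= e) (nbhs x0)) => q.
  rewrite -D1; exact: (continuous_dist_le (Cn_continuous (Cn_derive q.1 (CF 0 q.2)) Wx0) e0).
exists r => //; split; first by move=> x /rP[].
move=> x y xr yr; apply: norm_le_coord; first by rewrite mulr_ge0.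
move=> b; have := @box_mean_value _ _ (cube x0 r) (fun y => F y 0 b)
  (fun a x => 'D_(e_ a) (fun y => F y 0 b) x) (fun a => (a == b)%:R) e x y (@boxy_cube _ _ _ _) xr yr.
have -> : \sum_a (y 0 a - x 0 a) * (a == b)%:R = y 0 b - x 0 b.
  rewrite (bigD1 b)//= eqxx mulr1 big1 ?addr0// => a /negbTE ->; by rewrite mulr0.
rewrite !mxE => H; apply: le_trans (H _ _) _.
- by move=> z a /rP[Wz _]; exact: (Cn_is_derive a (CF 0 b) Wz).
- by move=> z a /rP[_ /(_ (a, b))].
- have := sum_coord_le (y - x); under eq_bigr do rewrite !mxE; move=> S.
  apply: (@le_trans _ _ (e * (m%:R * `|y - x|))); first by rewrite ler_wpM2l// ltW.
  rewrite mulrA ler_wpM2r// /e invfM -mulrA ler_piMr ?invr_ge0//.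
  by rewrite mulrC ler_pdivrMr// mul1r lerDl.
Qed.

Variables (x0 : 'rV[R]_m) (r : R).
Hypothesis (r0 : 0 < r) (idF : near_id x0 r).

Lemma near_id_expand x y : cube x0 r x -> cube x0 r y -> `|y - x| <= 2 * `|F y - F x|.
Proof.
move=> xr yr; have := idF xr yr; have := ler_normB (F y - F x) (F y - F x - (y - x)).
rewrite opprB addrC subrK; move: `|y - x| `|F y - F x| `|_ - (y - x)| => a b c; lra.
Qed.

(** The map x -> x - F x + z contracts the closed ball of radius r/2 with ratio 1/2. It moves the
    centre by at most r/8, and r/4 + r/8 <= r/2 keeps the ball invariant. *)
Lemma near_id_surj z : `|z - F x0| <= r / 8 -> exists2 x, cube x0 r x & F x = z.
Proof.
move=> zr; pose U : set 'rV[R]_m := [set x | `|x - x0| <= r / 2].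
have Uc x : U x -> cube x0 r x.
  move=> Ux a; have := coord_le_norm (x - x0) a; rewrite mxDE [(- x0) 0 a]mxE => H.
  apply: le_lt_trans H _; by apply: le_lt_trans Ux _; rewrite ltr_pdivrMr// ltr_pMr// ltr1n.
have aux (a b c : R) : a <= 2^-1 * b -> c <= r / 8 -> b <= r / 2 -> a + c <= r / 2.
  by move=> *; have r0' := r0; lra.
have Ux0 : U x0 by rewrite /U /= subrr normr0 divr_ge0// ltW.
pose g x := x - F x + z.
have gU : set_fun U U g.
  move=> x Ux; have := idF (Uc _ Ux0) (Uc _ Ux) => H; rewrite /U /= /g.
  have -> : x - F x + z - x0 = - (F x - F x0 - (x - x0)) + (z - F x0).
    by rewrite !opprB; apply/rowP => a; rewrite !mxE; ring.
  apply: le_trans (ler_normD _ _) _; rewrite normrN.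
  exact: (aux _ _ _ H zr Ux).
pose gf := mkfun_fun gU.
have cg : is_contraction gf.
  exists (2^-1)%:nng; split; first by rewrite /=; lra.
  move=> [x y] [/= Ux Uy]; have := idF (Uc _ Uy) (Uc _ Ux); rewrite /gf /= /g.
  have -> : x - F x + z - (y - F y + z) = - (F x - F y - (x - y)).
    by apply/rowP => a; rewrite !mxE; ring.
  by rewrite normrN.
have cU : closed U.
  have -> : U = closed_ball x0 (r / 2).
    rewrite closed_ballE; last by rewrite divr_gt0.
    by apply/seteqP; split => x; rewrite /U /closed_ball_ /= distrC.
  exact: closed_ball_closed.
pose X : completeNormedModType R :=
  HB.pack ('rV[R]_m : Type) (Complete.on 'rV[R]_m) (NormedModule.on 'rV[R]_m).
have [x Ux xg] := @banach_fixed_point R X U gf cg cU (ex_intro _ _ Ux0).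
exists x; first exact: Uc.
have : x = x - F x + z := xg.
move/eqP; rewrite -addrA -subr_eq0 opprD addrA subrr add0r oppr_eq0 addrC subr_eq0.
by move=> /eqP.
Qed.

End NearIdentity.

Section NormalBall.
Context {R : realType} {m : nat}.
Variables (G : 'rV[R]_m -> 'M[R]_m) (V : set 'rV[R]_m) (kap : R).
Hypotheses (HG : hyperbolic_on G V kap) (kap0 : 0 < kap).
Local Notation e_ a := (delta_mx 0 a : 'rV[R]_m).

(** The image of the centre of a normal ball in the frame given by its jet. *)
Definition origin : 'rV[R]_(1 + m) := delta_mx 0 (lshift m 0).

Lemma Dm_sym x : V x -> (Dm G kap x)^T = Dm G kap x.
Proof.
case: HG => _ _ symG _ _ Vx; rewrite /Dm tr_block_mx trmx1 !trmx0.
by rewrite linearZ /= symG.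
Qed.

Lemma bil_Dm x (s t : R) (v w : 'rV[R]_m) :
  bil (Dm G kap x) (row_mx s%:M v) (row_mx t%:M w) = s * t - kap * bil (G x) v w.
Proof.
rewrite /bil /Dm mul_row_block !mulmx0 !mulmx1 addr0 add0r tr_row_mx mul_row_col mxDE.
rewrite -scalemxAr -scalemxAl [in X in _ + X]mxE mulNr; congr (_ - _).
by rewrite tr_scalar_mx -scalar_mxM mxE mulr1n.
Qed.

Lemma bil_DmE x (Z : 'rV[R]_(1 + m)) :
  bil (Dm G kap x) Z Z = Z 0 (lshift m 0) ^+ 2 - kap * bil (G x) (rsubmx Z) (rsubmx Z).
Proof.
rewrite -[in LHS](hsubmxK Z) [lsubmx Z]mx11_scalar bil_Dm expr2.
by congr (_ * _ - _); rewrite mxE.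
Qed.

Lemma bil_origin x (Z : 'rV[R]_(1 + m)) : bil (Dm G kap x) Z origin = Z 0 (lshift m 0).
Proof.
have -> : origin = row_mx 1%:M 0.
  apply/rowP => a; case: (split_ordP a) => a' ->.
    by rewrite row_mxEl !mxE (ord1 a').
  by rewrite row_mxEr !mxE.
rewrite -[in LHS](hsubmxK Z) [lsubmx Z]mx11_scalar bil_Dm bil0r mulr0 subr0 mulr1.
by rewrite mxE.
Qed.

(** On the hyperboloid Z_0^2 = 1 + kap g(z, z), with z the other coordinates. A bound Z_0 < 1 + eta
    therefore confines z to a small ellipsoid, over which the space part of [Psi] can be inverted;
    positivity of Z_0 selects the sheet. *)
Lemma normal_ball x0 : V x0 -> exists (eta : R) (U : set 'rV[R]_m) (Psi : 'rV[R]_m -> 'rV[R]_(1 + m)),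
 [/\ 0 < eta, isdev G V kap (Dm G kap x0) U Psi, U x0, Psi x0 = origin /\ jet Psi x0 = 1%:M &
 [/\ forall x, U x -> 0 < Psi x 0 (lshift m 0) < 1 + eta,
     forall Z, bil (Dm G kap x0) Z Z = 1 -> 0 < Z 0 (lshift m 0) < 1 + eta -> exists2 x, U x & Psi x = Z &
     forall x y, U x -> U y -> `|y - x| <= 2 * `|Psi y - Psi x|]].
Proof.
move=> Vx0; have [oV sG symG posG _] := HG.
have [r1 [Psi [r10 HP J1]]] := dev_exists HG Vx0.
have [oW WV sP HD] := HP.
have aux1 (a b : R) : 0 < b -> - (b / 2) <= a - b -> 0 < a by move=> *; lra.
have aux2 (a b c : R) : 0 < c - b -> a - b <= (c - b) / 2 -> a < c by move=> *; lra.
have aux3 (u v : R) : 0 < u -> u <= v / 3 -> u <= 1 -> (1 + u) ^+ 2 - 1 <= v by move=> *; nra.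
have Psi0 : Psi x0 = origin.
  apply/rowP => al; have /matrixP/(_ (lshift m 0) al) := J1.
  by rewrite jet0 => ->; rewrite !mxE eqxx eq_sym.
pose F x := rsubmx (Psi x).
have FE x b : F x 0 b = Psi x 0 (rshift 1 b) by rewrite mxE.
pose W := cube x0 r1 `&` [set x | 0 < Psi x 0 (lshift m 0)].
have oW' : open W.
  rewrite openE => x [xr Px]; apply: filterI; first exact: open_nbhs_nbhs.
  have cP := Cn_continuous (sP 0 (lshift m 0)) xr.
  have := continuous_dist_le cP (divr_gt0 Px (@ltr0Sn _ 1)); apply: filterS => y.
  rewrite ler_norml => /andP[+ _]; exact: (aux1 _ _ Px).
have Wx0 : W x0 by split; [exact: cube_center|rewrite /= Psi0 mxE !eqxx ltr01].
have CF : Cmx W 1 F.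
  move=> a b; have := Cn_sub (@subIsetl _ _ _ : W `<=` cube x0 r1) (CnS (sP 0 (rshift 1 b))).
  by apply: Cn_ext => // y _; rewrite (ord1 a) FE.
have D1 a b : 'D_(e_ a) (fun y => F y 0 b) x0 = (a == b)%:R.
  have /matrixP/(_ (rshift 1 a) (rshift 1 b)) := J1.
  rewrite jet1 mxE (inj_eq (@rshift_inj _ _)) => <-.
  by apply: derive_ext => y; rewrite FE.
have [r r0 [rW idF]] := near_identity oW' Wx0 CF D1.
have F0 : F x0 = 0 by apply/rowP => b; rewrite FE Psi0 !mxE.
have gT := symG _ Vx0; have gP : posdef (G x0) by move=> v; exact: posG.
have r8 : 0 < r / 8 by rewrite divr_gt0.
have [s s0 sP'] := posdef_small gT gP r8.
(* The cap of height 1 + eta lies over the ellipsoid g(z, z) < s, whose coordinates are below r/8,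
   the range of [near_id_surj]. *)
have [eta eta0 etaP] : exists2 eta : R, 0 < eta & (1 + eta) ^+ 2 - 1 <= kap * s.
  exists (Num.min 1 (kap * s / 3)); first by rewrite lt_min ltr01 divr_gt0// mulr_gt0.
  have : Num.min 1 (kap * s / 3) <= 1 by rewrite ge_min lexx.
  have : Num.min 1 (kap * s / 3) <= kap * s / 3 by rewrite ge_min lexx orbT.
  have : 0 < Num.min 1 (kap * s / 3) by rewrite lt_min ltr01 divr_gt0// mulr_gt0.
  exact: aux3.
have H1 x : cube x0 r x -> Psi x 0 (lshift m 0) ^+ 2 = 1 + kap * bil (G x0) (F x) (F x).
  move=> /rW[xr _]; have := HD _ xr => /matrixP/(_ (lshift m 0) (lshift m 0)).
  rewrite [in RHS]/Dm block_mxEul [1%:M _ _]mxE => H.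
  have : bil (Dm G kap x0) (Psi x) (Psi x) = 1.
    rewrite -{}[RHS]H /bil.
    have E : row (lshift m 0) (jet Psi x) = Psi x.
      by apply/rowP => a; rewrite rowE' jet0.
    by rewrite -E tr_row colE !mulmxA -colE -!row_mul !mxE.
  by rewrite bil_DmE -/(F x) => /eqP; rewrite subr_eq => /eqP.
pose U := cube x0 r `&` [set x | Psi x 0 (lshift m 0) < 1 + eta].
have UW : U `<=` W by move=> x [/rW].
exists eta, U, Psi; split => //.
- split.
  + rewrite openE => x [xr Px]; apply: filterI; first by apply: open_nbhs_nbhs; split => //; exact: open_cube.
    have cP := Cn_continuous (sP 0 (lshift m 0)) (rW _ xr).1.
    have Px' : 0 < 1 + eta - Psi x 0 (lshift m 0) by rewrite subr_gt0.
    have := continuous_dist_le cP (divr_gt0 Px' (@ltr0Sn _ 1)); apply: filterS => y.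
    rewrite ler_norml => /andP[_]; exact: (aux2 _ _ _ Px').
  + by move=> x [/rW[/WV]].
  + by move=> a b; apply: Cn_sub (sP a b) => x /UW[].
  + by move=> x /UW[xr _]; exact: HD.
- by split; [exact: cube_center|rewrite /= Psi0 mxE !eqxx ltrDl].
- split.
  + by move=> x Ux; case: (Ux) => _ /= ->; have [_ /= ->] := UW _ Ux.
  + move=> Z; rewrite bil_DmE => /eqP; rewrite subr_eq => /eqP Z1 /andP[Z0 Zeta].
    have zs : bil (G x0) (rsubmx Z) (rsubmx Z) < s.
      rewrite -(ltr_pM2l kap0); apply: lt_le_trans etaP.
      rewrite ltrBrDl -Z1; by rewrite ltr_sqr ?nnegrE ?ltW// (lt_trans Z0).
    have zr : `|rsubmx Z - F x0| <= r / 8.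
      rewrite F0 subr0; apply: norm_le_coord; first exact: ltW.
      by move=> a; exact: ltW (sP' _ zs a).
    have [x xr Fx] := near_id_surj r0 idF zr.
    have PZ : Psi x 0 (lshift m 0) = Z 0 (lshift m 0).
      have := H1 _ xr; rewrite Fx -Z1 => /eqP; rewrite eqrXn2 ?ltW//; last by have [] := rW _ xr.
      by move=> /eqP.
    exists x; first by split => //=; rewrite PZ.
    rewrite -[LHS]hsubmxK -/(F x) Fx -[RHS]hsubmxK; congr row_mx.
    by apply/rowP => a; rewrite !mxE !(ord1 a).
  + move=> x y [xr _] [yr _]; apply: le_trans (near_id_expand idF xr yr) _.
    rewrite ler_wpM2l//; apply: norm_le_coord => // a; rewrite mxDE [(- F x) 0 a]mxE !FE.
    by have := coord_le_norm (Psi y - Psi x) (rshift 1 a); rewrite mxDE [(- Psi x) 0 _]mxE.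
Qed.

End NormalBall.

Lemma Cn_differentiable {R : realType} {m : nat} (W : set 'rV[R]_m) f x (e : R) :
  open W -> W x -> Cn 1 W f -> 0 < e ->
  exists2 r : R, 0 < r & forall y, cube x r y ->
    `|f y - f x - \sum_a (y 0 a - x 0 a) * 'D_(delta_mx 0 a) f x| <= e * `|y - x|.
Proof.
move=> oW Wx Cf e0; have m1 : 0 < m%:R + 1 :> R by rewrite ltr_wpDl.
pose e' : R := e / (m%:R + 1); have e'0 : 0 < e' by rewrite divr_gt0.
have [r r0 rP] : exists2 r : R, 0 < r & cube x r `<=` W `&`
   [set y | forall a, `|'D_(delta_mx 0 a) f y - 'D_(delta_mx 0 a) f x| <= e'].
  apply/nbhs_cubeP; apply: filterI; first exact: open_nbhs_nbhs.
  apply: (@filter_forall _ _ (fun a y => `|'D_(delta_mx 0 a) f y - 'D_(delta_mx 0 a) f x| <= e') (nbhs x)) => a.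
  exact: (continuous_dist_le (Cn_continuous (Cn_derive a Cf) Wx) e'0).
exists r => // y yr.
have := @box_mean_value _ _ (cube x r) f (fun a y => 'D_(delta_mx 0 a) f y)
  (fun a => 'D_(delta_mx 0 a) f x) e' x y (@boxy_cube _ _ _ _) (cube_center _ r0) yr.
move=> H; apply: le_trans (H _ _) _.
- by move=> z a /rP[Wz _]; exact: (Cn_is_derive a Cf Wz).
- by move=> z a /rP[_ /(_ a)].
- have := sum_coord_le (y - x); under eq_bigr do rewrite !mxE; move=> S.
  apply: (@le_trans _ _ (e' * (m%:R * `|y - x|))); first by rewrite ler_wpM2l// ltW.
  rewrite mulrA ler_wpM2r// /e' -mulrA ler_piMr ?(ltW e0)//.
  by rewrite mulrC ler_pdivrMr// mul1r lerDl.
Qed.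

Lemma row_mx0_jet {R : realType} {m : nat} (Psi : 'rV[R]_m -> 'rV[R]_(1 + m)) x (v : 'rV[R]_m) al :
  (row_mx 0 v *m jet Psi x) 0 al = \sum_a 'D_(delta_mx 0 a : 'rV[R]_m) (fun y => Psi y 0 al) x * v 0 a.
Proof.
have -> : (0 : 'rV[R]_1) = 0%:M by rewrite raddf0.
by rewrite row_mx_jet mul0r add0r.
Qed.

Lemma is_derive_local {R : realType} (f g : R -> R) (t d df : R) : 0 < d ->
  (forall s, `|s - t| < d -> f s = g s) -> is_derive t 1 f df -> is_derive t 1 g df.
Proof.
move=> d0 fg /is_derive_epsP H; apply/is_derive_epsP => e /H[r r0 Hr].
exists (Num.min r d); first by rewrite lt_min r0.
move=> h; rewrite lt_min => /andP[hr hd]; rewrite -!fg ?subrr ?normr0//; first exact: Hr.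
by rewrite addrAC subrr add0r.
Qed.

Lemma is_derive_unique {R : realType} (f : R -> R) (t d d' : R) :
  is_derive t 1 f d -> is_derive t 1 f d' -> d = d'.
Proof. by move=> [_ <-] [_ <-]. Qed.

(** * Pulling curves of the hyperboloid back to a chart *)

Section Pullback.
Context {R : realType} {m : nat}.
Variables (G : 'rV[R]_m -> 'M[R]_m) (V : set 'rV[R]_m) (kap : R).
Hypotheses (HG : hyperbolic_on G V kap) (kap0 : 0 < kap).
Variables (B : 'M[R]_(1 + m)) (W : set 'rV[R]_m) (Psi : 'rV[R]_m -> 'rV[R]_(1 + m)).
Hypotheses (BT : B^T = B) (HP : isdev G V kap B W Psi).

(** The tangent vector that the differential of [Psi] sends to [z]; the coordinate dropped by
    [rsubmx] is the component along [Psi x]. *)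
Definition pullback_vel (x : 'rV[R]_m) (z : 'rV[R]_(1 + m)) : 'rV[R]_m :=
  rsubmx (z *m invmx (jet Psi x)).

(** The curve [c] comes from inverting [Psi] pointwise, so its differentiability has to be proved.
    The inverse Lipschitz bound turns the remainder o(|c(t+h) - c(t)|) into o(h), and inverting the
    jet isolates the velocity. *)
Lemma pullback_velocity (c : R -> 'rV[R]_m) (t L d : R) (z : 'rV[R]_(1 + m)) a :
  W (c t) -> 0 < d -> 0 <= L ->
  (forall h, `|h| < d -> `|c (t + h) - c t| <= L * `|Psi (c (t + h)) - Psi (c t)|) ->
  (forall al, is_derive t 1 (fun s => Psi (c s) 0 al) (z 0 al)) ->
  is_derive t 1 (fun s => c s 0 a) (pullback_vel (c t) z 0 a).
Proof.
move=> Wc d0 L0 HL dz; set x := c t; have [oW _ sP _] := HP.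
have [uY _] := jet_units HG kap0 HP Wc.
pose Y := jet Psi x; pose N : R := \sum_al `|invmx Y al (rshift 1 a)|.
have N0 : 0 <= N by apply: sumr_ge0.
pose K : R := \sum_al `|z 0 al| + 1.
have K0 : 0 < K by rewrite ltr_wpDl// sumr_ge0.
have zK al : `|z 0 al| + 1 <= K by rewrite lerD2r (bigD1 al)//= lerDl sumr_ge0.
apply/is_derive_epsP => e e0.
have D0 : 0 < N * (1 + L * K) + 1 by rewrite ltr_wpDl// mulr_ge0// addr_ge0// mulr_ge0// ltW.
pose e1 : R := Num.min 1 (e / (N * (1 + L * K) + 1)).
have e10 : 0 < e1 by rewrite lt_min ltr01 divr_gt0.
have [r1 r10 H1] := is_derive_eps_fin dz e10.
have [r2 r20 H2] : exists2 r : R, 0 < r & forall y, cube x r y -> forall al,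
    `|Psi y 0 al - Psi x 0 al - \sum_a (y 0 a - x 0 a) * 'D_(delta_mx 0 a) (fun y => Psi y 0 al) x| <= e1 * `|y - x|.
  apply: (nbhs_cubeP _ _).1.
  apply: (@filter_forall _ _ (fun al y => `|Psi y 0 al - Psi x 0 al - \sum_a (y 0 a - x 0 a) * 'D_(delta_mx 0 a) (fun y => Psi y 0 al) x| <= e1 * `|y - x|) (nbhs x)) => al.
  by apply/nbhs_cubeP; exact: Cn_differentiable oW Wc (CnS (sP 0 al)) e10.
have LK0 : 0 < L * K + 1 by rewrite ltr_wpDl// mulr_ge0// ltW.
exists (Num.min (Num.min r1 d) (r2 / (L * K + 1))).
  by rewrite !lt_min r10 d0 divr_gt0.
move=> h; rewrite !lt_min => /andP[/andP[hr1 hd] hr2].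
pose y := c (t + h); pose q := Psi y - Psi x.
have qE al : q 0 al = Psi y 0 al - Psi x 0 al by rewrite mxDE [(- Psi x) 0 al]mxE.
have qz al : `|q 0 al - z 0 al * h| <= e1 * `|h| by rewrite qE; exact: H1.
have qK : `|q| <= K * `|h|.
  apply: norm_le_coord => [|al]; first by rewrite mulr_ge0// ltW.
  apply: (@le_trans _ _ ((`|z 0 al| + 1) * `|h|)); last by rewrite ler_wpM2r.
  rewrite -[q 0 al](subrK (z 0 al * h)); apply: le_trans (ler_normD _ _) _.
  rewrite normrM mulrDl addrC lerD2l mul1r; apply: le_trans (qz al) _.
  by rewrite ler_piMl// ge_min lexx.
have yx : `|y - x| <= L * K * `|h|.
  by apply: le_trans (HL _ hd) _; rewrite -mulrA ler_wpM2l.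
have yr2 : cube x r2 y.
  move=> b; have := coord_le_norm (y - x) b; rewrite mxDE [(- x) 0 b]mxE => H.
  apply: le_lt_trans H _; apply: le_lt_trans yx _.
  rewrite ltr_pdivlMr// in hr2; apply: le_lt_trans hr2.
  by rewrite mulrC ler_wpM2l// lerDl.
pose E := q - row_mx 0 (y - x) *m Y.
have EE al : `|E 0 al| <= e1 * (L * K * `|h|).
  apply: (@le_trans _ _ (e1 * `|y - x|)); last by rewrite ler_wpM2l// ltW.
  have := H2 _ yr2 al; congr (`|_| <= _).
  rewrite /E mxDE [(- (_ *m _)) 0 al]mxE qE; congr (_ - _).
  rewrite /Y row_mx0_jet.
  by apply: eq_bigr => b _; rewrite mulrC mxDE [(- x) 0 b]mxE.
have rE : row_mx 0 (y - x) = (q - E) *m invmx Y.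
  by rewrite /E opprB addrCA subrr addr0 mulmxK.
have -> : c (t + h) 0 a - x 0 a - pullback_vel x z 0 a * h =
    \sum_al (q 0 al - z 0 al * h - E 0 al) * invmx Y al (rshift 1 a).
  have -> : c (t + h) 0 a - x 0 a = ((q - E) *m invmx Y) 0 (rshift 1 a).
    by rewrite -rE row_mxEr mxDE [(- x) 0 a]mxE.
  rewrite /pullback_vel mxE -/Y !mxE mulr_suml -sumrB; apply: eq_bigr => al _.
  by rewrite mxDE [(- E) 0 al]mxE; ring.
apply: le_trans (ler_norm_sum _ _ _) _.
apply: (@le_trans _ _ (\sum_al (e1 * (1 + L * K) * `|h|) * `|invmx Y al (rshift 1 a)|)).
  apply: ler_sum => al _; rewrite normrM ler_wpM2r//.
  apply: le_trans (ler_normB _ _) _; rewrite mulrDr mulr1 mulrDl.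
  by apply: lerD (qz al) _; rewrite -mulrA.
rewrite -mulr_sumr -/N mulrAC ler_wpM2r//.
have : e1 <= e / (N * (1 + L * K) + 1) by rewrite ge_min lexx orbT.
rewrite ler_pdivlMr// => H; apply: le_trans H.
by rewrite -mulrA ler_wpM2l ?ltW// mulrC ltrDl.
Qed.

(** The second derivative of Psi o c is computed by [dev_acceleration] and from z'' = lam z;
    comparing the two through the invertible jet leaves zero covariant acceleration. *)
Lemma pullback_geodesic (c : R -> 'rV[R]_m) (z dz : R -> 'rV[R]_(1 + m)) (t L d lam : R) :
  0 < d -> 0 <= L ->
  (forall s, `|s - t| < d -> W (c s)) ->
  (forall s s', `|s - t| < d -> `|s' - t| < d -> `|c s' - c s| <= L * `|Psi (c s') - Psi (c s)|) ->
  (forall s, `|s - t| < d -> Psi (c s) = z s) ->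
  (forall s al, `|s - t| < d -> is_derive s 1 (fun s => z s 0 al) (dz s 0 al)) ->
  (forall al, is_derive t 1 (fun s => dz s 0 al) (lam * z t 0 al)) ->
  exists (v : R -> 'rV[R]_m) (w : 'rV[R]_m),
   [/\ forall s a, `|s - t| < d -> is_derive s 1 (fun s => c s 0 a) (v s 0 a),
       forall a, is_derive t 1 (fun s => v s 0 a) (w 0 a) &
       geo_acc G (c t) (v t) w = 0].
Proof.
move=> d0 L0 cW HL Pz dz1 dz2; have [oW WV sP _] := HP.
pose v s := pullback_vel (c s) (dz s).
have tt : `|t - t| < d by rewrite subrr normr0.
have Pc s al : `|s - t| < d -> is_derive s 1 (fun u => Psi (c u) 0 al) (dz s 0 al).
  move=> sd; have sd0 : 0 < d - `|s - t| by rewrite subr_gt0.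
  apply: (is_derive_local sd0) (dz1 s al sd) => u us; rewrite Pz//.
  have := ler_distD s u t; move: us; move: `|u - s| `|u - t| `|s - t| => *; lra.
have cv s a : `|s - t| < d -> is_derive s 1 (fun s => c s 0 a) (v s 0 a).
  move=> sd; have sd0 : 0 < d - `|s - t| by rewrite subr_gt0.
  apply: (pullback_velocity a (cW _ sd) sd0 L0) => [h hd|al]; last exact: Pc.
  apply: HL => //; have := ler_distD s (s + h) t; have -> : s + h - s = h by rewrite addrAC subrr add0r.
  by move: hd; move: `|h| `|s + h - t| `|s - t| => *; lra.
have uY x : W x -> jet Psi x \in unitmx by move=> Wx; have [] := jet_units HG kap0 HP Wx.
have CI : Cmx W 1 (fun x => invmx (jet Psi x)) := Cmx_invmx oW uY (Cmx_jet HP).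
have vd a : exists w : R, is_derive t 1 (fun s => v s 0 a) w.
  exists (\sum_al (dz t 0 al * (\sum_b 'D_(delta_mx 0 b) (fun x => invmx (jet Psi x) al (rshift 1 a)) (c t) * v t 0 b)
    + lam * z t 0 al * invmx (jet Psi (c t)) al (rshift 1 a))).
  have -> : (fun s => v s 0 a) = (fun s => \sum_al dz s 0 al * invmx (jet Psi (c s)) al (rshift 1 a)).
    by apply/funext => s; rewrite mxE mxE.
  apply: is_derive_sum_fun => al.
  exact: (is_derive_mul (dz2 al) (Cn_along oW (CI al (rshift 1 a)) (cW _ tt) (fun b => cv t b tt))).
have [w0 Hw] := choice vd; pose w : 'rV[R]_m := \row_a w0 a.
have wd a : is_derive t 1 (fun s => v s 0 a) (w 0 a) by rewrite mxE.
exists v, w; split => //.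
have vz s : `|s - t| < d -> row_mx 0 (v s) *m jet Psi (c s) = dz s.
  move=> sd; apply/rowP => al.
  exact: is_derive_unique (dev_velocity HP al (cW _ sd) (fun a => cv s a sd)) (Pc s al sd).
have E : row_mx (kap * ginner G (c t) (v t) (v t))%:M (geo_acc G (c t) (v t) w) *m jet Psi (c t)
    = row_mx lam%:M 0 *m jet Psi (c t).
  apply/rowP => al; rewrite [RHS]row_mx_jet [X in _ = _ + X]big1 ?addr0; last by move=> b _; rewrite [X in _ * X]mxE mulr0.
  have := dev_acceleration HG kap0 BT HP al (cW _ tt) (fun a => cv t a tt) wd.
  move=> A; apply: (is_derive_unique A); rewrite (Pz _ tt).
  by apply: (is_derive_local d0) (dz2 al) => s sd; rewrite vz.
have := congr1 (fun X => rsubmx (X *m invmx (jet Psi (c t)))) E.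
by rewrite /= !(mulmxK (uY _ (cW _ tt))) !row_mxKr.
Qed.

End Pullback.

(** * Local isometric immersions on the manifold *)
Lemma within_open_continuous {T U : topologicalType} (A V : set T) (f : T -> U) x :
  {within A, continuous f} -> open V -> V `<=` A -> V x -> {for x, continuous f}.
Proof.
move=> cf oV VA Vx; have := continuous_subspaceW VA cf.
by rewrite continuous_open_subspace// => /(_ x); apply; rewrite inE.
Qed.

Section SmoothFunctions.
Context {R : realType} {m : nat}.
Implicit Types (V W : set 'rV[R]_m) (f : 'rV[R]_m -> R).

Lemma Cn_local n V f :
  (forall x, V x -> exists U, [/\ open U, U x & Cn n U f]) -> Cn n V f.
Proof.
elim: n f => [|n IH] f H.
  by split => // x /H[U [_ Ux [cf _]]]; exact: cf.
split=> [x /H[U [_ Ux [cf _]]]|a]; first exact: cf.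
split=> [x /H[U [_ Ux [_ /(_ a)[df _]]]]|]; first exact: df.
by apply: IH => x /H[U [oU Ux [_ /(_ a)[_ df]]]]; exists U.
Qed.

Lemma smooth_on_Cn n V W f : smooth_on W f -> open V -> V `<=` W -> Cn n V f.
Proof.
move=> sf oV VW; apply: Cn_local => x Vx; have [U [F [oU Ux CF fF]]] := sf x (VW _ Vx).
have oUV : open (U `&` V) by exact: openI.
exists (U `&` V); split => //; apply: (Cn_ext oUV _ (Cn_sub _ (CF n))) => //.
by move=> y; rewrite inE => -[Uy /VW Wy]; rewrite fF.
Qed.

Lemma Cn_comp {q : nat} n V (W : set 'rV[R]_q) (T : 'rV[R]_m -> 'rV[R]_q) (f : 'rV[R]_q -> R) :
  open V -> open W -> (forall x, V x -> W (T x)) -> (forall b, Cn n V (fun x => T x 0 b)) ->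
  Cn n W f -> Cn n V (fun x => f (T x)).
Proof.
move=> oV oW VW; elim: n f => [|n IH] f CT Cf.
  split => // x Vx; have cfT := Cn_continuous Cf (VW _ Vx).
  apply: continuous_dist_intro => e e0.
  have [r r0 rP] : exists2 r : R, 0 < r & cube (T x) r `<=` [set y | `|f y - f (T x)| <= e].
    by apply/nbhs_cubeP; exact: (continuous_dist_le cfT e0).
  have : \forall y \near x, forall b, `|T y 0 b - T x 0 b| <= r / 2.
    apply: (@filter_forall _ _ (fun b y => `|T y 0 b - T x 0 b| <= r / 2) (nbhs x)) => b.
    have r2 : 0 < r / 2 by rewrite divr_gt0.
    exact: (continuous_dist_le (Cn_continuous (CT b) Vx) r2).
  apply: filterS => y H; apply: rP => b; apply: le_lt_trans (H b) _.
  by rewrite ltr_pdivrMr// ltr_pMr// ltr1n.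
have CT' b : Cn n V (fun x => T x 0 b) by exact: CnS.
have D x a : V x -> is_derive x (delta_mx 0 a) (fun x => f (T x))
    (\sum_b 'D_(delta_mx 0 b) f (T x) * 'D_(delta_mx 0 a) (fun x => T x 0 b) x).
  move=> Vx; apply: (is_derive_line0 _ _ _ _).2 => /=.
  have H0 : W (T (x + 0 *: delta_mx 0 a)) by rewrite scale0r addr0; exact: VW.
  have HV : V (x + 0 *: delta_mx 0 a) by rewrite scale0r addr0.
  have := Cn_along oW (CnW (ltn0Sn n) Cf) H0 (fun b => Cn_line (CT b) HV).
  by rewrite scale0r addr0.
apply: (Cn_intro oV) D _ => [x Vx|a h hE].
  by apply: Cn_continuous Vx; apply: IH => //; exact: CnS.
apply: (@Cn_ext _ _ _ _ (fun x => \sum_b 'D_(delta_mx 0 b) f (T x) * 'D_(delta_mx 0 a) (fun x => T x 0 b) x)) => //.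
  by move=> x; rewrite inE => /hE ->.
apply: Cn_sum => // b.
exact: (Cn_mul oV (IH _ CT' (Cn_derive b Cf)) (Cn_derive a (CT b))).
Qed.

End SmoothFunctions.

(** * Interior of charts and transition maps *)

Section Charts.
Context {R : realType} {m : nat} {M : topologicalType} {X : manifold R m M}.
Variable g : riemannian_metric X.
Implicit Types (i j : chart X) (p : M) (x : 'rV[R]_m).
Local Notation e_ a := (delta_mx 0 a : 'rV[R]_m).

(** The chart image without the boundary hyperplane: an open subset of R^m, where the one-sided
    derivatives of [partial] are ordinary ones. *)
Definition inner i : set 'rV[R]_m := (cmap i @` dom i) `\` @halfspace_bd R m.

Lemma innerK i x : inner i x -> dom i (par i x) /\ cmap i (par i x) = x.
Proof. by move=> [[p dp <-] _]; rewrite cmapK. Qed.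

Lemma open_halfspace_int : open [set x : 'rV[R]_m | forall a : 'I_m, a = 0%N :> nat -> 0 < x 0 a].
Proof.
rewrite openE => x xP.
have : nbhs x [set y : 'rV[R]_m | forall a : 'I_m, a = 0%N :> nat -> 0 < y 0 a].
  apply: (@filter_forall _ _ (fun (a : 'I_m) (y : 'rV[R]_m) => a = 0%N :> nat -> 0 < y 0 a) (nbhs x)) => a.
  have [a0|a0] := eqVneq (a : nat) 0%N; last by apply: filterE => y /eqP; rewrite (negbTE a0).
  have x0 := xP a a0.
  have : nbhs x [set y : 'rV[R]_m | `|y 0 a - x 0 a| <= x 0 a / 2].
    apply/nbhs_cubeP; exists (x 0 a / 2); first by rewrite divr_gt0.
    by move=> y /(_ a)/ltW.
  apply: filterS => y /ler_normlP[+ _] _; move: x0; move: (x 0 a) (y 0 a) => u v *; lra.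
by [].
Qed.

Lemma open_inner i : open (inner i).
Proof.
have [V oV E] := cmap_image i.
have -> : inner i = V `&` [set x | forall a : 'I_m, a = 0%N :> nat -> 0 < x 0 a].
  rewrite /inner E; apply/seteqP; split=> [x [[Vx hx] bx]|x [Vx hx]].
    split=> // a a0; rewrite lt_neqAle hx// andbT; apply/eqP => xa; apply: bx.
    by exists a.
  split; first by split=> // a a0; rewrite ltW// hx.
  by move=> [a [a0 xa]]; have := hx a a0; rewrite xa ltxx.
by apply: openI => //; exact: open_halfspace_int.
Qed.

Lemma inner_image i : inner i `<=` cmap i @` dom i.
Proof. by move=> x []. Qed.

Lemma par_continuous_inner i x : inner i x -> {for x, continuous (par i)}.
Proof.
move=> ix; exact: (within_open_continuous (@par_continuous _ _ _ X i) (@open_inner i) (@inner_image i) ix).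
Qed.

Definition chartset i (U : set M) : set 'rV[R]_m := inner i `&` (par i @^-1` U).

Lemma open_chartset i (U : set M) : open U -> open (chartset i U).
Proof.
move=> oU; rewrite openE => x [ix Ux]; apply: filterI.
  by apply: open_nbhs_nbhs; split => //; exact: open_inner.
by apply: (par_continuous_inner ix); exact: open_nbhs_nbhs.
Qed.

Lemma gmx_hyperbolic (k : R) i : constant_sectional_curvature g (- k ^+ 2) ->
  hyperbolic_on (gmx g i) (inner i) (k ^+ 2).
Proof.
move=> Mcurv; split.
- exact: open_inner.
- move=> n a b; have H := @smooth_on_Cn _ _ n (inner i) _ _ (@gmx_smooth _ _ _ _ g i a b) (@open_inner i) (@inner_image i).
  exact: H.
- by move=> x /innerK[dx <-]; exact: gmx_sym.
- by move=> x v /innerK[dx <-]; exact: gmx_pos.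
- by move=> x u v /innerK[dx <-]; exact: Mcurv.
Qed.

Definition trans i j x := cmap j (par i x).

Lemma trans_smooth n i j b : Cn n (chartset i (dom j)) (fun x => trans i j x 0 b).
Proof.
apply: smooth_on_Cn (@transition_smooth _ _ _ X i j b) _ _; first exact: open_chartset (@dom_open _ _ _ X j).
by move=> x [/innerK[dx ex] dj]; exists (par i x).
Qed.

Definition jac i j x : 'M[R]_m := \matrix_(a, b) 'D_(e_ a) (fun y => trans i j y 0 b) x.

Lemma jac_transition i j x : chartset i (dom j) x ->
  gmx g i x = jac i j x *m gmx g j (trans i j x) *m (jac i j x)^T.
Proof.
move=> xD; have [/innerK[dx ex] dj] := xD.
have := @gmx_transition _ _ _ _ g i j _ dx dj; rewrite ex /= => ->.
have -> : \matrix_(a, b) partial a (fun y => cmap j (par i y) 0 b) x = jac i j x.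
  apply/matrixP => a b; rewrite !mxE; apply: (@is_derive_partial _ _ _ (fun y => trans i j y 0 b)) => //.
    exact: filterE.
  exact: Cn_is_derive (trans_smooth 1 i j b) xD.
by [].
Qed.

Lemma gmx_unit i p : dom i p -> gmx g i (cmap i p) \in unitmx.
Proof. by move=> dp; apply: posdef_unit => v; exact: gmx_pos. Qed.

Lemma jac_unit i j x : chartset i (dom j) x -> jac i j x \in unitmx.
Proof.
move=> xD; have [/innerK[dx ex] dj] := xD; have := gmx_unit dx.
by rewrite ex (jac_transition xD) !unitmx_mul => /andP[/andP[]].
Qed.

Lemma min_derive0 (f : 'rV[R]_m -> R) x a (d : R) : is_derive x (e_ a) f d ->
  (\forall y \near x, f x <= f y) -> d = 0.
Proof.
move=> /(is_derive_line0 _ _ _ _).1 /is_derive_epsP H /nbhs_cubeP[r r0 rP].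
apply/eqP; rewrite -normr_eq0 eq_le normr_ge0 andbT; apply/ler_addgt0Pl => e e0; rewrite addr0.
have [s s0 sP] := H e e0; pose h : R := Num.min r s / 2.
have m0 : 0 < Num.min r s by rewrite lt_min r0.
have h0 : 0 < h by rewrite divr_gt0.
have [hr hs] : h < r /\ h < s.
  have : h < Num.min r s by rewrite ltr_pdivrMr// ltr_pMr// ltr1n.
  by rewrite lt_min => /andP[].
have F (t : R) : `|t| < r -> f x <= f (x + t *: e_ a).
  move=> tr; apply: rP => b; rewrite coord_line; case: ifP => _.
    by rewrite addrAC subrr add0r.
  by rewrite addr0 subrr normr0.
have hE : `|h| = h by rewrite ger0_norm// ltW.
have := sP h; have := sP (- h); rewrite normrN hE => /(_ hs) + /(_ hs).
rewrite !add0r scale0r addr0 => /ler_normlP[H1 H2] /ler_normlP[H3 H4].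
have := F h; have := F (- h); rewrite normrN hE => /(_ hr) + /(_ hr).
move: H1 H2 H3 H4; move: (f _) (f (_ + h *: _)) (f x) => u v w H1 H2 H3 H4 H5 H6.
rewrite ler_norml; apply/andP; split; rewrite -(ler_pM2r h0); lra.
Qed.

(** The interior does not depend on the chart. If a transition map reached the boundary hyperplane
    at an inner point, its first coordinate would have a minimum there and its Jacobian a zero
    column, but the transformation law of the metric makes the Jacobian invertible. *)
Lemma trans_inner i j x : chartset i (dom j) x -> inner j (trans i j x).
Proof.
move=> xD; have [_ dj] := xD; split; first by exists (par i x).
move=> [a [a0 Ta]]; have uJ := jac_unit xD.
have col0 : col a (jac i j x) = 0.
  apply/colP => b; rewrite !mxE.
  apply: (@min_derive0 (fun y => trans i j y 0 a) x b).
    exact: Cn_is_derive (trans_smooth 1 i j a) xD.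
  have : nbhs x (chartset i (dom j)).
    by apply: open_nbhs_nbhs; split => //; exact: open_chartset (@dom_open _ _ _ X j).
  apply: filterS => y [_ djy]; rewrite Ta.
  have [V oV E] := cmap_image j.
  have : (cmap j @` dom j) (trans i j y) by exists (par i y).
  by rewrite E => -[_ /(_ a a0)].
have : jac i j x *m (delta_mx a 0 : 'cV[R]_m) = 0 by rewrite -colE.
move=> /(congr1 (mulmx (invmx (jac i j x)))); rewrite mulKmx// mulmx0.
by move=> /matrixP/(_ a 0)/eqP; rewrite !mxE !eqxx oner_eq0.
Qed.

Lemma interior_inner i p : ~ boundary X p -> dom i p -> inner i (cmap i p).
Proof. by move=> np dp; split; [exists p|move=> H; apply: np; exists i]. Qed.

Lemma inner_interior i x : inner i x -> ~ boundary X (par i x).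
Proof.
move=> ix [j [dj bj]]; have : chartset i (dom j) x by [].
by move=> /trans_inner[].
Qed.

End Charts.

Opaque jet dmx.

Section Jets.
Context {R : realType} {m : nat}.
Local Notation e_ a := (delta_mx 0 a : 'rV[R]_m).

Lemma jet_ext (V : set 'rV[R]_m) (Psi Psi' : 'rV[R]_m -> 'rV[R]_(1 + m)) x : open V ->
  (forall y, V y -> Psi y = Psi' y) -> V x -> jet Psi x = jet Psi' x.
Proof.
move=> oV E Vx; apply/matrixP => a al; case: (split_ordP a) => a' ->.
  by rewrite (ord1 a') !jet0 E.
rewrite !jet1; apply: near_eq_derive; have : nbhs x V by exact: open_nbhs_nbhs.
by apply: filterS => y Vy; rewrite E.
Qed.

Lemma jet_comp (V W : set 'rV[R]_m) (T : 'rV[R]_m -> 'rV[R]_m) (Psi : 'rV[R]_m -> 'rV[R]_(1 + m)) x :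
  open W -> V x -> W (T x) -> (forall b, Cn 1 V (fun y => T y 0 b)) -> Cmx W 1 Psi ->
  jet (Psi \o T) x = block_mx 1%:M 0 0 (\matrix_(a, b) 'D_(e_ a) (fun y => T y 0 b) x) *m jet Psi (T x).
Proof.
move=> oW Vx WT CT CP; apply/matrixP => a al; case: (split_ordP a) => a' ->.
  rewrite (ord1 a') jet0 mxE big_split_ord /= big_ord1 block_mxEul jet0 mxE mul1r.
  by rewrite big1 ?addr0// => b _; rewrite block_mxEur [X in X * _]mxE mul0r.
rewrite jet1 mxE big_split_ord /= big_ord1 block_mxEdl [X in X * _]mxE mul0r add0r.
have HW : W (T (x + 0 *: e_ a')) by rewrite scale0r addr0.
have HV : V (x + 0 *: e_ a') by rewrite scale0r addr0.
have H := Cn_along oW (CP 0 al) HW (fun b => Cn_line (CT b) HV); rewrite scale0r addr0 in H.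
have [_ ->] := (is_derive_line0 (fun y => Psi (T y) 0 al) x (e_ a') _).2 H.
apply: eq_bigr => b _.
by rewrite block_mxEdr jet1 [in RHS]mxE mulrC.
Qed.

Lemma isdev_ext G V (kap : R) B W (Psi Psi' : 'rV[R]_m -> 'rV[R]_(1 + m)) :
  (forall x, W x -> Psi x = Psi' x) -> isdev G V kap B W Psi -> isdev G V kap B W Psi'.
Proof.
move=> E [oW WV CP H]; split; [exact: oW|exact: WV| |].
  by move=> a b; apply: (Cn_ext oW _ (CP a b)) => y; rewrite inE => Wy; rewrite E.
by move=> x Wx; rewrite -(jet_ext oW E Wx); exact: H.
Qed.

Lemma isdev_sub G V (kap : R) B (W W' : set 'rV[R]_m) Psi : open W' -> W' `<=` W ->
  isdev G V kap B W Psi -> isdev G V kap B W' Psi.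
Proof.
move=> oW' WW' [oW WV CP H]; split; first exact: oW'.
- exact: subset_trans WV.
- by move=> a b; exact: Cn_sub (CP a b).
- by move=> x /WW'; exact: H.
Qed.

Lemma isdev_local G V (kap : R) B (W : set 'rV[R]_m) Psi : open W ->
  (forall x, W x -> exists2 W', W' x & isdev G V kap B W' Psi) -> isdev G V kap B W Psi.
Proof.
move=> oW H; split => //.
- by move=> x /H[W' W'x [_ WV _ _]]; exact: WV.
- by move=> a b; apply: Cn_local => x /H[W' W'x [oW' _ CP _]]; exists W'; split => //; exact: CP.
- by move=> x /H[W' W'x [_ _ _]]; apply.
Qed.

Lemma jet_mulmx (W : set 'rV[R]_m) (Psi : 'rV[R]_m -> 'rV[R]_(1 + m)) (A : 'M[R]_(1 + m)) x :
  W x -> Cmx W 1 Psi -> jet (fun y => Psi y *m A) x = jet Psi x *m A.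
Proof.
move=> Wx CP; apply/matrixP => a al; case: (split_ordP a) => a' ->.
  by rewrite (ord1 a') jet0 !mxE; apply: eq_bigr => b _; rewrite jet0.
rewrite jet1 [RHS]mxE.
have : is_derive x (e_ a') (fun y => (Psi y *m A) 0 al) (\sum_be 'D_(e_ a') (fun y => Psi y 0 be) x * A be al).
  apply: (is_derive_line0 _ _ _ _).2.
  have -> : (fun s => (Psi (x + s *: e_ a') *m A) 0 al) =
     (fun s => \sum_be Psi (x + s *: e_ a') 0 be * A be al) by apply/funext => s; rewrite mxE.
  apply: is_derive_sum_fun => be.
  have HV : W (x + 0 *: e_ a') by rewrite scale0r addr0.
  have := is_derive_mul (Cn_line (CP 0 be) HV) (is_derive_cst (A be al) (0 : R) (1 : R)).
  by rewrite mulr0 add0r scale0r addr0.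
by move=> [_ ->]; apply: eq_bigr => be _; rewrite jet1.
Qed.

Lemma isdev_mulmx G V (kap : R) B B' (W : set 'rV[R]_m) Psi (A : 'M[R]_(1 + m)) :
  A *m B' *m A^T = B -> isdev G V kap B W Psi -> isdev G V kap B' W (fun y => Psi y *m A).
Proof.
move=> AB [oW WV CP H]; split; [exact: oW|exact: WV| |].
  move=> a b; apply: (@Cn_ext _ _ _ _ (fun y => \sum_c Psi y a c * A c b)) => //.
    by move=> y _; rewrite mxE.
  by apply: Cn_sum => // c; apply: Cn_mul => //; exact: Cn_cst.
move=> x Wx; rewrite (jet_mulmx A Wx (fun a b => CnS (CP a b))) trmx_mul.
by rewrite -H// -AB !mulmxA.
Qed.

End Jets.

Section ManifoldDev.
Context {R : realType} {m : nat} {M : topologicalType} {X : manifold R m M}.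
Variables (g : riemannian_metric X) (k : R).
Hypotheses (hk : 0 < k) (Mcurv : constant_sectional_curvature g (- k ^+ 2)).
Implicit Types (i j : chart X) (p : M) (x : 'rV[R]_m).

(** A local isometric immersion of [U] in the hyperboloid, read in every chart; by [mdev_chart] a
    single chart is enough to verify it. *)
Definition mdev (B : 'M[R]_(1 + m)) (U : set M) (Psi : M -> 'rV[R]_(1 + m)) :=
  [/\ open U, U `<=` ~` boundary X &
      forall i, isdev (gmx g i) (inner i) (k ^+ 2) B (chartset i U) (Psi \o par i)].

Lemma Dm_transition i j x : chartset i (dom j) x ->
  Dm (gmx g i) (k ^+ 2) x = block_mx 1%:M 0 0 (jac i j x) *m Dm (gmx g j) (k ^+ 2) (trans i j x)
    *m (block_mx 1%:M 0 0 (jac i j x))^T.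
Proof.
move=> xD; rewrite /Dm (jac_transition g xD) tr_block_mx !mulmx_block.
rewrite !(mul0mx, mulmx0, mul1mx, mulmx1, trmx0, trmx1, addr0, add0r).
by rewrite -scalemxAr -scalemxAl.
Qed.

Lemma open_chart_preimage i (W : set 'rV[R]_m) : open W -> open (dom i `&` cmap i @^-1` W).
Proof.
move=> oW; rewrite openE => p [dp Wp]; apply: filterI.
  by apply: open_nbhs_nbhs; split => //; exact: dom_open.
by apply: (@cmap_continuous _ _ _ X i _ dp); exact: open_nbhs_nbhs.
Qed.

Lemma mdev_chart B i (W : set 'rV[R]_m) Psi :
  isdev (gmx g i) (inner i) (k ^+ 2) B W (Psi \o par i) -> mdev B (dom i `&` cmap i @^-1` W) Psi.
Proof.
move=> HP; have [oW Wi CP HD] := HP; have oU := open_chart_preimage i oW; split => //.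
  by move=> p [dp Wp]; have := inner_interior g (Wi _ Wp); rewrite cmapK.
move=> j; pose V := chartset j (dom i `&` cmap i @^-1` W).
have oV : open V by exact: open_chartset.
have VD : V `<=` chartset j (dom i) by move=> y [ij [dy _]].
have VW y : V y -> W (trans j i y) by move=> [_ []].
have E y : V y -> (Psi \o par i) (trans j i y) = (Psi \o par j) y.
  by move=> [_ [dy _]]; rewrite /= cmapK.
have CT n b : Cn n V (fun y => trans j i y 0 b) by exact: Cn_sub VD (trans_smooth n j i b).
apply: (isdev_ext E); split => //.
- by move=> y [].
- by move=> a b; exact: Cn_comp oV oW VW (CT 2) (CP a b).
- move=> y Vy; have CP1 : Cmx W 1 (Psi \o par i) by move=> a b; exact: CnS.
  have -> := jet_comp oW Vy (VW _ Vy) (CT 1) CP1.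
  rewrite (Dm_transition (VD _ Vy)) trmx_mul -HD; last exact: VW.
  by rewrite !mulmxA.
Qed.

Lemma chartsetS i (U U' : set M) : U `<=` U' -> chartset i U `<=` chartset i U'.
Proof. by move=> UU' x [ix /UU']. Qed.

Lemma mdev_sub B (U U' : set M) Psi : open U' -> U' `<=` U -> mdev B U Psi -> mdev B U' Psi.
Proof.
move=> oU' UU [oU Ub H]; split => //; first exact: subset_trans Ub.
by move=> i; apply: isdev_sub (H i); [exact: open_chartset|exact: chartsetS].
Qed.

Lemma mdev_ext B (U : set M) Psi Psi' : (forall p, U p -> Psi p = Psi' p) ->
  mdev B U Psi -> mdev B U Psi'.
Proof.
move=> E [oU Ub H]; split; [exact: oU|exact: Ub|] => i; apply: isdev_ext (H i) => x [_ /E]; exact.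
Qed.

Lemma mdev_local B (U : set M) Psi : open U ->
  (forall p, U p -> exists2 U', U' p & mdev B U' Psi) -> mdev B U Psi.
Proof.
move=> oU H; split => //; first by move=> p /H[U' U'p [_ Ub _]]; exact: Ub.
move=> i; apply: isdev_local => [|x [ix Ux]]; first exact: open_chartset.
by have [U' U'p [_ _ H']] := H _ Ux; exists (chartset i U').
Qed.

Lemma mdev_mulmx B B' (U : set M) Psi (A : 'M[R]_(1 + m)) : A *m B' *m A^T = B ->
  mdev B U Psi -> mdev B' U (fun p => Psi p *m A).
Proof. by move=> AB [oU Ub H]; split; [exact: oU|exact: Ub|] => i; exact: isdev_mulmx (H i). Qed.

Lemma mdev_form B U Psi p : mdev B U Psi -> U p -> bil B (Psi p) (Psi p) = 1.
Proof.
move=> [oU Ub H] Up; pose i := chart_at X p; have dp : dom i p by exact: dom_chart_at.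
have [_ _ _ HD] := H i.
have Wx : chartset i U (cmap i p).
  by split; [exact: interior_inner (Ub _ Up) dp|rewrite /= cmapK].
have <- : Dm (gmx g i) (k ^+ 2) (cmap i p) (lshift m 0) (lshift m 0) = 1.
  by rewrite /Dm block_mxEul mxE eqxx.
rewrite -(HD _ Wx) /bil.
have -> : Psi p = row (lshift m 0) (jet (Psi \o par i) (cmap i p)).
  by apply/rowP => a; rewrite rowE' jet0 /= cmapK.
by rewrite tr_row colE !mulmxA -colE -!row_mul !mxE.
Qed.

Lemma mdev_unique B U Psi Psi' p i : B^T = B -> dom i p -> mdev B U Psi -> mdev B U Psi' -> U p ->
  jet (Psi \o par i) (cmap i p) = jet (Psi' \o par i) (cmap i p) ->
  \forall q \near p, Psi q = Psi' q.
Proof.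
move=> BT dp [oU Ub H] [_ _ H'] Up E.
have Wx : chartset i U (cmap i p).
  by split; [exact: interior_inner (Ub _ Up) dp|rewrite /= cmapK].
have := dev_unique (gmx_hyperbolic i Mcurv) (exprn_gt0 2 hk) BT (H i) (H' i) Wx E.
move=> N.
have : nbhs p (dom i `&` cmap i @^-1` [set x | (Psi \o par i) x = (Psi' \o par i) x]).
  apply: filterI; first by apply: open_nbhs_nbhs; split => //; exact: dom_open.
  exact: (@cmap_continuous _ _ _ X i _ dp).
by apply: filterS => q [dq] /=; rewrite cmapK.
Qed.

End ManifoldDev.

(** * Hyperbolic functions and geodesics *)
Section HyperbolicFunctions.
Context {R : realType}.
Implicit Types (x y : R).

Definition ch x : R := (expR x + expR (- x)) / 2.
Definition sh x : R := (expR x - expR (- x)) / 2.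

Lemma ch0 : ch 0 = 1. Proof. by rewrite /ch oppr0 expR0 -mulr2n -mulr_natl mulfV. Qed.
Lemma sh0 : sh 0 = 0. Proof. by rewrite /sh oppr0 subrr mul0r. Qed.
Lemma chN x : ch (- x) = ch x. Proof. by rewrite /ch opprK addrC. Qed.
Lemma shN x : sh (- x) = - sh x. Proof. by rewrite /sh opprK -mulNr opprB. Qed.

Lemma chD x y : ch (x + y) = ch x * ch y + sh x * sh y.
Proof. by rewrite /ch /sh opprD !expRD; lra. Qed.

Lemma shD x y : sh (x + y) = sh x * ch y + ch x * sh y.
Proof. by rewrite /ch /sh opprD !expRD; lra. Qed.

Lemma ch2_sh2 x : ch x ^+ 2 - sh x ^+ 2 = 1.
Proof. by have := chD x (- x); rewrite subrr ch0 chN shN => ->; ring. Qed.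

Lemma ch_gt0 x : 0 < ch x. Proof. by rewrite divr_gt0// addr_gt0// expR_gt0. Qed.

Lemma ch_ge1 x : 1 <= ch x.
Proof. by have := ch2_sh2 x; have := ch_gt0 x; have := sqr_ge0 (sh x); rewrite !expr2; nra. Qed.

Lemma sh_gt0 x : 0 < x -> 0 < sh x.
Proof. by move=> x0; rewrite divr_gt0// subr_gt0 ltr_expR; lra. Qed.

Lemma sh_ge0 x : 0 <= x -> 0 <= sh x.
Proof. by rewrite le_eqVlt => /predU1P[<-|/sh_gt0/ltW//]; rewrite sh0. Qed.

Lemma ch_lt x y : 0 <= x -> x < y -> ch x < ch y.
Proof.
move=> x0 xy; pose u := (x + y) / 2; pose v := (y - x) / 2.
have -> : y = u + v by rewrite /u /v; lra.
have -> : x = u - v by rewrite /u /v; lra.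
rewrite chD chD chN shN -subr_gt0 opprD addrACA subrr add0r mulrN opprK -mulr2n pmulrn_lgt0//.
by rewrite mulr_gt0// sh_gt0// /u /v; lra.
Qed.

Lemma ch_le x y : 0 <= x -> x <= y -> ch x <= ch y.
Proof. by move=> x0; rewrite le_eqVlt => /predU1P[->//|/(ch_lt x0)/ltW]. Qed.

Lemma ch_le_inv x y : 0 <= y -> ch x <= ch y -> x <= y.
Proof. by move=> y0; apply: contraTT; rewrite -!ltNge; exact: ch_lt. Qed.

Lemma ch_inj x y : 0 <= x -> 0 <= y -> ch x = ch y -> x = y.
Proof.
by move=> x0 y0 E; apply/le_anti/andP; split; apply: ch_le_inv => //; rewrite E.
Qed.

Definition arch (z : R) : R := ln (z + Num.sqrt (z ^+ 2 - 1)).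

Lemma arch_ge0 z : 1 <= z -> 0 <= arch z.
Proof. by move=> z1; apply: ln_ge0; rewrite -[leLHS]addr0 lerD// sqrtr_ge0. Qed.

Lemma ch_arch z : 1 <= z -> ch (arch z) = z.
Proof.
move=> z1; have s0 := sqrtr_ge0 (z ^+ 2 - 1); set s := Num.sqrt _ in s0 *.
have z2 : s ^+ 2 = z ^+ 2 - 1 by rewrite sqr_sqrtr// subr_ge0 expr_ge1//; lra.
have zs : 0 < z + s by lra.
have E : (z + s)^-1 = z - s.
  apply: (mulfI (lt0r_neq0 zs)); rewrite (mulfV (lt0r_neq0 zs)).
  have -> : (z + s) * (z - s) = z ^+ 2 - s ^+ 2 by ring.
  by rewrite z2; ring.
by rewrite /ch /arch -/s expRN lnK ?posrE// E; lra.
Qed.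

Lemma is_derive_affine (f : R -> R) (a b t d : R) : is_derive (a + b * t) 1 f d ->
  is_derive t 1 (fun s => f (a + b * s)) (b * d).
Proof.
move=> Hf; have Ha : is_derive t 1 (fun s : R => a + b * s) b.
  have := is_deriveD (is_derive_cst a t 1) (is_derive_scale b (is_derive_id t 1)).
  by rewrite add0r mulr1.
have := @is_derive1_comp _ f (fun s : R => a + b * s) t d b Hf Ha.
by rewrite mulrC.
Qed.

Lemma is_derive_expM (c t : R) : is_derive t 1 (fun s : R => expR (c * s)) (c * expR (c * t)).
Proof.
have := @is_derive_affine expR 0 c t _ (is_derive_expR _).
by under eq_fun do rewrite add0r; rewrite add0r.
Qed.

Lemma is_derive_ch x : is_derive x 1 ch (sh x).
Proof.
rewrite /ch /sh; have H := is_derive_expR x.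
have HN : is_derive x 1 (fun y : R => expR (- y)) (- expR (- x)).
  by have := is_derive_expM (- 1) x; under eq_fun do rewrite mulN1r; rewrite !mulN1r.
have := is_derive_scale 2^-1 (is_deriveD H HN); rewrite mulrC.
by have -> : (fun s : R => 2^-1 * (expR + (fun y : R => expR (- y))) s) = (fun x : R => (expR x + expR (- x)) / 2) by apply/funext => s; rewrite mulrC.
Qed.

Lemma is_derive_sh x : is_derive x 1 sh (ch x).
Proof.
rewrite /ch /sh; have H := is_derive_expR x.
have HN : is_derive x 1 (fun y : R => expR (- y)) (- expR (- x)).
  by have := is_derive_expM (- 1) x; under eq_fun do rewrite mulN1r; rewrite !mulN1r.
have := is_derive_scale 2^-1 (is_deriveB H HN); rewrite opprK mulrC.
by have -> : (fun s : R => 2^-1 * (expR - (fun y : R => expR (- y))) s) = (fun x : R => (expR x - expR (- x)) / 2) by apply/funext => s; rewrite mulrC.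
Qed.

(* [hg kap P w] is the geodesic of the hyperboloid with initial point P and
   initial velocity w, where B(w, w) = - kap ^ 2; for kap = 0 the second term
   vanishes since x / 0 = 0. *)
Definition hg n kap (P w : 'rV[R]_n) s : 'rV[R]_n := ch (kap * s) *: P + (sh (kap * s) / kap) *: w.

Lemma hg0 n kap (P w : 'rV[R]_n) : hg kap P w 0 = P.
Proof. by rewrite /hg mulr0 ch0 sh0 mul0r scale0r scale1r addr0. Qed.

(** For c = kap and for c = -kap the quantity (f' + c f) exp(-c s) is constant; the two constants
    determine f. *)
Lemma ode_hyperbolic (kap a b s0 : R) (f df : R -> R) : 0 < kap ->
  (forall s, a < s < b -> is_derive s 1 f (df s)) ->
  (forall s, a < s < b -> is_derive s 1 df (kap ^+ 2 * f s)) -> a < s0 < b ->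
  forall s, a < s < b -> f s = ch (kap * (s - s0)) * f s0 + sh (kap * (s - s0)) / kap * df s0.
Proof.
move=> k0 Hf Hdf s0ab.
have C (c : R) : c ^+ 2 = kap ^+ 2 -> forall s, a < s < b ->
    (df s + c * f s) * expR (- c * s) = (df s0 + c * f s0) * expR (- c * s0).
  move=> c2 s sab; apply: (@is_derive1_0_cst _ (fun s => (df s + c * f s) * expR (- c * s)) a b) => // t tab.
  have := is_derive_mul (is_deriveD (Hdf t tab) (is_derive_scale c (Hf t tab))) (is_derive_expM (- c) t).
  move=> H; apply: (is_derive_eq H); rewrite -c2.
  have -> : (df + (fun u => c * f u)) t = df t + c * f t by [].
  by ring.
move=> s sab; have := C kap erefl s sab; have := C (- kap) (sqrrN _) s sab.
rewrite opprK !mulNr => /(congr1 (fun x => x * expR (- (kap * s)))) + /(congr1 (fun x => x * expR (kap * s))).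
rewrite -!mulrA -!expRD addrN addNr expR0 !mulr1 => H1 H2.
have kn : kap != 0 by rewrite gt_eqF.
apply: (mulfI (mulf_neq0 kn (_ : 2 != 0))); first by rewrite pnatr_eq0.
have -> : kap * (s - s0) = - (kap * s0) + kap * s by ring.
rewrite /ch /sh opprD opprK.
have -> : kap * 2 * f s = (df s + kap * f s) - (df s - kap * f s) by ring.
rewrite H1 H2; move: (expR _) (expR _) => u v; by field.
Qed.

End HyperbolicFunctions.

Section UnitInterval.
Context {R : realType}.

(** Composition with this retraction turns continuity within [0, 1] into continuity on the line
    ([within01P]). *)
Definition clamp01 (t : R) : R := Num.max 0 (Num.min 1 t).

Lemma clamp01_id t : 0 <= t <= 1 -> clamp01 t = t.
Proof. by move=> /andP[t0 t1]; rewrite /clamp01 (min_idPr t1) (max_idPr t0). Qed.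

Lemma clamp01_in t : 0 <= clamp01 t <= 1.
Proof. by rewrite le_max lexx /= ge_max ler01 ge_min lexx. Qed.

Lemma continuous_clamp01 : continuous clamp01.
Proof.
move=> t; apply: continuous_dist_intro => e e0.
apply/nbhs_normP; exists e => //= s; rewrite /ball_ /= distrC => se.
apply: le_trans (ltW se).
have := ler_norm (s - t); have := ler_norm (- (s - t)); rewrite normrN => h1 h2.
rewrite ler_norml /clamp01; have m01 : Num.max 0 1 = 1 :> R by rewrite (max_idPr ler01).
move: h1 h2; move: `|s - t| => a h1 h2.
by case: (leP 1 s) => ?; case: (leP 1 t) => ?; rewrite ?m01;
  try (case: (leP 0 s) => ?); try (case: (leP 0 t) => ?); apply/andP; split; lra.
Qed.

Lemma within01P {T : topologicalType} (f : R -> T) :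
  {within `[0, 1], continuous f} <-> continuous (f \o clamp01).
Proof.
split=> [/subspace_continuousP cf t|cf].
  have c01 : [set` `[0, 1]] (clamp01 t) by rewrite /= in_itv /=; exact: clamp01_in.
  apply: cvg_trans (cf _ c01) => A /= H.
  have cc : {for t, continuous clamp01} by exact: continuous_clamp01.
  have H' : nbhs (clamp01 t) [set x | [set` `[0, 1]] x -> A (f x)] by exact: H.
  have H2 : nbhs t [set s | [set` `[0, 1]] (clamp01 s) -> A (f (clamp01 s))] by exact: (cc _ H').
  apply: (filterS _ H2) => s Hs; apply: Hs.
  by rewrite /= in_itv /=; exact: clamp01_in.
apply: (@subspace_eq_continuous _ _ _ (f \o clamp01)).
  by move=> t; rewrite inE /= in_itv /= => /clamp01_id ->.
exact: continuous_subspaceT.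
Qed.

Lemma within01_near {T : topologicalType} (f : R -> T) (U : set T) (t : R) :
  {within `[0, 1], continuous f} -> 0 < t < 1 -> open U -> U (f t) ->
  exists2 d : R, 0 < d & forall s, `|s - t| < d -> 0 < s < 1 /\ U (f s).
Proof.
move=> /within01P cf t01 oU Ut; pose e := Num.min t (1 - t).
have e0 : 0 < e by rewrite /e lt_min; case/andP: t01 => -> ?; rewrite subr_gt0.
have tE : clamp01 t = t by rewrite clamp01_id//; case/andP: t01 => /ltW -> /ltW ->.
have : nbhs t ((f \o clamp01) @^-1` U).
  by apply: cf; rewrite /= tE; exact: open_nbhs_nbhs.
move=> /nbhs_normP[r /= r0 rP]; exists (Num.min e r); first by rewrite lt_min e0.
move=> s; rewrite !lt_min => /andP[/andP[s1 s2] sr].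
have s01 : 0 < s < 1.
  by move: s1 s2; rewrite !ltr_norml => *; apply/andP; split; lra.
split => //; have := rP s; rewrite /ball_ /= distrC clamp01_id; last by case/andP: s01 => /ltW -> /ltW ->.
exact.
Qed.

End UnitInterval.

Opaque jet dmx Dm.

Section Geodesics.
Context {R : realType} {m : nat} {M : topologicalType} {X : manifold R m M}.
Variable g : riemannian_metric X.
Implicit Types (i j : chart X) (p q : M) (gam : R -> M).

(** The geodesic equation at [t] with the velocity and the acceleration as explicit data, the form
    in which lifted, reparametrized and glued curves deliver it. *)
Definition geo_pt i gam (t : R) : Prop := exists (v : R -> 'rV[R]_m) (w : 'rV[R]_m),
  [/\ exists2 d : R, 0 < d & forall s a, `|s - t| < d ->
        is_derive s 1 (fun u => cmap i (gam u) 0 a) (v s 0 a),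
      forall a, is_derive t 1 (fun s => v s 0 a) (w 0 a) &
      geo_acc (gmx g i) (cmap i (gam t)) (v t) w = 0].

Lemma is_derive_mx n (c : R -> 'rV[R]_n) (v : 'rV[R]_n) (t : R) :
  (derivable c t 1 /\ derive1 c t = v) <-> forall a, is_derive t 1 (fun s => c s 0 a) (v 0 a).
Proof.
split=> [[dc <-] a|H].
  rewrite derive1E (derive_mx dc) mxE; split => //.
  exact: (derivable_mxP _ _ _).1 dc 0 a.
have dc : derivable c t 1.
  by apply/derivable_mxP => i a; rewrite (ord1 i); have [] := H a.
split => //; apply/rowP => a; rewrite derive1E (derive_mx dc) mxE.
by have [_] := H a.
Qed.

Lemma geodesicP p q gam : geodesic g p q gam <->
  [/\ gam 0 = p, gam 1 = q, {within `[0, 1], continuous gam} &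
    forall t i, 0 < t < 1 -> dom i (gam t) -> geo_pt i gam t].
Proof.
split=> -[g0 g1 cg H]; split => // t i t01 dt.
  have [d d0 Hd] := within01_near cg t01 (@dom_open _ _ _ X i) dt.
  pose c s := cmap i (gam s); have [_ dd He] := H t i t01 dt.
  exists (derive1 c), (derive1 (derive1 c) t); split.
  - exists d => // s a /Hd[s01 ds]; have [dc _ _] := H s i s01 ds.
    by have /(_ a) := (is_derive_mx _ _ _).1 (conj dc erefl).
  - exact: (is_derive_mx _ _ _).1 (conj dd erefl).
  - by apply/rowP => l; rewrite !mxE; exact: He.
have [v [w [[d d0 Hv] Hw Ha]]] := H t i t01 dt; pose c s := cmap i (gam s).
have vE s : `|s - t| < d -> derivable c s 1 /\ derive1 c s = v s.
  by move=> sd; apply/is_derive_mx => a; exact: Hv.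
have tt : `|t - t| < d by rewrite subrr normr0.
have [dc vt] := vE t tt.
have [dv wE] : derivable v t 1 /\ derive1 v t = w by apply/is_derive_mx.
have N : \forall s \near t, v s = derive1 c s.
  apply/nbhs_normP; exists d => // s; rewrite /ball_ /= distrC => /vE[_ ->].
  by [].
have ddc : derivable (derive1 c) t 1 by exact: near_eq_derivable N dv.
have dE : derive1 (derive1 c) t = w.
  by rewrite -wE !derive1E; symmetry; exact: near_eq_derive.
split; [exact: dc|exact: ddc|] => l.
have /rowP/(_ l) := Ha; rewrite !mxE => H0; apply: etrans _ H0; rewrite dE; congr (_ + _).
by apply: eq_bigr => a _; apply: eq_bigr => b _; rewrite vt.
Qed.

Lemma geo_pt_local i gam gam' (t d : R) : 0 < d -> (forall s, `|s - t| < d -> gam s = gam' s) ->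
  geo_pt i gam t -> geo_pt i gam' t.
Proof.
move=> d0 E [v [w [[e e0 Hv] Hw Ha]]]; exists v, w; split => //; last first.
  by rewrite -E// subrr normr0.
have m0 : 0 < Num.min d e by rewrite lt_min d0.
exists (Num.min d e) => // s a; rewrite lt_min => /andP[sd se].
have ds : 0 < d - `|s - t| by rewrite subr_gt0.
apply: (is_derive_local ds) (Hv s a se) => u us; rewrite E//.
by have := ler_distD s u t; move: us; move: `|u - s| `|u - t| `|s - t| => *; lra.
Qed.

Lemma geo_acc_scale (G : 'rV[R]_m -> 'M[R]_m) x (b : R) v w : geo_acc G x (b *: v) ((b * b) *: w) = (b * b) *: geo_acc G x v w.
Proof.
apply/rowP => l; rewrite !mxE mulrDr; congr (_ + _); rewrite mulr_sumr; apply: eq_bigr => a _.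
by rewrite mulr_sumr; apply: eq_bigr => c _; rewrite !mxE; ring.
Qed.

Lemma geo_pt_affine i gam (a b t : R) : 0 < b -> geo_pt i gam (a + b * t) ->
  geo_pt i (fun u => gam (a + b * u)) t.
Proof.
move=> b0 [v [w [[e e0 Hv] Hw Ha]]].
exists (fun s => b *: v (a + b * s)), ((b * b) *: w); split.
- exists (e / b) => [|s l se]; first by rewrite divr_gt0.
  rewrite mxE; apply: (@is_derive_affine _ (fun u => cmap i (gam u) 0 l)); apply: Hv.
  have -> : a + b * s - (a + b * t) = (s - t) * b by ring.
  by rewrite normrM (gtr0_norm b0) -ltr_pdivlMr.
- move=> l; rewrite mxE; have := is_derive_scale b (@is_derive_affine _ (fun u => v u 0 l) a b t _ (Hw l)).
  by rewrite mulrA; have -> : (fun s => b * v (a + b * s) 0 l) = (fun s => (b *: v (a + b * s)) 0 l) by apply/funext => s; rewrite mxE.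
- by rewrite geo_acc_scale Ha scaler0.
Qed.

Lemma subgeodesic p q gam (a b : R) : geodesic g p q gam -> 0 <= a -> a < b -> b <= 1 ->
  geodesic g (gam a) (gam b) (fun u => gam (a + (b - a) * u)).
Proof.
move=> /geodesicP[_ _ cg H] a0 ab b1; apply/geodesicP; split.
- by rewrite mulr0 addr0.
- by rewrite mulr1 addrC subrK.
- apply/within01P; move/within01P: cg => cg.
  have -> : (fun u => gam (a + (b - a) * u)) \o clamp01 =
      (gam \o clamp01) \o (fun u => a + (b - a) * clamp01 u).
    apply/funext => u /=; have /andP[] := clamp01_in u; move: (clamp01 u) => c c0 c1.
    by rewrite clamp01_id//; apply/andP; split; nra.
  move=> u; apply: continuous_comp; last exact: cg.
  apply: continuousD; first exact: cst_continuous.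
  apply: continuousM; [exact: cst_continuous|exact: continuous_clamp01].
- move=> t i /andP[t0 t1] dt; apply: geo_pt_affine; first by rewrite subr_gt0.
  by apply: H => //; apply/andP; split; nra.
Qed.

Lemma cst_geodesic p : geodesic g p p (fun=> p).
Proof.
apply/geodesicP; split => //; first by apply: continuous_subspaceT => t; exact: cst_continuous.
move=> t i _ dp; exists (fun=> 0), 0; split.
- by exists 1 => // s a _; rewrite mxE; exact: is_derive_cst.
- move=> a; rewrite mxE; exact: is_derive_cst.
- apply/rowP => l; rewrite !mxE add0r big1// => a _; rewrite big1// => b _.
  by rewrite !mxE mulr0.
Qed.

End Geodesics.

(** * Geodesics and isometric immersions *)

Lemma is_derive_hg {R : realType} n (kap s : R) (P w : 'rV[R]_n) a : (kap = 0 -> w = 0) ->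
  is_derive s 1 (fun s => hg kap P w s 0 a) (((kap * sh (kap * s)) *: P + ch (kap * s) *: w) 0 a).
Proof.
move=> kw; have := is_deriveD
  (is_derive_scale (P 0 a) (is_derive_affine (a := 0) (b := kap) (t := s) (is_derive_ch _)))
  (is_derive_scale (w 0 a / kap) (is_derive_affine (a := 0) (b := kap) (t := s) (is_derive_sh _))).
rewrite add0r => H; have -> : (fun s => hg kap P w s 0 a) =
   ((fun u : R => P 0 a * ch (0 + kap * u)) + (fun u : R => w 0 a / kap * sh (0 + kap * u))).
  apply/funext => u; rewrite /hg !mxE [RHS]/GRing.add /= !add0r; by ring.
apply: (is_derive_eq H); rewrite !mxE.
have [k0|k0] := eqVneq kap 0; first by rewrite (kw k0) k0 mxE; ring.
by field.
Qed.

Lemma is_derive_dhg {R : realType} n (kap s : R) (P w : 'rV[R]_n) a : (kap = 0 -> w = 0) ->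
  is_derive s 1 (fun s => ((kap * sh (kap * s)) *: P + ch (kap * s) *: w) 0 a) (kap ^+ 2 * hg kap P w s 0 a).
Proof.
move=> kw; have := is_deriveD
  (is_derive_scale (kap * P 0 a) (is_derive_affine (a := 0) (b := kap) (t := s) (is_derive_sh _)))
  (is_derive_scale (w 0 a) (is_derive_affine (a := 0) (b := kap) (t := s) (is_derive_ch _))).
rewrite add0r => H; have -> : (fun s => ((kap * sh (kap * s)) *: P + ch (kap * s) *: w) 0 a) =
   ((fun u : R => kap * P 0 a * sh (0 + kap * u)) + (fun u : R => w 0 a * ch (0 + kap * u))).
  apply/funext => u; rewrite !mxE [RHS]/GRing.add /= !add0r; by ring.
apply: (is_derive_eq H); rewrite /hg !mxE.
have [k0|k0] := eqVneq kap 0; first by rewrite (kw k0) k0 mxE; ring.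
by field.
Qed.

Lemma is_derive_bil {R : realType} n (B : 'M[R]_n) (u v : R -> 'rV[R]_n) (du dv : 'rV[R]_n) (t : R) :
  (forall a, is_derive t 1 (fun s => u s 0 a) (du 0 a)) ->
  (forall a, is_derive t 1 (fun s => v s 0 a) (dv 0 a)) ->
  is_derive t 1 (fun s => bil B (u s) (v s)) (bil B du (v t) + bil B (u t) dv).
Proof.
have E (x y : 'rV[R]_n) : bil B x y = \sum_b \sum_a x 0 a * B a b * y 0 b.
  rewrite /bil mxE; apply: eq_bigr => b _; rewrite !mxE mulr_suml.
  by apply: eq_bigr => a _.
move=> Hu Hv; have -> : (fun s => bil B (u s) (v s)) = (fun s => \sum_b \sum_a u s 0 a * B a b * v s 0 b).
  by apply/funext => s; exact: E.
rewrite !E -big_split; apply: is_derive_sum_fun => b; rewrite -big_split; apply: is_derive_sum_fun => a.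
have := is_derive_mul (is_derive_scale (B a b) (Hu a)) (Hv b).
have -> : (fun s => B a b * u s 0 a * v s 0 b) = (fun s => u s 0 a * B a b * v s 0 b).
  by apply/funext => s; rewrite (mulrC (B a b)).
by move=> H; apply: (is_derive_eq H) => /=; ring.
Qed.

Lemma Cn_lipschitz {R : realType} {m q : nat} (V : set 'rV[R]_m) (T : 'rV[R]_m -> 'rV[R]_q) x0 :
  open V -> V x0 -> (forall b, Cn 1 V (fun x => T x 0 b)) ->
  exists r L : R, [/\ 0 < r, 0 <= L, cube x0 r `<=` V &
    forall x y, cube x0 r x -> cube x0 r y -> `|T y - T x| <= L * `|y - x|].
Proof.
move=> oV Vx CT; pose F a b : R := `|'D_(delta_mx 0 a) (fun x => T x 0 b) x0| + 1; pose K : R := \sum_a \sum_b F a b.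
have F0 a b : 0 <= F a b by rewrite addr_ge0.
have K0 : 0 <= K by apply: sumr_ge0 => a _; apply: sumr_ge0 => b _.
have [r r0 rP] : exists2 r : R, 0 < r & cube x0 r `<=` V `&`
   [set x | forall ab : 'I_m * 'I_q, `|'D_(delta_mx 0 ab.1) (fun x => T x 0 ab.2) x| <= K].
  apply/nbhs_cubeP; apply: filterI; first exact: open_nbhs_nbhs.
  apply: (@filter_forall _ _ (fun (ab : 'I_m * 'I_q) x => `|'D_(delta_mx 0 ab.1) (fun x => T x 0 ab.2) x| <= K) (nbhs x0)) => -[a b] /=.
  have := continuous_dist_le (Cn_continuous (Cn_derive a (CT b)) Vx) ltr01.
  apply: filterS => x Hx; have : F a b <= K.
    rewrite /K (bigD1 a)//= (bigD1 b)//= -addrA lerDl addr_ge0//; first exact: sumr_ge0.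
    by apply: sumr_ge0 => i _; exact: sumr_ge0.
  by apply: le_trans; rewrite -lerBlDl; apply: le_trans Hx; exact: lerB_dist.
exists r, (K * m%:R); split => //; [by rewrite mulr_ge0|by move=> x /rP[]|].
move=> x y xr yr; apply: norm_le_coord => [|b]; first by rewrite !mulr_ge0.
have := @box_mean_value _ _ (cube x0 r) (fun y => T y 0 b)
  (fun a x => 'D_(delta_mx 0 a) (fun y => T y 0 b) x) (fun=> 0) K x y (@boxy_cube _ _ _ _) xr yr.
rewrite big1 ?subr0; last by move=> a _; rewrite mulr0.
rewrite !mxE => H; apply: le_trans (H _ _) _.
- by move=> z a /rP[Vz _]; exact: (Cn_is_derive a (CT b) Vz).
- by move=> z a /rP[_ /(_ (a, b))]; rewrite subr0.
- have := sum_coord_le (y - x); under eq_bigr do rewrite !mxE; move=> S.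
  by rewrite -mulrA ler_wpM2l.
Qed.

Lemma coord_dist_le {R : realType} {m : nat} (x y : 'rV[R]_m) a : `|y 0 a - x 0 a| <= `|y - x|.
Proof. by have := coord_le_norm (y - x) a; rewrite mxBE. Qed.

Section GeodesicDev.
Context {R : realType} {m : nat} {M : topologicalType} {X : manifold R m M}.
Variables (g : riemannian_metric X) (k : R).
Hypotheses (hk : 0 < k) (Mcurv : constant_sectional_curvature g (- k ^+ 2)).
Implicit Types (i j : chart X) (p q : M) (x : 'rV[R]_m) (gam : R -> M).

Definition dcurve (Psi : M -> 'rV[R]_(1 + m)) gam s : 'rV[R]_(1 + m) :=
  \row_al 'D_1 (fun u : R => Psi (gam u) 0 al) s.

(** The coefficient in the equation z'' = lam z satisfied by the image of a geodesic in the
    hyperboloid. *)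
Definition lam gam (s : R) : R := (k * speed g gam s) ^+ 2.

Lemma ginner_ge0 i p v : dom i p -> 0 <= ginner (gmx g i) (cmap i p) v v.
Proof.
move=> dp; have [->|v0] := eqVneq v 0; first by rewrite /ginner !mul0mx mxE.
by rewrite ltW// gmx_pos.
Qed.

Lemma geod_dev B U Psi p q gam (t : R) : B^T = B -> mdev g k B U Psi -> geodesic g p q gam ->
  0 < t < 1 -> U (gam t) ->
  [/\ forall al, is_derive t 1 (fun u => Psi (gam u) 0 al) (dcurve Psi gam t 0 al),
      forall al, is_derive t 1 (fun s => dcurve Psi gam s 0 al) (lam gam t * Psi (gam t) 0 al) &
      bil B (dcurve Psi gam t) (dcurve Psi gam t) = - lam gam t].
Proof.
move=> BT HP /geodesicP[_ _ cg Hg] t01 Ut; have [oU Ub HD] := HP.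
pose i := chart_at X (gam t); have di : dom i (gam t) by exact: dom_chart_at.
have [v [w [[d1 d10 Hv] Hw Ha]]] := Hg t i t01 di.
have oUd : open (U `&` dom i) by apply: openI => //; exact: dom_open.
have [d2 d20 H2] := within01_near cg t01 oUd (conj Ut di).
pose c s := cmap i (gam s); pose d := Num.min d1 d2.
have d0 : 0 < d by rewrite lt_min d10.
have W s : `|s - t| < d -> chartset i U (c s).
  rewrite lt_min => /andP[_ /H2[_ [Us ds]]]; split.
    by apply: interior_inner ds; exact: Ub.
  by rewrite /= cmapK.
have ps s : `|s - t| < d -> par i (c s) = gam s.
  by rewrite lt_min => /andP[_ /H2[_ [Us ds]]]; rewrite cmapK.
have Hv' s a : `|s - t| < d -> is_derive s 1 (fun u => c u 0 a) (v s 0 a).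
  by rewrite lt_min => /andP[sd _]; exact: Hv.
have V s al : `|s - t| < d ->
    is_derive s 1 (fun u => Psi (gam u) 0 al) ((row_mx 0 (v s) *m jet (Psi \o par i) (c s)) 0 al).
  move=> sd; have sd0 : 0 < d - `|s - t| by rewrite subr_gt0.
  apply: (is_derive_local sd0) (dev_velocity (HD i) al (W _ sd) (fun a => Hv' s a sd)) => u us /=.
  by rewrite ps//; have := ler_distD s u t; move: us; move: `|u - s| `|u - t| `|s - t| => *; lra.
have dE s : `|s - t| < d -> dcurve Psi gam s = row_mx 0 (v s) *m jet (Psi \o par i) (c s).
  by move=> sd; apply/rowP => al; rewrite [LHS]mxE; have [_] := V s al sd.
have tt : `|t - t| < d by rewrite subrr normr0.
have lE : lam gam t = k ^+ 2 * ginner (gmx g i) (c t) (v t) (v t).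
  rewrite /lam exprMn /speed -/i; congr (_ * _); rewrite /gnorm sqr_sqrtr; last exact: ginner_ge0.
  by have [_ ->] := (is_derive_mx c (v t) t).2 (fun a => Hv' t a tt).
split.
- by move=> al; rewrite dE//; exact: V.
- move=> al; have := dev_acceleration (gmx_hyperbolic i Mcurv) (exprn_gt0 2 hk) BT (HD i) al (W _ tt)
    (fun a => Hv' t a tt) Hw.
  rewrite Ha row_mx_jet [X in _ + X]big1 ?addr0; last by move=> b _; rewrite [X in _ * X]mxE mulr0.
  rewrite -lE /= ps// => H; apply: (is_derive_local d0) H => s sd.
  by rewrite dE.
- rewrite dE// /bil trmx_mul; have [_ _ _ Hj] := HD i.
  rewrite (_ : _ *m _ *m B *m _ = row_mx 0 (v t) *m (jet (Psi \o par i) (c t) *m B *m (jet (Psi \o par i) (c t))^T) *m (row_mx 0 (v t))^T); last by rewrite !mulmxA.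
  rewrite Hj; last exact: W.
  have -> : (0 : 'rV[R]_1) = 0%:M by rewrite raddf0.
  by have := bil_Dm (gmx g i) (k ^+ 2) (c t) 0 0 (v t) (v t); rewrite /bil => ->; rewrite mul0r sub0r lE.
Qed.

Lemma mdev_velocity_perp B U Psi p q gam (t : R) : B^T = B -> mdev g k B U Psi -> geodesic g p q gam ->
  0 < t < 1 -> U (gam t) -> bil B (Psi (gam t)) (dcurve Psi gam t) = 0.
Proof.
move=> BT HP Hg t01 Ut; have [oU _ _] := HP; have [_ _ cg _] := Hg.
have [d d0 Hd] := within01_near cg t01 oU Ut.
have [H1 _ _] := geod_dev BT HP Hg t01 Ut.
have c1 s : `|s - t| < d -> bil B (Psi (gam s)) (Psi (gam s)) = 1.
  by move=> /Hd[_ Us]; exact: mdev_form HP Us.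
have D' := is_derive_local d0 c1 (is_derive_bil B H1 H1).
have := is_derive_unique D' (is_derive_cst (1 : R) t (1 : R)).
rewrite (bilC (dcurve _ _ _) _ BT); move: (bil _ _ _) => x; lra.
Qed.

(** Conservation of speed: lam = - B(z', z') has derivative - 2 lam B(z, z'), and z' is orthogonal
    to z. *)
Lemma lam_constant B U Psi p q gam (a b : R) : B^T = B -> mdev g k B U Psi -> geodesic g p q gam ->
  0 <= a -> b <= 1 -> (forall t, a < t < b -> U (gam t)) ->
  forall s t, a < s < b -> a < t < b -> lam gam s = lam gam t.
Proof.
move=> BT HP Hg a0 b1 Hab; apply: (@is_derive1_0_cst _ (lam gam) a b) => // t tab.
have [oU _ _] := HP; have t01 : 0 < t < 1.
  by case/andP: tab => *; apply/andP; split; lra.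
have Ut := Hab t tab.
have [_ _ cg _] := Hg; have [d d0 Hd] := within01_near cg t01 oU Ut.
have [H1 H2 H3] := geod_dev BT HP Hg t01 Ut.
have E0 : bil B (dcurve Psi gam t) (Psi (gam t)) = 0.
  by rewrite bilC//; exact: mdev_velocity_perp BT HP Hg t01 Ut.
have H2' al : is_derive t 1 (fun s => dcurve Psi gam s 0 al) ((lam gam t *: Psi (gam t)) 0 al).
  by rewrite mxE; exact: H2.
have H := is_derive_scale (-1) (is_derive_bil B H2' H2').
rewrite bilZl bilZr bilC// E0 mulr0 addr0 mulr0 in H.
apply: (is_derive_local d0) H => s sd; have [s01 Us] := Hd s sd.
by have [_ _ ->] := geod_dev BT HP Hg s01 Us; rewrite mulN1r opprK.
Qed.

(** Converse of [geod_dev]. The inverse Lipschitz bound is given in the chart [i] only; a Lipschitz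
    bound on the transition map carries it to any chart [j]. *)
Lemma pull_geodesic B U Psi i gam (z dz : R -> 'rV[R]_(1 + m)) (t d L la : R) :
  B^T = B -> mdev g k B U Psi -> U `<=` dom i -> 0 < d -> 0 <= L ->
  (forall p q, U p -> U q -> `|cmap i q - cmap i p| <= L * `|Psi q - Psi p|) ->
  (forall s, `|s - t| < d -> U (gam s)) ->
  (forall s, `|s - t| < d -> Psi (gam s) = z s) ->
  (forall s al, `|s - t| < d -> is_derive s 1 (fun s => z s 0 al) (dz s 0 al)) ->
  (forall al, is_derive t 1 (fun s => dz s 0 al) (la * z t 0 al)) ->
  {for t, continuous gam} /\ forall j, dom j (gam t) -> geo_pt g j gam t.
Proof.
move=> BT HP Ui d0 L0 Lip Ug Pz Hz Hdz; have [oU Ub HD] := HP.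
have tt : `|t - t| < d by rewrite subrr normr0.
have Ut := Ug t tt; have dt := Ui _ Ut.
have inn p j : U p -> dom j p -> chartset j U (cmap j p).
  by move=> Up dp; split; [exact: interior_inner (Ub _ Up) dp|rewrite /= cmapK].
have cz (e : R) : 0 < e -> exists2 r : R, 0 < r & forall s, `|s - t| < r -> `|z s - z t| <= e.
  move=> e0; have : \forall s \near t, forall al, `|z s 0 al - z t 0 al| <= e.
    apply: (@filter_forall _ _ (fun al s => `|z s 0 al - z t 0 al| <= e) (nbhs t)) => al.
    exact: (continuous_dist_le (is_derive_continuous (Hz t al tt)) e0).
  move=> /nbhs_normP[r /= r0 rP]; exists r => // s sr.
  apply: norm_le_coord => [|al]; first exact: ltW.
  by rewrite mxDE [(- z t) 0 al]mxE; apply: rP; rewrite /ball_ /= distrC.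
have cc (r : R) : 0 < r -> exists2 e : R, 0 < e & forall s, `|s - t| < e -> `|s - t| < d /\ cube (cmap i (gam t)) r (cmap i (gam s)).
  move=> r0; have L1 : 0 < L + 1 by rewrite ltr_wpDl.
  have [e e0 He] := cz (r / (L + 1)) (divr_gt0 r0 L1).
  exists (Num.min d e); first by rewrite lt_min d0.
  move=> s; rewrite lt_min => /andP[sd se]; split => // a.
  apply: le_lt_trans (coord_dist_le _ _ _) _; apply: le_lt_trans (Lip _ _ Ut (Ug _ sd)) _.
  rewrite !Pz//; apply: (@le_lt_trans _ _ (L * (r / (L + 1)))); first by rewrite ler_wpM2l// He.
  by rewrite mulrCA gtr_pMr// ltr_pdivrMr// mul1r ltrDl.
have cg : {for t, continuous gam}.
  move=> A /= NA; have ci := par_continuous_inner (inn _ _ Ut dt).1.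
  have NA' : nbhs (cmap i (gam t)) (par i @^-1` A) by apply: ci; rewrite cmapK.
  have /nbhs_cubeP[r r0 rP] := NA'; have [e e0 He] := cc r r0.
  apply/nbhs_normP; exists e => // s; rewrite /ball_ /= distrC => /He[sd /rP] /=.
  by rewrite cmapK//; apply: Ui; exact: Ug.
split=> // j dj; have xD : chartset i (dom j) (cmap i (gam t)).
  by split; [exact: (inn _ _ Ut dt).1|rewrite /= cmapK].
have [r [K [r0 K0 rV Klip]]] := Cn_lipschitz (open_chartset (@dom_open _ _ _ X j)) xD (trans_smooth 1 i j).
have [e e0 He] := cc r r0.
have tE s : `|s - t| < e -> [/\ dom j (gam s) & trans i j (cmap i (gam s)) = cmap j (gam s)].
  move=> /He[sd cs]; have := rV _ cs => -[_ /=]; rewrite /trans cmapK//; apply: Ui; exact: Ug.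
have de s : `|s - t| < e -> `|s - t| < d by move=> /He[].
have [|||||v [w [H1 H2 H3]]] := @pullback_geodesic _ _ _ _ _ (gmx_hyperbolic j Mcurv) (exprn_gt0 2 hk)
  _ _ _ BT (HD j) (fun s => cmap j (gam s)) z dz t (K * L) e la e0.
- by rewrite mulr_ge0.
- by move=> s se; have [djs _] := tE s se; apply: inn => //; apply: Ug; exact: de.
- move=> s s' se s'e; have [djs <-] := tE s se; have [djs' <-] := tE s' s'e.
  have [sd cs] := He s se; have [s'd cs'] := He s' s'e.
  apply: le_trans (Klip _ _ cs cs') _; rewrite -mulrA ler_wpM2l//=.
  rewrite /trans !cmapK//; try by apply: Ui; apply: Ug.
  by apply: Lip; exact: Ug.
- by move=> s se; have [djs _] := tE s se; rewrite /= cmapK// Pz//; exact: de.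
- by move=> s al se; apply: Hz; exact: de.
exists v, w; split => //; exists e => // s a; exact: H1.
Qed.

End GeodesicDev.

(** * Segments of the hyperboloid *)

Section HyperbolicLines.
Context {R : realType} {n : nat}.
Variable B : 'M[R]_n.
Hypothesis BT : B^T = B.
Implicit Types (kap s t u : R) (P w : 'rV[R]_n).

(** Lorentz signature in the form used below: the orthogonal complement of a point of the
    hyperboloid is negative definite. *)
Definition lorentz := forall P w, bil B P P = 1 -> bil B P w = 0 -> 0 <= bil B w w -> w = 0.

(** Initial data of a hyperboloid geodesic: point, tangent vector, speed. The last clause rules out
    nonzero null vectors, since [hg] is constant at speed zero. *)
Definition hyp kap P w := [/\ 0 <= kap, bil B P P = 1, bil B P w = 0, bil B w w = - kap ^+ 2 &
  kap = 0 -> w = 0].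

Definition dhg kap P w s : 'rV[R]_n := (kap * sh (kap * s)) *: P + ch (kap * s) *: w.

Lemma bil_hg kap P w s t : hyp kap P w -> bil B (hg kap P w s) (hg kap P w t) = ch (kap * (s - t)).
Proof.
move=> [k0 PP Pw ww kw]; rewrite /hg bilDl !bilDr !bilZl !bilZr PP (bilC w P BT) Pw ww.
rewrite mulrBr chD chN shN; have [->|kn] := eqVneq kap 0; last by field.
by rewrite !mul0r sh0; ring.
Qed.

Lemma hyp_shift kap P w s : hyp kap P w -> hyp kap (hg kap P w s) (dhg kap P w s).
Proof.
move=> H; have [k0 PP Pw ww kw] := H; split => //.
- by rewrite bil_hg// subrr mulr0 ch0.
- rewrite /hg /dhg bilDl !bilDr !bilZl !bilZr PP (bilC w P BT) Pw ww.
  by have [->|kn] := eqVneq kap 0; [rewrite !mul0r sh0; ring|field].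
- rewrite /dhg bilDl !bilDr !bilZl !bilZr PP (bilC w P BT) Pw ww.
  have := ch2_sh2 (kap * s); move: (ch _) (sh _) => x y.
  move=> H1; apply: etrans (_ : - kap ^+ 2 * (x ^+ 2 - y ^+ 2) = _); first by ring.
  by rewrite H1 mulr1.
- by move=> kz; rewrite /dhg kz (kw kz) !mul0r scale0r scaler0 addr0.
Qed.

Lemma hg_shift kap P w s u : (kap = 0 -> w = 0) ->
  hg kap P w (s + u) = hg kap (hg kap P w s) (dhg kap P w s) u.
Proof.
move=> kw; rewrite /hg /dhg mulrDr chD shD; have [kz|kn] := eqVneq kap 0.
  by rewrite kz (kw kz) !mul0r sh0 ch0 !(mul0r, mulr1, addr0, scaler0, scale0r, scale1r).
rewrite !scalerDr !scalerA addrACA -!scalerDl; congr (_ *: _ + _ *: _); by field.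
Qed.

Lemma hg_scale kap P w c s : c != 0 -> hg (c * kap) P (c *: w) s = hg kap P w (c * s).
Proof.
move=> c0; rewrite /hg scalerA.
have -> : c * kap * s = kap * (c * s) by ring.
congr (_ + _ *: _); have [->|kn] := eqVneq kap 0; first by rewrite mulr0 invr0 !(mulr0, mul0r).
by field; rewrite c0 kn.
Qed.

Lemma hyp_scale kap P w c : 0 < c -> hyp kap P w -> hyp (c * kap) P (c *: w).
Proof.
move=> c0 [k0 PP Pw ww kw]; split => //; first by rewrite mulr_ge0// ltW.
- by rewrite bilZr Pw mulr0.
- by rewrite bilZl bilZr ww; ring.
- by move=> /eqP; rewrite mulf_eq0 gt_eqF//= => /eqP/kw ->; rewrite scaler0.
Qed.

(** Injectivity of the exponential map of the hyperboloid: the speed is read off B(P, Z) = cosh(kap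
    s), then the direction. *)
Lemma hyp_inj kap kap' P w w' s : 0 < s -> hyp kap P w -> hyp kap' P w' ->
  hg kap P w s = hg kap' P w' s -> kap = kap' /\ w = w'.
Proof.
move=> s0 H H' E; have [k0 PP Pw ww kw] := H; have [k0' _ Pw' ww' kw'] := H'.
have kk : kap = kap'.
  have := bil_hg s 0 H; have := bil_hg s 0 H'; rewrite !hg0 -E => -> /ch_inj.
  rewrite subr0 !mulr_ge0 ?(ltW s0)// => /(_ isT isT) /(mulIf (lt0r_neq0 s0)) //.
rewrite -kk in H' kw' E *; split => //; have [kz|kn] := eqVneq kap 0; first by rewrite kw// kw'.
move: E; rewrite /hg => /addrI/scalerI; apply.
have kp : 0 < kap by rewrite lt_neqAle eq_sym kn.
by rewrite mulf_neq0 ?invr_eq0// gt_eqF// sh_gt0// mulr_gt0.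
Qed.

Lemma hyp_germ kap kap' P P' w w' s t : s < t -> hyp kap P w -> hyp kap' P' w' ->
  hg kap P w s = hg kap' P' w' s -> hg kap P w t = hg kap' P' w' t ->
  kap = kap' /\ forall u, hg kap P w u = hg kap' P' w' u.
Proof.
move=> st H H' Es Et; have S := hyp_shift s H; have S' := hyp_shift s H'.
have kw : kap = 0 -> w = 0 by case: H. have kw' : kap' = 0 -> w' = 0 by case: H'.
have ts : 0 < t - s by rewrite subr_gt0.
have E1 := hg_shift P s (t - s) kw; have E2 := hg_shift P' s (t - s) kw'.
have st' : s + (t - s) = t by rewrite addrC subrK.
rewrite st' in E1 E2; rewrite -Es in S' E2; rewrite E1 E2 in Et.
have [kk ww] := hyp_inj ts S S' Et; split => // u.
have su : s + (u - s) = u by rewrite addrC subrK.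
by rewrite -su (hg_shift P _ _ kw) (hg_shift P' _ _ kw') -Es ww -kk.
Qed.

(** The addition formula for sinh. For a <= s <= b the coefficients are nonnegative, which is how
    geodesic segments become segments of the cone over the hyperboloid. *)
Lemma hg_convex kap P w s a b : (kap = 0 -> w = 0) -> sh (kap * (b - a)) *: hg kap P w s =
  sh (kap * (b - s)) *: hg kap P w a + sh (kap * (s - a)) *: hg kap P w b.
Proof.
move=> kw; rewrite /hg !scalerDr !scalerA addrACA -!scalerDl.
have [kz|kn] := eqVneq kap 0; first by rewrite kz !mul0r sh0 !mul0r !addr0.
have E c d : kap * (c - d) = kap * c + - (kap * d) by ring.
have H x := ch2_sh2 (kap * x); have := H a; have := H b; have := H s.
rewrite !E !shD !chN !shN; move: (ch _) (sh _) (ch _) (sh _) (ch _) (sh _) => x1 y1 x2 y2 x3 y3 H1 H2 H3.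
by congr (_ *: _ + _ *: _); field.
Qed.

Lemma sh_superadd (x y : R) : 0 <= x -> 0 <= y -> sh x + sh y <= sh (x + y).
Proof.
move=> x0 y0; rewrite shD; have := ch_ge1 x; have := ch_ge1 y; have := sh_ge0 x0; have := sh_ge0 y0.
by move: (ch x) (ch y) (sh x) (sh y) => a b c d *; nra.
Qed.

(** Caps are geodesically convex: by superadditivity of sinh the coefficients in [hg_convex] add up
    to at most the factor on the left, and they are not both zero. *)
Lemma hg_cap kap P w Q (c a b s : R) : hyp kap P w -> a <= s <= b ->
  0 < bil B (hg kap P w a) Q < c -> 0 < bil B (hg kap P w b) Q < c ->
  0 < bil B (hg kap P w s) Q < c.
Proof.
move=> [k0 _ _ _ kw] /andP[sa sb] /andP[a0 ac] /andP[b0 bc].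
have [kz|kn] := eqVneq kap 0; first by move: a0 ac; rewrite /hg kz (kw kz) !scaler0 !mul0r => -> ->.
have kp : 0 < kap by rewrite lt_neqAle eq_sym kn.
have [ab|ab] := ltP a b; last first.
  have -> : s = a by apply/eqP; rewrite eq_le sa andbT (le_trans sb ab).
  by rewrite a0.
have := congr1 (fun Z => bil B Z Q) (hg_convex P s a b kw); rewrite /= bilDl !bilZl.
have h0 : 0 <= sh (kap * (b - s)) by rewrite sh_ge0// mulr_ge0// subr_ge0.
have h1 : 0 <= sh (kap * (s - a)) by rewrite sh_ge0// mulr_ge0// subr_ge0.
have h2 : 0 < sh (kap * (b - a)) by rewrite sh_gt0// mulr_gt0// subr_gt0.
have h3 : sh (kap * (b - s)) + sh (kap * (s - a)) <= sh (kap * (b - a)).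
  have -> : kap * (b - a) = kap * (b - s) + kap * (s - a) by ring.
  by apply: sh_superadd; rewrite mulr_ge0// subr_ge0.
have h4 : 0 < sh (kap * (b - s)) + sh (kap * (s - a)).
  have [E|E] := ltP s b; first by rewrite ltr_pwDl// sh_gt0// mulr_gt0// subr_gt0.
  by rewrite ltr_wpDl// sh_gt0// mulr_gt0// subr_gt0; lra.
move: h0 h1 h2 h3 h4 a0 ac b0 bc; move: (sh (kap * (b - a))) (sh (kap * (b - s))) (sh (kap * (s - a))) (bil B (hg kap P w s) Q)
  (bil B (hg kap P w a) Q) (bil B (hg kap P w b) Q).
move=> A x y X Y Z x0 y0 A0 xy xy0 Y0 Yc Z0 Zc E.
have pos u v : 0 < u -> 0 < v -> 0 < x * u + y * v.
  move=> u0 v0; have [xp|xn] := ltP 0 x.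
    by rewrite ltr_pwDl ?mulr_gt0// mulr_ge0// ltW.
  have yp : 0 < y by lra.
  by rewrite ltr_wpDl ?mulr_gt0// mulr_ge0// ltW.
have p1 : 0 < A * X by rewrite E; exact: pos.
have p2 : A * X < A * c.
  have := pos (c - Y) (c - Z); rewrite !subr_gt0 E => /(_ Yc Zc) H.
  have : (x + y) * c <= A * c by rewrite ler_wpM2r// ltW// (lt_trans Y0).
  by move: H; rewrite !mulrBr mulrDl; move: (x * _) (y * _) (x * _) (y * _) (A * c) => *; lra.
by rewrite -(pmulr_rgt0 _ A0) p1 -(ltr_pM2l A0).
Qed.

End HyperbolicLines.

(** * Normal balls on the manifold *)

Section NormalBalls.
Context {R : realType} {m : nat} {M : topologicalType} {X : manifold R m M}.
Variables (g : riemannian_metric X) (k : R).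
Hypotheses (hk : 0 < k) (Mcurv : constant_sectional_curvature g (- k ^+ 2)).
Implicit Types (i j : chart X) (p q : M) (x : 'rV[R]_m) (gam : R -> M).

(** [Psi] maps [U] bijectively onto a cap around [P], with an inverse that is Lipschitz in the chart
    [i]. The form and the centre are parameters so that a ball can be moved by linear isometries. *)
Record nball (B : 'M[R]_(1 + m)) (U : set M) (Psi : M -> 'rV[R]_(1 + m)) i (P : 'rV[R]_(1 + m)) (eta L : R) : Prop := NBall {
  nball_dev : mdev g k B U Psi;
  nball_dom : U `<=` dom i;
  nball_L : 0 <= L;
  nball_lip : forall p q, U p -> U q -> `|cmap i q - cmap i p| <= L * `|Psi q - Psi p|;
  nball_cap : forall p, U p -> 0 < bil B (Psi p) P < 1 + eta;
  nball_surj : forall Z, bil B Z Z = 1 -> 0 < bil B Z P < 1 + eta -> exists2 p, U p & Psi p = Z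
}.

Lemma nball_exists p : ~ boundary X p -> let i := chart_at X p in
  let B := Dm (gmx g i) (k ^+ 2) (cmap i p) in
  exists (U : set M) (Psi : M -> 'rV[R]_(1 + m)) (eta : R),
   [/\ 0 < eta, U p, Psi p = origin, nball B U Psi i origin eta 2 & B^T = B].
Proof.
move=> np i B; have dp : dom i p by exact: dom_chart_at.
have ip := interior_inner np dp.
have [eta [W [F [eta0 HF Wp [Fp _] [cap surj lip]]]]] :=
  normal_ball (gmx_hyperbolic i Mcurv) (exprn_gt0 2 hk) ip.
have [oW Wi _ _] := HF.
have E x : W x -> F x = (fun p => F (cmap i p)) (par i x).
  by move=> /Wi/innerK[_ ->].
exists (dom i `&` cmap i @^-1` W), (fun p => F (cmap i p)), eta; split => //; last first.
  exact: Dm_sym (gmx_hyperbolic i Mcurv) _ ip.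
have oB Z : bil B Z origin = Z 0 (lshift m 0) by exact: bil_origin.
apply: NBall.
- by apply: mdev_chart; exact: (isdev_ext E HF).
- by move=> q [].
- by [].
- by move=> q r [_ Wq] [_ Wr]; exact: lip.
- by move=> q [_ Wq]; rewrite oB; exact: cap.
- move=> Z Z1; rewrite oB => Z0; have [x Wx <-] := surj Z Z1 Z0.
  have [dx ex] := innerK (Wi _ Wx); exists (par i x); last by rewrite ex.
  by split => //=; rewrite ex.
Qed.

Lemma nball_transform B B' U Psi i P eta L (A : 'M[R]_(1 + m)) : A \in unitmx -> A *m B' *m A^T = B ->
  nball B U Psi i P eta L -> exists L', nball B' U (fun p => Psi p *m A) i (P *m A) eta L'.
Proof.
move=> uA AB [HP Ud L0 lip cap surj].
have bA Y Z : bil B' (Y *m A) (Z *m A) = bil B Y Z.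
  by rewrite /bil -AB trmx_mul !mulmxA.
pose C : R := \sum_a \sum_b `|invmx A a b|.
have C0 : 0 <= C by apply: sumr_ge0 => a _; exact: sumr_ge0.
have HC (Y : 'rV[R]_(1 + m)) : `|Y| <= C * `|Y *m A|.
  apply: norm_le_coord => [|b]; first by rewrite mulr_ge0.
  rewrite -{1}(mulmxK uA Y) mxE; apply: le_trans (ler_norm_sum _ _ _) _.
  rewrite /C mulr_suml; apply: ler_sum => a _; rewrite normrM mulrC.
  apply: ler_pM => //; last exact: coord_le_norm.
  by rewrite (bigD1 b)//= lerDl sumr_ge0.
exists (L * C); apply: NBall.
- exact: mdev_mulmx AB HP.
- exact: Ud.
- by rewrite mulr_ge0.
- move=> p q Up Uq; apply: le_trans (lip _ _ Up Uq) _; rewrite -mulrA ler_wpM2l//.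
  by apply: le_trans (HC _) _; rewrite mulmxBl.
- by move=> p Up; rewrite bA; exact: cap.
- move=> Z; have ZA : (Z *m invmx A) *m A = Z by rewrite mulmxKV.
  rewrite -{1 2 3 4}ZA !bA => Z1 Z0; have [p Up E] := surj _ Z1 Z0.
  by exists p => //; rewrite E.
Qed.

Section Ball.
Variables (B : 'M[R]_(1 + m)) (U : set M) (Psi : M -> 'rV[R]_(1 + m)) (i : chart X)
  (P : 'rV[R]_(1 + m)) (eta L : R).
Hypotheses (BT : B^T = B) (HB : nball B U Psi i P eta L).

Lemma nball_inj p q : U p -> U q -> Psi p = Psi q -> p = q.
Proof.
move=> Up Uq E; have := nball_lip HB Up Uq; rewrite E subrr normr0 mulr0 normr_le0 subr_eq0.
by move=> /eqP/(congr1 (par i)); rewrite !cmapK//; exact: (nball_dom HB).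
Qed.

Lemma nball_inv_near p (A : set M) : U p -> nbhs p A -> exists2 e : R, 0 < e &
  forall q, U q -> `|Psi q - Psi p| < e -> A q.
Proof.
move=> Up Ap; have [oU Ub _] := nball_dev HB; have dp := nball_dom HB Up.
have NA : nbhs (cmap i p) (par i @^-1` A).
  by apply: (par_continuous_inner (interior_inner (Ub _ Up) dp)); rewrite cmapK.
have /nbhs_cubeP[r r0 rP] := NA; have L1 : 0 < L + 1 by rewrite ltr_wpDl// (nball_L HB).
exists (r / (L + 1)); first by rewrite divr_gt0.
move=> q Uq qe; rewrite -[q](cmapK (nball_dom HB Uq)); apply: rP => a.
apply: le_lt_trans (coord_dist_le _ _ _) _; apply: le_lt_trans (nball_lip HB Up Uq) _.
apply: (@le_lt_trans _ _ (L * (r / (L + 1)))); first by rewrite ler_wpM2l ?(nball_L HB)// ltW.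
by rewrite mulrCA gtr_pMr// ltr_pdivrMr// mul1r ltrDl.
Qed.

(** The geodesic is lifted at every time it spends in the cap, by surjectivity; at other times [c]
    is arbitrary. The lift is a geodesic by [pull_geodesic]. *)
Lemma nball_lift kap Q w : hyp B kap Q w -> exists c : R -> M,
  forall t, 0 < bil B (hg kap Q w t) P < 1 + eta ->
   [/\ U (c t), Psi (c t) = hg kap Q w t, {for t, continuous c} &
       forall j, dom j (c t) -> geo_pt g j c t].
Proof.
move=> Hh; have [k0 QQ Qw ww kw] := Hh.
pose S (t : R) := 0 < bil B (hg kap Q w t) P < 1 + eta.
have /choice[c Hc] : forall t : R, exists p : M, S t -> U p /\ Psi p = hg kap Q w t.
  move=> t; have [St|nSt] := boolP (S t); last by exists (par i 0).
  have [|p Up E] := nball_surj HB _ St; last by exists p.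
  by rewrite bil_hg// subrr mulr0 ch0.
exists c => t St; have [Ut Et] := Hc t St.
have oS : exists2 d : R, 0 < d & forall s, `|s - t| < d -> S s.
  have cb : {for t, continuous (fun s : R => bil B (hg kap Q w s) P)}.
    have Hd a := is_derive_hg t Q a kw.
    have H0 a : is_derive t 1 (fun=> P 0 a) ((0 : 'rV[R]_(1 + m)) 0 a) by rewrite mxE; exact: is_derive_cst.
    exact: is_derive_continuous (is_derive_bil B Hd H0).
  move: St => /andP[S0 S1].
  pose e := Num.min (bil B (hg kap Q w t) P) (1 + eta - bil B (hg kap Q w t) P) / 2.
  have e0 : 0 < e by rewrite divr_gt0// lt_min S0 subr_gt0.
  have /nbhs_normP[d /= d0 dP] := continuous_dist_le cb e0; exists d => // s sd.
  have := dP s; rewrite /ball_ /= distrC => /(_ sd).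
  have : e <= bil B (hg kap Q w t) P / 2 by rewrite /e ler_pM2r// ge_min lexx.
  have : e <= (1 + eta - bil B (hg kap Q w t) P) / 2 by rewrite /e ler_pM2r// ge_min lexx orbT.
  rewrite /S ler_norml => H1 H2 /andP[H3 H4]; apply/andP.
  move: H1 H2 H3 H4 S0 S1; move: (bil _ _ _) (bil _ _ _) => u v *; split; lra.
have [d d0 dS] := oS.
have [cc geo] : {for t, continuous c} /\ forall j, dom j (c t) -> geo_pt g j c t.
  apply: (pull_geodesic hk Mcurv BT (nball_dev HB) (nball_dom HB) d0 (nball_L HB) (nball_lip HB)
    (z := hg kap Q w) (dz := dhg kap Q w) (la := kap ^+ 2)).
  - by move=> s /dS Ss; have [] := Hc s Ss.
  - by move=> s /dS Ss; have [] := Hc s Ss.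
  - by move=> s al _; exact: is_derive_hg.
  - by move=> al; exact: is_derive_dhg.
by split.
Qed.

End Ball.

End NormalBalls.

Lemma continuous_agree {R : realType} (f g : R -> R) (t : R) :
  {for t, continuous f} -> {for t, continuous g} ->
  (forall e : R, 0 < e -> exists2 s, `|s - t| < e & f s = g s) -> f t = g t.
Proof.
move=> cf cg H; apply/eqP; rewrite -subr_eq0 -normr_le0; apply/ler_addgt0Pl => e e0.
have e2 : 0 < e / 2 by rewrite divr_gt0.
have /nbhs_normP[r1 /= r10 H1] := continuous_dist_le cf e2.
have /nbhs_normP[r2 /= r20 H2] := continuous_dist_le cg e2.
have [s] := H (Num.min r1 r2) ltac:(by rewrite lt_min r10).
rewrite lt_min => /andP[s1 s2] E; rewrite addr0.
have := H1 s; have := H2 s; rewrite /ball_ /= distrC => /(_ s2) + /(_ s1).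
rewrite E => h2 h1.
rewrite (splitr e); apply: le_trans (lerD h1 h2).
by rewrite (distrC (g s) (f t)); have := ler_distD (g s) (f t) (g t).
Qed.

Lemma sqr_inj_ge0 {R : realType} (x y : R) : 0 <= x -> 0 <= y -> x ^+ 2 = y ^+ 2 -> x = y.
Proof. by move=> x0 y0 /eqP; rewrite eqrXn2// => /eqP. Qed.

(** Reversed Cauchy-Schwarz in coordinates: (p a)^2 = (kap c)^2 <= (kap u)(kap v) <= (p^2 - 1) a^2,
    so a^2 <= 0. *)
Lemma lorentz_aux {R : realType} (kap p a u v c : R) : 0 < kap -> p * p - kap * u = 1 ->
  p * a - kap * c = 0 -> 0 <= a * a - kap * v -> c ^+ 2 <= u * v -> 0 <= u -> 0 <= v -> a = 0.
Proof.
move=> k0 H1 H2 H3 CS u0 v0.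
have E : (p * a) ^+ 2 <= (kap * u) * (kap * v).
  have -> : p * a = kap * c by lra.
  by rewrite exprMn [leRHS]mulrACA -expr2 ler_wpM2l// sqr_ge0.
have h1 : 0 <= kap * u by rewrite mulr_ge0// ltW.
have H : (kap * u) * (kap * v) <= (kap * u) * (a * a) by rewrite ler_wpM2l//; lra.
have a0 : a ^+ 2 <= 0.
  move: E H; have -> : kap * u = p * p - 1 by lra.
  rewrite exprMn mulrBl mul1r => E H; have := le_trans E H.
  have -> : p ^+ 2 * a ^+ 2 = p * p * (a * a) by ring.
  rewrite expr2; move: (p * p * (a * a)) (a * a) => *; lra.
by apply/eqP; rewrite -sqrf_eq0 eq_le a0 sqr_ge0.
Qed.

Lemma lorentz_Dm {R : realType} {m : nat} (G : 'rV[R]_m -> 'M[R]_m) (kap : R) x :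
  0 < kap -> (G x)^T = G x -> posdef (G x) -> lorentz (Dm G kap x).
Proof.
move=> k0 GT pG P w; rewrite -[P]hsubmxK -[w]hsubmxK [lsubmx P]mx11_scalar [lsubmx w]mx11_scalar.
rewrite !bil_Dm; set p := lsubmx P 0 0; set a := lsubmx w 0 0.
move: (rsubmx P) (rsubmx w) => u v H1 H2 H3.
have CS := cauchy_schwarz u v GT pG; have gv := posdef_ge0 v pG; have gu := posdef_ge0 u pG.
have a00 : a = 0 by exact: lorentz_aux k0 H1 H2 H3 CS gu gv.
have v0 : v = 0.
  apply/eqP/negPn/negP => /pG; rewrite a00 in H3; move: H3; rewrite mulr0 sub0r oppr_ge0 pmulr_rle0//.
  by move=> h1 h2; have := lt_le_trans h2 h1; rewrite ltxx.
by rewrite a00 v0 raddf0 row_mx0.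
Qed.

Section GeodesicsInDev.
Context {R : realType} {m : nat} {M : topologicalType} {X : manifold R m M}.
Variables (g : riemannian_metric X) (k : R).
Hypotheses (hk : 0 < k) (Mcurv : constant_sectional_curvature g (- k ^+ 2)).
Implicit Types (i j : chart X) (p q : M) (x : 'rV[R]_m) (gam : R -> M).

Lemma mdev_continuous B U Psi p al : mdev g k B U Psi -> U p ->
  {for p, continuous (fun q => Psi q 0 al)}.
Proof.
move=> [oU Ub HD] Up; pose i := chart_at X p; have dp : dom i p by exact: dom_chart_at.
have [_ _ CP _] := HD i.
have Wx : chartset i U (cmap i p).
  by split; [exact: interior_inner (Ub _ Up) dp|rewrite /= cmapK].
have c1 := Cn_continuous (CP 0 al) Wx; have c2 := @cmap_continuous _ _ _ X i p dp.
apply: continuous_dist_intro => e e0.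
have H : nbhs p [set q | `|(Psi \o par i) (cmap i q) 0 al - (Psi \o par i) (cmap i p) 0 al| <= e].
  exact: (c2 _ (continuous_dist_le c1 e0)).
have H2 : nbhs p (dom i) by apply: open_nbhs_nbhs; split => //; exact: dom_open.
by apply: (filterS _ (filterI H H2)) => q [/= + dq]; rewrite !cmapK.
Qed.

(** The image solves z'' = kap^2 z with constant [kap]. Initial data are taken at the middle of the
    interval, since its ends may lie outside [U]; at speed zero negative definiteness makes the
    velocity vanish. *)
Lemma geod_hg B U Psi p q gam (a b : R) : B^T = B -> lorentz B -> mdev g k B U Psi ->
  geodesic g p q gam -> 0 <= a -> a < b -> b <= 1 -> (forall t, a < t < b -> U (gam t)) ->
  exists kap P w, [/\ hyp B kap P w, forall t, a < t < b -> Psi (gam t) = hg kap P w t &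
    forall t, a < t < b -> k * speed g gam t = kap].
Proof.
move=> BT LB HP Hg a0 ab b1 Hab; pose s0 := (a + b) / 2.
have sab : a < s0 < b by rewrite /s0; apply/andP; split; lra.
have t01 t : a < t < b -> 0 < t < 1 by case/andP=> *; apply/andP; split; lra.
have sp0 t : 0 <= k * speed g gam t by rewrite mulr_ge0 ?(ltW hk)// sqrtr_ge0.
pose kap := k * speed g gam s0.
have lc t : a < t < b -> k * speed g gam t = kap.
  move=> tab; have := lam_constant hk Mcurv BT HP Hg a0 b1 Hab tab sab.
  exact: sqr_inj_ge0.
pose P1 := Psi (gam s0); pose w1 := dcurve Psi gam s0.
have D t := fun tab : a < t < b => geod_dev hk Mcurv BT HP Hg (t01 t tab) (Hab t tab).
have L t : a < t < b -> lam g k gam t = kap ^+ 2 by move=> /lc; rewrite /lam => ->.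
have Z t : a < t < b -> kap = 0 -> dcurve Psi gam t = 0.
  move=> tab k0; apply: (LB (Psi (gam t))).
  - exact: mdev_form HP (Hab t tab).
  - exact: (mdev_velocity_perp hk Mcurv BT HP Hg (t01 t tab) (Hab t tab)).
  - by have [_ _ ->] := D t tab; rewrite L// k0 expr0n oppr0.
have H1 : hyp B kap P1 w1.
  split => //.
  - exact: sp0.
  - exact: mdev_form HP (Hab s0 sab).
  - exact: (mdev_velocity_perp hk Mcurv BT HP Hg (t01 s0 sab) (Hab s0 sab)).
  - by have [_ _ ->] := D s0 sab; rewrite L.
  - exact: Z.
have kw1 : kap = 0 -> w1 = 0 by exact: Z.
have E t : a < t < b -> Psi (gam t) = hg kap P1 w1 (t - s0).
  move=> tab; apply/rowP => al; have [kz|kn] := eqVneq kap 0.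
    rewrite /hg (kw1 kz) scaler0 addr0 kz mul0r ch0 scale1r.
    apply: (@is_derive1_0_cst _ (fun s => Psi (gam s) 0 al) a b) => // s sab'.
    by have [/(_ al)] := D s sab'; rewrite Z// mxE.
  have kp : 0 < kap by rewrite lt_neqAle eq_sym kn sp0.
  have D1 s : a < s < b -> is_derive s 1 (fun s => Psi (gam s) 0 al) (dcurve Psi gam s 0 al).
    by move=> sab'; have [/(_ al)] := D s sab'.
  have D2 s : a < s < b -> is_derive s 1 (fun s => dcurve Psi gam s 0 al) (kap ^+ 2 * Psi (gam s) 0 al).
    by move=> sab'; have [_ /(_ al)] := D s sab'; rewrite L.
  by rewrite (ode_hyperbolic kp D1 D2 sab tab) /hg !mxE.
(* The data at the middle are transported to parameter 0 along the hyperboloid geodesic, which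
   exists for all times. *)
exists kap, (hg kap P1 w1 (- s0)), (dhg kap P1 w1 (- s0)); split.
- exact: hyp_shift.
- by move=> t tab; rewrite E// -hg_shift// addrC.
- exact: lc.
Qed.

(** * Arcs do not return to their endpoints *)

Section NoReturn.
Hypothesis Mconvex : convex_manifold g.

Lemma geodesic_unique p q gam gam' t : geodesic g p q gam -> geodesic g p q gam' ->
  0 <= t <= 1 -> gam t = gam' t.
Proof.
move=> H H' t01; have [[c _ Hc] _] := Mconvex p q.
by rewrite (Hc _ H) ?(Hc _ H')// in_itv.
Qed.

Lemma level_compact p gam : {within `[0, 1], continuous gam} ->
  compact ([set` `[0, 1]] `&` [set t : R | gam t = p]).
Proof.
move=> cg; have -> : [set` `[0, 1]] `&` [set t : R | gam t = p] =
    [set` `[0, 1]] `&` (gam \o clamp01) @^-1` [set p].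
  by apply/seteqP; split => t [/= t01 E]; split => //=; move: t01 E; rewrite in_itv /= => /clamp01_id ->.
apply: compact_closedI; first exact: segment_compact.
apply: closed_comp; first by move=> t _; exact: ((within01P gam).1 cg t).
by apply: compact_closed; [exact: (@manifold_hausdorff _ _ _ X)|exact: compact_set1].
Qed.

(** Let T be the last time at [p]. The rest of the arc, reparametrized, is again a geodesic from [p]
    to [q], so gam(t) = gam(T + (1 - T) t); a return at [t] > 0 would give one later than T. *)
Lemma geodesic_noreturn p q gam t : geodesic g p q gam -> p <> q -> 0 < t <= 1 -> gam t <> p.
Proof.
move=> Hg pq t01; have [g0 g1 cg _] := Hg.
have ne : ([set` `[0, 1]] `&` [set t : R | gam t = p]) !=set0.
  by exists 0; split => //=; rewrite in_itv /= lexx ler01.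
have [|T] := compact_EVT_max (f := id) ne (@level_compact p _ cg).
  by apply: continuous_subspaceT => x; exact: cvg_id.
rewrite inE => -[/= + gT] Tmax; rewrite in_itv /= => /andP[T0 T1].
have T1' : T < 1.
  rewrite lt_neqAle T1 andbT; apply/eqP => TE; apply: pq.
  by rewrite -gT TE.
have Hs := subgeodesic Hg T0 T1' (lexx 1); rewrite gT g1 in Hs.
case/andP: t01 => t0 t1; have t01 : 0 <= t <= 1 by rewrite (ltW t0).
rewrite (geodesic_unique Hg Hs t01) => gE.
have : T + (1 - T) * t <= T.
  apply: Tmax; rewrite inE; split => //=; rewrite in_itv /=; apply/andP; split; nra.
by rewrite gerDl pmulr_rle0 ?subr_gt0// leNgt t0.
Qed.

Lemma geodesic_noreturn_end p q gam t : geodesic g p q gam -> p <> q -> 0 <= t < 1 -> gam t <> q.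
Proof.
move=> Hg pq t01; have [g0 g1 cg _] := Hg.
have ne : ([set` `[0, 1]] `&` [set t : R | gam t = q]) !=set0.
  by exists 1; split => //=; rewrite in_itv /= lexx ler01.
have [|T] := compact_EVT_min (f := id) ne (@level_compact q _ cg).
  by apply: continuous_subspaceT => x; exact: cvg_id.
rewrite inE => -[/= + gT] Tmin; rewrite in_itv /= => /andP[T0 T1].
have T0' : 0 < T.
  rewrite lt_neqAle T0 andbT; apply/eqP => TE; apply: pq.
  by rewrite -gT -TE.
have Hs := subgeodesic Hg (lexx 0) T0' T1; rewrite gT g0 in Hs.
case/andP: t01 => t0 t1; have t01 : 0 <= t <= 1 by rewrite t0 ltW.
rewrite (geodesic_unique Hg Hs t01) subr0 add0r => gE.
have : T <= T * t.
  apply: Tmin; rewrite inE; split => //=; rewrite in_itv /=; apply/andP; split; nra.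
by rewrite -{1}[T]mulr1 ler_pM2l// leNgt t1.
Qed.

(** Convexity restricts which points of the arc lie on the boundary; the two preceding lemmas turn
    this into a statement about parameters. *)
Lemma geodesic_interior p q gam t : geodesic g p q gam -> p <> q -> 0 < t < 1 ->
  ~ boundary X (gam t).
Proof.
move=> Hg pq /andP[t0 t1] bt; have [_ /(_ (gam t))] := Mconvex p q.
have t01 : 0 <= t <= 1 by rewrite !ltW.
move=> []; first by split => //; exists gam, t.
  by apply: (geodesic_noreturn Hg pq); rewrite t0 ltW.
by apply: (geodesic_noreturn_end Hg pq); rewrite t1 ltW.
Qed.

End NoReturn.

End GeodesicsInDev.

(** * The developing map *)

Lemma near_eq_continuous {T U : topologicalType} (f h : T -> U) (t : T) :
  (\forall s \near t, f s = h s) -> {for t, continuous f} -> {for t, continuous h}.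
Proof.
move=> E cf; rewrite /prop_for /continuous_at -(nbhs_singleton E).
exact: (cvg_trans (near_eq_cvg E) cf).
Qed.

Section Logarithm.
Context {R : realType} {n : nat}.
Variable B : 'M[R]_n.
Hypotheses (BT : B^T = B) (LB : lorentz B).

(** Write Z = z O + N with N orthogonal to O. Negative definiteness forces z >= 1, so z is the cosh
    of a distance, and the initial velocity is a multiple of N. *)
Lemma log_exists (O Z : 'rV[R]_n) : bil B O O = 1 -> bil B Z Z = 1 -> 0 < bil B Z O ->
  exists w, hyp B (arch (bil B Z O)) O w /\ hg (arch (bil B Z O)) O w 1 = Z.
Proof.
move=> OO ZZ; set z := bil B Z O => z0; pose N := Z - z *: O.
have ON : bil B O N = 0.
  by rewrite bilDr bilNr bilZr OO mulr1 (bilC O Z BT) subrr.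
have NN : bil B N N = 1 - z ^+ 2.
  rewrite /N bilDl bilNl !bilDr !bilNr !bilZr !bilZl ZZ OO (bilC O Z BT) -/z; ring.
have ZE : Z = z *: O + N by rewrite addrC subrK.
have z1 : 1 <= z.
  rewrite leNgt; apply/negP => z1; have N0 : N = 0.
    by apply: (LB OO ON); rewrite NN expr2; nra.
  by move: NN; rewrite N0 bil0l expr2; nra.
have cz := ch_arch z1; have k0 := arch_ge0 z1; have [kz|kn] := eqVneq (arch z) 0.
  have z1' : z = 1 by rewrite -cz kz ch0.
  have N0 : N = 0 by apply: (LB OO ON); rewrite NN z1'; lra.
  exists 0; rewrite kz; split; last by rewrite /hg scaler0 addr0 mul0r ch0 ZE N0 addr0 z1'.
  by split => //; rewrite ?bil0r// expr0n oppr0.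
have kp : 0 < arch z by rewrite lt_neqAle eq_sym kn.
have sn : sh (arch z) != 0 by rewrite gt_eqF// sh_gt0.
exists ((arch z / sh (arch z)) *: N); split; last first.
  rewrite /hg mulr1 scalerA cz [RHS]ZE; congr (_ + _).
  by rewrite mulrA divfK// divff// scale1r.
split => //; first by rewrite bilZr ON mulr0.
  rewrite bilZl bilZr NN; have -> : 1 - z ^+ 2 = - sh (arch z) ^+ 2.
    by have := ch2_sh2 (arch z); rewrite cz; lra.
  by field.
by move=> /eqP; rewrite (negbTE kn).
Qed.

(** Expresses an intermediate point by the endpoint [Z] instead of the velocity, so that its
    continuous dependence on [Z] becomes visible. *)
Lemma hg_log (O Z w : 'rV[R]_n) kap tau : kap != 0 -> 0 <= kap -> hg kap O w 1 = Z ->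
  hg kap O w tau = ch (kap * tau) *: O + (sh (kap * tau) / sh kap) *: (Z - ch kap *: O).
Proof.
move=> kn k0 <-; have kp : 0 < kap by rewrite lt_neqAle eq_sym kn.
have sn : sh kap != 0 by rewrite gt_eqF// sh_gt0.
have -> : hg kap O w 1 - ch kap *: O = (sh kap / kap) *: w.
  by rewrite /hg mulr1 addrAC subrr add0r.
rewrite /hg scalerA; congr (_ + _ *: _).
by rewrite mulrA divfK.
Qed.

End Logarithm.

Lemma continuous_bil {R : realType} {n : nat} {T : topologicalType} (B : 'M[R]_n) (F : T -> 'rV[R]_n)
  (Q : 'rV[R]_n) (p : T) : (forall al, {for p, continuous (fun q => F q 0 al)}) ->
  {for p, continuous (fun q => bil B (F q) Q)}.
Proof.
move=> cF; have -> : (fun q => bil B (F q) Q) = (fun q => \sum_a F q 0 a * (B *m Q^T) a 0).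
  by apply/funext => q; rewrite /bil -mulmxA mxE.
apply: continuous_sum_at => a; apply: continuousM; first exact: cF.
exact: cst_continuous.
Qed.

Lemma arch_continuous {R : realType} (z : R) : 1 < z -> {for z, continuous (@arch R)}.
Proof.
move=> z1; apply: (@continuous_comp _ _ _ (fun z : R => z + Num.sqrt (z ^+ 2 - 1)) (@ln R)).
  apply: continuousD; first exact: cvg_id.
  apply: (@continuous_comp _ _ _ (fun z : R => z ^+ 2 - 1) Num.sqrt); last exact: sqrt_continuous.
  by apply: continuousB; [exact: exprn_continuous|exact: cst_continuous].
by apply: continuous_ln; rewrite ltr_wpDr ?sqrtr_ge0//; lra.
Qed.

Lemma congruence_inv {R : comUnitRingType} {n : nat} (T P B C : 'M[R]_n) : T \in unitmx ->
  P *m B *m P^T = T *m C *m T^T -> (invmx T *m P) *m B *m (invmx T *m P)^T = C.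
Proof.
move=> uT E; have -> : invmx T *m P *m B *m (invmx T *m P)^T = invmx T *m (P *m B *m P^T) *m (invmx T)^T.
  by rewrite trmx_mul !mulmxA.
by rewrite E trmx_inv -!mulmxA mulmxV ?unitmx_tr// mulmx1 mulKmx.
Qed.

Section Developing.
Context {R : realType} {m : nat} {M : topologicalType} {X : manifold R m M}.
Variables (g : riemannian_metric X) (k : R).
Hypotheses (hk : 0 < k) (Mcurv : constant_sectional_curvature g (- k ^+ 2)).
Hypothesis Mconvex : convex_manifold g.
Variables (B : 'M[R]_(1 + m)) (o : M) (O : 'rV[R]_(1 + m)).
Hypotheses (BT : B^T = B) (LB : lorentz B).
Variables (U0 : set M) (Psi0 : M -> 'rV[R]_(1 + m)) (i0 : chart X) (eta0 L0 : R).
Hypotheses (HB0 : nball g k B U0 Psi0 i0 O eta0 L0) (U0o : U0 o) (P0o : Psi0 o = O).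
Implicit Types (i j : chart X) (p q : M).

Let OO : bil B O O = 1.
Proof. by rewrite -P0o; exact: mdev_form (nball_dev HB0) U0o. Qed.

Definition ray q : R -> M := projT1 (cid2 (proj1 (Mconvex o q))).

Lemma ray_geodesic q : geodesic g o q (ray q).
Proof. by rewrite /ray; case: cid2. Qed.

Lemma within01_near0 {T : topologicalType} (gam : R -> T) (U : set T) : {within `[0, 1], continuous gam} ->
  open U -> U (gam 0) -> exists2 e : R, 0 < e & forall s, 0 <= s < e -> s <= 1 /\ U (gam s).
Proof.
move=> /within01P cg oU Ug; have : nbhs (0 : R) ((gam \o clamp01) @^-1` U).
  by apply: cg; rewrite /= clamp01_id ?lexx ?ler01//; exact: open_nbhs_nbhs.
move=> /nbhs_normP[r /= r0 rP]; exists (Num.min r 1); first by rewrite lt_min r0 ltr01.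
move=> s /andP[s0]; rewrite lt_min => /andP[sr s1]; split; first exact: ltW.
have := rP s; rewrite /ball_ /= sub0r normrN ger0_norm// clamp01_id; first exact.
by rewrite s0 ltW.
Qed.

(** The geodesic equation says nothing at parameter 0, so the initial velocity is read off small
    positive parameters; continuity at 0 then identifies the starting point with [O]. *)
Lemma germ q : exists kw : R * 'rV[R]_(1 + m), hyp B kw.1 O kw.2 /\
  exists2 e : R, 0 < e & forall s, 0 < s < e -> Psi0 (ray q s) = hg kw.1 O kw.2 s.
Proof.
have Hg := ray_geodesic q; have [g0 g1 cg _] := Hg; have [oU Ub _] := nball_dev HB0.
have [e e0 He] : exists2 e : R, 0 < e & forall s, 0 <= s < e -> s <= 1 /\ U0 (ray q s).
  by apply: within01_near0 => //; rewrite g0.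
pose b := Num.min e 1; have b0 : 0 < b by rewrite lt_min e0 ltr01.
have b1 : b <= 1 by rewrite ge_min lexx orbT.
have Hb t : 0 < t < b -> U0 (ray q t).
  move=> /andP[t0 tb]; apply: (He t _).2; rewrite (ltW t0) (lt_le_trans tb)//.
  by rewrite ge_min lexx.
have [kap [P [w [Hh HP _]]]] := geod_hg hk Mcurv BT LB (nball_dev HB0) Hg (lexx 0) b0 b1 Hb.
have PO : P = O.
  apply/rowP => al; have [_ _ _ _ kw] := Hh.
  have := @continuous_agree _ (fun s => hg kap P w s 0 al) (fun s => Psi0 ((ray q \o clamp01) s) 0 al) 0.
  rewrite hg0 /= clamp01_id ?lexx ?ler01// g0 P0o; apply.
  - exact: is_derive_continuous (is_derive_hg 0 P al kw).
  - apply: (@continuous_comp _ _ _ (ray q \o clamp01) (fun p => Psi0 p 0 al)).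
      exact: (within01P _).1 cg 0.
    by rewrite /= clamp01_id ?lexx ?ler01// g0; exact: mdev_continuous (nball_dev HB0) U0o.
  - move=> d d0; pose s := Num.min b d / 2; have m0 : 0 < Num.min b d by rewrite lt_min b0.
    have s0 : 0 < s by rewrite divr_gt0.
    have : s < Num.min b d by rewrite ltr_pdivrMr// ltr_pMr// ltr1n.
    rewrite lt_min => /andP[sb sd]; exists s; first by rewrite subr0 gtr0_norm.
    rewrite /= clamp01_id; last by rewrite (ltW s0) (le_trans (ltW sb)).
    by rewrite HP// s0.
by rewrite PO in Hh HP; exists (kap, w); split => //; exists b.
Qed.

Definition kray q : R := (projT1 (cid (germ q))).1.
Definition wray q : 'rV[R]_(1 + m) := (projT1 (cid (germ q))).2.

(* The initial velocity of the ray from o to q is read off Psi0 near o; Phi follows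
   the corresponding geodesic of the hyperboloid for the same time. *)
Definition Phi q := hg (kray q) O (wray q) 1.

Lemma hyp_ray q : hyp B (kray q) O (wray q).
Proof. by rewrite /kray /wray; case: cid => x []. Qed.

Lemma ray_germ q : exists2 e : R, 0 < e & forall s, 0 < s < e -> Psi0 (ray q s) = hg (kray q) O (wray q) s.
Proof. by rewrite /kray /wray; case: cid => x []. Qed.

Lemma germ_unique q c kap w (e : R) : geodesic g o q c -> 0 < e -> hyp B kap O w ->
  (forall s, 0 < s < e -> Psi0 (c s) = hg kap O w s) -> kray q = kap /\ wray q = w.
Proof.
move=> Hc e0 Hh He; have [d d0 Hd] := ray_germ q.
pose s := Num.min (Num.min e d) 1 / 2.
have m0 : 0 < Num.min (Num.min e d) 1 by rewrite !lt_min e0 d0 ltr01.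
have s0 : 0 < s by rewrite divr_gt0.
have : s < Num.min (Num.min e d) 1 by rewrite ltr_pdivrMr// ltr_pMr// ltr1n.
rewrite !lt_min => /andP[/andP[se sd] s1].
apply: (hyp_inj BT s0 (hyp_ray q) Hh); rewrite -Hd ?s0// -He ?s0//; congr Psi0.
by apply: (geodesic_unique Mconvex (ray_geodesic q) Hc); rewrite !ltW.
Qed.

Lemma Phi_curve q c kap w (e : R) : geodesic g o q c -> 0 < e -> hyp B kap O w ->
  (forall s, 0 < s < e -> Psi0 (c s) = hg kap O w s) -> Phi q = hg kap O w 1.
Proof. by move=> Hc e0 Hh He; rewrite /Phi; have [-> ->] := germ_unique Hc e0 Hh He. Qed.

Lemma ray_sub q s : 0 < s <= 1 -> kray (ray q s) = s * kray q /\ wray (ray q s) = s *: wray q.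
Proof.
move=> /andP[s0 s1]; have [d d0 Hd] := ray_germ q.
have [r0 _ _ _] := ray_geodesic q.
have := subgeodesic (ray_geodesic q) (lexx 0) s0 s1; rewrite r0 => Hs.
apply: (germ_unique Hs d0 (hyp_scale s0 (hyp_ray q))) => t /andP[t0 td].
rewrite hg_scale ?gt_eqF// subr0 add0r Hd// mulr_gt0//=.
by apply: le_lt_trans td; rewrite ler_piMl// ltW.
Qed.

Lemma Phi_o : Phi o = O.
Proof.
have Hh : hyp B 0 O 0 by split => //; rewrite ?bil0r// expr0n oppr0.
rewrite (Phi_curve (cst_geodesic g o) ltr01 Hh); first by rewrite /hg mul0r ch0 scaler0 addr0 scale1r.
by move=> s _; rewrite /hg mul0r ch0 scaler0 addr0 scale1r.
Qed.

Lemma Phi_ray q s : 0 <= s <= 1 -> Phi (ray q s) = hg (kray q) O (wray q) s.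
Proof.
move=> /andP[]; rewrite le_eqVlt => /predU1P[<-|s0] s1.
  by have [-> _ _ _] := ray_geodesic q; rewrite Phi_o hg0.
have [E1 E2] := @ray_sub q s ltac:(by rewrite s0).
by rewrite /Phi E1 E2 hg_scale ?gt_eqF// mulr1.
Qed.

(** The hyperboloid geodesic from [O] to [Psi0 q] stays in the cap and lifts to a geodesic from [o]
    to [q], which must be the ray. *)
Lemma Phi_base q : U0 q -> Phi q = Psi0 q.
Proof.
move=> Uq; have /andP[c0 c1] := nball_cap HB0 Uq.
have [w [Hh Z1]] := log_exists BT LB OO (mdev_form (nball_dev HB0) Uq) c0.
set kap := arch _ in Hh Z1.
have [c Hc] := nball_lift hk Mcurv BT HB0 Hh.
have k0 : 0 <= kap by case: Hh.
have cap t : 0 <= t <= 1 -> 0 < bil B (hg kap O w t) O < 1 + eta0.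
  move=> /andP[t0 t1]; have := bil_hg BT t 0 Hh; rewrite hg0 subr0 => ->; rewrite ch_gt0/=.
  apply: (@le_lt_trans _ _ (ch kap)); first by apply: ch_le; [rewrite mulr_ge0|rewrite ler_piMr].
  have := bil_hg BT 1 0 Hh; rewrite hg0 subr0 mulr1 => <-.
  by rewrite Z1.
have e0 : c 0 = o.
  have [U E _ _] := Hc 0 (cap 0 ltac:(by rewrite lexx ler01)).
  by apply: (nball_inj HB0) => //; rewrite E hg0 P0o.
have e1 : c 1 = q.
  have [U E _ _] := Hc 1 (cap 1 ltac:(by rewrite lexx ler01)).
  by apply: (nball_inj HB0) => //; rewrite E.
have Hg : geodesic g o q c.
  apply/geodesicP; split => //.
    apply: continuous_in_subspaceT => t; rewrite inE /= in_itv /= => /cap/Hc[_ _ + _].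
    exact.
  by move=> t i /andP[t0 t1] dt; have [_ _ _] := Hc t (cap t ltac:(by rewrite !ltW)); exact.
rewrite -Z1; apply: (Phi_curve Hg ltr01 Hh) => s /andP[s0 s1].
by have [_ ->] := Hc s (cap s ltac:(by rewrite !ltW)).
Qed.

Lemma ray_near1 q (U : set M) : open U -> U q -> exists2 e : R, 0 < e &
  forall s, 1 - e < s <= 1 -> 0 < s /\ U (ray q s).
Proof.
move=> oU Uq; have [_ r1 /within01P cg _] := ray_geodesic q.
have : nbhs (1 : R) ((ray q \o clamp01) @^-1` U).
  by apply: cg; rewrite /= clamp01_id ?lexx ?ler01// r1; exact: open_nbhs_nbhs.
move=> /nbhs_normP[r /= r0 rP]; exists (Num.min r 1); first by rewrite lt_min r0 ltr01.
move=> s /andP[se s1]; have : 1 - s < Num.min r 1 by rewrite ltrBlDr addrC -ltrBlDr.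
rewrite lt_min => /andP[sr s0']; have s0 : 0 < s by lra.
split => //; have := rP s; rewrite /ball_ /= ger0_norm ?subr_ge0// clamp01_id; first exact.
by rewrite s1 ltW.
Qed.

Section Step.
Variables (U : set M) (Th : M -> 'rV[R]_(1 + m)) (i : chart X) (P : 'rV[R]_(1 + m)) (eta L : R).
Hypothesis HB : nball g k B U Th i P eta L.

(* The geodesic from o to q' is the concatenation of the one to p'' and of the
   lift of a hyperbolic segment. *)
Lemma Phi_step p q kap w tau : U p -> U q -> (\forall x \near p, Phi x = Th x) ->
  hyp B kap O w -> hg kap O w 1 = Th q -> 0 < tau < 1 -> hg kap O w tau = Th p -> Phi q = Th q.
Proof.
move=> Up Uq Np Hh E1 /andP[t0 t1] Et; have [oU Ub _] := nball_dev HB.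
have [kp wp] : kray p = tau * kap /\ wray p = tau *: w.
  apply: (hyp_inj BT ltr01 (hyp_ray p) (hyp_scale t0 Hh)).
  by rewrite hg_scale ?gt_eqF// mulr1 Et -(nbhs_singleton Np).
have tn : tau != 0 by rewrite gt_eqF.
have ti0 : 0 < tau^-1 by rewrite invr_gt0.
have HR s : hg (kray p) O (wray p) (tau^-1 * s) = hg kap O w s.
  by rewrite kp wp hg_scale// mulVKf.
have [c2 Hc2] := nball_lift hk Mcurv BT HB Hh.
(* Both ends of the remaining segment lie in the convex cap, so the lift [c2] is meaningful on all
   of [tau, 1]. *)
have cap s : tau <= s <= 1 -> 0 < bil B (hg kap O w s) P < 1 + eta.
  move=> st; apply: (hg_cap Hh st); first by rewrite Et; exact: (nball_cap HB).
  by rewrite E1; exact: (nball_cap HB).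
pose h (u : R) := ray p (clamp01 (tau^-1 * u)).
pose c (s : R) := if s < tau then ray p (tau^-1 * s) else c2 s.
have ch' s : 0 <= s -> s < tau -> c s = h s.
  move=> s0 st; rewrite /c st /h clamp01_id// mulr_ge0 ?(ltW ti0)//=.
  by rewrite mulrC ler_pdivrMr// mul1r ltW.
(* Just before [tau] the ray already agrees with the lift, because [Phi] = [Th] near [p] and [Th] is
   injective on [U]. Hence the glued curve has no corner. *)
have [d d0 Hd] : exists2 d : R, 0 < d & forall s, `|s - tau| < d -> c s = c2 s.
  have : nbhs p (U `&` [set x | Phi x = Th x]).
    by apply: filterI => //; exact: open_nbhs_nbhs.
  rewrite nbhsE => -[V [oV Vp] VU].
  have [e e0 He] := ray_near1 oV Vp.
  exists (tau * e) => [|s]; first by rewrite mulr_gt0.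
  rewrite /c; have [st|//] := ltP s tau; rewrite ler0_norm ?subr_le0 ?ltW// opprB => sd.
  have [|s0 /VU[Ur Pr]] := He (tau^-1 * s).
    apply/andP; split; last by rewrite mulrC ler_pdivrMr// mul1r ltW.
    by rewrite mulrC ltr_pdivlMr//; move: sd; rewrite mulrBl mul1r (mulrC e); lra.
  have hs : Th (ray p (tau^-1 * s)) = hg kap O w s.
    rewrite -HR -Phi_ray// (ltW s0)/=; by rewrite mulrC ler_pdivrMr// mul1r ltW.
  have [|U2 P2 _ _] := Hc2 s; first by rewrite -hs; exact: (nball_cap HB).
  by apply: (nball_inj HB) => //; rewrite P2.
have c0 : c 0 = o.
  by rewrite /c t0 mulr0; have [-> _ _ _] := ray_geodesic p.
have c1 : c 1 = q.
  rewrite /c ltNge (ltW t1) /=; have [|U2 P2 _ _] := Hc2 1; first by apply: cap; rewrite lexx ltW.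
  by apply: (nball_inj HB) => //; rewrite P2.
have cc : {within `[0, 1], continuous c}.
  apply/within01P => t; have [st|st] := ltP (clamp01 t) tau.
    have N : \forall s \near t, (h \o clamp01) s = (c \o clamp01) s.
      have cl : {for t, continuous clamp01} by exact: continuous_clamp01.
      have : nbhs (clamp01 t) [set u : R | u < tau].
        by apply: open_nbhs_nbhs; split => //; exact: open_lt.
      move=> N0; have N1 : nbhs t [set s | clamp01 s < tau] by exact: (cl _ N0).
      apply: (filterS _ N1) => s /= ss; rewrite ch'//.
      by have /andP[] := clamp01_in s.
    apply: near_eq_continuous N _.
    have -> : h \o clamp01 = (ray p \o clamp01) \o (fun s => tau^-1 * clamp01 s) by [].
    apply: continuous_comp; last first.
      by have [_ _ /within01P + _] := ray_geodesic p; apply.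
    by apply: continuousM; [exact: cst_continuous|exact: continuous_clamp01].
  have /andP[_ ct1] := clamp01_in t; have [U2 _ cc2 _] := Hc2 _ (cap (clamp01 t) ltac:(by rewrite st ct1)).
  apply: continuous_comp; first exact: continuous_clamp01.
  apply: near_eq_continuous cc2; move: st; rewrite le_eqVlt => /predU1P[<-|st].
    by apply/nbhs_normP; exists d => // s; rewrite /ball_ /= distrC => /Hd.
  have : nbhs (clamp01 t) [set u : R | tau < u] by apply: open_nbhs_nbhs; split => //; exact: open_gt.
  by apply: filterS => s /= ts; rewrite /c ltNge (ltW ts).
have Hg : geodesic g o q c.
  apply/geodesicP; split => // t j /andP[tt0 tt1] dt; have [st|st] := ltP t tau.
    have [_ _ _ Hr] := (geodesicP _ _ _ _).1 (ray_geodesic p).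
    have tr : 0 < 0 + tau^-1 * t < 1 by rewrite add0r mulr_gt0//= mulrC ltr_pdivrMr// mul1r.
    have dr : dom j (ray p (0 + tau^-1 * t)) by move: dt; rewrite /c st add0r.
    have st' : 0 < tau - t by rewrite subr_gt0.
    apply: (geo_pt_local st') (geo_pt_affine ti0 (Hr _ j tr dr)) => s.
    by rewrite ltr_norml add0r /c => /andP[_ sd]; have -> : s < tau by lra.
  have [|U2 _ _ G2] := Hc2 t; first by apply: cap; rewrite st ltW.
  have [e e0 He] : exists2 e : R, 0 < e & forall s, `|s - t| < e -> c2 s = c s.
    move: st; rewrite le_eqVlt => /predU1P[<-|st]; first by exists d => // s /Hd.
    exists (t - tau) => [|s]; first by rewrite subr_gt0.
    by rewrite ltr_norml /c => /andP[sd _]; have -> : (s < tau) = false by apply/negbTE; rewrite -leNgt; lra.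
  apply: (geo_pt_local e0 He); apply: G2; rewrite He// subrr normr0; exact: e0.
have [e e0 He] := ray_germ p.
have m0 : 0 < Num.min (tau * e) tau by rewrite lt_min t0 mulr_gt0.
rewrite -E1; apply: (Phi_curve Hg m0 Hh) => s /andP[s0]; rewrite lt_min => /andP[se st].
by rewrite /c st He ?HR// mulr_gt0//= mulrC ltr_pdivrMr// mulrC.
Qed.

End Step.

(** At speed zero the ray would stay at [o] for small parameters, against [geodesic_noreturn]. *)
Lemma ray_pos q : q <> o -> 0 < kray q.
Proof.
move=> qo; have [k0 _ _ _ kw] := hyp_ray q; rewrite lt_neqAle k0 andbT eq_sym; apply/eqP => kz.
have [r0 _ cg _] := ray_geodesic q; have [oU _ _] := nball_dev HB0.
have [e e0 He] : exists2 e : R, 0 < e & forall s, 0 <= s < e -> s <= 1 /\ U0 (ray q s).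
  by apply: within01_near0 => //; rewrite r0.
have [d d0 Hd] := ray_germ q.
pose s := Num.min e d / 2; have m0 : 0 < Num.min e d by rewrite lt_min e0.
have s0 : 0 < s by rewrite divr_gt0.
have : s < Num.min e d by rewrite ltr_pdivrMr// ltr_pMr// ltr1n.
rewrite lt_min => /andP[se sd]; have [s1 Us] := He s ltac:(by rewrite (ltW s0) se).
apply: (@geodesic_noreturn _ _ _ _ g Mconvex _ _ _ s (ray_geodesic q)).
- by move=> oq; apply: qo.
- by rewrite s0 s1.
apply: (nball_inj HB0) => //; rewrite Hd ?s0// P0o /hg kz (kw kz) scaler0 addr0 mul0r ch0.
by rewrite scale1r.
Qed.

Definition dev_at q := exists2 U, U q & mdev g k B U Phi.

Lemma ray_near q T (U : set M) : 0 <= T <= 1 -> open U -> U (ray q T) -> exists2 e : R, 0 < e &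
  forall t, 0 <= t <= 1 -> `|t - T| < e -> U (ray q t).
Proof.
move=> T01 oU UT; have [_ _ /within01P cg _] := ray_geodesic q.
have : nbhs T ((ray q \o clamp01) @^-1` U).
  by apply: cg; rewrite /= clamp01_id//; exact: open_nbhs_nbhs.
move=> /nbhs_normP[r /= r0 rP]; exists r => // t t01 tT.
by have := rP t; rewrite /ball_ /= distrC clamp01_id//; apply.
Qed.

(** [A] is the linear map that matches the jets of the two immersions at [p']; since both jets pull
    their form back to the same [Dm], it is an isometry of the forms, and [mdev_unique] gives
    agreement near [p']. *)
Lemma nball_match Bp Up Th i P eta L V Psi p' : nball g k Bp Up Th i P eta L -> mdev g k B V Psi ->
  Up p' -> V p' -> exists A L', nball g k B Up (fun p => Th p *m A) i (P *m A) eta L' /\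
    nbhs p' [set y | Psi y = Th y *m A].
Proof.
move=> HBp HV Up' Vp'; have [oUp Ubp HDp] := nball_dev HBp.
have [oV Vb HDV] := HV; have dp' : dom i p' by exact: (nball_dom HBp).
pose x' := cmap i p'.
have Wx U : U `<=` ~` boundary X -> U p' -> chartset i U x'.
  by move=> Ub Uup; split; [exact: interior_inner (Ub _ Uup) dp'|rewrite /= cmapK].
pose JT := jet (Th \o par i) x'; pose JP := jet (Psi \o par i) x'.
have HG := gmx_hyperbolic i Mcurv; have k2 : 0 < k ^+ 2 by rewrite exprn_gt0.
have [uT _] := jet_units HG k2 (HDp i) (Wx _ Ubp Up').
have [uP _] := jet_units HG k2 (HDV i) (Wx _ Vb Vp').
pose A := invmx JT *m JP.
have uA : A \in unitmx by rewrite unitmx_mul unitmx_inv uT uP.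
have AB : A *m B *m A^T = Bp.
  have [_ _ _ H1] := HDp i; have [_ _ _ H2] := HDV i.
  have E : JP *m B *m JP^T = JT *m Bp *m JT^T by exact: etrans (H2 _ (Wx _ Vb Vp')) (esym (H1 _ (Wx _ Ubp Up'))).
  exact: (congruence_inv uT E).
have [L' HB'] := nball_transform uA AB HBp; exists A, L'; split => //.
pose Th' := fun p => Th p *m A.
have oVU : open (V `&` Up) by exact: openI.
have HV1 := mdev_sub oVU (@subIsetl _ _ _) HV.
have HV2 := mdev_sub oVU (@subIsetr _ _ _) (nball_dev HB').
have JE : jet (Psi \o par i) x' = jet (Th' \o par i) x'.
  have [_ _ CP _] := HDp i.
  have := jet_mulmx A (Wx _ Ubp Up') (fun a b => CnS (CP a b)); rewrite /A => E.
  by apply: etrans _ (esym E); rewrite mulKVmx.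
exact: (mdev_unique hk Mcurv BT dp' HV1 HV2 (conj Vp' Up') JE).
Qed.

(** A normal ball at p = ray q T is matched with [Phi] at an earlier point p' of the ray. For [y]
    near [p], the geodesic of the hyperboloid from [O] to [Th' y] passes near [Th' p'], where [Phi]
    and [Th'] already agree, so [Phi_step] gives [Phi y] = [Th' y]. *)
Lemma dev_extend q T : q <> o -> 0 < T <= 1 -> ~ boundary X (ray q T) ->
  (forall t, 0 <= t < T -> dev_at (ray q t)) -> dev_at (ray q T).
Proof.
move=> qo /andP[T0 T1] nb HS; set p := ray q T.
have [Up [Th [eta [etap Upp Thp HBp BpT]]]] := nball_exists hk Mcurv nb.
set i := chart_at X p in HBp BpT; set Bp := Dm _ _ _ in HBp BpT.
have [oUp Ubp HDp] := nball_dev HBp.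
have T01 : 0 <= T <= 1 by rewrite (ltW T0).
have [e e0 He] := ray_near T01 oUp Upp.
(* A positive parameter before [T], close enough for the ray to lie in [Up] from there on. *)
pose T' := Num.max (T / 2) (T - e / 2).
have T'T : T' < T by rewrite gt_max; apply/andP; split; lra.
have T'0 : 0 < T' by rewrite lt_max divr_gt0.
have T'e : `|T' - T| < e.
  rewrite ler0_norm ?subr_le0 ?ltW// opprB; have : T - e / 2 <= T' by rewrite le_max lexx orbT.
  by move=> *; lra.
have [V Vp' HV] := HS T' ltac:(by rewrite (ltW T'0)); set p' := ray q T' in Vp'.
have T'1 : T' <= 1 by lra.
have Up' : Up p' by apply: He T'e; rewrite (ltW T'0).
have [A [L' [HB' NN]]] := nball_match HBp HV Up' Vp'.
set Th' := (fun p => Th p *m A) in HB' NN; set P' := origin *m A in HB'.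
move: NN; rewrite nbhsE => -[N [oN Np'] NE].
have T'01 : 0 <= T' <= 1 by rewrite (ltW T'0).
have [d d0 Hd] := ray_near T'01 oN Np'.
have Hw := hyp_ray q; have kp := ray_pos qo; set kap := kray q in Hw kp; set w := wray q in Hw.
have kn : kap != 0 by rewrite gt_eqF.
pose a := Num.max 0 (T - e).
have a0 : 0 <= a by rewrite le_max lexx.
have aT' : a < T' by rewrite gt_max T'0 /=; move: T'e; rewrite ltr_norml => /andP[+ _]; lra.
have aT : a < T by rewrite (lt_trans aT').
have Hab t : a < t < T -> Up (ray q t).
  move=> /andP[ta tT]; have t0 : 0 <= t by rewrite (le_trans a0)// ltW.
  apply: He; first by rewrite t0 (le_trans (ltW tT)).
  rewrite ler0_norm ?subr_le0 ?ltW// opprB; have : T - e <= a by rewrite le_max lexx orbT.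
  by move=> *; lra.
have [k1 [P1 [w1 [H1 E1 _]]]] := geod_hg hk Mcurv BT LB (nball_dev HB') (ray_geodesic q) a0 aT T1 Hab.
(* Near [T'] the ray has the same image under [Th'] and [Phi], so the two hyperboloid geodesics
   share two points and coincide by [hyp_germ]. *)
have E2 u : hg k1 P1 w1 u = hg kap O w u.
  pose s2 := T' + Num.min d (T - T') / 2.
  have m0 : 0 < Num.min d (T - T') by rewrite lt_min d0 subr_gt0.
  have : Num.min d (T - T') / 2 < Num.min d (T - T') by rewrite ltr_pdivrMr// ltr_pMr// ltr1n.
  have h0 : 0 < Num.min d (T - T') / 2 by rewrite divr_gt0.
  rewrite lt_min => /andP[hd hT].
  have s2T : T' < s2 by rewrite ltrDl.
  have ag s : T' <= s <= s2 -> hg k1 P1 w1 s = hg kap O w s.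
    move=> /andP[s1 ss2]; have s01 : 0 <= s <= 1.
      by apply/andP; split; [rewrite (le_trans (ltW T'0))|apply: le_trans ss2 _; rewrite /s2; lra].
    rewrite -E1; last by rewrite (lt_le_trans aT')//=; apply: le_lt_trans ss2 _; rewrite /s2; lra.
    rewrite -Phi_ray//; apply: esym; apply: NE; apply: Hd s01 _.
    rewrite ger0_norm ?subr_ge0//; apply: le_lt_trans hd; move: ss2; rewrite /s2; lra.
  have [_ ->//] := hyp_germ BT s2T H1 Hw (ag T' ltac:(by rewrite lexx ltW)) (ag s2 ltac:(by rewrite lexx andbT ltW)).
have Tp : Th' p = hg kap O w T.
  apply/rowP => al.
  have := @continuous_agree _ (fun s => Th' ((ray q \o clamp01) s) 0 al) (fun s => hg kap O w s 0 al) T.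
  have cT : clamp01 T = T by rewrite clamp01_id// (ltW T0).
  rewrite /= cT; apply.
  - apply: (@continuous_comp _ _ _ (ray q \o clamp01) (fun p => Th' p 0 al)).
      by have [_ _ /within01P + _] := ray_geodesic q; apply.
    by rewrite /= cT; exact: mdev_continuous (nball_dev HB') Upp.
  - apply: is_derive_continuous (is_derive_hg T O al _).
    by move=> kz; rewrite kz eqxx in kn.
  - move=> c c0; pose s := T - Num.min c (T - a) / 2.
    have m0 : 0 < Num.min c (T - a) by rewrite lt_min c0 subr_gt0.
    have : Num.min c (T - a) / 2 < Num.min c (T - a) by rewrite ltr_pdivrMr// ltr_pMr// ltr1n.
    have h0 : 0 < Num.min c (T - a) / 2 by rewrite divr_gt0.
    rewrite lt_min => /andP[hc ha]; exists s.
      by rewrite /s addrAC subrr add0r normrN gtr0_norm.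
    have sa : a < s < T by rewrite /s; apply/andP; split; lra.
    rewrite clamp01_id; first by rewrite E1// E2.
    by case/andP: sa => *; apply/andP; split; lra.
pose z y := bil B (Th' y) O; have cTh al : {for p, continuous (fun y => Th' y 0 al)}.
  exact: mdev_continuous (nball_dev HB') Upp.
have cz : {for p, continuous z} by exact: continuous_bil.
have zp : z p = ch (kap * T) by rewrite /z Tp; have := bil_hg BT T 0 Hw; rewrite hg0 subr0.
have kT : 0 < kap * T by rewrite mulr_gt0.
have z1 : 1 < z p by rewrite zp -(ch0 (R := R)); exact: ch_lt.
have ca : {for p, continuous (fun y => arch (z y))}.
  by apply: continuous_comp; [exact: cz|exact: arch_continuous].
have zpk : arch (z p) = kap * T.
  by apply: ch_inj; rewrite ?arch_ge0 ?ltW// ch_arch// ltW.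
pose tau := T' / T; have tau0 : 0 < tau by rewrite divr_gt0.
have tau1 : tau < 1 by rewrite ltr_pdivrMr// mul1r.
have kTt : kap * T * tau = kap * T' by rewrite /tau; field; rewrite gt_eqF.
pose f1 y := ch (arch (z y) * tau); pose f2 y := sh (arch (z y) * tau) / sh (arch (z y)).
have cat_ : {for p, continuous (fun y => arch (z y) * tau)}.
  by apply: continuousM; [exact: ca|exact: cst_continuous].
have c1 : {for p, continuous f1}.
  by apply: (continuous_comp cat_); exact: is_derive_continuous (is_derive_ch _).
have c2 : {for p, continuous f2}.
  apply: continuousM; first by apply: (continuous_comp cat_); exact: is_derive_continuous (is_derive_sh _).
  apply: continuousV; first by rewrite gt_eqF// sh_gt0// zpk.
  by apply: (continuous_comp ca); exact: is_derive_continuous (is_derive_sh _).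
(* The point at fraction [tau] of the segment from [O] to [Th' y], in the form of [hg_log]. It
   depends continuously on [y] and equals [Th' p'] for [y] = [p]. *)
pose Y y := f1 y *: O + f2 y *: (Th' y - z y *: O).
have cY al : {for p, continuous (fun y => Y y 0 al)}.
  have -> : (fun y => Y y 0 al) = (fun y => f1 y * O 0 al + f2 y * (Th' y 0 al - z y * O 0 al)).
    by apply/funext => y; rewrite !mxE.
  apply: continuousD; first by apply: continuousM => //; exact: cst_continuous.
  apply: continuousM => //; apply: continuousB => //.
  by apply: continuousM => //; exact: cst_continuous.
have YE y v : hyp B (arch (z y)) O v -> 1 < z y -> hg (arch (z y)) O v 1 = Th' y ->
    hg (arch (z y)) O v tau = Y y.
  move=> [ka _ _ _ _] zy H; rewrite (hg_log tau _ ka H) ?ch_arch ?(ltW zy)//.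
  by apply/eqP => ay; have := ch_arch (ltW zy); rewrite ay ch0 => h; rewrite h ltxx in zy.
have Yp : Y p = Th' p'.
  have HwT := hyp_scale T0 Hw; rewrite mulrC in HwT.
  have HT1 : hg (kap * T) O (T *: w) 1 = Th' p by rewrite mulrC hg_scale ?gt_eqF// mulr1 Tp.
  have := YE p (T *: w); rewrite zpk => /(_ HwT z1 HT1) <-.
  rewrite mulrC hg_scale ?gt_eqF// [T * tau]mulrC divfK ?gt_eqF//.
  by apply: etrans _ (NE _ Np'); rewrite Phi_ray// (ltW T'0).
have [e1 e10 He1] := nball_inv_near HB' Up' (open_nbhs_nbhs (conj oN Np')).
have e12 : 0 < e1 / 2 by rewrite divr_gt0.
have near1 : nbhs p [set y | `|Y y - Th' p'| < e1].
  have : \forall y \near p, forall al, `|Y y 0 al - Y p 0 al| <= e1 / 2.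
    apply: (@filter_forall _ _ (fun al y => `|Y y 0 al - Y p 0 al| <= e1 / 2) (nbhs p)) => al.
    exact: (continuous_dist_le (cY al) e12).
  apply: filterS => y Hy /=; rewrite -Yp; apply: (@le_lt_trans _ _ (e1 / 2)).
    by apply: norm_le_coord => [|al]; [rewrite divr_ge0// ltW|rewrite mxBE; exact: Hy].
  by rewrite ltr_pdivrMr// ltr_pMr// ltr1n.
have cYP : {for p, continuous (fun y => bil B (Y y) P')} by exact: continuous_bil.
have near2 : nbhs p [set y | 0 < bil B (Y y) P' < 1 + eta].
  have := nball_cap HB' Up'; rewrite -Yp => cap.
  have O1 : open [set u : R | 0 < u < 1 + eta].
    have -> : [set u : R | 0 < u < 1 + eta] = [set u | 0 < u] `&` [set u | u < 1 + eta].
      by apply/seteqP; split => u /=; [move=> /andP[]|move=> [-> ->]].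
    by apply: openI; [exact: open_gt|exact: open_lt].
  have N1 : nbhs (bil B (Y p) P') [set u : R | 0 < u < 1 + eta] by exact: open_nbhs_nbhs.
  exact: (cYP _ N1).
have near3 : nbhs p [set y | 1 < z y].
  have N1 : nbhs (z p) [set u : R | 1 < u] by apply: open_nbhs_nbhs; split => //; exact: open_gt.
  exact: (cz _ N1).
have near4 : nbhs p Up by exact: open_nbhs_nbhs.
have : nbhs p [set y | Up y /\ Phi y = Th' y].
  apply: (filterS _ (filterI (filterI near1 near2) (filterI near3 near4))) => y [[y1 y2] [y3 y4]].
  split => //; have := mdev_form (nball_dev HB') y4 => ZZ.
  have [v [Hv Hv1]] := log_exists BT LB OO ZZ (lt_trans ltr01 y3).
  have YY := YE y v Hv y3 Hv1.
  have Y1 : bil B (Y y) (Y y) = 1 by rewrite -YY (bil_hg BT _ _ Hv) subrr mulr0 ch0.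
  have [x Ux xY] := nball_surj HB' Y1 y2.
  have Nx : N x by apply: He1 => //; rewrite xY.
  apply: (@Phi_step _ _ _ _ _ _ HB' x y _ v tau Ux y4 _ Hv Hv1).
  - by have : nbhs x N by [exact: open_nbhs_nbhs]; apply: filterS => u /NE.
  - by rewrite tau0.
  - by rewrite YY.
rewrite nbhsE => -[W [oW Wp] WE]; exists W => //.
apply: (mdev_ext (Psi := Th')); first by move=> y /WE[_ ->].
by apply: mdev_sub (nball_dev HB') => // y /WE[].
Qed.

Lemma dev_open q : dev_at q -> nbhs q dev_at.
Proof.
move=> [U Uq HU]; have [oU _ _] := HU; rewrite nbhsE; exists U; first by split.
by move=> p Up; exists U.
Qed.

(** Continuity method along the ray: at the infimum of the bad parameters [dev_extend] applies, and
    the resulting neighbourhood contradicts the infimum. *)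
Lemma Phi_dev q : ~ boundary X q -> dev_at q.
Proof.
move=> nq; have Ho : dev_at o.
  by exists U0 => //; apply: mdev_ext (nball_dev HB0) => p Up; rewrite Phi_base.
have [->//|/eqP qo] := eqVneq q o.
have [_ Ubo _] := nball_dev HB0.
have [r0 r1 _ _] := ray_geodesic q.
have nb t : 0 <= t <= 1 -> ~ boundary X (ray q t).
  move=> /andP[]; rewrite le_eqVlt => /predU1P[<- _|t0]; first by rewrite r0; exact: Ubo.
  rewrite le_eqVlt => /predU1P[->|t1]; first by rewrite r1.
  apply: (geodesic_interior Mconvex (ray_geodesic q)); last by rewrite t0.
  by move=> oq; apply: qo.
apply: contrapT => nS; pose E : set R := [set t | 0 <= t <= 1 /\ ~ dev_at (ray q t)].
have E1 : E 1 by rewrite /E /= lexx ler01 r1.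
have Elb : lbound E 0 by move=> t [/andP[]].
have hi : has_inf E by split; [exists 1|exists 0].
pose T := inf E; have T0 : 0 <= T by apply: lb_le_inf => //; exists 1.
have T1 : T <= 1 by apply: ge_inf => //; exists 0.
have ST t : 0 <= t < T -> dev_at (ray q t).
  move=> /andP[t0 tT]; apply: contrapT => nt; have : E t.
    by split => //; rewrite t0 (le_trans (ltW tT)).
  move=> Et; have : T <= t by apply: ge_inf => //; exists 0.
  by rewrite leNgt tT.
have HT : dev_at (ray q T).
  move: T0; rewrite le_eqVlt => /predU1P[<-|T0]; first by rewrite r0.
  by apply: dev_extend => //; [rewrite T0|apply: nb; rewrite ltW].
have [V VT HV] := HT; have [oV _ _] := HV.
have T01 : 0 <= T <= 1 by rewrite T0.
have [e e0 He] := ray_near T01 oV VT.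
have [t Et tT] := inf_adherent e0 hi.
have Tt : T <= t by apply: ge_inf => //; exists 0.
case: Et => t01; apply; exists V => //; apply: He => //.
by rewrite ger0_norm ?subr_ge0// ltrBlDr addrC.
Qed.

Lemma Phi_mdev : mdev g k B (~` boundary X) Phi.
Proof.
have oI : open (~` boundary X).
  by rewrite openE => q /Phi_dev/dev_open; apply: filterS => p [U Up [_ Ub _]]; exact: Ub.
by apply: mdev_local => // q /Phi_dev[U Uq HU]; exists U.
Qed.

End Developing.

(** Forgets the base normal ball and the chosen rays; what remains is the form, the immersion of the
    interior, and the shape of the map along a geodesic from [o] to each point. *)
Lemma developing_map {R : realType} {m : nat} {M : topologicalType} {X : manifold R m M}
  (g : riemannian_metric X) (k : R) (o : M) : 0 < k -> constant_sectional_curvature g (- k ^+ 2) ->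
  convex_manifold g -> ~ boundary X o ->
  exists (B : 'M[R]_(1 + m)) (Phi : M -> 'rV[R]_(1 + m)),
   [/\ B^T = B, lorentz B, mdev g k B (~` boundary X) Phi &
    forall y, exists gam kap w, [/\ geodesic g o y gam, hyp B kap (Phi o) w &
      forall s : R, 0 <= s <= 1 -> Phi (gam s) = hg kap (Phi o) w s]].
Proof.
move=> hk Mcurv Mconvex no; have [U0 [Psi0 [eta [eta0 Uo Po HB BT]]]] := nball_exists hk Mcurv no.
set B := Dm _ _ _ in HB BT; set i := chart_at X o in B HB BT.
have dp : dom i o by exact: dom_chart_at.
have [_ _ symG posG _] := gmx_hyperbolic i Mcurv.
have io := interior_inner no dp.
have LB : lorentz B.
  by apply: lorentz_Dm; [rewrite exprn_gt0|exact: symG|move=> v; exact: posG].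
exists B, (Phi hk Mcurv Mconvex BT LB HB Uo Po); split => //; first exact: Phi_mdev.
move=> y; exists (ray Mconvex o y); rewrite Phi_o.
exists (kray hk Mcurv Mconvex BT LB HB Uo Po y), (wray hk Mcurv Mconvex BT LB HB Uo Po y).
split; [exact: ray_geodesic|exact: hyp_ray|].
by move=> s s01; exact: Phi_ray.
Qed.

(** * Continuity and injectivity up to the boundary *)
Opaque jet dmx Dm Gam.

Section Global.
Context {R : realType} {m : nat} {M : topologicalType} {X : manifold R m M}.
Variables (g : riemannian_metric X) (k : R).
Hypotheses (hk : 0 < k) (Mcurv : constant_sectional_curvature g (- k ^+ 2)).
Hypothesis Mconvex : convex_manifold g.
Variables (B : 'M[R]_(1 + m)) (Phi : M -> 'rV[R]_(1 + m)) (o : M).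
Hypotheses (BT : B^T = B) (LB : lorentz B) (HPhi : mdev g k B (~` boundary X) Phi).
Hypothesis (no : ~ boundary X o).
Hypothesis Hray : forall y, exists gam kap w, [/\ geodesic g o y gam, hyp B kap (Phi o) w &
      forall s : R, 0 <= s <= 1 -> Phi (gam s) = hg kap (Phi o) w s].
Implicit Types (i : chart X) (p q : M) (x : 'rV[R]_m).
Local Notation e_ a := (delta_mx 0 a : 'rV[R]_m).

(** Smoothness at a boundary point means extendability; finitely many entries have a common cube of
    extension. *)
Lemma gmx_extension i q : dom i q -> exists (r : R) (F : 'rV[R]_m -> 'M[R]_m),
  [/\ 0 < r, cube (cmap i q) r `&` @halfspace R m `<=` cmap i @` dom i,
    forall x, cube (cmap i q) r x -> (cmap i @` dom i) x -> F x = gmx g i x &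
    forall n, Cmx (cube (cmap i q) r) n F].
Proof.
move=> dq; set x0 := cmap i q; set G := gmx g i.
have [V oV EV] := @cmap_image _ _ _ X i.
have Vx0 : V x0 by have : (cmap i @` dom i) x0 by [exists q]; rewrite EV => -[].
have /choice[VF HVF] : forall ab : 'I_m * 'I_m, exists VF : set 'rV[R]_m * ('rV[R]_m -> R),
    [/\ open VF.1, VF.1 x0, Cinfty VF.1 VF.2 & forall y, VF.1 y -> (cmap i @` dom i) y -> G y ab.1 ab.2 = VF.2 y].
  move=> ab; have [|U [F [oU Ux CF E]]] := @gmx_smooth _ _ _ _ g i ab.1 ab.2 x0; first by exists q.
  by exists (U, F).
have [r1 r10 H1] : exists2 r : R, 0 < r & cube x0 r `<=` V `&` [set x | forall ab, (VF ab).1 x].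
  apply/nbhs_cubeP; apply: filterI; first exact: open_nbhs_nbhs.
  apply: (@filter_forall _ _ (fun ab x => (VF ab).1 x) (nbhs x0)) => ab.
  by have [oU Ux _ _] := HVF ab; exact: open_nbhs_nbhs.
exists r1, (fun x => \matrix_(a, b) (VF (a, b)).2 x); split => //.
- by move=> x [/H1[Vx _] hx]; rewrite EV.
- move=> x /H1[_ Hx] ix; apply/matrixP => a b; rewrite mxE.
  by have [_ _ _ E] := HVF (a, b); rewrite -E.
move=> n a b; have [_ _ CFab _] := HVF (a, b).
apply: (@Cn_ext _ _ _ _ (VF (a, b)).2); first exact: open_cube.
  by move=> x _; rewrite mxE.
by apply: Cn_sub (CFab n) => x /H1[_ /(_ (a, b))].
Qed.

(** At inner points the Christoffel symbols are those of the smooth extension of the metric, which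
    are continuous at the boundary point and so bounded near it. *)
Lemma tA_bounded_boundary i q : dom i q -> exists (r C : R), [/\ 0 < r, 0 <= C,
    cube (cmap i q) r `&` @halfspace R m `<=` cmap i @` dom i &
    forall x (j : 'I_m) a b, cube (cmap i q) r x -> inner i x -> `|tA (gmx g i) (k ^+ 2) j x a b| <= C].
Proof.
move=> dq; have [r1 [F [r10 HI FG CF]]] := gmx_extension dq.
set x0 := cmap i q in r1 F r10 HI FG CF *; set G := gmx g i.
have uF0 : \det (F x0) != 0.
  rewrite FG; [|exact: cube_center|by exists q].
  by have := gmx_unit g dq; rewrite unitmxE unitfE.
have cd := Cn_continuous (Cn_det (@open_cube _ _ x0 r1) (CF 0)) (cube_center x0 r10).
have [r2 r20 H2] : exists2 r : R, 0 < r & cube x0 r `<=` cube x0 r1 `&` [set x | \det (F x) != 0].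
  apply/nbhs_cubeP; apply: filterI; first by apply/nbhs_cubeP; exists r1.
  have N : nbhs (\det (F x0)) [set u : R | u != 0].
    by apply: open_nbhs_nbhs; split => //; exact: open_neq.
  exact: (cd _ N).
have oc := @open_cube _ _ x0 r2.
have CF2 n : Cmx (cube x0 r2) n F by move=> a b; apply: Cn_sub (CF n a b) => x /H2[].
have uF x : cube x0 r2 x -> F x \in unitmx by move=> /H2[_ /=]; rewrite unitmxE unitfE.
have CI n := Cmx_invmx oc uF (CF2 n).
have CS n (j : 'I_m) : Cmx (cube x0 r2) n (Smx F j).
  move=> a b; apply: (@Cn_ext _ _ _ _ (fun x => 'D_(e_ j) (fun y => F y a b) x + 'D_(e_ a) (fun y => F y j b) x
   + - 'D_(e_ b) (fun y => F y j a) x)) => //; first by move=> x _; rewrite mxE.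
  apply: Cn_add => //; first by apply: Cn_add => //; apply: Cn_derive (CF2 n.+1 _ _).
  by apply: Cn_opp => //; apply: Cn_derive (CF2 n.+1 _ _).
pose Q (j : 'I_m) x : 'M[R]_m := 2^-1 *: (Smx F j x *m invmx (F x)).
have CQ j a b : {for x0, continuous (fun x => Q j x a b)}.
  apply: (Cn_continuous (n := 0) (V := cube x0 r2)); last exact: cube_center.
  apply: (@Cn_ext _ _ _ _ (fun x => 2^-1 * (Smx F j x *m invmx (F x)) a b)) => //.
    by move=> x _; rewrite [RHS]mxE.
  by apply: Cn_mul => //; [exact: Cn_cst|exact: (Cmx_mul oc (CS 0%N j) (CI 0%N))].
have cF a b : {for x0, continuous (fun x => F x a b)}.
  exact: Cn_continuous (CF 0 a b) (cube_center x0 r10).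
pose K : R := 1 + (k ^+ 2 * \sum_(ab : 'I_m * 'I_m) (`|F x0 ab.1 ab.2| + 1)) +
   \sum_(q : 'I_m * ('I_m * 'I_m)) (`|Q q.1 x0 q.2.1 q.2.2| + 1).
have SF0 : 0 <= \sum_(ab : 'I_m * 'I_m) (`|F x0 ab.1 ab.2| + 1) by apply: sumr_ge0 => ? _; rewrite addr_ge0.
have SQ0 : 0 <= \sum_(q : 'I_m * ('I_m * 'I_m)) (`|Q q.1 x0 q.2.1 q.2.2| + 1) by apply: sumr_ge0 => ? _; rewrite addr_ge0.
have k20 : 0 <= k ^+ 2 by rewrite exprn_ge0// ltW.
have near_bound (f : 'rV[R]_m -> R) : {for x0, continuous f} -> \forall x \near x0, `|f x| <= `|f x0| + 1.
  move=> cf; have := continuous_dist_le cf ltr01; apply: filterS => x Hx.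
  by rewrite -lerBlDl; apply: le_trans Hx; exact: lerB_dist.
have [r3 r30 H3] : exists2 r : R, 0 < r & cube x0 r `<=` cube x0 r2 `&`
    ([set x | forall ab : 'I_m * 'I_m, `|F x ab.1 ab.2| <= `|F x0 ab.1 ab.2| + 1] `&`
     [set x | forall q : 'I_m * ('I_m * 'I_m), `|Q q.1 x q.2.1 q.2.2| <= `|Q q.1 x0 q.2.1 q.2.2| + 1]).
  apply/nbhs_cubeP; apply: filterI; first by apply/nbhs_cubeP; exists r2.
  apply: filterI.
    apply: (@filter_forall _ _ (fun (ab : 'I_m * 'I_m) x => `|F x ab.1 ab.2| <= `|F x0 ab.1 ab.2| + 1) (nbhs x0)) => ab.
    exact: near_bound.
  apply: (@filter_forall _ _ (fun (q : 'I_m * ('I_m * 'I_m)) x => `|Q q.1 x q.2.1 q.2.2| <= `|Q q.1 x0 q.2.1 q.2.2| + 1) (nbhs x0)) => -[j [a b]].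
  exact: near_bound.
exists r3, K; split => //.
- by rewrite /K !addr_ge0// mulr_ge0.
- by move=> x [/H3[/H2[x1 _] _] hx]; exact: HI.
- move=> x j a b /H3[x2 [HF HQ]] ix; have [x1 _] := H2 _ x2.
  have [_ sG symG posG _] := gmx_hyperbolic i Mcurv; have oi := @open_inner _ _ _ X i.
  have HFab c d : k ^+ 2 * `|F x c d| <= K.
    apply: (@le_trans _ _ (k ^+ 2 * \sum_(ab : 'I_m * 'I_m) (`|F x0 ab.1 ab.2| + 1))).
      rewrite ler_wpM2l//; apply: le_trans (HF (c, d)) _ => /=.
      by rewrite (bigD1 (c, d))//= lerDl sumr_ge0// => ? _; rewrite addr_ge0.
    by rewrite /K addrAC lerDr addr_ge0.
  have HQab c d e : `|Q c x d e| <= K.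
    apply: le_trans (HQ (c, (d, e))) _ => /=.
    apply: (@le_trans _ _ (\sum_(q : 'I_m * ('I_m * 'I_m)) (`|Q q.1 x0 q.2.1 q.2.2| + 1))).
      by rewrite (bigD1 (c, (d, e)))//= lerDl sumr_ge0// => ? _; rewrite addr_ge0.
    by rewrite /K lerDr addr_ge0// mulr_ge0.
  have K1 : 1 <= K by rewrite /K -addrA lerDl addr_ge0// mulr_ge0.
  have K0 : 0 <= K by rewrite (le_trans ler01).
  have Fx : F x = G x by apply: FG => //; exact: inner_image.
  have GamQ : Gam G j x = Q j x.
    have SE c d e : 'D_(e_ c) (fun y => G y d e) x = 'D_(e_ c) (fun y => F y d e) x.
      apply: near_eq_derive; have : nbhs x (inner i `&` cube x0 r1).
        by apply: filterI; apply: open_nbhs_nbhs; split => //; exact: open_cube.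
      by apply: filterS => y [iy y1]; rewrite FG//; exact: inner_image.
    have SG : Smx F j x = Smx G j x by apply/matrixP => c d; rewrite [LHS]mxE [RHS]mxE !SE.
    by rewrite /Q SG Fx; exact: (GamE sG symG j ix).
  rewrite /tA; case: (split_ordP a) => a' ->; case: (split_ordP b) => b' ->.
  + by rewrite block_mxEul mxE normr0.
  + rewrite block_mxEur mxE; case: (_ && _); rewrite ?normr1 ?normr0//.
  + rewrite block_mxEdl; have -> : (k ^+ 2 *: col j (G x)) a' b' = k ^+ 2 * F x a' j by rewrite Fx !mxE.
    by rewrite normrM ger0_norm.
  + by rewrite block_mxEdr GamQ.
Qed.

(** Gronwall on the inner points of a cube, which form a box, bounds the jet of [Phi] by its size at
    one of them; bounded partial derivatives on a box give a Lipschitz constant valid up to the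
    boundary. *)
Lemma Phi_half_lipschitz i q : dom i q -> exists (r K : R), [/\ 0 < r, 0 <= K &
    forall x y al, cube (cmap i q) r x -> inner i x -> cube (cmap i q) r y -> inner i y ->
      `|Phi (par i y) 0 al - Phi (par i x) 0 al| <= K * `|y - x|].
Proof.
move=> dq; have [r [C [r0 C0 rI HC]]] := tA_bounded_boundary dq; set x0 := cmap i q in rI HC *.
pose W := cube x0 r `&` inner i.
have oW : open W by apply: openI; [exact: open_cube|exact: open_inner].
have Wpos x : W x -> forall a : 'I_m, a = 0%N :> nat -> 0 < x 0 a.
  move=> [_ [ix bx]] a a0; have [V oV E] := @cmap_image _ _ _ X i.
  move: ix; rewrite E => -[_ /(_ a a0)]; rewrite le_eqVlt => /predU1P[xa|//].
  by case: bx; exists a.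
have bW : boxy W.
  move=> y z w Wy Wz H; have cw : cube x0 r w by apply: (@boxy_cube _ _ x0 r y z w) => //; [case: Wy|case: Wz].
  have w0 (a : 'I_m) : a = 0%N :> nat -> 0 < w 0 a.
    move=> a0; have /andP[+ _] := H a; apply: lt_le_trans.
    by rewrite lt_min (Wpos _ Wy)// (Wpos _ Wz).
  split => //; split; first by apply: rI; split => // a a0; rewrite ltW// w0.
  by move=> [a [a0 wa]]; have := w0 a a0; rewrite wa ltxx.
have HD : isdev (gmx g i) (inner i) (k ^+ 2) B W (Phi \o par i).
  have [_ _ /(_ i)] := HPhi; apply: isdev_sub => // x [_ ix]; split => //.
  by have := inner_interior g ix.
have HG := gmx_hyperbolic i Mcurv; have k2 : 0 < k ^+ 2 by rewrite exprn_gt0.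
have [[x1 Wx1]|W0] := pselect (W !=set0); last first.
  by exists r, 0; split => // x y al cx ix; case: W0; exists x.
have CF := Cmx_jet HD.
have dF x a c b : W x -> `|dmx a (jet (Phi \o par i)) x c b| <= C * \sum_(c : 'I_(1 + m) * 'I_(1 + m)) `|jet (Phi \o par i) x c.1 c.2|.
  move=> Wx; rewrite (jet_eq HG k2 BT HD a Wx); apply: mulmx_entry_sum_le => // c' d.
  by apply: HC; case: Wx.
pose N : R := #|{: 'I_(1 + m) * 'I_(1 + m)}|%:R.
pose S1 : R := \sum_(c : 'I_(1 + m) * 'I_(1 + m)) jet (Phi \o par i) x1 c.1 c.2 ^+ 2.
have S10 : 0 <= S1 by apply: sumr_ge0 => ? _; exact: sqr_ge0.
pose E : R := expR (2 * (\sum_(a < m) (2 * r) * C) * N) * S1.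
have E0 : 0 <= E by rewrite mulr_ge0// expR_ge0.
have HE x a b : W x -> `|jet (Phi \o par i) x a b| <= Num.sqrt E.
  move=> Wx; rewrite -sqrtr_sqr ler_sqrt//; apply: (@le_trans _ _ (\sum_(c : 'I_(1 + m) * 'I_(1 + m)) jet (Phi \o par i) x c.1 c.2 ^+ 2)).
    by rewrite (bigD1 (a, b))//= lerDl sumr_ge0// => ? _; exact: sqr_ge0.
  apply: le_trans (matrix_growth oW bW CF C0 dF Wx1 Wx) _.
  rewrite ler_wpM2r// ler_expR ler_wpM2r// ler_wpM2l//; apply: ler_sum => a' _.
  rewrite ler_wpM2r//; have [c1 _] := Wx1; have [c2 _] := Wx.
  have := c1 a'; have := c2 a'; have := ler_distD (x0 0 a') (x 0 a') (x1 0 a').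
  by rewrite (distrC (x0 0 a')); move: `|_ - _| `|_ - _| `|_ - _| => *; lra.
exists r, (Num.sqrt E * m%:R); split => //.
move=> x y al cx ix cy iy.
have Wx : W x by []. have Wy : W y by [].
have [_ _ CP _] := HD.
have := @box_mean_value _ _ W (fun y => Phi (par i y) 0 al)
  (fun a x => jet (Phi \o par i) x (rshift 1 a) al) (fun=> 0) (Num.sqrt E) x y bW Wx Wy.
rewrite big1 ?subr0; last by move=> a _; rewrite mulr0.
move=> H; apply: le_trans (H _ _) _.
- by move=> z a Wz; rewrite jet1; exact: (Cn_is_derive a (CP 0 al) Wz).
- by move=> z a Wz; rewrite subr0; exact: HE.
- have := sum_coord_le (y - x); under eq_bigr do rewrite mxBE; move=> S.
  by rewrite -mulrA ler_wpM2l// sqrtr_ge0.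
Qed.

(** The ray to [q] is interior before its end, and along it [Phi] is the continuous curve [hg]; this
    is what ties the values at boundary points to interior ones. *)
Lemma Phi_approx q al (N : set M) (e : R) : 0 < e -> nbhs q N ->
  exists z, [/\ N z, ~ boundary X z & `|Phi z 0 al - Phi q 0 al| <= e].
Proof.
move=> e0 Nq; have [qo|/eqP qo] := eqVneq q o.
  by exists o; split => //; [rewrite -qo; exact: nbhs_singleton Nq|rewrite qo subrr normr0 ltW].
have [gam [kap [w [Hg Hh HP]]]] := Hray q; have [g0 g1 /within01P cg _] := Hg.
have kw : kap = 0 -> w = 0 by case: Hh.
have N1 : nbhs (1 : R) ((gam \o clamp01) @^-1` N).
  by apply: cg; rewrite /= clamp01_id ?lexx ?ler01// g1.
have N2 : nbhs (1 : R) [set s | `|hg kap (Phi o) w s 0 al - hg kap (Phi o) w 1 0 al| <= e].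
  exact: (continuous_dist_le (is_derive_continuous (is_derive_hg 1 (Phi o) al kw)) e0).
have /nbhs_normP[d /= d0 Hd] : nbhs (1 : R) (((gam \o clamp01) @^-1` N) `&`
   [set s | `|hg kap (Phi o) w s 0 al - hg kap (Phi o) w 1 0 al| <= e]) by exact: filterI.
pose s : R := 1 - Num.min d 1 / 2.
have m0 : 0 < Num.min d 1 by rewrite lt_min d0 ltr01.
have : Num.min d 1 / 2 < Num.min d 1 by rewrite ltr_pdivrMr// ltr_pMr// ltr1n.
have h0 : 0 < Num.min d 1 / 2 by rewrite divr_gt0.
rewrite lt_min => /andP[hd h1].
have s01 : 0 < s < 1 by rewrite /s; apply/andP; split; lra.
have s01' : 0 <= s <= 1 by case/andP: s01 => *; rewrite !ltW.
have [] := Hd s; first by rewrite /ball_ /= /s opprB addrCA subrr addr0 gtr0_norm.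
rewrite /= clamp01_id// => Ns; rewrite -!HP ?lexx ?ler01// g1 => Hs.
exists (gam s); split => //; apply: (geodesic_interior Mconvex Hg) s01.
by move=> oq; apply: qo.
Qed.

(** Both points are replaced by nearby interior points through [Phi_approx], at cost e/3 each, and
    these are compared by [Phi_half_lipschitz]. *)
Lemma Phi_continuous al : continuous (fun q => Phi q 0 al).
Proof.
move=> q; pose i := chart_at X q; have dq : dom i q by exact: dom_chart_at.
have [r [K [r0 K0 Lip]]] := Phi_half_lipschitz dq.
apply: continuous_dist_intro => e e0.
have K1 : 0 < K + 1 by rewrite ltr_wpDl.
pose rho := Num.min r (e / 6 / (K + 1)).
have rho0 : 0 < rho by rewrite lt_min r0 !divr_gt0.
have rr : rho <= r by rewrite ge_min lexx.
have re : K * rho <= e / 6.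
  have : rho <= e / 6 / (K + 1) by rewrite ge_min lexx orbT.
  rewrite ler_pdivlMr// => H; apply: le_trans H; rewrite mulrC ler_wpM2l// ?ltW//; lra.
pose N : set M := dom i `&` cmap i @^-1` (cube (cmap i q) rho).
have oN : open N by apply: open_chart_preimage; exact: open_cube.
have Nq : N q by split => //; exact: cube_center.
have e3 : 0 < e / 3 by rewrite divr_gt0.
have NN : nbhs q N by exact: open_nbhs_nbhs.
apply: (filterS _ NN) => y Ny.
have NNy : nbhs y N by exact: open_nbhs_nbhs.
have [z [[dz cz] nz Hz]] := Phi_approx al e3 NN.
have [y' [[dy cy] ny Hy]] := Phi_approx al e3 NNy.
have := Lip (cmap i z) (cmap i y') al (cubeS rr cz) (interior_inner nz dz) (cubeS rr cy) (interior_inner ny dy).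
rewrite !cmapK// => HL.
have HL2 : `|Phi y' 0 al - Phi z 0 al| <= e / 3.
  apply: le_trans HL _; apply: (@le_trans _ _ (K * (2 * rho))); last by lra.
  rewrite ler_wpM2l//; apply: norm_le_coord => [|a]; first by rewrite mulr_ge0// ltW.
  rewrite mxBE; have := cz a; have := cy a; have := ler_distD (cmap i q 0 a) (cmap i y' 0 a) (cmap i z 0 a).
  by rewrite (distrC (cmap i q 0 a)); move: `|_ - _| `|_ - _| `|_ - _| => *; lra.
have T1 := ler_distD (Phi y' 0 al) (Phi y 0 al) (Phi q 0 al).
have T2 := ler_distD (Phi z 0 al) (Phi y' 0 al) (Phi q 0 al).
move: T1 T2 Hz Hy HL2; rewrite (distrC (Phi y 0 al) (Phi y' 0 al)).
by move: `|_ - _| `|_ - _| `|_ - _| `|_ - _| `|_ - _| => *; lra.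
Qed.

(** For distinct ends the open arc is interior and [geod_hg] applies; the ends follow by continuity.
    For equal ends uniqueness makes the arc constant. *)
Lemma Phi_geodesic p q gam : geodesic g p q gam -> exists kap w, [/\ hyp B kap (Phi p) w,
    forall t, 0 <= t <= 1 -> Phi (gam t) = hg kap (Phi p) w t &
    forall t, 0 < t < 1 -> k * speed g gam t = kap].
Proof.
move=> Hg; have [g0 g1 cg _] := Hg; have [pq|/eqP pq] := eqVneq p q.
  have gE t : 0 <= t <= 1 -> gam t = p.
    by rewrite -pq in Hg; exact: (geodesic_unique Mconvex Hg (cst_geodesic g p)).
  have PP : bil B (Phi p) (Phi p) = 1.
    have [c [kap [w [[_ c1 _ _] Hh HP]]]] := Hray p.
    by rewrite -[in LHS]c1 HP ?lexx ?ler01// (bil_hg BT _ _ Hh) subrr mulr0 ch0.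
  exists 0, 0; split.
  - by split => //; rewrite ?bil0r// expr0n oppr0.
  - by move=> t /gE ->; rewrite /hg mul0r ch0 scale1r scaler0 addr0.
  - move=> t t01; rewrite /speed; set i := chart_at X _.
    have -> : derive1 (fun s => cmap i (gam s)) t = 0.
      have t0 : 0 < Num.min t (1 - t) by case/andP: t01 => ? ?; rewrite lt_min subr_gt0; apply/andP.
      have H (a : 'I_m) : is_derive t 1 (fun s => cmap i (gam s) 0 a) ((0 : 'rV[R]_m) 0 a).
        rewrite mxE.
        apply: (is_derive_local t0 _ (is_derive_cst (cmap i p 0 a) t (1 : R))) => s.
        rewrite lt_min ltr_norml => /andP[/andP[h1 h2] h3]; rewrite gE//.
        by move: h3; rewrite ltr_norml => /andP[h3 h4]; apply/andP; split; lra.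
      by have [_ ->] := (is_derive_mx (fun s => cmap i (gam s)) 0 t).2 H.
    by rewrite /Defs.gnorm /ginner !mul0mx mxE sqrtr0 mulr0.
have nb t : 0 < t < 1 -> (~` boundary X) (gam t) by exact: (geodesic_interior Mconvex Hg pq).
have [kap [P [w [Hh HP Hs]]]] := geod_hg hk Mcurv BT LB HPhi Hg (lexx 0) ltr01 (lexx 1) nb.
have kw : kap = 0 -> w = 0 by case: Hh.
have E t : 0 <= t <= 1 -> Phi (gam t) = hg kap P w t.
  move=> t01; apply/rowP => al.
  have := @continuous_agree _ (fun s => Phi ((gam \o clamp01) s) 0 al) (fun s => hg kap P w s 0 al) t.
  rewrite /= clamp01_id//; apply.
  - apply: (@continuous_comp _ _ _ (gam \o clamp01) (fun p => Phi p 0 al)); last exact: Phi_continuous.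
    exact: (within01P _).1 cg t.
  - exact: is_derive_continuous (is_derive_hg t P al kw).
  - move=> e e0; pose d := Num.min e 1 / 2; have m0 : 0 < Num.min e 1 by rewrite lt_min e0 ltr01.
    have : d < Num.min e 1 by rewrite ltr_pdivrMr// ltr_pMr// ltr1n.
    have d0 : 0 < d by rewrite divr_gt0.
    rewrite lt_min => /andP[de d1].
    have [s s01 st] : exists2 s, 0 < s < 1 & `|s - t| < e.
      case/andP: t01 => t0 t1; exists (t + d * (1 / 2 - t)).
        by apply/andP; split; nra.
      have -> : t + d * (1 / 2 - t) - t = d * (1 / 2 - t) by ring.
      rewrite normrM gtr0_norm//; have : `|1 / 2 - t| <= 1.
        by rewrite ler_norml; apply/andP; split; lra.
      by move=> h; apply: le_lt_trans de; rewrite ler_piMr// ltW.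
    exists s => //; rewrite clamp01_id; first by rewrite HP.
    by case/andP: s01 => *; rewrite !ltW.
have P0 : Phi p = P by rewrite -g0 E ?lexx ?ler01// hg0.
by exists kap, w; rewrite P0.
Qed.

Lemma Phi_form p q : exists2 kap : R, 0 <= kap & bil B (Phi p) (Phi q) = ch kap.
Proof.
have [[gam Hg _] _] := Mconvex p q; have [g0 g1 _ _] := Hg.
have [kap [w [Hh HP _]]] := Phi_geodesic Hg; exists kap; first by case: Hh.
have := bil_hg BT 0 1 Hh; rewrite -!HP ?lexx ?ler01// g0 g1 => ->.
by rewrite sub0r mulrN mulr1 chN.
Qed.

Lemma Phi_self p : bil B (Phi p) (Phi p) = 1.
Proof.
have [c [kap [w [[_ c1 _ _] Hh HP]]]] := Hray p.
by rewrite -[in LHS]c1 HP ?lexx ?ler01// (bil_hg BT _ _ Hh) subrr mulr0 ch0.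
Qed.

Lemma Phi_local_inj p : ~ boundary X p -> exists2 N, nbhs p N &
  forall (x y : M), N x -> N y -> Phi x = Phi y -> x = y.
Proof.
move=> np; have [U [Th [eta [eta0 Up _ HB _]]]] := nball_exists hk Mcurv np.
have [A [L' [HB' NN]]] := nball_match hk Mcurv BT HB HPhi Up np.
exists (U `&` [set y | Phi y = Th y *m A]).
  apply: filterI => //; apply: open_nbhs_nbhs; split => //.
  by have [] := nball_dev HB.
by move=> x y [Ux Px] [Uy Py]; rewrite Px Py => E; exact: (nball_inj HB').
Qed.

(** Equal images force speed zero, so [Phi] is constant along the arc. By local injectivity at its
    midpoint the arc stands still there, against [geodesic_noreturn] for its second half. *)
Lemma Phi_inj p q : Phi p = Phi q -> p = q.
Proof.
move=> E; apply: contrapT => pq; have [[gam Hg _] _] := Mconvex p q; have [g0 g1 cg _] := Hg.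
have [kap [w [Hh HP _]]] := Phi_geodesic Hg; have [k0 _ _ _ kw] := Hh.
have kz : kap = 0.
  apply: ch_inj => //; rewrite ch0; have := bil_hg BT 1 0 Hh; rewrite -!HP ?lexx ?ler01//.
  by rewrite g0 g1 -E Phi_self subr0 mulr1 => <-.
have PE t : 0 <= t <= 1 -> Phi (gam t) = Phi p.
  by move=> /HP ->; rewrite /hg (kw kz) scaler0 addr0 kz mul0r ch0 scale1r.
have h01 : 0 < (2^-1 : R) < 1 by apply/andP; split; lra.
have [N NN inj] := Phi_local_inj (geodesic_interior Mconvex Hg pq h01).
move: NN; rewrite nbhsE => -[V [oV Vp] VN].
have [d d0 Hd] := within01_near cg h01 oV Vp.
pose s : R := 2^-1 + d / 2.
have sd : `|s - 2^-1| < d by rewrite /s addrAC subrr add0r gtr0_norm ?divr_gt0// ltr_pdivrMr// ltr_pMr// ltr1n.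
have [/andP[s0 s1] Vs] := Hd s sd.
have s12 : 2^-1 < s by rewrite ltrDl divr_gt0.
have gs : gam s = gam 2^-1.
  apply: inj; [exact: VN|exact: VN|]; rewrite !PE//; last by rewrite !ltW.
  by case/andP: h01 => *; rewrite !ltW.
have h0 : 0 <= 2^-1 :> R by rewrite invr_ge0.
have h1 : 2^-1 < 1 :> R by case/andP: h01.
have Hs := subgeodesic Hg h0 h1 (lexx 1); rewrite g1 in Hs.
have ne : gam 2^-1 <> q by apply: (geodesic_noreturn_end Mconvex Hg pq); rewrite h0.
apply: (@geodesic_noreturn _ _ _ _ g Mconvex _ _ _ ((s - 2^-1) / (1 - 2^-1)) Hs ne).
  apply/andP; split; first by rewrite divr_gt0 ?subr_gt0.
  by rewrite ler_pdivrMr ?subr_gt0// mul1r lerB// ltW.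
have -> : 2^-1 + (1 - 2^-1) * ((s - 2^-1) / (1 - 2^-1)) = s.
  by rewrite mulrCA divff ?subr_eq0 ?(gt_eqF h1)// mulr1 addrC subrK.
exact: gs.
Qed.

(** Converse of the sinh formula for points of a segment: the combination determines its distance
    from [Phi p], and hence the parameter on the arc. *)
Lemma segment_combination p q (al be : R) : 0 <= al -> 0 <= be ->
  bil B (al *: Phi p + be *: Phi q) (al *: Phi p + be *: Phi q) = 1 ->
  exists2 z, geodesic_arc g p q z & Phi z = al *: Phi p + be *: Phi q.
Proof.
move=> a0 b0 Z1; have [[gam Hg _] _] := Mconvex p q; have [g0 g1 _ _] := Hg.
have [kap [w [Hh HP _]]] := Phi_geodesic Hg; have [k0 _ _ _ kw] := Hh.
have PQ : bil B (Phi p) (Phi q) = ch kap.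
  have := bil_hg BT 0 1 Hh; rewrite -!HP ?lexx ?ler01// g0 g1 => ->.
  by rewrite sub0r mulrN mulr1 chN.
have E1 : hg kap (Phi p) w 1 = Phi q by rewrite -HP ?lexx ?ler01// g1.
move: Z1; rewrite bilDl !bilDr !bilZl !bilZr !Phi_self (bilC (Phi q) _ BT) PQ => Z1.
suff [t t01 Ht] : exists2 t, 0 <= t <= 1 & hg kap (Phi p) w t = al *: Phi p + be *: Phi q.
  by exists (gam t); [exists gam, t|rewrite HP].
have [kz|kn] := eqVneq kap 0.
  exists 0; first by rewrite lexx ler01.
  move: Z1; rewrite hg0 -E1 /hg kz (kw kz) !scaler0 !addr0 mul0r ch0 scale1r -scalerDl => Z1.
  have -> : al + be = 1.
    by apply: sqr_inj_ge0; rewrite ?addr_ge0// expr1n -Z1; ring.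
  by rewrite scale1r.
have kp : 0 < kap by rewrite lt_neqAle eq_sym kn.
have s0 := sh_gt0 kp; have c1 := ch_ge1 kap; have cs := ch2_sh2 kap.
(* The product of the combination with [Phi p], that is, the cosh of their distance [v]; the bound
   [be] <= 1 proved below keeps [v] at most [kap]. *)
pose u := al + be * ch kap.
have u2 : u ^+ 2 - (be * sh kap) ^+ 2 = 1.
  rewrite -Z1 /u [in RHS](_ : be * (be * 1) = be * be * (ch kap ^+ 2 - sh kap ^+ 2)); last by rewrite cs; ring.
  by ring.
have bs : 0 <= be * sh kap by rewrite mulr_ge0// ltW.
have u0 : 0 <= u by rewrite addr_ge0// mulr_ge0// (le_trans ler01).
have u1 : 1 <= u by rewrite -(@expr_ge1 _ 2)//; have := sqr_ge0 (be * sh kap); lra.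
pose v := arch u; have v0 := arch_ge0 u1; have cv : ch v = u := ch_arch u1.
have sv : sh v = be * sh kap.
  apply: sqr_inj_ge0 => //; first exact: sh_ge0.
  by have := ch2_sh2 v; rewrite cv; lra.
have be1 : be <= 1.
  have h : be * be <= 1.
    rewrite -Z1 ; have : 0 <= al * al by rewrite mulr_ge0.
    have : 0 <= al * be * ch kap by rewrite !mulr_ge0// (le_trans ler01).
    by rewrite !mulr1; move: (al * al) (be * be) => x y; rewrite mulrA [be * (al * _)]mulrCA mulrA; lra.
  by rewrite -(@expr_le1 _ 2)// expr2.
have vk : v <= kap.
  rewrite leNgt; apply/negP => kv; have : sh kap < sh v.
    have d0 : 0 < v - kap by rewrite subr_gt0.
    have := sh_superadd k0 (ltW d0); have -> : kap + (v - kap) = v by ring.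
    by have := sh_gt0 d0; lra.
  by rewrite sv ltNge ler_piMl// ltW.
exists (v / kap); first by rewrite divr_ge0//= ler_pdivrMr// mul1r.
rewrite (hg_log _ kn k0 E1) mulrCA divff// mulr1 cv sv mulfK ?gt_eqF//.
by rewrite scalerBr scalerA addrCA -scalerBl /u addrK addrC.
Qed.

End Global.

(** * Riemannian distance *)

Section NonmeasurableIntegral.
Local Open Scope ereal_scope.
Context d (T : measurableType d) (R : realType) (mu : {measure set T -> \bar R}).
Implicit Types (f g : T -> \bar R) (D : set T).
Import HBNNSimple.

(* No measurability: the integral of a nonnegative function is a supremum over
   simple functions. *)
Lemma ge0_integral_le D f g : (forall x, D x -> 0 <= f x) -> (forall x, D x -> f x <= g x) ->
  \int[mu]_(x in D) f x <= \int[mu]_(x in D) g x.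
Proof.
move=> f0 fg; have g0 x : D x -> 0 <= g x by move=> Dx; apply: le_trans (f0 x Dx) (fg x Dx).
rewrite !ge0_integralE//; apply: ereal_sup_le => _ [h /= Hh <-]; exists h => //= x; apply: le_trans (Hh x) _; rewrite /patch; case: ifPn => //.
by rewrite inE => /fg.
Qed.

(** Reduces an upper bound to the simple functions below [f], which are measurable even if [f] is
    not. *)
Lemma ge0_integral_ub D f (c : \bar R) : (forall x, D x -> 0 <= f x) ->
  (forall h : {nnsfun T >-> R}, (forall x, D x -> (h x)%:E <= f x) -> (forall x, ~ D x -> h x = 0%R) ->
    \int[mu]_x (h x)%:E <= c) ->
  \int[mu]_(x in D) f x <= c.
Proof.
move=> f0 H; rewrite ge0_integralE//; apply: ge_ereal_sup => _ [h /= Hh <-].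
have -> : sintegral mu h = \int[mu]_x (h x)%:E by rewrite integral_nnsfun// patch_setT.
apply: H => x Dx; have := Hh x; rewrite /patch.
  by rewrite mem_set.
by rewrite memNset// lee_fin => h0; apply: le_anti; rewrite h0/= fun_ge0.
Qed.

End NonmeasurableIntegral.

Section LebesgueScale.
Local Open Scope ereal_scope.
Context (R : realType).
Local Notation mu := (@lebesgue_measure R).

Lemma measurable_scale (a : R) : measurable_fun [set: measurableTypeR R] ( *%R a : _ -> measurableTypeR R).
Proof. exact: mulrl_measurable. Qed.

Let pmeasure (phi : measurableTypeR R -> measurableTypeR R) (mphi : measurable_fun setT phi) :
  {measure set (measurableTypeR R) -> \bar R}.
Proof. by refine (pushforward mu phi). Defined.

Lemma lebesgue_measure_scale (a : R) (A : set (measurableTypeR R)) : (0 < a)%R -> measurable A ->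
  mu A = a%:E * mu (( *%R a) @^-1` A).
Proof.
move=> a0 mA; have a0' := ltW a0.
pose ph : {measure set (measurableTypeR R) -> \bar R} :=
  pmeasure (measurable_scale a).
pose nu : {measure set (measurableTypeR R) -> \bar R} := mscale (NngNum a0') ph.
suff : mu A = nu A by [].
apply: lebesgue_measure_unique => // _ [[x y] _ <-].
suff : mu `]x, y]%classic = a%:E * ph `]x, y]%classic by [].
have -> : ph `]x, y]%classic = mu `](x / a)%R, (y / a)%R]%classic.
  congr (mu _).
  apply/seteqP; split => u /=; rewrite !in_itv/= ltr_pdivrMr// ler_pdivlMr// mulrC//.
rewrite !lebesgue_measure_itv/= !lte_fin ltr_pM2r ?invr_gt0//; case: ifP => // _.
  by rewrite -!EFinB -EFinM -mulrBl mulrC divfK// gt_eqF.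
by rewrite mule0.
Qed.

Lemma ge0_integral_scale (a : R) (f : R -> \bar R) : (0 < a)%R ->
  measurable_fun [set: R] f -> (forall x, 0 <= f x) ->
  \int[mu]_x f x = a%:E * \int[mu]_x f (a * x)%R.
Proof.
move=> a0 mf f0; have a0' := ltW a0; have ma := measurable_scale a.
pose ph : {measure set (measurableTypeR R) -> \bar R} :=
  pmeasure (measurable_scale a).
transitivity (\int[mscale (NngNum a0') ph]_x f x).
  by apply: eq_measure_integral => A mA _; exact: lebesgue_measure_scale.
rewrite ge0_integral_mscale//=; congr (_ * _).
by rewrite (ge0_integral_pushforward ma).
Qed.

End LebesgueScale.

Section Concatenation.
Context {R : realType}.
Local Notation half := (2^-1 : R).

Definition concat {T : Type} (c d : R -> T) (t : R) : T :=
  if t <= half then c (2 * t) else d (2 * t - 1).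

Lemma concat0 {T : Type} (c d : R -> T) : concat c d 0 = c 0.
Proof. by rewrite /concat invr_ge0 ler0n mulr0. Qed.

Lemma concat1 {T : Type} (c d : R -> T) : concat c d 1 = d 1.
Proof. by rewrite /concat leNgt invf_lt1 ?ltr1n//= mulr1; congr d; ring. Qed.

Lemma clamp01_le0 (t : R) : t <= 0 -> clamp01 t = 0.
Proof. by move=> t0; apply/max_idPl; rewrite ge_min t0 orbT. Qed.

Lemma clamp01_ge1 (t : R) : 1 <= t -> clamp01 t = 1.
Proof. by move=> t1; rewrite /clamp01 (min_idPl t1); apply/max_idPr/ler01. Qed.

Lemma concat_continuous {T : topologicalType} (c d : R -> T) : c 1 = d 0 ->
  {within `[0, 1], continuous c} -> {within `[0, 1], continuous d} ->
  {within `[0, 1], continuous (concat c d)}.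
Proof.
move=> cd /within01P cc /within01P cd'; apply/within01P => t.
have E s : (concat c d \o clamp01) s = if s <= half then (c \o clamp01) (2 * s) else (d \o clamp01) (2 * s - 1).
  have h2 : half = 1 / 2 by rewrite mul1r.
  rewrite /= /concat; have [s0|s0] := leP s 0.
    have -> : clamp01 s = 0 by exact: clamp01_le0.
    have -> : clamp01 (2 * s) = 0 by apply: clamp01_le0; lra.
    by rewrite invr_ge0 ler0n mulr0 ifT// (le_trans s0)// invr_ge0.
  have [s1|s1] := leP 1 s.
    have -> : clamp01 s = 1 by exact: clamp01_ge1.
    have -> : clamp01 (2 * s - 1) = 1 by apply: clamp01_ge1; lra.
    rewrite !ifF; first by congr d; ring.
      by apply/negbTE; rewrite -ltNge; lra.
    by apply/negbTE; rewrite -ltNge; lra.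
  rewrite clamp01_id; last by rewrite !ltW.
  by case: leP => hs; rewrite clamp01_id//; apply/andP; split; lra.
have c2 : {for t, continuous (fun s : R => (c \o clamp01) (2 * s))}.
  apply: (@continuous_comp _ _ _ (fun s : R => 2 * s) (c \o clamp01)); [exact: mulrl_continuous|exact: cc].
have d2 : {for t, continuous (fun s : R => (d \o clamp01) (2 * s - 1))}.
  apply: (@continuous_comp _ _ _ (fun s : R => 2 * s - 1) (d \o clamp01)); last exact: cd'.
  by apply: continuousB; [exact: mulrl_continuous|exact: cst_continuous].
move=> A /=; have := E t; rewrite /= => -> NA.
have N1 : nbhs t [set s | s <= half -> A ((c \o clamp01) (2 * s))].
  have [th|th] := leP t half.
    rewrite th in NA; apply: (filterS (P := fun s => A ((c \o clamp01) (2 * s)))); first by move=> s As _.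
    exact: c2.
  have : nbhs t `]half, +oo[%classic by apply: open_nbhs_nbhs; split; [exact: interval_open|rewrite /= in_itv/= th].
  by apply: filterS => s /=; rewrite in_itv/= andbT => hs /(lt_le_trans hs); rewrite ltxx.
have N2 : nbhs t [set s | half < s -> A ((d \o clamp01) (2 * s - 1))].
  have [th|th] := ltP t half.
    have : nbhs t `]-oo, half[%classic by apply: open_nbhs_nbhs; split; [exact: interval_open|rewrite /= in_itv/= th].
    by apply: filterS => s /=; rewrite in_itv/= => hs /(lt_trans hs); rewrite ltxx.
  apply: (filterS (P := fun s => A ((d \o clamp01) (2 * s - 1)))); first by move=> s As _.
  apply: d2; move: NA; case: ifPn => //= h; have -> : t = half by apply/eqP; rewrite eq_le h.
  by rewrite divff// subrr !clamp01_id ?lexx ?ler01// cd.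
have E' s : concat c d (clamp01 s) = if s <= half then (c \o clamp01) (2 * s) else (d \o clamp01) (2 * s - 1) by exact: E.
apply: filterS2 N1 N2 => s /= H1 H2; rewrite E'; case: leP => hs; [exact: H1|exact: H2].
Qed.

End Concatenation.

Section CurveLength.
Context {R : realType} {m : nat} {M : topologicalType} {X : manifold R m M}.
Variable (g : riemannian_metric X).
Implicit Types (i : chart X) (p q : M) (t : R).
Local Notation half := (2^-1 : R).

Lemma geodesic_piecewise p q gam : geodesic g p q gam -> piecewise_C1 (X := X) p q gam.
Proof.
move=> [g0 g1 cg H]; split => //; exists [::] => t i t01 _ dt; have [d1 d2 _] := H t i t01 dt.
by split; [exact: d1|exact: (differentiable_continuous ((derivable1_diffP _ _).1 d2))].
Qed.

Lemma gnormZ (G : 'rV[R]_m -> 'M[R]_m) x (v : 'rV[R]_m) (a : R) : 0 <= a ->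
  Defs.gnorm G x (a *: v) = a * Defs.gnorm G x v.
Proof.
move=> a0; rewrite /Defs.gnorm /ginner linearZ /= -!scalemxAl -scalemxAr mxE [X in a * X]mxE mulrA -expr2.
by rewrite sqrtrM ?exprn_ge0// sqrtr_sqr ger0_norm.
Qed.

Definition C1at (c : R -> M) (t : R) : Prop := forall i, dom i (c t) ->
  derivable (fun s => cmap i (c s)) t 1 /\ {for t, continuous (derive1 (fun s => cmap i (c s)))}.

Lemma derive1_affine (c : R -> 'rV[R]_m) (a b t : R) : derivable c (a + b * t) 1 ->
  derivable (fun s => c (a + b * s)) t 1 /\
  derive1 (fun s => c (a + b * s)) t = b *: derive1 c (a + b * t).
Proof.
move=> dc; apply/is_derive_mx => al; rewrite mxE.
apply: (@is_derive_affine _ (fun u => c u 0 al)).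
exact: ((is_derive_mx c (derive1 c (a + b * t)) (a + b * t)).1 (conj dc erefl) al).
Qed.

Lemma C1at_affine (c c' : R -> M) (a b t : R) :
  (\forall s \near t, c' s = c (a + b * s)) ->
  (\forall s \near a + b * t, C1at c s) -> {for a + b * t, continuous c} ->
  C1at c' t /\ (0 <= b -> speed g c' t = b * speed g c (a + b * t)).
Proof.
move=> cc C1 cont.
have aff : {for t, continuous (fun s : R => a + b * s)}.
  by apply: continuousD; [exact: cst_continuous|exact: mulrl_continuous].
have ct : c' t = c (a + b * t) by exact: nbhs_singleton cc.
have key i : dom i (c' t) -> \forall s \near t, derivable (fun u => cmap i (c' u)) s 1 /\
    derive1 (fun u => cmap i (c' u)) s = b *: derive1 (fun u => cmap i (c u)) (a + b * s).
  move=> dt; have N1 : \forall s \near a + b * t, dom i (c s).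
    by apply: cont; apply: open_nbhs_nbhs; split; [exact: dom_open|rewrite -ct].
  have N2 : \forall s \near t, C1at c (a + b * s) /\ dom i (c (a + b * s)).
    by apply: (aff (fun s => C1at c s /\ dom i (c s))); apply: filterI.
  apply: filterS2 (near_join cc) N2 => s ns [C1s ds].
  have [dd _] := C1s i ds; have [d1 d2] := derive1_affine dd.
  have ne : \forall u \near s, cmap i (c' u) = cmap i (c (a + b * u)) by apply: filterS ns => u ->.
  split; first by apply: near_eq_derivable d1; rewrite ?oner_eq0//; apply: filterS ne.
  rewrite -d2 !derive1E; apply: near_eq_derive; rewrite ?oner_eq0//.
split.
  move=> i dt; have K := key i dt; split; first by have [] := nbhs_singleton K.
  have dt' := dt; rewrite ct in dt'.
  have [_ c1] := nbhs_singleton C1 i dt'.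
  apply: (@near_eq_continuous _ _ (fun s : R => b *: derive1 (fun u => cmap i (c u)) (a + b * s))).
    by apply: filterS K => s [_ ->].
  apply: continuousZr.
  exact: (@continuous_comp _ _ _ (fun s : R => a + b * s) (derive1 (fun u => cmap i (c u)))).
move=> b0; rewrite /speed; have [_ ->] := nbhs_singleton (key _ (dom_chart_at X (c' t))).
by rewrite ct gnormZ.
Qed.

End CurveLength.

(** * Length of a curve prolonged by a geodesic *)

Section Triangle.
Import HBNNSimple.
Context {R : realType} {m : nat} {M : topologicalType} {X : manifold R m M}.
Variable (g : riemannian_metric X).
Implicit Types (i : chart X) (p q : M) (t : R).
Local Notation half := (2^-1 : R).

Lemma within01_continuous {T : topologicalType} (c : R -> T) t :
  {within `[0, 1], continuous c} -> 0 < t < 1 -> {for t, continuous c}.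
Proof.
move=> /within01P cc /andP[t0 t1]; apply: (@near_eq_continuous _ _ (c \o clamp01)); last exact: cc.
have : nbhs t `]0, 1[%classic.
  by apply: open_nbhs_nbhs; split; [exact: interval_open|rewrite /= in_itv/= t0].
by apply: filterS => s /=; rewrite in_itv/= => /andP[s0 s1]; rewrite clamp01_id// !ltW.
Qed.

Lemma near_notin (s : seq R) t : t \notin s -> \forall u \near t, u \notin s.
Proof.
elim: s => [|a s IH]; first by move=> _; apply: filterE => u.
rewrite inE negb_or => /andP[ta /IH H].
have N : nbhs t [set u : R | u != a] by apply: open_nbhs_nbhs; split => //; exact: open_neq.
by apply: filterS2 N H => u; rewrite inE negb_or => /= -> ->.
Qed.

Lemma measurable_seq (s : seq R) : measurable ([set` s] : set (measurableTypeR R)).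
Proof.
elim: s => [|a s IH]; first by rewrite set_nil.
have -> : [set` a :: s] = [set a] `|` [set` s].
  apply/seteqP; split => [u|u [->|us]]; rewrite /= inE; [|by rewrite eqxx|by rewrite us orbT].
  by case/predU1P => [->|us]; [left|right].
by apply: measurableU => //; exact: measurable_set1.
Qed.

Lemma near_C1at (c : R -> M) (s : seq R) t :
  (forall (u : R) i, 0 < u < 1 -> u \notin s -> dom i (c u) ->
     derivable (fun v => cmap i (c v)) u 1 /\ {for u, continuous (derive1 (fun v => cmap i (c v)))}) ->
  0 < t < 1 -> t \notin s -> \forall u \near t, C1at (X := X) c u.
Proof.
move=> H /andP[t0 t1] /near_notin N.
have N2 : nbhs t `]0, 1[%classic.
  by apply: open_nbhs_nbhs; split; [exact: interval_open|rewrite /= in_itv/= t0].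
by apply: filterS2 N2 N => u; rewrite /= in_itv/= => u01 us i du; exact: H.
Qed.

(** The speed of [c] need not be measurable, so the integral is split on a simple function below the
    speed: its first half is rescaled to a function below the speed of [c], its second half is
    bounded by the constant 2 l. *)
Lemma concat_length p q z (c d : R -> M) (l : R) : piecewise_C1 (X := X) p q c -> geodesic g q z d ->
  (forall t, 0 < t < 1 -> speed g d t = l) ->
  piecewise_C1 (X := X) p z (concat c d) /\ (curve_length g (concat c d) <= curve_length g c + l%:E)%E.
Proof.
move=> Pc Gd Hl; have [c0 c1 cc [s Hs]] := Pc; have [d0 d1 cd [s' Hs']] := geodesic_piecewise Gd.
have l0 : 0 <= l by rewrite -(Hl half) ?sqrtr_ge0// invr_gt0 ltr0n invf_lt1// ltr1n.
have h2 : half = 1 / 2 by rewrite mul1r.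
(* The junction and the exceptional parameters of both pieces; a finite set, hence null. *)
pose N := half :: [seq u / 2 | u <- s] ++ [seq (u + 1) / 2 | u <- s'].
have left_ t : 0 < t < half -> t \notin N -> C1at (X := X) (concat c d) t /\
    speed g (concat c d) t = 2 * speed g c (2 * t).
  move=> /andP[t0 th] tN; have t2 : 0 < 0 + 2 * t < 1 by apply/andP; split; lra.
  have [] := @C1at_affine _ _ _ _ g c (concat c d) 0 2 t.
  - have : nbhs t `]-oo, half[%classic by apply: open_nbhs_nbhs; split; [exact: interval_open|rewrite /= in_itv/= th].
    by apply: filterS => u /=; rewrite in_itv/= /concat => /ltW ->; rewrite add0r.
  - apply: (near_C1at Hs t2); apply: contra tN => ts; rewrite inE mem_cat; apply/or3P/Or32.
    by apply/mapP; exists (0 + 2 * t) => //; field.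
  - exact: within01_continuous.
  - move=> C S; have E := S (ler0n _ 2); rewrite add0r in E; split; [exact: C|exact: E].
have right_ t : half < t < 1 -> t \notin N -> C1at (X := X) (concat c d) t /\
    speed g (concat c d) t = 2 * l.
  move=> /andP[th t1] tN; have t2 : 0 < -1 + 2 * t < 1 by apply/andP; split; lra.
  have [] := @C1at_affine _ _ _ _ g d (concat c d) (-1) 2 t.
  - have : nbhs t `]half, +oo[%classic by apply: open_nbhs_nbhs; split; [exact: interval_open|rewrite /= in_itv/= th].
    by apply: filterS => u /=; rewrite in_itv/= andbT /concat leNgt => ->; rewrite addrC.
  - apply: (near_C1at Hs' t2); apply: contra tN => ts; rewrite inE mem_cat; apply/or3P/Or33.
    by apply/mapP; exists (-1 + 2 * t) => //; field.
  - exact: within01_continuous.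
  - move=> C S; have E := S (ler0n _ 2); rewrite (Hl _ t2) in E; split; [exact: C|exact: E].
split.
  split; [by rewrite concat0|by rewrite concat1| |].
    by apply: concat_continuous; rewrite ?c1 ?d0.
  exists N => t i /andP[t0 t1] tN; have [th|th|th] := ltgtP t half.
  - by apply: (left_ t _ tN).1; rewrite t0.
  - by apply: (right_ t _ tN).1; rewrite th.
  - by move: tN; rewrite th inE eqxx.
rewrite /curve_length; apply: ge0_integral_ub => [t _|h hle h0]; first by rewrite lee_fin sqrtr_ge0.
pose NS : set (measurableTypeR R) := [set` N].
pose E1 : set (measurableTypeR R) := `]0, half[%classic `\` NS.
pose E2 : set (measurableTypeR R) := `]half, 1[%classic.
have mN : measurable NS by exact: measurable_seq.
have mN0 : lebesgue_measure NS = 0%E by apply: countable_lebesgue_measure0; apply: finite_set_countable; exact: finite_seq.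
have mE1 : measurable E1 by apply: measurableD.
have mE2 : measurable E2 by exact: measurable_itv.
pose h1 (t : measurableTypeR R) : R := h t * \1_E1 t.
have h1_ge0 t : 0 <= h1 t by rewrite /h1 mulr_ge0.
have mh1 : measurable_fun [set: measurableTypeR R] h1 by apply: measurable_funM.
have mh : measurable_fun [set: measurableTypeR R] (EFin \o h) by apply/measurable_EFinP.
rewrite (@ge0_negligible_integral _ _ _ _ _ NS)//; last by move=> t _; rewrite lee_fin.
pose F (t : measurableTypeR R) : \bar R := ((h1 t)%:E + (2 * l * \1_E2 t)%:E)%E.
have mF1 : measurable_fun [set: measurableTypeR R] (EFin \o h1) by apply/measurable_EFinP.
have mF2 : measurable_fun [set: measurableTypeR R] (fun t => (2 * l * \1_E2 t)%:E).
  by apply/measurable_EFinP; apply: measurable_funM.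
have F0 t : (0 <= F t)%E by rewrite adde_ge0// lee_fin// !mulr_ge0.
apply: (@le_trans _ _ (\int[lebesgue_measure]_(t in setT `\` NS) F t)%E).
  apply: ge0_integral_le => t; first by rewrite lee_fin.
  move=> [_ tN]; rewrite /F -EFinD lee_fin /h1.
  have {}tN' : t \notin N by apply/negP.
  have [|/h0 ->] := pselect ([set` `]0, 1[] t); last by rewrite mul0r add0r !mulr_ge0.
  rewrite /= in_itv/= => /andP[t0 t1]; have [th|th|th] := ltgtP t half.
  - rewrite [\1_E1 t]indicE mem_set ?mulr1; last by split => //=; rewrite in_itv/= t0.
    by rewrite lerDl !mulr_ge0.
  - rewrite [\1_E2 t]indicE mem_set ?mulr1; last by rewrite /E2 /= in_itv/= th.
    rewrite -[leLHS]add0r lerD// ?mulr_ge0// -(right_ t _ tN').2 ?th// -lee_fin.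
    by apply: hle; rewrite /= in_itv/= t0.
  - by move: tN'; rewrite th inE eqxx.
apply: (@le_trans _ _ (\int[lebesgue_measure]_t F t)%E).
  by apply: ge0_subset_integral => //; [exact: measurableD|apply: emeasurable_funD].
rewrite ge0_integralD//; last 2 first.
  - by move=> t _; rewrite lee_fin.
  - by move=> t _; rewrite lee_fin !mulr_ge0.
apply: leeD.
  have h0' : 0 < half by rewrite invr_gt0.
  rewrite (ge0_integral_scale h0' mF1); last by move=> t; rewrite lee_fin.
  have mS : measurable_fun [set: measurableTypeR R] (fun t => (h1 (half * t))%:E).
    apply/measurable_EFinP; apply: (measurableT_comp mh1 (measurable_scale half)).
  rewrite -ge0_integralZl_EFin//; last by move=> t _; rewrite lee_fin.
  rewrite [leRHS]integral_mkcond; apply: ge0_integral_le => t _ /=.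
    by rewrite -EFinM lee_fin mulr_ge0// ltW.
  rewrite /patch; case: ifPn => [|/negP tn].
    rewrite inE /= in_itv/= => /andP[t0 t1]; rewrite -EFinM lee_fin /h1.
    have [tE|tE] := pselect (E1 (half * t)); last first.
      by rewrite [\1_E1 _]indicE memNset// mulr0 mulr0 sqrtr_ge0.
    rewrite [\1_E1 _]indicE mem_set// mulr1; case: tE => ht hN.
    have hN' : half * t \notin N by apply/negP.
    have := hle (half * t); rewrite lee_fin (left_ _ _ hN').2; last by move: ht; rewrite /= in_itv.
    rewrite mulVKf// => H.
    have : h (half * t) <= 2 * speed g c t by apply: H; rewrite /= in_itv/=; apply/andP; split; lra.
    by move: (h _) (speed _ _ _) => a b; lra.
  rewrite -EFinM lee_fin /h1 [\1_E1 _]indicE memNset ?mulr0// => -[/=].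
  rewrite in_itv/= => /andP[t0 t1] _; apply: tn; rewrite inE /= in_itv/=; apply/andP; split; lra.
have l2 : 0 <= 2 * l by rewrite mulr_ge0.
under eq_integral do rewrite EFinM.
rewrite ge0_integralZl_EFin//; last by apply/measurable_EFinP.
have mu2 : lebesgue_measure E2 = (1 / 2)%:E.
  rewrite /E2 lebesgue_measure_itv/= lte_fin ifT; last by rewrite invf_lt1 ?ltr1n.
  by rewrite -EFinB h2; congr _%:E; field.
have -> : (\int[lebesgue_measure]_x (\1_E2 x)%:E)%E = (1 / 2)%:E.
  rewrite -mu2 -[E2 in RHS]setIT; exact: integral_indic.
by rewrite -EFinM lee_fin mul1r mulrAC divff ?mul1r.
Qed.

End Triangle.

Section HyperbolicDistance.
Context {R : realType} {m : nat} {M : topologicalType} {X : manifold R m M}.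
Variables (g : riemannian_metric X) (k : R).
Hypotheses (hk : 0 < k) (Mcurv : constant_sectional_curvature g (- k ^+ 2)).
Hypothesis Mconvex : convex_manifold g.
Variables (B : 'M[R]_(1 + m)) (Phi : M -> 'rV[R]_(1 + m)) (o : M).
Hypotheses (BT : B^T = B) (LB : lorentz B) (HPhi : mdev g k B (~` boundary X) Phi).
Hypothesis (no : ~ boundary X o).
Hypothesis Hray : forall y, exists gam kap w, [/\ geodesic g o y gam, hyp B kap (Phi o) w &
      forall s : R, 0 <= s <= 1 -> Phi (gam s) = hg kap (Phi o) w s].
Implicit Types (p q : M).
Let Pself := Phi_self BT Hray.

Lemma unit_speed p q : exists gam kap, [/\ geodesic g p q gam, 0 <= kap,
  bil B (Phi p) (Phi q) = ch kap & forall t, 0 < t < 1 -> speed g gam t = kap / k].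
Proof.
have [[gam Hg _] _] := Mconvex p q; have [g0 g1 _ _] := Hg.
have [kap [w [Hh HP HS]]] := Phi_geodesic hk Mcurv Mconvex BT LB HPhi no Hray Hg.
exists gam, kap; split => //; first by case: Hh.
  have := bil_hg BT 0 1 Hh; rewrite -!HP ?lexx ?ler01// g0 g1 => ->.
  by rewrite sub0r mulrN mulr1 chN.
by move=> t /HS <-; rewrite mulrAC divff ?mul1r// gt_eqF.
Qed.

(** The arc from [p] to [q] is a competitor of length kap / k, where cosh(kap) is the product of the
    images. *)
Lemma dist_le p q (r : R) : 0 <= r -> bil B (Phi p) (Phi q) <= ch (k * r) -> (dist g p q <= r%:E)%E.
Proof.
move=> r0 H; have [gam [kap [Hg k0 PQ S]]] := unit_speed p q.
have kr : kap / k <= r.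
  by rewrite ler_pdivrMr// mulrC; apply: ch_le_inv; rewrite -?PQ// mulr_ge0// ltW.
apply: (@le_trans _ _ (curve_length g gam)).
  by apply: ereal_inf_lbound; exists gam => //; exact: geodesic_piecewise Hg.
rewrite /curve_length; under eq_integral => t.
  rewrite inE /= in_itv /= => /S ->; over.
rewrite integral_cst//= lebesgue_measure_itv/= lte_fin ltr01 -EFinB subr0 mule1.
by rewrite lee_fin.
Qed.

(** Every competitor from [p] to [q] is prolonged by the arc from [q] to [z], of length at most
    [r]. *)
Lemma dist_triangle p q z (r : R) : 0 <= r -> bil B (Phi q) (Phi z) <= ch (k * r) ->
  (dist g p z <= dist g p q + r%:E)%E.
Proof.
move=> r0 H; have [gam [kap [Hg k0 PQ S]]] := unit_speed q z.
have kr : kap / k <= r.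
  by rewrite ler_pdivrMr// mulrC; apply: ch_le_inv; rewrite -?PQ// mulr_ge0// ltW.
rewrite -leeBlDr//; apply: le_ereal_inf_tmp => _ [c Pc <-].
have [Pz L] := concat_length Pc Hg S; rewrite leeBlDr//.
apply: (@le_trans _ _ (curve_length g (concat c gam))).
  by apply: ereal_inf_lbound; exists (concat c gam).
by apply: le_trans L _; rewrite leeD2l// lee_fin.
Qed.

Lemma bil_Phi_continuous p : continuous (fun q => bil B (Phi p) (Phi q)).
Proof.
move=> q; have -> : (fun q => bil B (Phi p) (Phi q)) = (fun q => bil B (Phi q) (Phi p)) by apply/funext => ?; rewrite bilC.
apply: continuous_bil => al; exact: (Phi_continuous hk Mcurv Mconvex BT HPhi no Hray).
Qed.

(** A limit point [y] of the ball is within [e], measured by the form, of some point of the ball;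
    [dist_triangle] gives distance at most r + e, for every [e]. *)
Lemma gball_closed p (r : R) : closed (gball g p r).
Proof.
move=> y cy; rewrite /gball /=; apply/lee_addgt0Pr => e e0.
have N : nbhs y [set y' | bil B (Phi y) (Phi y') < ch (k * e)].
  apply: (@bil_Phi_continuous y y [set u | u < ch (k * e)]).
  apply: open_nbhs_nbhs; split; first exact: open_lt.
  by rewrite /= Pself -ch0 ch_lt// ?mulr_ge0 ?mulr_gt0// ltW.
have [y' [/= Hy' Hb]] := cy _ N.
apply: le_trans (@dist_triangle p y' y e (ltW e0) _) _; first by rewrite bilC// ltW.
exact: (leeD2r e%:E Hy').
Qed.

End HyperbolicDistance.

(** * Helly's theorem and the centerpoint *)

Section LinearForms.
Context {R : realType} {n : nat}.
Implicit Types (l : 'cV[R]_n) (x y : 'rV[R]_n).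

Definition lf l x : R := (x *m l) 0 0.

Lemma lfD l x y : lf l (x + y) = lf l x + lf l y.
Proof. by rewrite /lf mulmxDl mxE. Qed.

Lemma lfZ l (a : R) x : lf l (a *: x) = a * lf l x.
Proof. by rewrite /lf -scalemxAl mxE. Qed.

Lemma lf_subl l l' (a : R) x : lf (l - a *: l') x = lf l x - a * lf l' x.
Proof. by rewrite /lf mulmxBr -scalemxAr !mxE. Qed.

Lemma lf_sum l (I : finType) (P : pred I) (c : I -> R) (x : I -> 'rV[R]_n) :
  lf l (\sum_(i | P i) c i *: x i) = \sum_(i | P i) c i * lf l (x i).
Proof.
elim/big_ind2: _ => [|_ a _ b <- <-|i _]; [by rewrite /lf mul0mx mxE|by rewrite lfD|by rewrite lfZ].
Qed.

Lemma linear_dependence (N : nat) (x : 'I_N -> 'rV[R]_n) : (n < N)%N ->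
  exists2 c : 'I_N -> R, \sum_i c i *: x i = 0 & exists i, c i != 0.
Proof.
move=> nN; pose A : 'M[R]_(N, n) := \matrix_i x i.
have K0 : kermx A != 0.
  by rewrite -mxrank_eq0 mxrank_ker subn_eq0 -ltnNge (leq_ltn_trans (rank_leq_col A)).
pose u := nz_row (kermx A).
have uA : u *m A = 0 by apply/sub_kermxP; exact: nz_row_sub.
exists (fun i => u 0 i).
  transitivity (u *m A); last exact: uA.
  by rewrite mulmx_sum_row; apply: eq_bigr => i _; rewrite rowK.
have un0 : u != 0 by rewrite nz_row_eq0.
apply: contrapT => /forallNP H; case/negP: un0; apply/eqP/rowP => i; rewrite mxE.
by apply/eqP; apply: contrapT => /negP; exact: H.
Qed.

End LinearForms.

Section Centerpoint.
Context {R : realType} {n : nat} {M : ptopologicalType}.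
Variables (mu : {measure set (borel M) -> \bar R}) (Phi : M -> 'rV[R]_n) (l0 : 'cV[R]_n).
Hypotheses (muoo : (mu setT < +oo)%E) (Mcompact : compact [set: M]).
Hypothesis cPhi : forall al, continuous (fun q => Phi q 0 al).
Hypothesis l0_gt0 : forall q, 0 < lf l0 (Phi q).
Hypothesis cone : forall p q (al be : R), 0 <= al -> 0 <= be -> 0 < al + be ->
  exists z c, 0 < c /\ al *: Phi p + be *: Phi q = c *: Phi z.
Implicit Types (p q z : M) (l : 'cV[R]_n).

Lemma closed_borel (A : set M) : closed A -> measurable (A : set (borel M)).
Proof.
move=> cA; rewrite -(setCK A); apply: measurableC; apply: sub_sigma_algebra.
exact: closed_openC.
Qed.

Lemma lf_continuous l : continuous (fun q => lf l (Phi q)).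
Proof.
move=> q; rewrite (_ : (fun q => _) = (fun q => \sum_al Phi q 0 al * l al 0)); last first.
  by apply/funext => ?; rewrite /lf mxE.
by apply: continuous_sum_at => al; apply: continuousM; [exact: cPhi|exact: cst_continuous].
Qed.

Lemma lf_le_closed l (a : R) l' : closed [set q | lf l (Phi q) <= a * lf l' (Phi q)].
Proof.
have -> : [set q | lf l (Phi q) <= a * lf l' (Phi q)] = (fun q => lf (l - a *: l') (Phi q)) @^-1` [set u | u <= 0].
  by apply/seteqP; split => q /=; rewrite lf_subl subr_le0.
by apply: closed_comp => [q _|]; [exact: lf_continuous|exact: closed_le].
Qed.

Lemma lf_le0_closed l : closed [set q | lf l (Phi q) <= 0].
Proof.
by have := @lf_le_closed l 0 l; under eq_set do rewrite mul0r.
Qed.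

Lemma fine_mu_le (A A' : set (borel M)) : measurable A -> measurable A' -> A `<=` A' ->
  fine (mu A) <= fine (mu A').
Proof.
have fin (C : set (borel M)) : measurable C -> mu C \is a fin_num.
  move=> mC; rewrite ge0_fin_numE//; apply: le_lt_trans muoo.
  by apply: le_measure; rewrite ?inE.
by move=> mA mA' AA'; apply: fine_le; rewrite ?fin// le_measure ?inE.
Qed.

(* [n] is the dimension of the linear span, i.e. m + 1 for the hyperboloid. *)
Definition big_form l : Prop := fine (mu [set q | lf l (Phi q) <= 0]) * n%:R < fine (mu setT).

(** The partial sums are zero or in the cone by [cone]; [l0], positive on the cone, excludes zero as
    soon as one coefficient is positive. *)
Lemma cone_sum (I : finType) (P : pred I) (c : I -> R) (z : I -> M) :
  (forall i, P i -> 0 <= c i) -> (exists2 i, P i & 0 < c i) ->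
  exists w a, 0 < a /\ \sum_(i | P i) c i *: Phi (z i) = a *: Phi w.
Proof.
move=> c0 [i0 Pi0 ci0].
have : \sum_(i | P i) c i *: Phi (z i) = 0 \/
    exists w a, 0 < a /\ \sum_(i | P i) c i *: Phi (z i) = a *: Phi w.
  elim/big_rec: _ => [|i v Pi [->|[w [a [a0 ->]]]]]; first by left.
    rewrite addr0; have := c0 i Pi; rewrite le_eqVlt => /predU1P[<-|ci]; first by left; rewrite scale0r.
    by right; exists (z i), (c i).
  have ca : 0 < c i + a by rewrite ltr_wpDl// c0.
  by right; have [w' [b Hb]] := cone (z i) w (c0 i Pi) (ltW a0) ca; exists w', b.
case=> // E; have := congr1 (lf l0) E; rewrite lf_sum (bigD1 i0)//= [X in _ = X]/lf mul0mx mxE.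
move=> /eqP; rewrite gt_eqF// ltr_wpDr//; last by rewrite mulr_gt0.
by apply: sumr_ge0 => i /andP[Pi _]; rewrite mulr_ge0 ?c0// ltW.
Qed.

(** Union bound: at most n sets l <= 0, each of measure less than 1/n of the total, cannot cover
    M. *)
Lemma helly_small (N : nat) (l : 'I_N -> 'cV[R]_n) : (N <= n)%N -> (forall i, big_form (l i)) ->
  exists z, forall i, 0 < lf (l i) (Phi z).
Proof.
move=> Nn big; have [N0|N0] := posnP N.
  by exists point => i; have := ltn_ord i; rewrite {2}N0.
apply: contrapT => /forallNP H.
pose A (i : nat) : set (borel M) := if insub i is Some j then [set q | lf (l j) (Phi q) <= 0] else set0.
have AE (i : 'I_N) : A i = [set q | lf (l i) (Phi q) <= 0] by rewrite /A valK.
have mA i : (i < N)%N -> measurable (A i).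
  by move=> iN; rewrite (AE (Ordinal iN)); apply: closed_borel; exact: lf_le0_closed.
have AT : \big[setU/set0]_(i < N) A i = setT.
  apply/seteqP; split => // q _; have /existsNP[i /negP] := H q; rewrite -leNgt => Hi.
  by rewrite -bigcup_mkord; exists i => //=; rewrite AE.
have fin i : (i < N)%N -> mu (A i) \is a fin_num.
  move=> iN; rewrite ge0_fin_numE//; apply: le_lt_trans muoo.
  by apply: le_measure; rewrite ?inE; [exact: mA|exact: measurableT|].
have := Boole_inequality mu mA; rewrite AT => le.
have {le} : fine (mu setT) <= \sum_(i < N) fine (mu (A i)).
  rewrite -lee_fin fineK ?ge0_fin_numE//; apply: le_trans le _.
  rewrite -sumEFin; apply: lee_sum => i _; rewrite fineK// fin//.
apply/negP; rewrite -ltNge.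
have n0 : 0 < n%:R :> R by rewrite ltr0n (leq_trans N0).
rewrite -(ltr_pM2r n0) mulr_suml.
apply: (@lt_le_trans _ _ (\sum_(i < N) fine (mu setT))).
  apply: ltr_sum => [|i _]; last by rewrite AE; exact: big.
  by apply/hasP; exists (Ordinal N0); rewrite ?mem_index_enum.
by rewrite sumr_const card_ord -[X in X <= _]mulr_natr; apply: ler_wpM2l; [exact: fine_ge0|rewrite ler_nat].
Qed.

(** Radon's argument for cones. A linear dependence of the points z_j, sorted by sign, writes one
    vector of the cone as a combination of each of two disjoint groups. The form l_i is positive at
    all z_j with j != i, hence on the group not containing i; positivity of [l0] makes both groups
    contribute. *)
Lemma helly (N : nat) (l : 'I_N -> 'cV[R]_n) : (forall i, big_form (l i)) ->
  exists z, forall i, 0 < lf (l i) (Phi z).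
Proof.
elim: N l => [|N IH] l big; first by exists point => -[].
have [Nn|nN] := leqP N.+1 n; first exact: helly_small.
have /choice[z Hz] : forall j : 'I_N.+1, exists z, forall i, i != j -> 0 < lf (l i) (Phi z).
  move=> j; have [z Hz] := IH (fun i => l (lift j i)) (fun i => big _).
  by exists z => i; case: (unliftP j i) => [i' ->|->]; rewrite ?eqxx.
have [c c0 [i0 ci0]] := linear_dependence (fun j => Phi (z j)) nN.
pose P := [pred i | 0 < c i].
have split_sum : \sum_(i | P i) c i *: Phi (z i) = \sum_(i | ~~ P i) (- c i) *: Phi (z i).
  move: c0; rewrite (bigID P)/= => /eqP; rewrite addr_eq0 => /eqP ->.
  by rewrite -sumrN; apply: eq_bigr => i _; rewrite scaleNr.
have pos i : P i -> 0 <= c i by move=> /ltW.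
have neg i : ~~ P i -> 0 <= - c i by rewrite /= -leNgt oppr_ge0.
have eqsum : \sum_(i | P i) c i * lf l0 (Phi (z i)) = \sum_(i | ~~ P i) (- c i) * lf l0 (Phi (z i)).
  by rewrite -!lf_sum split_sum.
have exneg : exists2 i, ~~ P i & 0 < - c i.
  have [ci|ci] := boolP (P i0); last first.
    by exists i0 => //; rewrite lt_neqAle eq_sym oppr_eq0 ci0 neg.
  apply: contrapT => H; have : 0 < \sum_(i | P i) c i * lf l0 (Phi (z i)).
    rewrite (bigD1 i0)//= ltr_wpDr ?mulr_gt0//; apply: sumr_ge0 => i /andP[Pi _].
    by rewrite mulr_ge0 ?pos// ltW.
  rewrite eqsum big1 ?ltxx// => i nPi; have := neg i nPi; rewrite le_eqVlt => /predU1P[<-|ci'].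
    by rewrite mul0r.
  by case: H; exists i.
have expos : exists2 i, P i & 0 < c i.
  have [j nPj cj] := exneg; apply: contrapT => H.
  have : 0 < \sum_(i | ~~ P i) (- c i) * lf l0 (Phi (z i)).
    rewrite (bigD1 j)//= ltr_wpDr ?mulr_gt0//; apply: sumr_ge0 => i /andP[Pi _].
    by rewrite mulr_ge0 ?neg// ltW.
  by rewrite -eqsum big1 ?ltxx// => i Pi; case: H; exists i.
have [w [a [a0 Hw]]] := cone_sum z pos expos.
exists w => i; rewrite -(pmulr_rgt0 _ a0) -lfZ -Hw.
have gen (Q : pred 'I_N.+1) (d : 'I_N.+1 -> R) : (forall j, Q j -> 0 <= d j) -> (exists2 j, Q j & 0 < d j) ->
    ~~ Q i -> 0 < \sum_(j | Q j) d j * lf (l i) (Phi (z j)).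
  move=> d0 [j Qj dj] nQi; have ne j' : Q j' -> 0 < lf (l i) (Phi (z j')).
    by move=> Qj'; apply: Hz; apply: contraNneq nQi => ->.
  rewrite (bigD1 j)//= ltr_wpDr ?mulr_gt0 ?ne//; apply: sumr_ge0 => j' /andP[Qj' _].
  by rewrite mulr_ge0 ?d0// ltW// ne.
have [Pi|nPi] := boolP (P i).
  by rewrite split_sum lf_sum; apply: (gen (fun j => ~~ P j)) => //; rewrite negbK.
by rewrite lf_sum; apply: (gen P).
Qed.

(** Compactness needs closed sets, so the strict inequality obtained from [helly] for finitely many
    forms is weakened before passing to all forms. *)
Lemma centerpoint_closed : exists x0, forall l, big_form l -> 0 <= lf l (Phi x0).
Proof.
have := Mcompact; rewrite compact_In0 => /(_ 'cV[R]_n big_form (fun l => [set q | 0 <= lf l (Phi q)])).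
case.
- exists (fun l => [set q | 0 <= lf l (Phi q)]) => [l _|l _]; last by rewrite setTI.
  apply: (@closed_comp _ _ (fun q => lf l (Phi q)) [set u | 0 <= u]) => [q _|]; [exact: lf_continuous|exact: closed_ge].
- move=> D HD; pose s : seq 'cV[R]_n := finmap.enum_fset D.
  have [z Hz] := @helly (size s) (fun i => nth 0 s i) (fun i => set_mem (HD _ (mem_nth 0 (ltn_ord i)))).
  exists z => l /= lD; have ls : (index l s < size s)%N by rewrite index_mem.
  by have := Hz (Ordinal ls); rewrite /= nth_index// => /ltW.
- by move=> x0 H; exists x0 => l /H.
Qed.

(** If l vanishes at [Phi x0], then l - l0/(j+1) is negative there and cannot be a [big_form]. Its
    nonpositive sets decrease to {l <= 0} as j grows, and the finite measure is continuous from
    above. *)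
Lemma centerpoint : exists x0, forall l, lf l (Phi x0) = 0 ->
  fine (mu setT) <= fine (mu [set q | lf l (Phi q) <= 0]) * n%:R.
Proof.
have [x0 H] := centerpoint_closed; exists x0 => l lx.
pose F (j : nat) : set (borel M) := [set q | lf l (Phi q) <= j.+1%:R^-1 * lf l0 (Phi q)].
have mF j : measurable (F j) by apply: closed_borel; exact: lf_le_closed.
have Fle j : fine (mu setT) <= fine (mu (F j)) * n%:R.
  rewrite leNgt; apply/negP => lt.
  have : big_form (l - j.+1%:R^-1 *: l0).
    rewrite /big_form; under eq_set do rewrite lf_subl subr_le0.
    exact: lt.
  by move=> /H; rewrite lf_subl lx sub0r oppr_ge0 leNgt mulr_gt0.
have mcap : measurable (\bigcap_j F j) by exact: bigcapT_measurable.
have capE : \bigcap_j F j = [set q | lf l (Phi q) <= 0].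
  apply/seteqP; split => q /=.
    move=> Hq; rewrite leNgt; apply/negP => lq.
    have := l0_gt0 q => l0q; pose e := lf l (Phi q) / lf l0 (Phi q).
    have e0 : 0 < e by rewrite divr_gt0.
    have [j Hj] : exists j : nat, j.+1%:R^-1 < e.
      exists (Num.truncn e^-1); rewrite -[ltRHS]invrK ltf_pV2 ?posrE ?invr_gt0//.
      by have /andP[] := truncn_itv (ltW (eqbRL (invr_gt0 e) e0)).
    have := Hq j I; rewrite /F /= -ler_pdivrMr// leNgt => /negP; apply.
    exact: Hj.
  by move=> Hq j _; apply: le_trans Hq _; rewrite mulr_ge0// ltW.
have nF : nonincreasing_seq F.
  move=> i j ij; apply/subsetPset => q; rewrite /F /= => /le_trans; apply.
  by rewrite ler_pM2r// lef_pV2 ?posrE// ler_nat.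
have fin (C : set (borel M)) : measurable C -> mu C \is a fin_num.
  move=> mC; rewrite ge0_fin_numE//; apply: le_lt_trans muoo.
  by apply: le_measure; rewrite ?inE.
have F0 : (mu (F 0%N) < +oo)%E by rewrite -ge0_fin_numE ?fin.
have cv := nonincreasing_cvg_mu F0 mF mcap nF; rewrite capE in cv mcap.
have cv' : (fun j => fine (mu (F j)) * n%:R) @ \oo --> fine (mu [set q | lf l (Phi q) <= 0]) * n%:R.
  apply: cvgM; last exact: cvg_cst.
  by apply: fine_cvg; rewrite fineK ?fin.
rewrite -(cvg_lim _ cv')//; apply: limr_ge; first by apply/cvg_ex; exists (fine (mu [set q | lf l (Phi q) <= 0]) * n%:R).
exact: nearW.
Qed.

End Centerpoint.

(** * Volume *)

Lemma continuous_det {R : realType} {T : topologicalType} {n : nat} (A : T -> 'M[R]_n) (t : T) :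
  (forall a b, {for t, continuous (fun s => A s a b)}) -> {for t, continuous (fun s => \det (A s))}.
Proof.
move=> cA; apply: continuous_sum_at => s; apply: continuousM; first exact: cst_continuous.
suff H (f : 'I_n -> 'I_n) (l : seq 'I_n) : {for t, continuous (fun u => \prod_(i <- l) A u i (f i))} by exact: H.
elim: l => [|a l IH].
  have -> : (fun u => \prod_(i <- [::]) A u i (f i)) = cst 1 by apply/funext => u; rewrite big_nil.
  exact: cst_continuous.
have -> : (fun u => \prod_(i <- a :: l) A u i (f i)) = (fun u => A u a (f a) * \prod_(i <- l) A u i (f i)).
  by apply/funext => u; rewrite big_cons.
by apply: continuousM; [exact: cA|exact: IH].
Qed.

(** The determinant has no zero on the segment from the identity to [G], which consists of positive
    definite matrices. *)
Lemma posdef_det_gt0 {R : realType} {n : nat} (G : 'M[R]_n) : posdef G -> 0 < \det G.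
Proof.
move=> pG; pose A (t : R) : 'M[R]_n := (1 - t)%:M + t *: G.
have unA t : 0 <= t <= 1 -> \det (A t) != 0.
  move=> /andP[t0 t1]; rewrite -unitfE -unitmxE; apply: posdef_unit => v v0.
  have -> : bil (A t) v v = (1 - t) * bil 1%:M v v + t * bil G v v.
    by rewrite /bil /A mulmxDr mulmxDl -scalemx1 -!scalemxAr -!scalemxAl !mxE.
  have vv : 0 < bil 1%:M v v.
    rewrite /bil mulmx1 mxE; under eq_bigr do rewrite mxE -expr2.
    rewrite lt_neqAle sumr_ge0 ?andbT; last by move=> ? _; exact: sqr_ge0.
    apply: contra_neq v0 => /esym/eqP; rewrite psumr_eq0 => [/allP H|? _]; last exact: sqr_ge0.
    by apply/rowP => a; rewrite mxE; apply/eqP; rewrite -sqrf_eq0; apply: H; rewrite mem_index_enum.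
  have := pG v v0; have [->|tp] := eqVneq t 0; first by lra.
  have tp' : 0 < t by rewrite lt_neqAle eq_sym tp.
  by move=> gp; rewrite ltr_wpDl ?mulr_gt0// mulr_ge0 ?subr_ge0// ltW.
have cA : continuous (fun t => \det (A t)).
  move=> t; apply: continuous_det => a b.
  have -> : (fun s => A s a b) = (fun s => (1 - s) * (a == b)%:R + s * G a b).
    by apply/funext => s; rewrite /A !mxE mulr_natr.
  apply: continuousD; apply: continuousM; try exact: cst_continuous; last exact: cvg_id.
  by apply: continuousB; [exact: cst_continuous|exact: cvg_id].
have A0 : \det (A 0) = 1 by rewrite /A subr0 scale0r addr0 det1.
have A1 : \det (A 1) = \det G by rewrite /A subrr scale1r raddf0 add0r.
rewrite ltNge; apply/negP => dG.
have [||t t01 /eqP] := @IVT _ (fun t => \det (A t)) 0 1 0 ler01.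
- by apply: continuous_subspaceT.
- by rewrite A0 A1 ge_min le_max ler01 dG orbT.
by apply/negP; apply: unA; move: t01; rewrite in_itv.
Qed.

Lemma cube_row_mx {R : realType} n (x0 : 'rV[R]_(1 + n)) (r x : R) (v : 'rV[R]_n) :
  cube x0 r (row_mx x%:M v) <-> `|x - x0 0 (lshift n 0)| < r /\ cube (rsubmx x0) r v.
Proof.
split=> [H|[Hx Hv] b].
  split; first by have := H (lshift n 0); rewrite row_mxEl mxE eqxx mulr1n.
  by move=> b; have := H (rshift 1 b); rewrite row_mxEr mxE.
case: (split_ordP b) => b' ->; first by rewrite row_mxEl mxE (ord1 b') eqxx mulr1n.
by have := Hv b'; rewrite row_mxEr mxE.
Qed.

Section LebesgueCube.
Context {R : realType}.
Local Open Scope ereal_scope.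

Lemma lebesgue_int_ge0 n (f : 'rV[R]_n -> \bar R) : (forall x, 0 <= f x) -> 0 <= lebesgue_int f.
Proof.
elim: n f => [|n IH] f f0 /=; first exact: f0.
by apply: integral_ge0 => x _; apply: IH.
Qed.

Lemma lebesgue_int_le n (f h : 'rV[R]_n -> \bar R) : (forall x, 0 <= f x) -> (forall x, f x <= h x) ->
  lebesgue_int f <= lebesgue_int h.
Proof.
elim: n f h => [|n IH] f h f0 fh /=; first exact: fh.
by apply: ge0_integral_le => x _; [apply: lebesgue_int_ge0|apply: IH].
Qed.

Lemma lebesgue_int_cube n (x0 : 'rV[R]_n) (r c : R) : (0 < r)%R -> (0 <= c)%R ->
  lebesgue_int (fun x => (c * \1_(cube x0 r) x)%:E) = (c * (2 * r) ^+ n)%:E.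
Proof.
move=> r0; elim: n x0 c => [|n IH] x0 c c0.
  by rewrite /= indicE mem_set ?mulr1 ?expr0 ?mulr1// => -[].
pose a : R := (x0 : 'rV_(1 + n)) 0%R (lshift n 0%R); pose y0 : 'rV[R]_n := rsubmx (x0 : 'rV_(1 + n)).
pose J : set R := `](a - r)%R, (a + r)%R[%classic.
have mJ : measurable (J : set (measurableTypeR R)) by exact: measurable_itv.
have E (x : R) (v : 'rV[R]_n) : \1_(cube x0 r) (row_mx (x%:M : 'rV_1) v : 'rV_n.+1) = (\1_J x * \1_(cube y0 r) v)%R :> R.
  have K := @cube_row_mx _ n (x0 : 'rV_(1 + n)) r x v.
  have JE : J x <-> (`|x - a| < r)%R by rewrite /J /= in_itv/= ltr_distl.
  rewrite !indicE -natrM mulnb; congr (nat_of_bool _)%:R; apply/idP/andP; rewrite !inE.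
    by move=> /K[/JE ? ?].
  by move=> [/JE ? ?]; apply/K.
rewrite /=; transitivity (\int[lebesgue_measure]_x ((c * (2 * r) ^+ n)%:E * (\1_J x)%:E)).
  apply: eq_integral => x _.
  rewrite (_ : (fun v => _) = (fun v => ((c * \1_J x) * \1_(cube y0 r) v)%:E)); last first.
    by apply/funext => v; rewrite E mulrA.
  by rewrite IH ?mulr_ge0// -EFinM; congr _%:E; ring.
rewrite ge0_integralZl_EFin//; last 2 first.
- by apply/measurable_EFinP; exact: measurable_indic.
- by rewrite mulr_ge0// exprn_ge0// mulr_ge0// ltW.
have -> : \int[lebesgue_measure]_x (\1_J x)%:E = (2 * r)%:E.
  transitivity (@lebesgue_measure R J).
    by rewrite -[J in RHS]setIT; exact: integral_indic.
  rewrite /J lebesgue_measure_itv/= lte_fin ltrD2l gt0_cp// -EFinB; congr _%:E; ring.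
by rewrite -EFinM; congr _%:E; rewrite exprS; ring.
Qed.

End LebesgueCube.

Section Volume.
Context {R : realType} {m : nat} {M : ptopologicalType} {X : manifold R m M}.
Variables (g : riemannian_metric X) (mu : {measure set (borel M) -> \bar R}).
Hypothesis muvol : volume_measure g mu.
Implicit Types (i : chart X) (p q : M) (x : 'rV[R]_m).

Lemma open_borel (A : set M) : open A -> measurable (A : set (borel M)).
Proof. by move=> oA; exact: sub_sigma_algebra. Qed.

(** Adding r/2 to all coordinates of a chart point stays in the chart image and makes the first
    coordinate positive. *)
Lemma nonboundary_point : exists q, ~ boundary X q.
Proof.
pose q : M := point; pose i := chart_at X q; have dq : dom i q by exact: dom_chart_at.
have [V oV EV] := @cmap_image _ _ _ X i; pose x0 := cmap i q.
have [Vx0 hx0] : (V `&` @halfspace R m) x0 by rewrite -EV; exists q.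
have [r r0 rV] := open_cubeP oV Vx0.
pose x : 'rV[R]_m := x0 + const_mx (r / 2); have r2 : 0 < r / 2 by rewrite divr_gt0.
have ix : inner i x.
  split; last by move=> [a [a0]]; rewrite !mxE => xa; have := hx0 a a0; lra.
  rewrite EV; split; last by move=> a a0; rewrite !mxE; have := hx0 a a0; lra.
  by apply: rV => a; rewrite !mxE addrAC subrr add0r gtr0_norm// ltr_pdivrMr// ltr_pMr// ltr1n.
by exists (par i x); exact: (inner_interior g ix).
Qed.

(** The density is continuous and positive up to the boundary, through the extension of the metric.
    The upper bound serves for finiteness of the volume, the lower one for its positivity. *)
Lemma sqrt_det_bounds i q : dom i q -> exists (r c1 c2 : R), [/\ 0 < r, 0 < c1, 0 < c2,
  cube (cmap i q) r `&` @halfspace R m `<=` cmap i @` dom i &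
  forall x, cube (cmap i q) r x -> (cmap i @` dom i) x ->
    c1 <= Num.sqrt (\det (gmx g i x)) <= c2].
Proof.
move=> dq; have [r1 [F [r10 HI FG CF]]] := gmx_extension g dq; set x0 := cmap i q in HI FG CF *.
have cF : {for x0, continuous (fun x => \det (F x))}.
  by apply: continuous_det => a b; exact: Cn_continuous (CF 0%N a b) (cube_center x0 r10).
have d0 : 0 < \det (F x0).
  rewrite FG; [|exact: cube_center|by exists q].
  by apply: posdef_det_gt0 => v v0; exact: gmx_pos.
have d02 : 0 < \det (F x0) / 2 by rewrite divr_gt0.
have [r2 r20 H2] : exists2 r : R, 0 < r & cube x0 r `<=` cube x0 r1 `&`
    [set x | `|\det (F x) - \det (F x0)| <= \det (F x0) / 2].
  apply/nbhs_cubeP; apply: filterI; first by apply/nbhs_cubeP; exists r1.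
  exact: (continuous_dist_le cF d02).
exists r2, (Num.sqrt (\det (F x0) / 2)), (Num.sqrt (2 * \det (F x0))); split => //.
- by rewrite sqrtr_gt0.
- by rewrite sqrtr_gt0 mulr_gt0.
- by move=> x [/H2[cx _] hx]; exact: HI.
- move=> x /H2[cx /= dx] ix; rewrite -FG//; move: dx; rewrite ler_norml => /andP[dx1 dx2].
  have E : \det (F x0) = \det (F x0) / 2 + \det (F x0) / 2 by field.
  by rewrite !ler_sqrt; [apply/andP; split|..]; move: (\det (F x0) / 2) E dx1 dx2 d02 => d E *; lra.
Qed.

Lemma chart_image_preimage i (W : set 'rV[R]_m) :
  cmap i @` (dom i `&` cmap i @^-1` W) = (cmap i @` dom i) `&` W.
Proof.
apply/seteqP; split => [_ [p [dp Wp] <-]|_ [[p dp <-] Wp]]; first by split=> //; exists p.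
by exists p.
Qed.

Lemma local_volume_finite q : exists A : set M, [/\ open A, A q & (mu A < +oo)%E].
Proof.
pose i := chart_at X q; have dq : dom i q by exact: dom_chart_at.
have [r [c1 [c2 [r0 _ c20 _ Hc]]]] := sqrt_det_bounds dq; set x0 := cmap i q in Hc.
have oA : open (dom i `&` cmap i @^-1` (cube x0 r)) by apply: open_chart_preimage; exact: open_cube.
exists (dom i `&` cmap i @^-1` (cube x0 r)); split => //; first by split => //; exact: cube_center.
rewrite (muvol (open_borel oA) (@subIsetl _ _ _)) chart_image_preimage.
apply: (@le_lt_trans _ _ (lebesgue_int (fun x => (c2 * \1_(cube x0 r) x)%:E))).
  apply: lebesgue_int_le => x; first by rewrite lee_fin mulr_ge0// sqrtr_ge0.
  rewrite lee_fin !indicE; have [[ix cx]|nx] := pselect ((cmap i @` dom i `&` cube x0 r) x).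
    by rewrite !mem_set// !mulr1; have /andP[] := Hc x cx ix.
  by rewrite memNset// mulr0 mulr_ge0// ltW.
by rewrite lebesgue_int_cube ?ltry// ltW.
Qed.

Lemma volume_finite : compact [set: M] -> (mu setT < +oo)%E.
Proof.
have /choice[A HA] := local_volume_finite.
rewrite compact_cover => /(_ M setT A)[q _|q _|D _ DA]; first by have [] := HA q.
  by exists q => //; have [] := HA q.
have fin (s : seq M) : open (\bigcup_(q in [set` s]) A q) /\ (mu (\bigcup_(q in [set` s]) A q) < +oo)%E.
  elim: s => [|a s [oB IH]]; first by rewrite set_nil bigcup_set0 measure0; split => //; exact: open0.
  have [oa _ fa] := HA a.
  have -> : \bigcup_(q in [set` a :: s]) A q = A a `|` \bigcup_(q in [set` s]) A q.
    apply/seteqP; split => [z [q /= qs Aq]|z [Az|[q /= qs Aq]]].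
    - by move: qs Aq; rewrite inE => /predU1P[-> ?|qs Aq]; [left|right; exists q].
    - by exists a => //=; rewrite inE eqxx.
    - by exists q => //=; rewrite inE qs orbT.
  split; first exact: openU.
  by apply: le_lt_trans (measureU2 _ (open_borel oa) (open_borel oB)) _; rewrite lte_add_pinfty.
have [oB fB] := fin (finmap.enum_fset D); apply: le_lt_trans fB.
apply: le_measure; rewrite ?inE//; first exact: open_borel.
Qed.

Lemma volume_gt0 : (0 < mu setT)%E.
Proof.
have [q nq] := nonboundary_point; pose i := chart_at X q; have dq : dom i q by exact: dom_chart_at.
have iq := interior_inner nq dq.
have [r [c1 [c2 [r0 c10 _ _ Hc]]]] := sqrt_det_bounds dq; set x0 := cmap i q in iq Hc.
have [s s0 sI] := open_cubeP (@open_inner _ _ _ X i) iq.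
pose t := Num.min r s; have t0 : 0 < t by rewrite lt_min r0.
have oA : open (dom i `&` cmap i @^-1` (cube x0 t)) by apply: open_chart_preimage; exact: open_cube.
apply: (@lt_le_trans _ _ (mu (dom i `&` cmap i @^-1` (cube x0 t)))); last first.
  by apply: le_measure; rewrite ?inE//; exact: open_borel.
rewrite (muvol (open_borel oA) (@subIsetl _ _ _)) chart_image_preimage.
apply: (@lt_le_trans _ _ (lebesgue_int (fun x => (c1 * \1_(cube x0 t) x)%:E))).
  by rewrite lebesgue_int_cube ?lte_fin ?mulr_gt0 ?exprn_gt0// ?mulr_gt0// ltW.
apply: lebesgue_int_le => x; first by rewrite lee_fin mulr_ge0// ltW.
rewrite lee_fin !indicE; have [cx|nx] := pselect (cube x0 t x); last first.
  by rewrite memNset// mulr0 mulr_ge0// sqrtr_ge0.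
have ix : (cmap i @` dom i) x by apply: inner_image; apply: sI; apply: cubeS cx; rewrite ge_min lexx orbT.
rewrite !mem_set// !mulr1; have cr : cube x0 r x by apply: cubeS cx; rewrite ge_min lexx.
by have /andP[] := Hc x cr ix.
Qed.

End Volume.

(** * Sections of the set of geodesics through the ball *)

Section MainInequality.
Context {R : realType} {m : nat} {M : ptopologicalType} {X : manifold R m M}.
Variables (g : riemannian_metric X) (k : R).
Hypotheses (hk : 0 < k) (Mcurv : constant_sectional_curvature g (- k ^+ 2)).
Hypotheses (Mconvex : convex_manifold g) (Mcompact : compact [set: M]).
Variables (B : 'M[R]_(1 + m)) (Phi : M -> 'rV[R]_(1 + m)) (o : M).
Hypotheses (BT : B^T = B) (LB : lorentz B) (HPhi : mdev g k B (~` boundary X) Phi).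
Hypothesis (no : ~ boundary X o).
Hypothesis Hray : forall y, exists gam kap w, [/\ geodesic g o y gam, hyp B kap (Phi o) w &
      forall s : R, 0 <= s <= 1 -> Phi (gam s) = hg kap (Phi o) w s].
Implicit Types (p q z : M).
Let Pself := Phi_self BT Hray.
Let Pform := Phi_form hk Mcurv Mconvex BT LB HPhi no Hray.
Let Pcont := Phi_continuous hk Mcurv Mconvex BT HPhi no Hray.
Let Pinj := Phi_inj hk Mcurv Mconvex BT LB HPhi no Hray.

Let Pge1 p q : 1 <= bil B (Phi p) (Phi q).
Proof. by have [kap _ ->] := Pform p q; exact: ch_ge1. Qed.

Lemma lf_bil (v u : 'rV[R]_(1 + m)) : lf (B *m v^T) u = bil B u v.
Proof. by rewrite /lf /bil mulmxA. Qed.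

Lemma bil_combination p q (al be : R) :
  bil B (al *: Phi p + be *: Phi q) (al *: Phi p + be *: Phi q) =
  al ^+ 2 + be ^+ 2 + 2 * (al * be * bil B (Phi p) (Phi q)).
Proof.
rewrite bilDl !bilDr !bilZl !bilZr !Pself (bilC (Phi q) _ BT).
by move: (bil _ _ _) => c; ring.
Qed.

(** The combination has positive B-square because products of images are at least 1; dividing by the
    square root puts it on the hyperboloid, where [segment_combination] finds the point. *)
Lemma hyperboloid_cone p q (al be : R) : 0 <= al -> 0 <= be -> 0 < al + be ->
  exists z c, 0 < c /\ al *: Phi p + be *: Phi q = c *: Phi z.
Proof.
move=> a0 b0 ab; have c1 := Pge1 p q; set c := bil B (Phi p) (Phi q) in c1.
pose N := al ^+ 2 + be ^+ 2 + 2 * (al * be * c).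
have N0 : 0 < N.
  have h : 0 <= al * be by rewrite mulr_ge0.
  have h2 : 0 <= al * be * (c - 1) by rewrite mulr_ge0// subr_ge0.
  have h3 : 0 < (al + be) ^+ 2 by rewrite exprn_gt0.
  have -> : N = (al + be) ^+ 2 + 2 * (al * be * (c - 1)) by rewrite /N; ring.
  by rewrite ltr_wpDr// mulr_ge0.
pose s := Num.sqrt N; have s0 : 0 < s by rewrite sqrtr_gt0.
have sn : s != 0 by rewrite gt_eqF.
have ss : s ^+ 2 = N by rewrite sqr_sqrtr// ltW.
have [|||z _ Hz] := @segment_combination _ _ _ _ g k hk Mcurv Mconvex B Phi o BT LB HPhi no Hray p q (al / s) (be / s).
- by rewrite divr_ge0// ltW.
- by rewrite divr_ge0// ltW.
- rewrite bil_combination -/c; have -> : (al / s) ^+ 2 + (be / s) ^+ 2 + 2 * (al / s * (be / s) * c) = N / s ^+ 2.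
    by rewrite /N; field.
  by rewrite ss divff// gt_eqF.
exists z, s; split => //; rewrite Hz scalerDr !scalerA !(mulrC s) !divfK//.
Qed.

(** Since 1 = al^2 + be^2 + 2 al be B(Phi p, Phi q) with nonnegative terms, the coefficients lie in
    [0, 1]; this compactness is what [section_closed] exploits. *)
Lemma geodesic_arcP p q z : geodesic_arc g p q z <->
  exists al be : R, [/\ 0 <= al <= 1, 0 <= be <= 1 & Phi z = al *: Phi p + be *: Phi q].
Proof.
split=> [[gam [t [Hg t01 ->]]]|[al [be [/andP[a0 _] /andP[b0 _] E]]]]; last first.
  have [|z' Hz' Ez'] := @segment_combination _ _ _ _ g k hk Mcurv Mconvex B Phi o BT LB HPhi no Hray p q al be a0 b0.
    by rewrite -E Pself.
  by have -> : z = z' by apply: Pinj; rewrite Ez'.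
have [kap [w [Hh HP _]]] := Phi_geodesic hk Mcurv Mconvex BT LB HPhi no Hray Hg.
have [k0 _ _ _ kw] := Hh; have [g0 g1 _ _] := Hg; have [t0 t1] := andP t01.
have P1 : hg kap (Phi p) w 1 = Phi q by rewrite -HP ?lexx ?ler01// g1.
suff [al [be [a0 b0 E]]] : exists al be : R, [/\ 0 <= al, 0 <= be & Phi (gam t) = al *: Phi p + be *: Phi q].
  have := Pself (gam t); rewrite E bil_combination => N1; have c1 := Pge1 p q.
  have h : 0 <= al * be * bil B (Phi p) (Phi q) by rewrite !mulr_ge0// (le_trans ler01).
  exists al, be; split => //; apply/andP; split => //.
    rewrite -(@expr_le1 _ 2)//; have := sqr_ge0 be; lra.
  rewrite -(@expr_le1 _ 2)//; have := sqr_ge0 al; lra.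
have [kz|kn] := eqVneq kap 0.
  exists 1, 0; split => //; rewrite scale1r scale0r addr0 HP// /hg kz (kw kz) scaler0 addr0 mul0r ch0 scale1r//.
have kp : 0 < kap by rewrite lt_neqAle eq_sym kn.
have sn : sh kap != 0 by rewrite gt_eqF// sh_gt0.
exists (sh (kap * (1 - t)) / sh kap), (sh (kap * t) / sh kap); split.
- by rewrite divr_ge0// ?sh_ge0// mulr_ge0// subr_ge0.
- by rewrite divr_ge0// ?sh_ge0// mulr_ge0.
have := hg_convex (Phi p) t 0 1 kw; rewrite subr0 mulr1 subr0 hg0 P1 -HP// => E.
apply: (scalerI sn); rewrite E scalerDr !scalerA !(mulrC (sh kap)) !divfK//.
Qed.

(** The section is the projection of the compact set of (q, z, al, be) with z in [C] and Phi z = al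
    Phi p + be Phi q. *)
Lemma section_closed p (C : set M) : closed C -> closed [set q | geodesic_arc g p q `&` C !=set0].
Proof.
move=> cC; pose E : set (M * (M * (R * R))) := setT `*` (C `*` (`[0, 1]%classic `*` `[0, 1]%classic)) `&`
  [set u | forall a, Phi u.2.1 0 a = u.2.2.1 * Phi p 0 a + u.2.2.2 * Phi u.1 0 a].
have -> : [set q | geodesic_arc g p q `&` C !=set0] = fst @` E.
  apply/seteqP; split => [q [z [/geodesic_arcP[al [be [a01 b01 Ez]]] Cz]]|_ [[q [z [al be]]] [[_ [Cz [a01 b01]]] Ez] <-]].
    exists (q, (z, (al, be))) => //; split; last by move=> a; rewrite /= Ez !mxE.
    by do !split => //=; rewrite in_itv.
  exists z; split => //; apply/geodesic_arcP; exists al, be; split; [by move: a01; rewrite /= in_itv|by move: b01; rewrite /= in_itv|].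
  by apply/rowP => a; rewrite !mxE; exact: Ez.
apply: compact_closed; first exact: (manifold_hausdorff X).
apply: continuous_compact; first by apply: continuous_subspaceT => u; exact: cvg_fst.
apply: compact_closedI.
  apply: compact_setX => //; apply: compact_setX; last by apply: compact_setX; exact: segment_compact.
  exact: (subclosed_compact cC Mcompact).
have c1 : continuous (fun u : M * (M * (R * R)) => u.1) by move=> u; exact: cvg_fst.
have c2 : continuous (fun u : M * (M * (R * R)) => u.2) by move=> u; exact: cvg_snd.
have c21 : continuous (fun u : M * (M * (R * R)) => u.2.1).
  by move=> u; apply: (@continuous_comp _ _ _ snd fst); [exact: cvg_snd|exact: cvg_fst].
have c22 : continuous (fun u : M * (M * (R * R)) => u.2.2).
  by move=> u; apply: (@continuous_comp _ _ _ snd snd); [exact: cvg_snd|exact: cvg_snd].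
have c221 : continuous (fun u : M * (M * (R * R)) => u.2.2.1).
  by move=> u; apply: (@continuous_comp _ _ _ (fun u => u.2.2) fst); [exact: c22|exact: cvg_fst].
have c222 : continuous (fun u : M * (M * (R * R)) => u.2.2.2).
  by move=> u; apply: (@continuous_comp _ _ _ (fun u => u.2.2) snd); [exact: c22|exact: cvg_snd].
pose H (a : 'I_(1 + m)) (u : M * (M * (R * R))) : R := Phi u.2.1 0 a - (u.2.2.1 * Phi p 0 a + u.2.2.2 * Phi u.1 0 a).
have -> : [set u : M * (M * (R * R)) | forall a, Phi u.2.1 0 a = u.2.2.1 * Phi p 0 a + u.2.2.2 * Phi u.1 0 a] =
    \bigcap_(a in [set: 'I_(1 + m)]) (H a @^-1` [set 0]).
  apply/seteqP; split => [u Hu a _|u Hu a]; rewrite /H /=; first by rewrite Hu subrr.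
  by apply/eqP; rewrite -subr_eq0; apply/eqP; exact: (Hu a I).
apply: closed_bigI => a _; suff cH : continuous (H a).
  by apply: closed_comp; [move=> u _; exact: cH|exact: closed_eq].
move=> u.
have P1 : {for u, continuous (fun u : M * (M * (R * R)) => Phi u.2.1 0 a)}.
  by apply: (@continuous_comp _ _ _ (fun u : M * (M * (R * R)) => u.2.1) (fun z => Phi z 0 a)); [exact: c21|exact: Pcont].
have P2 : {for u, continuous (fun u : M * (M * (R * R)) => Phi u.1 0 a)}.
  by apply: (@continuous_comp _ _ _ (fun u : M * (M * (R * R)) => u.1) (fun z => Phi z 0 a)); [exact: c1|exact: Pcont].
have A := continuousM (c221 u) (@cst_continuous _ _ (Phi p 0 a) u).
exact: (continuousB P1 (continuousD A (continuousM (c222 u) P2))).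
Qed.

(** The origin of r0: exp(k r0) = sqrt 2 + 1 and its inverse sqrt 2 - 1 have mean sqrt 2. *)
Lemma ch_radius : ch (k * (k^-1 * ln (Num.sqrt 2 + 1))) = Num.sqrt 2.
Proof.
have s0 : 0 <= Num.sqrt 2 :> R by exact: sqrtr_ge0.
have ss : Num.sqrt 2 ^+ 2 = 2 :> R by rewrite sqr_sqrtr.
have p : 0 < Num.sqrt 2 + 1 :> R by rewrite ltr_wpDl.
rewrite mulVKf ?gt_eqF// /ch expRN lnK ?posrE//.
have -> : (Num.sqrt 2 + 1)^-1 = Num.sqrt 2 - 1 :> R.
  apply: (mulfI (x := Num.sqrt 2 + 1)); first by rewrite gt_eqF.
  by rewrite divff ?gt_eqF// mulrC -subr_sqr ss expr1n; ring.
by move: (Num.sqrt 2) => s; field.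
Qed.

(** With a, b the products of P, Q with O and c that of P and Q, the hypothesis is c >= a b. Then
    P/a + Q/b has B-square N >= 2, its cross term alone contributing at least 2, and B-product
    exactly 2 with O. After normalization the product is 2/sqrt N <= sqrt 2. *)
Lemma arc_meets_ball (x0 p q : M) :
  lf (B *m (bil B (Phi p) (Phi x0) *: Phi x0 - Phi p)^T) (Phi q) <= 0 ->
  geodesic_arc g p q `&` gball g x0 (k^-1 * ln (Num.sqrt 2 + 1)) !=set0.
Proof.
rewrite lf_bil bilDr bilZr bilNr subr_le0 => H.
have a1 := Pge1 p x0; have b1 := Pge1 q x0; have c1 := Pge1 p q.
rewrite (bilC (Phi q) (Phi p) BT) in H; set a := bil B (Phi p) (Phi x0) in H a1.
set b := bil B (Phi q) (Phi x0) in H b1; set c := bil B (Phi p) (Phi q) in H c1.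
have a0 : 0 < a by rewrite (lt_le_trans ltr01). have b0 : 0 < b by rewrite (lt_le_trans ltr01).
pose N := a^-1 ^+ 2 + b^-1 ^+ 2 + 2 * (a^-1 * b^-1 * c).
have N2 : 2 <= N.
  have h : 1 <= a^-1 * b^-1 * c by rewrite -invfM ler_pdivlMl ?mulr_gt0// mulr1.
  by rewrite /N; have := sqr_ge0 a^-1; have := sqr_ge0 b^-1; lra.
have N0 : 0 < N by rewrite (lt_le_trans _ N2).
pose s := (Num.sqrt N)^-1; have q0 : 0 < Num.sqrt N by rewrite sqrtr_gt0.
have s0 : 0 < s by rewrite invr_gt0.
have sN : s ^+ 2 * N = 1 by rewrite /s exprVn sqr_sqrtr ?mulVf ?gt_eqF// ltW.
have [|||z Hz Ez] := @segment_combination _ _ _ _ g k hk Mcurv Mconvex B Phi o BT LB HPhi no Hray p q (s / a) (s / b).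
- by rewrite divr_ge0// ltW.
- by rewrite divr_ge0// ltW.
- by rewrite bil_combination -/c; transitivity (s ^+ 2 * N); [rewrite /N; ring|exact: sN].
exists z; split => //; apply: (dist_le hk Mcurv Mconvex BT LB HPhi no Hray).
  by apply: mulr_ge0; [rewrite invr_ge0 ltW|rewrite ln_ge0// lerDr sqrtr_ge0].
rewrite ch_radius bilC// Ez bilDl !bilZl -/a -/b !divfK ?gt_eqF//.
have s2 : (s + s) ^+ 2 <= 2.
  have : s ^+ 2 * 2 <= s ^+ 2 * N by rewrite ler_pM2l// exprn_gt0.
  by rewrite sN; have -> : (s + s) ^+ 2 = 4 * s ^+ 2 by [ring]; lra.
have ss0 : 0 <= s + s by rewrite addr_ge0// ltW.
by rewrite -(ger0_norm ss0) -sqrtr_sqr ler_sqrt.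
Qed.

End MainInequality.

(** The product measure of [A] is by definition the integral of the measures of its sections, and
    [ge0_integral_le] compares integrals of nonnegative functions pointwise. *)
Lemma product_measure_lower {d} {T : measurableType d} {R : realType}
  (mu : {measure set T -> \bar R}) (A : set (T * T)) (c : R) : (mu setT < +oo)%E ->
  (forall p, measurable (xsection A p)) -> 0 <= c -> (forall p, c <= fine (mu (xsection A p))) ->
  c * fine (mu setT) <= fine ((mu \x mu)%E A).
Proof.
move=> muoo mA c0 Hc.
have muT : mu setT \is a fin_num by rewrite ge0_fin_numE.
have fin p : mu (xsection A p) \is a fin_num.
  rewrite ge0_fin_numE//; apply: le_lt_trans muoo; apply: le_measure; rewrite ?inE//.
have lb : (c%:E * mu setT <= (mu \x mu) A)%E.
  rewrite -integral_cst//; apply: ge0_integral_le => p _ /=; first by rewrite lee_fin.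
  by rewrite -[leRHS]fineK// lee_fin.
have ub : ((mu \x mu) A <= mu setT * mu setT)%E.
  rewrite -integral_cst//; apply: ge0_integral_le => p _ //=.
  by apply: le_measure; rewrite ?inE.
have fA : (mu \x mu)%E A \is a fin_num.
  rewrite ge0_fin_numE; last by apply: integral_ge0.
  by apply: le_lt_trans ub _; rewrite -ge0_fin_numE ?mule_ge0// fin_numM.
by rewrite -lee_fin EFinM !fineK.
Qed.

Theorem theorem1 (R : realType) (m : nat) (M : ptopologicalType)
    (X : manifold R m M) (g : riemannian_metric X)
    (mu : {sigma_finite_measure set (borel M) -> \bar R})
    (k : R) (hk : 0 < k)
    (Mcompact : compact [set: M])
    (Mconvex : convex_manifold g)
    (Mcurv : constant_sectional_curvature g (- k ^+ 2))
    (muvol : volume_measure g mu) :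
  let r0 := k^-1 * ln (Num.sqrt 2 + 1) in
  exists x0 : M,
    (m.+1%:R)^-1 <=
      fine ((mu \x mu)%E (geodesics_through g x0 r0)) / fine (mu [set: M]) ^+ 2.
Proof.
have [q0 nq0] := nonboundary_point g.
have [B [Phi [BT LB HPhi Hray]]] := developing_map hk Mcurv Mconvex nq0.
have muoo : (mu setT < +oo)%E := volume_finite muvol Mcompact.
have mu0 : (0 < mu setT)%E := volume_gt0 muvol.
have Pcont := Phi_continuous hk Mcurv Mconvex BT HPhi nq0 Hray.
have Pcone := hyperboloid_cone hk Mcurv Mconvex BT LB HPhi nq0 Hray.
have l0pos q : 0 < lf (B *m (Phi q0)^T) (Phi q).
  rewrite lf_bil; have [kap _ ->] := Phi_form hk Mcurv Mconvex BT LB HPhi nq0 Hray q q0.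
  exact: ch_gt0.
have [x0 Hx0] := centerpoint muoo Mcompact Pcont l0pos Pcone.
move=> r0; exists x0.
have cS p : closed [set q | geodesic_arc g p q `&` gball g x0 r0 !=set0].
  apply: (section_closed hk Mcurv Mconvex Mcompact BT LB HPhi nq0 Hray).
  exact: (gball_closed hk Mcurv Mconvex BT LB HPhi nq0 Hray).
have xS p : xsection (geodesics_through g x0 r0) p = [set q | geodesic_arc g p q `&` gball g x0 r0 !=set0].
  by apply/seteqP; split => q; rewrite /xsection /= inE.
have mS p : measurable (xsection (geodesics_through g x0 r0) p : set (borel M)).
  by rewrite xS; exact: closed_borel.
have V0 : 0 < fine (mu setT) by rewrite fine_gt0// mu0.
have Hc p : fine (mu setT) / m.+1%:R <= fine (mu (xsection (geodesics_through g x0 r0) p)).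
  rewrite ler_pdivrMr//.
  (* This form vanishes at [x0] because B(O, O) = 1, so the centerpoint property applies to it; on
     its nonpositive side [arc_meets_ball] holds. *)
  have := Hx0 (B *m (bil B (Phi p) (Phi x0) *: Phi x0 - Phi p)^T).
  rewrite lf_bil bilDr bilZr bilNr (Phi_self BT Hray) mulr1 (bilC (Phi x0) _ BT) subrr => /(_ erefl) H.
  apply: le_trans H _; rewrite ler_wpM2r//; apply: (fine_mu_le muoo) => //.
    by apply: closed_borel; exact: (lf_le0_closed Pcont).
  by rewrite xS => q; exact: (arc_meets_ball hk Mcurv Mconvex BT LB HPhi nq0 Hray).
have c0 : 0 <= fine (mu setT) / m.+1%:R by rewrite divr_ge0// ltW.
have H := product_measure_lower muoo mS c0 Hc.
rewrite ler_pdivlMr ?exprn_gt0//; apply: le_trans H.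
by rewrite expr2 mulrA [X in X * _ <= _]mulrC.
Qed.
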